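(* Let $\lambda\in(0,\infty)$ and suppose that the random variable $\alpha$ with values in $(0,1)$ has a probability density of the form $\psi(x)(1-x)^{\beta}$, $x\in(0,1)$, where $\psi$ is a function on $(0,1)$ having a limit $\lim_{x\uparrow 1}\psi(x)=\psi_1\in(0,\infty)$. Let $S^{(N,n)}$ be the doubly aggregated partial sum process, centered by expectation, of independent copies of the randomized INAR(1) process with Poisson innovations (defined in the context). If $\beta\in(0,1)$, then $$\mathcal D_{\mathrm f}\text{-}\lim_{n\to\infty}\ \mathcal D_{\mathrm f}\text{-}\lim_{N\to\infty}\ n^{-1}N^{-\frac{1}{1+\beta}}S^{(N,n)}=\mathcal D_{\mathrm f}\text{-}\lim_{N\to\infty}\ \mathcal D_{\mathrm f}\text{-}\lim_{n\to\infty}\ n^{-1}N^{-\frac{1}{1+\beta}}S^{(N,n)}=(Z_{1+\beta}\,t)_{t\in[0,\infty)},$$ where $Z_{1+\beta}$ is a $(1+\beta)$-stable random variable with characteristic function $\mathbb E(e^{i\theta Z_{1+\beta}})=e^{-|\theta|^{1+\beta}\omega_\beta(\theta)}$, $\theta\in\mathbb R$, where $$\omega_\beta(\theta):=\frac{\psi_1\Gamma(1-\beta)\lambda^{1+\beta}}{-\beta(1+\beta)}\,e^{-i\pi\operatorname{sign}(\theta)(1+\beta)/2},\qquad\theta\in\mathbb R.$$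
   Context: Randomized INAR(1) process: let $\lambda\in(0,\infty)$ and let $\alpha$ be a random variable with values in $(0,1)$. Let $X_0$, $\xi_{k,j}$, $\varepsilon_k$ ($k,j\in\mathbb N=\{1,2,\dots\}$) be random variables which are conditionally independent given $\alpha$ and such that, conditionally on $\alpha$, each $\xi_{k,j}$ is Bernoulli with $\mathbb P(\xi_{k,j}=1\mid\alpha)=\alpha=1-\mathbb P(\xi_{k,j}=0\mid\alpha)$, each $\varepsilon_k$ is Poisson with parameter $\lambda$, and $X_0$ is Poisson with parameter $\lambda/(1-\alpha)$. Define $X_k=\sum_{j=1}^{X_{k-1}}\xi_{k,j}+\varepsilon_k$, $k\in\mathbb N$ (with $\sum_{j=1}^0:=0$). Let $(\alpha^{(j)},(X^{(j)}_k)_{k\in\mathbb Z_+})$, $j\in\mathbb N$, be independent copies of $(\alpha,(X_k)_{k\in\mathbb Z_+})$, where $\mathbb Z_+=\{0,1,2,\dots\}$. For $N,n\in\mathbb N$ set $S^{(N,n)}_t:=\sum_{j=1}^N\sum_{k=1}^{\lfloor nt\rfloor}\bigl(X^{(j)}_k-\mathbb E(X^{(j)}_k)\bigr)$, $t\in[0,\infty)$; here $\mathbb E(X^{(j)}_k)=\mathbb E\bigl(\frac{\lambda}{1-\alpha}\bigr)$, which is finite when $\beta>0$. $\mathcal D_{\mathrm f}\text{-}\lim$ denotes weak convergence of finite dimensional distributions. In an iterated limit the inner (right-hand) limit is taken first with the other index fixed (and is asserted to exist), and then the resulting limit processes converge in finite dimensional distributions, as the outer index tends to infinity, to the stated process.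 *)

(* Defs.v *)
From HB Require Import structures.
From mathcomp Require Import all_boot all_order all_algebra archimedean.
From mathcomp Require Import interval_inference.
From mathcomp Require Import all_classical all_reals all_analysis measurable_realfun.
From mathcomp Require Import complex.

Set Implicit Arguments.
Unset Strict Implicit.
Unset Printing Implicit Defensive.

Import Order.TTheory GRing.Theory Num.Theory.
Import numFieldNormedType.Exports.

Local Open Scope classical_set_scope.
Local Open Scope ring_scope.
Local Open Scope complex_scope.

Section conditioning.
Context {R : realType} {d : measure_display} {T : measurableType d}.
Variables (P : probability T R) (alpha : {RV P >-> R}).

(* [g \o alpha] is a version of the conditional probability P(A | alpha). *)
Definition is_cond_prob (A : set T) (g : R -> R) : Prop :=
  measurable_fun setT g /\
  forall B : set R, measurable B ->
    P (A `&` alpha @^-1` B) = (\int[P]_(w in alpha @^-1` B) (g (alpha w))%:E)%E.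

(* For every finite subfamily, the conditional probability given alpha of the
   intersection of events [Y i \in B i] is the product of their conditional
   probabilities. *)
Definition cond_independent (I : eqType) (Y : I -> {RV P >-> nat}) : Prop :=
  forall (s : seq I) (B : I -> set nat) (g : I -> R -> R), uniq s ->
    (forall i, i \in s -> is_cond_prob (Y i @^-1` B i) (g i)) ->
    is_cond_prob (\big[setI/setT]_(i <- s) (Y i @^-1` B i))
      (fun a => \prod_(i <- s) g i a).

End conditioning.

Section randomized_inar.
Context {R : realType} {d : measure_display} {T : measurableType d}.
Variables (P : probability T R) (lambda : R) (alpha : {RV P >-> R}).
(* The indices k, j = 1, 2, ... of the innovations and of the thinning variables
   are shifted to start at 0: [xi k j] is xi_{k+1,j+1} and [eps k] is
   eps_{k+1}. *)
Variables (X0 : {RV P >-> nat}) (xi : nat -> nat -> {RV P >-> nat})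
  (eps : nat -> {RV P >-> nat}).

Definition inar_inputs (i : option (nat + nat * nat)) : {RV P >-> nat} :=
  match i with
  | None => X0
  | Some (inl k) => eps k
  | Some (inr (k, j)) => xi k j
  end.

Definition randomized_inar_inputs : Prop :=
  [/\ forall w, 0 < alpha w < 1,
      cond_independent alpha inar_inputs,
      forall k j, is_cond_prob alpha (xi k j @^-1` [set 1%N]) (fun a => a) /\
                  is_cond_prob alpha (xi k j @^-1` [set 0%N]) (fun a => 1 - a),
      forall k m, is_cond_prob alpha (eps k @^-1` [set m])
                    (fun=> poisson_pmf lambda m) &
      forall m, is_cond_prob alpha (X0 @^-1` [set m])
                  (fun a => poisson_pmf (lambda / (1 - a)) m)].

Fixpoint inar (k : nat) (w : T) : nat :=
  if k is k'.+1 then (\sum_(j < inar k' w) xi k' j w + eps k' w)%N else X0 w.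

End randomized_inar.

Section copies.
Context {R : realType}.

Definition trajectory (T : Type) (a : T -> R) (X : nat -> T -> nat) (w : T) :
  R * (nat -> nat) := (a w, fun k => X k w).

(* The product sigma-algebra on R * nat^nat. *)
Definition trajectory_measurable : set (set (R * (nat -> nat))) :=
  <<s [set C | (exists2 B : set R, measurable B & C = fst @^-1` B) \/
               (exists (k : nat) (B : set nat), C = (fun p => p.2 k) @^-1` B)] >>.

Definition independent_copies
    (d0 : measure_display) (T0 : measurableType d0) (P0 : probability T0 R)
    (alpha : T0 -> R) (X : nat -> T0 -> nat)
    (d : measure_display) (T : measurableType d) (P : probability T R)
    (alpha_ : nat -> {RV P >-> R}) (X_ : nat -> nat -> {RV P >-> nat}) : Prop :=
  let Tr j := trajectory (alpha_ j) (fun k => X_ j k) in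
  (forall j C, trajectory_measurable C ->
     P (Tr j @^-1` C) = P0 (trajectory alpha X @^-1` C)) /\
  (forall (J : seq nat) (C : nat -> set (R * (nat -> nat))), uniq J ->
     (forall j, j \in J -> trajectory_measurable (C j)) ->
     P (\big[setI/setT]_(j <- J) (Tr j @^-1` C j)) =
       (\prod_(j <- J) P (Tr j @^-1` C j))%E).

End copies.

Section fdd.
Context {R : realType}.

Record process := Process {
  proc_display : measure_display;
  proc_space : measurableType proc_display;
  proc_prob : probability proc_space R;
  proc_val : {nonneg R} -> proc_space -> R;
  proc_measurable : forall t, measurable_fun setT (proc_val t) }.

Definition proc_vec (Y : process) (m : nat) (t : 'I_m -> {nonneg R})
  (w : proc_space Y) : 'rV[R]_m := \row_(i < m) proc_val (t i) w.

(* The processes may live on different probability spaces. *)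
Definition fdd_cvg (U : nat -> process) (Y : process) : Prop :=
  forall (m : nat) (t : 'I_m -> {nonneg R}) (g : 'rV[R]_m -> R),
    continuous g -> bounded_fun g ->
    ('E_(proc_prob (U n))[g \o @proc_vec (U n) m t])%E @[n --> \oo] -->
      ('E_(proc_prob Y)[g \o @proc_vec Y m t])%E.

(* The first index of [U] is the outer one; the inner limits are required for
   positive values of the outer index only. *)
Definition iterated_fdd_lim (U : nat -> nat -> process) (Y : process) : Prop :=
  exists V : nat -> process,
    (forall m, (0 < m)%N -> fdd_cvg (U m) (V m)) /\ fdd_cvg V Y.

End fdd.
Arguments process : clear implicits.

Section aggregation.
Context {R : realType} {d : measure_display} {T : measurableType d}.
Variable P : probability T R.

Definition aggregated (X_ : nat -> nat -> {RV P >-> nat}) (N n : nat)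
    (t : {nonneg R}) (w : T) : R :=
  \sum_(j < N) \sum_(1 <= k < (Num.truncn (n%:R * t%:num)).+1)
    ((X_ j k w)%:R - fine ('E_P[fun w' => (X_ j k w')%:R])%E).

Definition scaled (beta : R) (X_ : nat -> nat -> {RV P >-> nat}) (N n : nat)
    (t : {nonneg R}) (w : T) : R :=
  n%:R^-1 * N%:R `^ (- (1 + beta)^-1) * aggregated X_ N n t w.

Lemma measurable_scaled beta X_ N n t :
  measurable_fun setT (@scaled beta X_ N n t).
Proof.
apply: measurable_funM => //; apply: measurable_sum => j.
apply: measurable_sum => k; apply: measurable_funB => //.
by apply: (@measurableT_comp _ _ _ _ _ _ (fun m : nat => m%:R : R)).
Qed.

Definition scaled_process beta X_ N n : process R :=
  Process P (@measurable_scaled beta X_ N n).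

Lemma measurable_line (Z : {RV P >-> R}) (t : {nonneg R}) :
  measurable_fun setT (fun w => Z w * t%:num).
Proof. exact: measurable_funM. Qed.

Definition line_process (Z : {RV P >-> R}) : process R :=
  Process P (measurable_line Z).

(* On [P \x P], [Z \o fst] and [Z \o snd] are independent copies of [Z]. *)
Definition stable_rv (a : R) (Z : {RV P >-> R}) : Prop :=
  (forall z : R, P (Z @^-1` [set z]) != 1%E) /\
  forall b c : R, 0 < b -> 0 < c -> exists D : R,
    forall B : set R, measurable B ->
      (P \x P)%E [set w | B (b * Z w.1 + c * Z w.2)] =
      P [set w | B ((b `^ a + c `^ a) `^ a^-1 * Z w + D)].

Definition char_fun (Z : {RV P >-> R}) (theta : R) : R[i] :=
  fine ('E_P[fun w => cos (theta * Z w)])%E +i*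
  fine ('E_P[fun w => sin (theta * Z w)])%E.

End aggregation.

Definition cexp {R : realType} (z : R[i]) : R[i] :=
  let: x +i* y := z in (expR x)%:C * (cos y +i* sin y).

Definition Gamma {R : realType} (s : R) : R :=
  \int[lebesgue_measure]_(x in `]0, +oo[) (x `^ (s - 1) * expR (- x)).

Definition omega {R : realType} (lambda psi1 beta theta : R) : R[i] :=
  (psi1 * Gamma (1 - beta) * lambda `^ (1 + beta) / (- beta * (1 + beta)))%:C *
  cexp (0 -i* (pi * Num.sg theta * (1 + beta) / 2)).

Definition has_density_on01 {R : realType} {d : measure_display}
    {T : measurableType d} (P : probability T R) (alpha : {RV P >-> R})
    (f : R -> R) : Prop :=
  [/\ measurable_fun (`]0, 1[ : set R) f,
      forall x, 0 < x < 1 -> 0 <= f x &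
      forall B : set R, measurable B ->
        P (alpha @^-1` B) =
          (\int[lebesgue_measure]_(x in B `&` `]0%R, 1%R[) (f x)%:E)%E].

(* Main.v *)
Require Import Defs.
From HB Require Import structures.
From mathcomp Require Import all_boot all_order all_algebra archimedean.
From mathcomp Require Import interval_inference.
From mathcomp Require Import all_classical all_reals all_analysis measurable_realfun.
From mathcomp Require Import complex ring lra.

(** Given its thinning probability [a], the process is stationary with Poisson
    marginals of mean [rate a = lambda / (1 - a)] and with geometrically decaying
    covariances.  Hence the partial sums of one copy, centred by the common mean
    of the rates, split ([scaled_decomposition]) into the number of summands times
    the centred rate of the copy, which is linear in time, and the deviations
    around the rate.  The deviations disappear in both iterated limits: for a
    fixed time horizon they are square-integrable and independent over the copies,
    while [1 / (1 + b) > 1 / 2] ([deviations_vanish_copies]); for a fixed number of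
    copies they obey a law of large numbers ([deviation_vanish_time]).  What is left
    is the line whose slope is the normalized sum of the centred rates of [N]
    copies, and both limits reduce, by a Slutsky argument ([Slutsky_row]), to the
    convergence in law of this slope.

    The density of the thinning probability near [1] gives the rate a power tail of
    index [1 + b] ([upper_tail_equiv]).  By the layer-cake formula ([layer_cake])
    the characteristic function of the rate is an integral of its tail against a
    sine or a cosine, and rescaling at the origin produces the Fourier integrals of
    [v `^ (-1 - b)] ([tail_integral_cvg]).  These are computed by turning the
    argument of the Laplace transform of the power from the positive axis, where it
    is a Gamma integral, to the imaginary axis ([onem_cos_integral],
    [sin_integral]).  The characteristic function of the slope is a power by
    independence ([char_sum]) and converges to
    [exp (- (A + i B) t ^ (1 + b))], [t > 0] ([char_pow_cvg]).

    This limit is integrable and continuous at the origin, so that the limit law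
    can be exhibited through the density given by Fourier inversion
    ([Levy_continuity], [stable_limit]).  Since its characteristic function
    determines it, the homogeneity of the exponent makes it stable
    ([char_stable_rv]).

    The conditional moments of the process are obtained by induction over time
    from the conditional independence of the inputs ([input_given_others]), always
    integrated against nonnegative functions of the past, so that integrability
    questions arise only where the deviations are formed
    ([deviation_sum_square_le]). *)

Set Implicit Arguments.
Unset Strict Implicit.
Unset Printing Implicit Defensive.

Import Order.TTheory GRing.Theory Num.Theory.
Import numFieldNormedType.Exports.

Local Open Scope classical_set_scope.
Local Open Scope ring_scope.
Local Open Scope complex_scope.

(** * Real-valued integrals: domination, exhaustion, Fubini *)

Section integral_tools.
Context {R : realType} d {T : measurableType d}.
Implicit Type mu : {measure set T -> \bar R}.

Lemma Rintegral_dominated_cvg mu (D : set T) (mD : measurable D)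
    (f_ : nat -> T -> R) (f g : T -> R) :
  (forall n, measurable_fun D (f_ n)) ->
  (forall x, D x -> f_ n x @[n --> \oo] --> f x) ->
  mu.-integrable D (EFin \o g) ->
  (forall n x, D x -> `|f_ n x| <= g x) ->
  mu.-integrable D (EFin \o f) /\
  \int[mu]_(x in D) f_ n x @[n --> \oo] --> \int[mu]_(x in D) f x.
Proof.
move=> mf_ cf ig fg.
have mf : measurable_fun D f by apply: measurable_fun_cvg cf.
have mEf_ n : measurable_fun D (EFin \o f_ n) by exact/measurable_EFinP.
have mEf : measurable_fun D (EFin \o f) by exact/measurable_EFinP.
have cEf : {ae mu, forall x, D x -> (EFin \o f_ n) x @[n --> \oo] --> (f x)%:E}.
  by apply: aeW => x Dx; apply: cvg_EFin; [exact: nearW | exact: cf].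
have fEg : {ae mu, forall x n, D x -> (`|(EFin \o f_ n) x| <= (EFin \o g) x)%E}.
  by apply: aeW => x n Dx; rewrite lee_fin fg.
have [i1 _ i3] := dominated_convergence mD mEf_ mEf cEf ig fEg.
split=> //; apply/fine_cvg; move: i3; rewrite /= fineK//.
exact: integrable_fin_num.
Qed.

Lemma dominated_integrable mu (D : set T) (f g : T -> R) :
  measurable D -> measurable_fun D f -> mu.-integrable D (EFin \o g) ->
  (forall x, D x -> `|f x| <= g x) -> mu.-integrable D (EFin \o f).
Proof.
move=> mD mf ig fg; apply: le_integrable ig => //; first exact/measurable_EFinP.
by move=> x Dx; rewrite lee_fin (le_trans (fg _ Dx))// ler_norm.
Qed.

Lemma Rintegral_le_dominated mu (D : set T) (f g : T -> R) :
  measurable D -> measurable_fun D f -> mu.-integrable D (EFin \o g) ->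
  (forall x, D x -> `|f x| <= g x) ->
  `|\int[mu]_(x in D) f x| <= \int[mu]_(x in D) g x.
Proof.
move=> mD mf ig fg; have jf := dominated_integrable mD mf ig fg.
apply: (le_trans (le_normr_Rintegral mD jf)).
by apply: le_Rintegral => //; exact: integrable_norm.
Qed.

Lemma RintegrableD mu (D : set T) (mD : measurable D) (f g : T -> R) :
  mu.-integrable D (EFin \o f) -> mu.-integrable D (EFin \o g) ->
  mu.-integrable D (EFin \o (fun x => f x + g x)).
Proof. by move=> jf jg; exact: (integrableD mD jf jg). Qed.

Lemma RintegrableB mu (D : set T) (mD : measurable D) (f g : T -> R) :
  mu.-integrable D (EFin \o f) -> mu.-integrable D (EFin \o g) ->
  mu.-integrable D (EFin \o (fun x => f x - g x)).
Proof. by move=> jf jg; exact: (integrableB mD jf jg). Qed.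

Lemma RintegrableZl mu (D : set T) (mD : measurable D) (c : R) (f : T -> R) :
  mu.-integrable D (EFin \o f) ->
  mu.-integrable D (EFin \o (fun x => c * f x)).
Proof. by move=> jf; exact: (integrableZl mD c jf). Qed.

End integral_tools.
Arguments Rintegral_dominated_cvg {R d T} mu {D} _ {f_ f g}.
Arguments dominated_integrable {R d T} mu {D f g}.
Arguments Rintegral_le_dominated {R d T} mu {D f g}.

Section probability_integral.
Context {R : realType} d {T : measurableType d} (P : probability T R).

Lemma bounded_integrable (f : T -> R) (M : R) :
  measurable_fun setT f -> (forall x, `|f x| <= M) ->
  P.-integrable setT (EFin \o f).
Proof.
move=> mf fM; apply: (dominated_integrable P (g := cst M)) => //.
exact: finite_measure_integrable_cst.
Qed.

Lemma Rintegral_le_bound (f : T -> R) (M : R) :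
  measurable_fun setT f -> (forall x, `|f x| <= M) ->
  `|\int[P]_x f x| <= M.
Proof.
move=> mf fM.
apply: (le_trans (Rintegral_le_dominated P (g := cst M) _ mf _ _)) => //.
  exact: finite_measure_integrable_cst.
by rewrite Rintegral_cst//= probability_setT mulr1.
Qed.

Lemma expectation_Rintegral (f : T -> R) : fine 'E_P[f] = \int[P]_x f x.
Proof. by rewrite unlock. Qed.

Lemma Fubini_dominated (f : T * R -> R) (h : R -> R) :
  measurable_fun setT f ->
  (@lebesgue_measure R).-integrable setT (EFin \o h) ->
  (forall w x, `|f (w, x)| <= h x) ->
  \int[P]_w (\int[lebesgue_measure]_x f (w, x)) =
  \int[lebesgue_measure]_x (\int[P]_w f (w, x)).
Proof.
move=> mf ih fh.
have mh : measurable_fun setT h by have /integrableP[/measurable_EFinP] := ih.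
have jf : (P \x lebesgue_measure)%E.-integrable setT (EFin \o f).
  apply/integrable21ltyP; first exact/measurable_EFinP.
  apply: (@le_lt_trans _ _ (\int[lebesgue_measure]_y `|h y|%:E)%E).
    apply: ge0_le_integral => //.
    - by move=> x _; apply: integral_ge0 => y _; rewrite abse_ge0.
    - apply: (@measurable_fun_fubini_tonelli_G _ _ _ _ R P
        (fun z => `|(f z)%:E|%E)) => //.
      by apply/measurable_EFinP; exact: measurableT_comp.
    - by apply/measurable_EFinP; exact: measurableT_comp.
    - move=> y _; apply: (@le_trans _ _ (\int[P]_x (h y)%:E)%E).
        apply: ge0_le_integral => //.
        + apply/measurable_EFinP; apply: measurableT_comp => //.
          exact: (measurableT_comp mf).
        + by move=> w _; rewrite lee_fin fh.
      rewrite [leLHS](_ : _ = (h y)%:E * P setT)%E; last exact: integral_cst.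
      by rewrite probability_setT mule1 lee_fin ler_norm.
  by move/integrableP : ih => [].
have := Fubini jf; rewrite /Rintegral.
have s1 w : (@lebesgue_measure R).-integrable setT (EFin \o (fun x => f (w, x))).
  have mfw : measurable_fun setT (fun x => f (w, x)) by exact: (measurableT_comp mf).
  exact: (dominated_integrable (@lebesgue_measure R) measurableT mfw ih
    (fun x _ => fh w x)).
have s2 x : P.-integrable setT (EFin \o (fun w => f (w, x))).
  apply: (@bounded_integrable (fun w => f (w, x)) (h x)) => //.
  exact: (measurableT_comp mf).
move=> eF; congr fine.
have -> : (\int[P]_x (fine (\int[lebesgue_measure]_x0 (f (x, x0))%:E))%:E =
    \int[P]_x (\int[lebesgue_measure]_x0 (f (x, x0))%:E))%E.
  by apply: eq_integral => x _; rewrite fineK//; apply: integrable_fin_num => //; exact: s1.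
rewrite eF; apply: eq_integral => x _.
by rewrite fineK//; apply: integrable_fin_num => //; exact: s2.
Qed.

End probability_integral.

(** The fundamental theorem of calculus on a domain exhausted by compact
    intervals: the primitive only needs limits along the endpoints, so it may be
    undefined at the ends of the domain, and these may be infinite. *)
Section improper_FTC.
Context {R : realType}.
Local Notation mu := (@lebesgue_measure R).
Variables (D : set R) (u v : nat -> R) (f F : R -> R) (A B : R).
Hypotheses (mD : measurable D) (uv : forall n, u n < v n)
  (uvD : forall n, `[u n, v n]%classic `<=` D)
  (nd : forall m n, (m <= n)%N -> `[u m, v m] `<=` `[u n, v n])
  (Duv : forall x, D x -> exists n, u n <= x <= v n)
  (cf : forall x, D x -> {for x, continuous f})
  (dF : forall x, D x -> is_derive x (1 : R) F (f x))
  (FA : F (u n) @[n --> \oo] --> A) (FB : F (v n) @[n --> \oo] --> B).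

Let FTC_uv n : (\int[mu]_(x in `[u n, v n]) (f x)%:E = (F (v n) - F (u n))%:E)%E.
Proof.
have dFx x : D x -> derivable F x 1 by move=> /dF[].
have cF x : D x -> {for x, continuous F}.
  by move=> /dFx dx; apply/differentiable_continuous/derivable1_diffP.
have Du : D (u n) by apply: (uvD (n := n)); rewrite /= in_itv/= lexx ltW.
have Dv : D (v n) by apply: (uvD (n := n)); rewrite /= in_itv/= lexx ltW.
rewrite EFinB; apply: continuous_FTC2 => //.
- apply: continuous_in_subspaceT => x; rewrite inE => /uvD Dx.
  exact: cf.
- split.
  + move=> x; rewrite in_itv/= => /andP[ux xv]; apply: dFx.
    by apply: (uvD (n := n)); rewrite /= in_itv/= !ltW.
  + by apply: cvg_at_right_filter; exact: cF.
  + by apply: cvg_at_left_filter; exact: cF.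
- move=> x; rewrite in_itv/= => /andP[ux xv]; rewrite derive1E.
  by apply/derive_val/dF/(uvD (n := n)); rewrite /= in_itv/= !ltW.
Qed.

Let DE : D = \bigcup_n `[u n, v n]%classic.
Proof.
apply/seteqP; split => [x /Duv[n xn]|x [n _] /uvD//].
by exists n => //=; rewrite in_itv.
Qed.

Let mfD : measurable_fun D f.
Proof.
rewrite DE; apply/measurable_fun_bigcup => // n.
apply: subspace_continuous_measurable_fun => //.
by apply: continuous_in_subspaceT => x; rewrite inE => /uvD; exact: cf.
Qed.

Lemma ge0_improper_FTC : (forall x, D x -> 0 <= f x) ->
  (\int[mu]_(x in D) (f x)%:E = (B - A)%:E)%E.
Proof.
move=> f0.
have h : (\int[mu]_(x in `[u n, v n]) (f x)%:E)%E @[n --> \oo] -->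
    (\int[mu]_(x in D) (f x)%:E)%E.
  rewrite DE; apply: ge0_nondecreasing_set_cvg_integral => //.
  - by move=> m n mn; apply/subsetPset; exact: nd.
  - move=> n; apply/measurable_EFinP.
    by apply: (measurable_funS mD (uvD (n := n))).
  - by move=> n x /uvD /f0; rewrite lee_fin.
move: h; under eq_fun do rewrite FTC_uv.
move=> /cvg_unique; apply => //.
by apply: cvg_EFin; [exact: nearW|exact: cvgB].
Qed.

Lemma improper_FTC : mu.-integrable D (EFin \o f) ->
  \int[mu]_(x in D) f x = B - A.
Proof.
move=> jf.
have m1 n : measurable_fun D (f \_ `[u n, v n]).
  apply/(measurable_restrict f _ mD) => //.
  by apply: measurable_funS mfD => //; apply: subIset; right.
have c1 x : D x -> (f \_ `[u n, v n]) x @[n --> \oo] --> f x.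
  move=> /Duv[n xn]; apply: cvg_near_cst; near=> k.
  rewrite patchE mem_set//; apply: (nd (m := n)).
    by near: k; exact: nbhs_infty_ge.
  by rewrite /= in_itv.
have l1 n x : D x -> `|(f \_ `[u n, v n]) x| <= (Num.norm \o f) x.
  by move=> Dx; rewrite patchE/=; case: ifPn => // _; rewrite normr0.
have [_] := Rintegral_dominated_cvg mu mD m1 c1 (integrable_norm jf) l1.
rewrite (_ : (fun n => _) = (fun n => F (v n) - F (u n))).
  by move=> /cvg_unique; apply => //; exact: cvgB.
apply/funext => n; rewrite -Rintegral_mkcondr setIidr; last exact: uvD.
by rewrite /Rintegral FTC_uv.
Unshelve. all: by end_near. Qed.

End improper_FTC.

(** * Integrals determined by the masses of events *)

(** Expectations are only ever known through the probabilities of events, in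
    many guises: as a density, as a conditional probability, as independence,
    or as equality in law.  All these say that two weighted images of measures
    agree on measurable sets, and hence integrate functions equally. *)
Section weighted_transfer.
Context {R : realType} d1 d2 d {T1 : measurableType d1} {T2 : measurableType d2}
  {U : measurableType d}.
Variables (mu1 : {measure set T1 -> \bar R}) (mu2 : {measure set T2 -> \bar R}).
Variables (w1 : T1 -> R) (w2 : T2 -> R) (phi1 : T1 -> U) (phi2 : T2 -> U).
Hypotheses (mw1 : measurable_fun setT w1) (mw2 : measurable_fun setT w2)
  (w1_ge0 : forall x, 0 <= w1 x) (w2_ge0 : forall x, 0 <= w2 x)
  (mphi1 : measurable_fun setT phi1) (mphi2 : measurable_fun setT phi2).
Hypothesis agree : forall B, measurable B ->
  (\int[mu1]_x (w1 x * \1_B (phi1 x))%:E = \int[mu2]_x (w2 x * \1_B (phi2 x))%:E)%E.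

Import HBNNSimple.

Let agree_nnsfun (g : {nnsfun U >-> R}) :
  (\int[mu1]_x (w1 x * g (phi1 x))%:E = \int[mu2]_x (w2 x * g (phi2 x))%:E)%E.
Proof.
have h di (Ti : measurableType di) (mu : {measure set Ti -> \bar R})
    (w : Ti -> R) (phi : Ti -> U) :
    measurable_fun setT w -> (forall x, 0 <= w x) -> measurable_fun setT phi ->
    (\int[mu]_x (w x * g (phi x))%:E = \sum_(r \in range g)
      r%:E * \int[mu]_x (w x * \1_(g @^-1` [set r]) (phi x))%:E)%E.
  move=> mw w0 mphi.
  transitivity (\int[mu]_x (\sum_(r \in range g)
      (r * (w x * \1_(g @^-1` [set r]) (phi x)))%:E))%E.
    apply: eq_integral => x _; rewrite fsumEFin//; congr EFin.
    rewrite {1}fimfunE mulr_fsumr.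
    by apply: eq_fsbigr => r _; rewrite mulrCA.
  have m1 r : measurable_fun setT (fun x => w x * \1_(g @^-1` [set r]) (phi x)).
    by apply: measurable_funM => //; apply: measurableT_comp mphi.
  rewrite ge0_integral_fsum//; last 2 first.
  - move=> r; apply/measurable_EFinP; apply: measurable_funM => //; exact: m1.
  - move=> r x _; rewrite lee_fin.
    have [[y _ <-]|nr] := pselect (range g r); first by rewrite !mulr_ge0// indicE.
    rewrite indicE memNset ?mulr0// => /= gr; apply: nr.
    by exists (phi x).
  apply: eq_fsbigr => r /[!inE] -[y _ <-].
  rewrite -ge0_integralZl_EFin//.
  - by move=> x _; rewrite lee_fin mulr_ge0// indicE.
  - exact/measurable_EFinP.
rewrite !h//; apply: eq_fsbigr => r _; congr (_ * _)%E; apply: agree.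
exact: measurable_sfunP.
Qed.

Lemma weighted_ge0_integral (f : U -> R) :
  measurable_fun setT f -> (forall y, 0 <= f y) ->
  (\int[mu1]_x (w1 x * f (phi1 x))%:E = \int[mu2]_x (w2 x * f (phi2 x))%:E)%E.
Proof.
move=> mf f0.
have mEf : measurable_fun setT (EFin \o f) by exact/measurable_EFinP.
pose g n := nnsfun_approx measurableT mEf n.
have h di (Ti : measurableType di) (mu : {measure set Ti -> \bar R})
    (w : Ti -> R) (phi : Ti -> U) :
    measurable_fun setT w -> (forall x, 0 <= w x) -> measurable_fun setT phi ->
    (\int[mu]_x (w x * f (phi x))%:E =
      limn (fun n => \int[mu]_x (w x * g n (phi x))%:E))%E.
  move=> mw w0 mphi; rewrite -monotone_convergence//.
  - apply: eq_integral => x _; apply/esym/cvg_lim => //.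
    rewrite EFinM; under eq_fun do rewrite EFinM.
    apply: cvgeZl => //.
    by apply: (cvg_nnsfun_approx measurableT mEf) => //= y _; rewrite lee_fin.
  - move=> n; apply/measurable_EFinP; apply: measurable_funM => //.
    exact: measurableT_comp.
  - by move=> n x _; rewrite lee_fin mulr_ge0.
  - move=> x _ m n mn; rewrite lee_fin ler_wpM2l//.
    exact/lefP/nd_nnsfun_approx.
rewrite !h//; congr (limn _); apply/funext => n; exact: agree_nnsfun.
Qed.

Lemma weighted_integrable (f : U -> R) : measurable_fun setT f ->
  mu1.-integrable setT (EFin \o (fun x => w1 x * f (phi1 x))) ->
  mu2.-integrable setT (EFin \o (fun x => w2 x * f (phi2 x))).
Proof.
move=> mf /integrableP[_ i1]; apply/integrableP; split.
  by apply/measurable_EFinP; apply: measurable_funM => //; exact: measurableT_comp.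
rewrite (_ : integral _ _ _ = \int[mu2]_x (w2 x * `|f (phi2 x)|)%:E)%E; last first.
  by apply: eq_integral => x _; rewrite /= normrM (ger0_norm (w2_ge0 _)).
rewrite -(@weighted_ge0_integral (fun y => `|f y|))//; last exact: measurableT_comp.
move: i1; congr (_ < _)%E; apply: eq_integral => x _.
by rewrite /= normrM (ger0_norm (w1_ge0 _)).
Qed.

Lemma weighted_Rintegral (f : U -> R) : measurable_fun setT f ->
  mu1.-integrable setT (EFin \o (fun x => w1 x * f (phi1 x))) ->
  \int[mu1]_x (w1 x * f (phi1 x)) = \int[mu2]_x (w2 x * f (phi2 x)).
Proof.
move=> mf i1; have i2 := weighted_integrable mf i1.
have mfp : measurable_fun setT f^\+ by exact: measurable_funrpos.
have mfn : measurable_fun setT f^\- by exact: measurable_funrneg.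
have h di (Ti : measurableType di) (mu : {measure set Ti -> \bar R})
    (w : Ti -> R) (phi : Ti -> U) :
    measurable_fun setT w -> (forall x, 0 <= w x) -> measurable_fun setT phi ->
    mu.-integrable setT (EFin \o (fun x => w x * f (phi x))) ->
    \int[mu]_x (w x * f (phi x)) =
    \int[mu]_x (w x * f^\+ (phi x)) - \int[mu]_x (w x * f^\- (phi x)).
  move=> mw w0 mphi ii; rewrite -RintegralB//.
  - by apply: eq_Rintegral => x _; rewrite -mulrBr -{1}(funrposBneg f).
  - apply: le_integrable ii => //.
      by apply/measurable_EFinP; apply: measurable_funM => //; exact: measurableT_comp.
    move=> x _; rewrite lee_fin !normrM ler_wpM2l// ger0_norm ?funrpos_ge0//.
    by rewrite /funrpos ge_max ler_norm normr_ge0.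
  - apply: le_integrable ii => //.
      by apply/measurable_EFinP; apply: measurable_funM => //; exact: measurableT_comp.
    move=> x _; rewrite lee_fin !normrM ler_wpM2l// ger0_norm ?funrneg_ge0//.
    by rewrite /funrneg ge_max normr_ge0 -normrN ler_norm.
rewrite !h// /Rintegral !weighted_ge0_integral//.
Qed.

End weighted_transfer.

(** * Improper integrals on the half-line and the Poisson kernel *)

Section half_line.
Context {R : realType}.
Local Notation mu := (@lebesgue_measure R).

Lemma derivable_continuous_at (f : R -> R) (x : R) :
  derivable f x 1 -> {for x, continuous f}.
Proof. by move=> df; apply/differentiable_continuous/derivable1_diffP. Qed.

Lemma cvg_harmonicS : (n.+1%:R^-1 : R) @[n --> \oo] --> 0.
Proof. exact: cvg_harmonic. Qed.

Lemma cvg_natSS_pinfty : (n.+2%:R : R) @[n --> \oo] --> +oo.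
Proof.
have h : (n%:R : R) @[n --> \oo] --> +oo by exact: cvgr_idn.
have := h; rewrite -(cvg_shiftn 2) => {}h.
by apply: cvg_trans h; apply: near_eq_cvg; apply: nearW => n; rewrite /= addn2.
Qed.

Lemma continuous_measurable_pos (f : R -> R) :
  (forall x : R, 0 < x -> {for x, continuous f}) -> measurable_fun (`]0, +oo[ : set R) f.
Proof.
move=> cf; apply: open_continuous_measurable_fun; first exact: interval_open.
by move=> x; rewrite inE/= in_itv/= andbT => /cf.
Qed.

Section FTC_pos.
Variables (f F : R -> R) (A B : R).
Hypotheses (cf : forall x : R, 0 < x -> {for x, continuous f})
  (dF : forall x : R, 0 < x -> is_derive x (1 : R) F (f x))
  (FA : F x @[x --> 0^'+] --> A) (FB : F x @[x --> +oo] --> B).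

Let u n : R := n.+1%:R^-1.
Let v n : R := n.+2%:R.

Let u_gt0 n : 0 < u n. Proof. by rewrite /u invr_gt0. Qed.
Let uv n : u n < v n.
Proof.
apply: (@le_lt_trans _ _ 1); last by rewrite /v ltr1n.
by rewrite /u invf_le1 ?ler1n.
Qed.
Let uvD n : `[u n, v n]%classic `<=` (`]0, +oo[%classic : set R).
Proof.
by move=> x /=; rewrite !in_itv/= andbT => /andP[+ _]; apply: lt_le_trans.
Qed.
Let nd m n : (m <= n)%N -> `[u m, v m] `<=` `[u n, v n].
Proof.
move=> mn; apply: subset_itv; rewrite bnd_simp /u /v ?lef_pV2 ?posrE// ?ler_nat//.
Qed.
Let Duv x : (`]0, +oo[%classic : set R) x -> exists n, u n <= x <= v n.
Proof.
rewrite /= in_itv/= andbT => x0.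
exists (maxn (Num.truncn x) (Num.truncn x^-1)); apply/andP; split.
  rewrite /u -[leRHS]invrK lef_pV2 ?posrE ?invr_gt0//.
  apply/ltW; apply: (lt_le_trans (truncnS_gt _)).
  by rewrite ler_nat ltnS leq_maxr.
apply/ltW; apply: (lt_le_trans (truncnS_gt _)).
by rewrite /v ler_nat ltnS (leq_trans (leq_maxl _ _) (leqnSn _)).
Qed.
Let cfD x : (`]0, +oo[%classic : set R) x -> {for x, continuous f}.
Proof. by rewrite /= in_itv/= andbT; exact: cf. Qed.
Let dFD x : (`]0, +oo[%classic : set R) x -> is_derive x (1 : R) F (f x).
Proof. by rewrite /= in_itv/= andbT; exact: dF. Qed.
Let FuA : F (u n) @[n --> \oo] --> A.
Proof. by move/cvg_at_rightP : FA; apply; split=> //; exact: cvg_harmonicS. Qed.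
Let FvB : F (v n) @[n --> \oo] --> B.
Proof. by move/cvg_pinftyP : FB; apply; exact: cvg_natSS_pinfty. Qed.

Lemma ge0_improper_FTC_pos : (forall x : R, 0 < x -> 0 <= f x) ->
  (\int[mu]_(x in `]0%R, +oo[) (f x)%:E = (B - A)%:E)%E.
Proof.
move=> f0; apply: (@ge0_improper_FTC _ _ u v f F) => //.
by move=> x; rewrite /= in_itv/= andbT; exact: f0.
Qed.

Lemma ge0_improper_FTC_pos_integrable : (forall x : R, 0 < x -> 0 <= f x) ->
  mu.-integrable `]0, +oo[ (EFin \o f).
Proof.
move=> f0; apply/integrableP; split.
  by apply/measurable_EFinP; exact: continuous_measurable_pos.
rewrite (_ : integral _ _ _ = (B - A)%:E) ?ltry// -ge0_improper_FTC_pos//.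
apply: eq_integral => x; rewrite inE/= in_itv/= andbT => x0.
by rewrite ger0_norm// f0.
Qed.

Lemma improper_FTC_pos : mu.-integrable `]0, +oo[ (EFin \o f) ->
  \int[mu]_(x in `]0, +oo[) f x = B - A.
Proof. by move=> jf; apply: (@improper_FTC _ _ u v f F). Qed.

End FTC_pos.

Lemma cvg_at_right0_continuous (F : R -> R) :
  {for 0, continuous F} -> F x @[x --> 0^'+] --> F 0.
Proof. by move=> cF; exact: cvg_at_right_filter. Qed.

Lemma cvg_expRN (s : R) : 0 < s -> expR (- s * x) @[x --> +oo] --> 0.
Proof.
move=> s0; have h : s * x @[x --> +oo] --> +oo by exact: gt0_cvgMry.
have := cvg_comp _ _ h (@cvgr_expR R); apply: cvg_trans.
by apply: near_eq_cvg; apply: nearW => x; rewrite /= mulNr.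
Qed.

Lemma integrable_expRN (s : R) : 0 < s ->
  mu.-integrable `]0, +oo[ (EFin \o (fun x => expR (- s * x))).
Proof.
move=> s0.
have dE x : is_derive x (1 : R) (fun t => - s^-1 * expR (- s * t)) (expR (- s * x)).
  apply: is_derive_eq; rewrite /GRing.scale/= !mulr1; field; exact: lt0r_neq0.
apply: (@ge0_improper_FTC_pos_integrable _ (fun t => - s^-1 * expR (- s * t))
  (- s^-1 * expR (- s * 0)) (- s^-1 * 0)) => //.
- move=> x _; apply: derivable_continuous_at; apply: ex_derive.
- apply: (@cvg_at_right0_continuous (fun t => - s^-1 * expR (- s * t))).
  by apply: derivable_continuous_at; have [] := dE 0.
- by apply: cvgMr; exact: cvg_expRN.
Qed.

(** The Laplace transform of a cosine is the Poisson kernel: smoothing a law by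
    this kernel is multiplying its characteristic function by an exponential. *)
Lemma Laplace_cos (s y : R) : 0 < s ->
  \int[mu]_(x in `]0, +oo[) (expR (- s * x) * cos (x * y)) = s / (s ^+ 2 + y ^+ 2).
Proof.
move=> s0.
have q0 : s ^+ 2 + y ^+ 2 != 0.
  by rewrite lt0r_neq0// ltr_wpDr ?sqr_ge0 ?exprn_gt0.
pose F t : R := expR (- s * t) * (y * sin (t * y) - s * cos (t * y)) / (s ^+ 2 + y ^+ 2).
have dF x : is_derive x (1 : R) F (expR (- s * x) * cos (x * y)).
  apply: is_derive_eq; rewrite /GRing.scale/= !mulr0 !add0r !mulr1.
  by field.
have cc x : {for x, continuous (fun x => expR (- s * x) * cos (x * y))}.
  by apply: derivable_continuous_at; apply: ex_derive.
rewrite (@improper_FTC_pos _ F (F 0) 0) => //.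
- rewrite sub0r /F !mulr0 mul0r expR0 sin0 cos0; field; exact: q0.
- apply: cvg_at_right0_continuous; apply: derivable_continuous_at.
  by have [] := dF 0.
- apply: (@squeeze_cvgr _ _ _ _ (fun t => - (expR (- s * t) * ((`|y| + s) / (s ^+ 2 + y ^+ 2))))
    (fun t => expR (- s * t) * ((`|y| + s) / (s ^+ 2 + y ^+ 2)))).
  + apply: nearW => t; rewrite -ler_norml /F -mulrA !normrM.
    rewrite (ger0_norm (expR_ge0 _)) ler_wpM2l ?expR_ge0//.
    have h : `|(s ^+ 2 + y ^+ 2)^-1| = (s ^+ 2 + y ^+ 2)^-1.
      by rewrite ger0_norm// invr_ge0 addr_ge0// sqr_ge0.
    rewrite h ler_wpM2r//; first by rewrite -h.
    rewrite (le_trans (ler_normB _ _))// !normrM lerD//.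
      by rewrite ler_piMr// ler_norml sin_geN1 sin_le1.
    by rewrite (gtr0_norm s0) ler_piMr ?(ltW s0)// ler_norml cos_geN1 cos_le1.
  + rewrite -[X in _ --> X]oppr0; apply: cvgN.
    by rewrite -[X in _ --> X](mul0r ((`|y| + s) / (s ^+ 2 + y ^+ 2))); apply: cvgMl; exact: cvg_expRN.
  + by rewrite -[X in _ --> X](mul0r ((`|y| + s) / (s ^+ 2 + y ^+ 2))); apply: cvgMl; exact: cvg_expRN.
- apply: (dominated_integrable mu (g := fun x => expR (- s * x))) => //.
  + exact: continuous_measurable_pos.
  + exact: integrable_expRN.
  + move=> x _; rewrite normrM (ger0_norm (expR_ge0 _)) ler_piMr ?expR_ge0//.
    by rewrite ler_norml cos_geN1 cos_le1.
Qed.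

Definition poisson_kernel (s y : R) : R := s / (s ^+ 2 + y ^+ 2).

Lemma poisson_kernel_den (s y : R) : 0 < s -> 0 < s ^+ 2 + y ^+ 2.
Proof. by move=> s0; rewrite ltr_wpDr ?sqr_ge0 ?exprn_gt0. Qed.

Lemma poisson_kernel_ge0 (s y : R) : 0 < s -> 0 <= poisson_kernel s y.
Proof. by move=> s0; rewrite divr_ge0 ?(ltW s0)// ltW// poisson_kernel_den. Qed.

Lemma poisson_kernel_le (s y : R) : 0 < s -> poisson_kernel s y <= s^-1.
Proof.
move=> s0; rewrite /poisson_kernel ler_pdivrMr ?poisson_kernel_den//.
by rewrite mulrDr expr2 mulKf ?lt0r_neq0// lerDl mulr_ge0 ?sqr_ge0 ?invr_ge0 ?ltW.
Qed.

(** The kernel has no mean, so its tails are compared with a wider kernel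
    instead of being bounded by a moment. *)
Lemma poisson_kernel_tail (s r y : R) : 0 < s -> 0 < r -> r <= `|y| ->
  poisson_kernel s y <= 2 * s / r * poisson_kernel r y.
Proof.
move=> s0 r0 ry; rewrite /poisson_kernel.
have r2y : r ^+ 2 <= y ^+ 2 by rewrite -[leRHS]real_normK ?num_real// ler_sqr ?nnegrE// ltW.
have -> : 2 * s / r * (r / (r ^+ 2 + y ^+ 2)) = s * (2 / (r ^+ 2 + y ^+ 2)).
  by field; rewrite (gt_eqF r0)/= gt_eqF// poisson_kernel_den.
rewrite ler_pM2l// -[leLHS]div1r ler_pdivlMr ?poisson_kernel_den//.
rewrite mulrAC mul1r ler_pdivrMr ?poisson_kernel_den//.
by have := sqr_ge0 s; lra.
Qed.

Lemma continuous_poisson_kernel (s : R) : 0 < s -> continuous (poisson_kernel s).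
Proof.
move=> s0 y; apply: cvgM; first exact: cvg_cst.
apply: cvgV; first by rewrite lt0r_neq0// poisson_kernel_den.
by apply: cvgD; [exact: cvg_cst|exact: exprn_continuous].
Qed.

(** The primitive is an arctangent, whose limits at both ends are [pi / 2] in
    absolute value. *)
Lemma poisson_kernel_mass (s w : R) : 0 < s ->
  (\int[mu]_x (poisson_kernel s (w - x))%:E = pi%:E)%E.
Proof.
move=> s0; pose F (x : R) : R := atan ((x - w) / s).
have cF x : is_derive x (1 : R) F (poisson_kernel s (w - x)).
  apply: is_derive_eq; rewrite /GRing.scale/= /poisson_kernel.
  have h1 := poisson_kernel_den (w - x) s0.
  have -> : s ^+ 2 + (w - x) ^+ 2 = s ^+ 2 * (1 + ((x - w) / s) ^+ 2).
    by field; exact: lt0r_neq0.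
  have h2 : 1 + ((x - w) / s) ^+ 2 != 0 by rewrite lt0r_neq0// ltr_wpDr ?sqr_ge0.
  field; rewrite (gt_eqF s0)/=.
  have : s ^+ 2 * (1 + ((x - w) / s) ^+ 2) != 0.
    by rewrite mulf_neq0// expf_neq0// gt_eqF.
  apply: contra_neq => <-; field; exact: lt0r_neq0.
have uny n : - (n.+1%:R : R) < n.+1%:R by rewrite gtrN// ltr0n.
have nS_ge (A : R) : \forall n \near \oo, A <= n.+1%:R.
  near=> n; apply: (@le_trans _ _ n%:R); last by rewrite ler_nat.
  by near: n; exact: nbhs_infty_ger.
have hy : ((n.+1%:R : R) - w) / s @[n --> \oo] --> +oo.
  by apply/cvgryPge => A; near=> n; rewrite ler_pdivlMr// lerBrDr; near: n.
have hn : ((n.+1%:R : R) + w) / s @[n --> \oo] --> +oo.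
  by apply/cvgryPge => A; near=> n; rewrite ler_pdivlMr// -lerBlDr; near: n.
have -> : pi = pi / 2 - (- (pi / 2)) :> R by field.
apply: (@ge0_improper_FTC _ _ (fun n => - n.+1%:R) (fun n => n.+1%:R) _ F) => //.
- by move=> m n mn; apply: subset_itv; rewrite bnd_simp ?lerN2 ler_nat ltnS.
- move=> x _; exists (Num.truncn `|x|); rewrite -ler_norml ltW//.
  exact: truncnS_gt.
- move=> x _; apply: (@continuous_comp _ _ _ (fun x => w - x) (poisson_kernel s)).
    by apply: cvgB; [exact: cvg_cst|exact: cvg_id].
  exact: continuous_poisson_kernel.
- rewrite (_ : (fun n => _) = (fun n => - atan ((n.+1%:R + w) / s))).
    by apply: cvgN; exact: (cvg_comp _ _ hn (@cvgy_atan R)).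
  by apply/funext => n; rewrite /F -atanN -mulNr opprD.
- exact: (cvg_comp _ _ hy (@cvgy_atan R)).
- by move=> x _; exact: poisson_kernel_ge0.
Unshelve. all: by end_near. Qed.

Lemma measurable_poisson_kernel (s : R) : 0 < s ->
  measurable_fun setT (poisson_kernel s).
Proof.
by move=> s0; apply: continuous_measurable_fun; exact: continuous_poisson_kernel.
Qed.

Lemma poisson_kernel_integrable (s w : R) : 0 < s ->
  mu.-integrable setT (EFin \o (fun x => poisson_kernel s (w - x))).
Proof.
move=> s0; apply/integrableP; split.
  apply/measurable_EFinP; apply: (measurableT_comp (measurable_poisson_kernel s0)).
  exact: measurable_funB.
rewrite (_ : integral _ _ _ = pi%:E) ?ltry// -(poisson_kernel_mass w s0).
by apply: eq_integral => x _; rewrite /= ger0_norm// poisson_kernel_ge0.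
Qed.

Lemma Rintegral_poisson_kernel (s w : R) : 0 < s ->
  \int[mu]_x (poisson_kernel s (w - x)) = pi.
Proof. by move=> s0; rewrite /Rintegral poisson_kernel_mass. Qed.

(** Poisson kernels form an approximate identity: within distance [r] of [w] the
    oscillation of [g] is at most [e], and beyond it the kernel of width [s] is
    dominated by a small multiple of the kernel of width [r]. *)
Lemma poisson_smoothing_close (g : R -> R) (B e r s w : R) :
  measurable_fun setT g -> (forall x, `|g x| <= B) -> 0 < e -> 0 < r -> 0 < s ->
  (forall x, `|x - w| < r -> `|g x - g w| <= e) ->
  `|\int[mu]_x (g x * poisson_kernel s (w - x)) - pi * g w| <=
    e * pi + 2 * B * (2 * s / r) * pi.
Proof.
move=> mg gB e0 r0 s0 gw.
have B0 : 0 <= B by rewrite (le_trans _ (gB 0)).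
have mk : measurable_fun setT (fun x : R => poisson_kernel s (w - x)).
  by apply: (measurableT_comp (measurable_poisson_kernel s0)); exact: measurable_funB.
have ik := poisson_kernel_integrable w s0.
have iR := poisson_kernel_integrable w r0.
have ig : mu.-integrable setT (EFin \o (fun x => g x * poisson_kernel s (w - x))).
  apply: (dominated_integrable mu (g := fun x => B * poisson_kernel s (w - x))) => //.
  - exact: measurable_funM.
  - exact: RintegrableZl.
  - move=> x _; rewrite normrM (ger0_norm (poisson_kernel_ge0 _ s0)).
    by rewrite ler_wpM2r ?poisson_kernel_ge0.
have -> : pi * g w = \int[mu]_x (g w * poisson_kernel s (w - x)).
  by rewrite RintegralZl// Rintegral_poisson_kernel// mulrC.
rewrite -RintegralB//; last first.
  exact: RintegrableZl.
apply: (@le_trans _ _ (\int[mu]_x (e * poisson_kernel s (w - x) +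
    (2 * B * (2 * s / r)) * poisson_kernel r (w - x)))); last first.
  rewrite RintegralD//; [|exact: RintegrableZl|
    exact: RintegrableZl].
  have E c t : 0 < t -> \int[mu]_x (c * poisson_kernel t (w - x)) = c * pi.
    move=> t0; rewrite RintegralZl//; last exact: poisson_kernel_integrable.
    by rewrite Rintegral_poisson_kernel.
  by rewrite !E.
apply: Rintegral_le_dominated => //.
- by apply: measurable_funB => //; apply: measurable_funM.
- by apply: RintegrableD => //; exact: RintegrableZl.
- move=> x _; rewrite -mulrBl normrM (ger0_norm (poisson_kernel_ge0 _ s0)).
  have [xw|xw] := ltP `|x - w| r.
    rewrite -[leLHS]addr0 lerD// ?ler_wpM2r ?poisson_kernel_ge0 ?gw//.
    apply: mulr_ge0; last exact: poisson_kernel_ge0.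
    apply: mulr_ge0; first exact: mulr_ge0.
    by apply: divr_ge0; [apply: mulr_ge0 => //; exact: ltW|exact: ltW].
  rewrite -[leLHS]add0r lerD//; first by rewrite mulr_ge0 ?poisson_kernel_ge0 ?ltW.
  rewrite -mulrA; apply: ler_pM => //; first exact: poisson_kernel_ge0.
    rewrite (le_trans (ler_normB _ _))// mulr_natl mulr2n lerD//.
  by apply: poisson_kernel_tail => //; rewrite distrC.
Qed.

End half_line.

(** * The continuity theorem of Levy for integrable limits *)

Section limits.
Context {R : realType}.

Lemma norm_cos_le1 (x : R) : `|cos x| <= 1.
Proof. by rewrite ler_norml cos_geN1 cos_le1. Qed.

Lemma norm_sin_le1 (x : R) : `|sin x| <= 1.
Proof. by rewrite ler_norml sin_geN1 sin_le1. Qed.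

Lemma measurable_fun_cos : measurable_fun setT (@cos R).
Proof. by apply: continuous_measurable_fun; exact: continuous_cos. Qed.

Lemma measurable_fun_sin : measurable_fun setT (@sin R).
Proof. by apply: continuous_measurable_fun; exact: continuous_sin. Qed.

Lemma continuous_mulr_comp (f : R -> R) (y : R) : continuous f ->
  continuous (fun t : R => f (t * y)).
Proof.
move=> cf t; apply: (@continuous_comp R R R (fun t => t * y) f t); last exact: cf.
exact: mulrr_continuous.
Qed.

Lemma continuous_expRM (a : R) : continuous (fun t : R => expR (a * t)).
Proof. by move=> t; apply: derivable_continuous_at; apply: ex_derive. Qed.

Lemma continuous_param_integral d (T : measurableType d)
    (mu : {measure set T -> \bar R}) (D : set T) (f : R -> T -> R) (g : T -> R) :
  measurable D -> mu.-integrable D (EFin \o g) ->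
  (forall l, measurable_fun D (f l)) ->
  (forall y, D y -> continuous (f ^~ y)) ->
  (forall l y, D y -> `|f l y| <= g y) ->
  continuous (fun l => \int[mu]_(y in D) f l y).
Proof.
move=> mD ig mf cf fg l.
have li : l \in `]l - 1, l + 1[%classic.
  by rewrite inE/= in_itv/= gtrBl ltr01 ltrDl ltr01.
apply: (@continuity_under_integral _ _ _ mu f D mD (l - 1) (l + 1)
  _ _ g ig _ l li).
- by move=> x _; apply: (dominated_integrable mu mD (mf x) ig); exact: fg.
- by apply: aeW => y Dy x _; exact: cf.
- by move=> x _; apply: aeW => y; exact: fg.
Qed.

Lemma cvg_uniform_approx (a : nat -> R) (b : R) :
  (forall e, 0 < e -> exists a' b', [/\ a' n @[n --> \oo] --> b',
    \forall n \near \oo, `|a' n - a n| <= e & `|b' - b| <= e]) ->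
  a n @[n --> \oo] --> b.
Proof.
move=> h; apply/cvgrPdist_lt => r r0.
have r3 : 0 < r / 3 by rewrite divr_gt0.
have [a' [b' [ca aa bb]]] := h _ r3.
near=> n.
have h1 : `|b' - a' n| < r / 3.
  by near: n; move/cvgrPdist_lt : ca => /(_ _ r3).
have h2 : `|a' n - a n| <= r / 3 by near: n.
have -> : b - a n = (b - b') + (b' - a' n) + (a' n - a n) by ring.
apply: (le_lt_trans (ler_normD _ _)).
have -> : r = r / 3 + r / 3 + r / 3 by field.
apply: ltr_leD => //.
apply: (le_lt_trans (ler_normD _ _)); apply: ler_ltD => //.
by rewrite distrC.
Unshelve. all: by end_near. Qed.

(** A trapezoidal cut-off, constant outside two strips of width one. *)
Definition cutoff (L x : R) : R := Num.min 1 (Num.max 0 (L + 1 - `|x|)).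

Lemma cutoff_ge0 L x : 0 <= cutoff L x.
Proof. by rewrite /cutoff le_min ler01 le_max lexx. Qed.

Lemma cutoff_le1 L x : cutoff L x <= 1.
Proof. by rewrite /cutoff ge_min lexx. Qed.

Lemma cutoff1 L x : `|x| <= L -> cutoff L x = 1.
Proof.
move=> xL; rewrite /cutoff; apply/min_idPl; rewrite le_max; apply/orP; right.
by rewrite -addrA addrC -addrA lerDl addrC subr_ge0.
Qed.

Lemma cutoff0 L x : L + 1 < `|x| -> cutoff L x = 0.
Proof.
move=> xL; rewrite /cutoff (max_idPl _) ?subr_le0 ?ltW//.
by apply/min_idPr.
Qed.

Lemma continuous_cutoff L : continuous (cutoff L).
Proof.
move=> x.
have h : {for x, continuous (fun y : R => L + 1 - `|y|)}.
  by apply: cvgB; [exact: cvg_cst|exact: norm_continuous].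
exact: (continuous_min (cvg_cst _) (continuous_max (cvg_cst _) h)).
Qed.

Lemma le_cutoff L L' x : L <= L' -> cutoff L x <= cutoff L' x.
Proof.
move=> LL; rewrite /cutoff le_min ge_min lexx/= ge_min; apply/orP; right.
by rewrite ge_max !le_max lexx/= !lerD2r LL orbT.
Qed.

(** The theorem of Heine on a compact arc [phi `[- L, L]], with the difference
    that [u] need not lie on the arc: uniform continuity of the restriction of [g]
    to the arc would not control [g u]. *)
Lemma uniformly_continuous_near_arc (Y : pseudoMetricType R) (g : Y -> R)
    (phi : R -> Y) (L e : R) : continuous g -> continuous phi -> 0 < e ->
  exists2 r, 0 < r & forall w u, `|w| <= L -> ball (phi w) r u ->
    `|g u - g (phi w)| < e.
Proof.
move=> cg cphi e0.
have := @compact_near_coveringP _ (`[- L, L]%classic : set R).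
move=> [/(_ (@segment_compact _ _ _)) h _].
have {h} := h R (0^'+) (fun r w => forall u, ball (phi w) r u -> `|g u - g (phi w)| < e) _.
case.
  move=> w _.
  have e2 : 0 < e / 2 by rewrite divr_gt0.
  have /nbhs_ballP[r /= r0 rg] : \forall u \near phi w, `|g (phi w) - g u| < e / 2.
    by have /cvgrPdist_lt := cg (phi w); exact.
  have r2 : 0 < r / 2 by rewrite divr_gt0.
  have nw : \forall w' \near w, ball (phi w) (r / 2) (phi w').
    by have := cphi w; move/cvg_ballP => /(_ _ r2).
  exists ([set w' | ball (phi w) (r / 2) (phi w')], [set t | t < r / 2]).
    split=> //=; near=> t => /=; near: t; exact: nbhs_right_lt.
  move=> [w' t] /= [bw' tr] u bu.
  have bwu : ball (phi w) r u.
    rewrite (splitr r); apply: ball_triangle bw' _.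
    by apply: le_ball bu; exact: ltW.
  have bww : ball (phi w) r (phi w').
    by apply: le_ball bw'; rewrite ler_pdivrMr// ler_peMr ?(ltW r0)// ler1n.
  have := rg _ bwu; have := rg _ bww => /= h1 h2.
  rewrite (splitr e); apply: le_lt_trans (ltrD h2 h1).
  by rewrite (distrC _ (g u)) (le_trans _ (ler_normD _ _))// addrA subrK.
move=> r /= r0 h; exists (r / 2); first by rewrite divr_gt0.
move=> w u wL; apply: (h (r / 2)) => /=.
- by rewrite sub0r normrN gtr0_norm ?divr_gt0// ltr_pdivrMr// ltr_pMr// ltr1n.
- by rewrite divr_gt0.
- by rewrite in_itv/= -ler_norml.
Unshelve. all: by end_near. Qed.

End limits.

Section characteristic_smoothing.
Context {R : realType}.
Local Notation mu := (@lebesgue_measure R).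

(** With [c] and [s] the real and imaginary parts of a characteristic function,
    this is [pi] times the density of the law smoothed by the Poisson kernel of
    width [sg]; the law itself is the case [sg = 0], when the integral makes
    sense. *)
Definition damped_inversion (c s : R -> R) (sg x : R) : R :=
  \int[mu]_(t in `]0, +oo[)
    (expR (- sg * t) * (c t * cos (t * x) + s t * sin (t * x))).

Context d (T : measurableType d) (P : probability T R).

Lemma measurable_cos_scale (W : T -> R) (t : R) : measurable_fun setT W ->
  measurable_fun setT (fun w => cos (t * W w)).
Proof.
move=> mW; apply: measurableT_comp; first exact: measurable_fun_cos.
exact: measurable_funM.
Qed.

Lemma measurable_sin_scale (W : T -> R) (t : R) : measurable_fun setT W ->
  measurable_fun setT (fun w => sin (t * W w)).
Proof.
move=> mW; apply: measurableT_comp; first exact: measurable_fun_sin.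
exact: measurable_funM.
Qed.

Lemma continuous_char_re (W : T -> R) : measurable_fun setT W ->
  continuous (fun t : R => \int[P]_w cos (t * W w)).
Proof.
move=> mW; apply: (@continuous_param_integral R _ T P setT _ (cst 1)) => //.
- exact: finite_measure_integrable_cst.
- by move=> l; exact: measurable_cos_scale.
- by move=> w _; apply: continuous_mulr_comp; exact: continuous_cos.
- by move=> l w _; exact: norm_cos_le1.
Qed.

Lemma continuous_char_im (W : T -> R) : measurable_fun setT W ->
  continuous (fun t : R => \int[P]_w sin (t * W w)).
Proof.
move=> mW; apply: (@continuous_param_integral R _ T P setT _ (cst 1)) => //.
- exact: finite_measure_integrable_cst.
- by move=> l; exact: measurable_sin_scale.
- by move=> w _; apply: continuous_mulr_comp; exact: continuous_sin.
- by move=> l w _; exact: norm_sin_le1.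
Qed.

Lemma integrable_cos_scale (W : T -> R) (t : R) : measurable_fun setT W ->
  P.-integrable setT (EFin \o (fun w => cos (t * W w))).
Proof.
move=> mW; apply: (@bounded_integrable _ _ _ _ _ 1); first exact: measurable_cos_scale.
by move=> x; exact: norm_cos_le1.
Qed.

Lemma integrable_sin_scale (W : T -> R) (t : R) : measurable_fun setT W ->
  P.-integrable setT (EFin \o (fun w => sin (t * W w))).
Proof.
move=> mW; apply: (@bounded_integrable _ _ _ _ _ 1); first exact: measurable_sin_scale.
by move=> x; exact: norm_sin_le1.
Qed.

(** The Poisson kernel is the Laplace transform of a cosine; integrating over the
    law first, by Fubini, leaves the damped inversion integral. *)
Lemma smoothing_char (W : T -> R) (sg x : R) : measurable_fun setT W -> 0 < sg ->
  \int[P]_w poisson_kernel sg (W w - x) =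
  damped_inversion (fun t => \int[P]_w cos (t * W w))
    (fun t => \int[P]_w sin (t * W w)) sg x.
Proof.
move=> mW s0.
pose f (z : T * R) : R :=
  expR (- sg * z.2) * cos (z.2 * (W z.1 - x)) * \1_(`]0, +oo[%classic : set R) z.2.
have mf : measurable_fun setT f.
  apply: measurable_funM; last by apply: measurableT_comp.
  apply: measurable_funM.
    apply: measurableT_comp => //; exact: measurable_funM.
  apply: measurableT_comp; first exact: measurable_fun_cos.
  apply: measurable_funM => //; apply: measurable_funB => //.
  exact: measurableT_comp.
pose h : R -> R := (fun t => expR (- sg * t)) \_ `]0, +oo[.
have ih : mu.-integrable setT (EFin \o h).
  rewrite /h -restrict_EFin.
  have mD : measurable (`]0, +oo[%classic : set (measurableTypeR R)).
    exact: measurable_itv.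
  exact: ((integrable_mkcond _ mD).1 (integrable_expRN s0)).
have fh w t : `|f (w, t)| <= h t.
  rewrite /f /h patchE indicE /=; case: ifPn => _; last by rewrite mulr0 normr0.
  by rewrite mulr1 normrM ger0_norm ?expR_ge0// ler_piMr ?expR_ge0// norm_cos_le1.
transitivity (\int[P]_w \int[mu]_t f (w, t)).
  apply: eq_Rintegral => w _; rewrite /poisson_kernel -Laplace_cos// Rintegral_mkcond.
  by apply: eq_Rintegral => t _; rewrite patch_indic.
rewrite (Fubini_dominated P mf ih fh) /damped_inversion [in RHS]Rintegral_mkcond.
apply: eq_Rintegral => t _; rewrite patch_indic /f /=.
under eq_Rintegral => w _.
  rewrite (_ : _ * _ * _ = (expR (- sg * t) * \1_`]0, +oo[ t) *
    (cos (t * W w) * cos (t * x) + sin (t * W w) * sin (t * x))); last first.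
    by rewrite mulrBr cosB; ring.
  over.
rewrite RintegralZl//; last first.
  apply: RintegrableD => //.
    by under eq_fun do rewrite mulrC; apply: RintegrableZl => //; exact: integrable_cos_scale.
  by under eq_fun do rewrite mulrC; apply: RintegrableZl => //; exact: integrable_sin_scale.
rewrite RintegralD//; last 2 first.
- by under eq_fun do rewrite mulrC; apply: RintegrableZl => //; exact: integrable_cos_scale.
- by under eq_fun do rewrite mulrC; apply: RintegrableZl => //; exact: integrable_sin_scale.
rewrite (RintegralZr _ _ (integrable_cos_scale t mW))//.
rewrite (RintegralZr _ _ (integrable_sin_scale t mW))//.
by ring.
Qed.

End characteristic_smoothing.

(** Only the limits [c] and [s] of the characteristic functions are given, not
    the limit law: it is recovered from its density, the inversion integral of
    [c] and [s], which converges since both are dominated by an integrable [M].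
    Smoothing by a Poisson kernel damps the inversion integral, hence smoothed laws
    converge by dominated convergence; letting the width tend to [0] gives
    convergence against compactly supported functions, and continuity of [c] at
    the origin prevents mass from escaping to infinity. *)
Section Levy.
Context {R : realType} d (T : measurableType d) (P : probability T R).
Local Notation mu := (@lebesgue_measure R).
Variables (W : nat -> T -> R) (c s M : R -> R).
Hypotheses (mW : forall n, measurable_fun setT (W n))
  (cc : forall t : R, 0 < t -> {for t, continuous c})
  (cs : forall t : R, 0 < t -> {for t, continuous s})
  (iM : mu.-integrable `]0, +oo[ (EFin \o M))
  (cM : forall t : R, 0 < t -> `|c t| <= M t)
  (sM : forall t : R, 0 < t -> `|s t| <= M t)
  (cvgc : forall t : R, 0 < t -> \int[P]_w cos (t * W n w) @[n --> \oo] --> c t)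
  (cvgs : forall t : R, 0 < t -> \int[P]_w sin (t * W n w) @[n --> \oo] --> s t)
  (c1 : c t @[t --> 0^'+] --> (1 : R)).

Let psi := damped_inversion c s.

Let integrand (sg x t : R) :=
  expR (- sg * t) * (c t * cos (t * x) + s t * sin (t * x)).

Let integrand_cont (sg x t : R) : 0 < t -> {for t, continuous (integrand sg x)}.
Proof.
move=> t0; apply: cvgM.
  exact: continuous_expRM.
apply: cvgD; apply: cvgM; [exact: cc| |exact: cs|].
- by apply: continuous_mulr_comp; exact: continuous_cos.
- by apply: continuous_mulr_comp; exact: continuous_sin.
Qed.

Let combo_le (a b m x y : R) : `|a| <= m -> `|b| <= m ->
  `|a * cos x + b * sin y| <= 2 * m.
Proof.
move=> am bm; rewrite (le_trans (ler_normD _ _))// !normrM mulr_natl mulr2n.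
have m0 : 0 <= m by rewrite (le_trans _ am).
by apply: lerD; rewrite -[leRHS]mulr1; apply: ler_pM => //;
  [exact: norm_cos_le1|exact: norm_sin_le1].
Qed.

Let integrand_le sg x t : 0 <= sg -> 0 < t -> `|integrand sg x t| <= 2 * M t.
Proof.
move=> s0 t0; rewrite normrM ger0_norm ?expR_ge0//.
apply: (@le_trans _ _ (1 * `|c t * cos (t * x) + s t * sin (t * x)|)).
  by rewrite ler_wpM2r// -expR0 ler_expR mulNr oppr_le0 mulr_ge0// ltW.
by rewrite mul1r combo_le ?cM ?sM.
Qed.

Let pos_itv (t : R) : (`]0, +oo[%classic : set R) t -> 0 < t.
Proof. by rewrite /= in_itv/= andbT. Qed.

Let i2M : mu.-integrable `]0, +oo[ (EFin \o (fun t => 2 * M t)).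
Proof. exact: RintegrableZl. Qed.

Let integrand_int sg x : 0 <= sg ->
  mu.-integrable `]0, +oo[ (EFin \o integrand sg x).
Proof.
move=> s0; apply: (dominated_integrable mu _ _ i2M) => //.
  by apply: continuous_measurable_pos => t; exact: integrand_cont.
by move=> t /pos_itv; exact: integrand_le.
Qed.

Let bound2 := \int[mu]_(t in `]0, +oo[) (2 * M t).

Let psi_le x : `|psi 0 x| <= bound2.
Proof.
apply: (Rintegral_le_dominated mu) => //.
  by apply: continuous_measurable_pos => t; exact: integrand_cont.
by move=> t /pos_itv; exact: integrand_le.
Qed.

Let psi_cont : continuous (psi 0).
Proof.
apply: (@continuous_param_integral R _ _ mu _ (integrand 0) (fun t => 2 * M t)) => //.
- move=> x; by apply: continuous_measurable_pos => t; exact: integrand_cont.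
- move=> t _ x; apply: cvgM; first exact: cvg_cst.
  by apply: cvgD; apply: cvgM; [exact: cvg_cst| |exact: cvg_cst|];
    (under [X in X @ _ --> _]eq_fun do rewrite mulrC); rewrite mulrC;
    apply: continuous_mulr_comp; [exact: continuous_cos|exact: continuous_sin].
- by move=> x t /pos_itv; exact: integrand_le.
Qed.

Let smoothing_cvg sg x : 0 < sg ->
  \int[P]_w poisson_kernel sg (W n w - x) @[n --> \oo] --> psi sg x.
Proof.
move=> s0; under eq_fun do rewrite smoothing_char//.
have ig : mu.-integrable `]0, +oo[ (EFin \o (fun t => 2 * expR (- sg * t))).
  by apply: RintegrableZl => //; exact: integrable_expRN.
apply: (Rintegral_dominated_cvg mu _ _ _ ig _).2 => //.
- move=> n; apply: continuous_measurable_pos => t t0; apply: cvgM.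
    exact: continuous_expRM.
  apply: cvgD; apply: cvgM.
  + exact: continuous_char_re.
  + by apply: continuous_mulr_comp; exact: continuous_cos.
  + exact: continuous_char_im.
  + by apply: continuous_mulr_comp; exact: continuous_sin.
- move=> t /pos_itv t0; apply: cvgMr; apply: cvgD; apply: cvgMl.
    exact: cvgc.
  exact: cvgs.
- move=> n t _; rewrite normrM ger0_norm ?expR_ge0// mulrC.
  rewrite ler_wpM2r ?expR_ge0// -[leRHS]mulr1 combo_le//.
    apply: Rintegral_le_bound; first exact: measurable_cos_scale.
    by move=> w; exact: norm_cos_le1.
  apply: Rintegral_le_bound; first exact: measurable_sin_scale.
  by move=> w; exact: norm_sin_le1.
Qed.

Let eta k := \int[mu]_(t in `]0, +oo[) (2 * M t * (1 - expR (- k.+1%:R^-1 * t))).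

Let eta_le k t : (`]0, +oo[%classic : set R) t ->
  `|2 * M t * (1 - expR (- k.+1%:R^-1 * t))| <= 2 * M t.
Proof.
move=> /pos_itv t0; have M0 : 0 <= M t by rewrite (le_trans _ (cM t0)).
have e1 : expR (- k.+1%:R^-1 * t) <= 1.
  by rewrite -expR0 ler_expR mulNr oppr_le0 mulr_ge0// ltW.
rewrite normrM ger0_norm ?mulr_ge0// ler_piMr ?mulr_ge0// ger0_norm ?subr_ge0// gerBl expR_ge0.

Qed.

Let meta k : measurable_fun (`]0, +oo[ : set R)
  (fun t => 2 * M t * (1 - expR (- k.+1%:R^-1 * t))).
Proof.
apply: measurable_funM; first by have /integrableP[/measurable_EFinP] := i2M.
apply: measurable_funB => //; apply: continuous_measurable_pos => t _.
exact: continuous_expRM.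
Qed.

Let eta0 : eta k @[k --> \oo] --> 0.
Proof.
have -> : 0 = \int[mu]_(t in `]0, +oo[) (2 * M t * (1 - expR (- 0 * t))) :> R.
  by under eq_Rintegral do rewrite oppr0 mul0r expR0 subrr mulr0; rewrite Rintegral_cst// mul0r.
apply: (Rintegral_dominated_cvg mu _ meta _ i2M eta_le).2 => //.
move=> t _; apply: cvgMr; apply: cvgB; first exact: cvg_cst.
apply: continuous_cvg; first exact: continuous_expR.
by apply: cvgMl; apply: cvgN; exact: cvg_harmonicS.
Qed.

(** Removing the damping costs an error that does not depend on [x]. *)
Let psi_close k x : `|psi k.+1%:R^-1 x - psi 0 x| <= eta k.
Proof.
have k0 : 0 <= k.+1%:R^-1 :> R by rewrite invr_ge0.
rewrite -RintegralB//; [|exact: integrand_int|exact: integrand_int].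
apply: (Rintegral_le_dominated mu) => //.
- by apply: measurable_funB; apply: continuous_measurable_pos => t; exact: integrand_cont.
- by apply: (dominated_integrable mu _ (meta k) i2M) => //; exact: eta_le.
move=> t /pos_itv t0; rewrite /integrand oppr0 mul0r expR0 mul1r.
rewrite -{2}[c t * _ + _]mul1r -mulrBl normrM mulrC distrC ler_pM//.
  by rewrite combo_le ?cM ?sM.
rewrite ger0_norm// subr_ge0 -expR0 ler_expR mulNr oppr_le0 mulr_ge0//.
exact: ltW.
Qed.

Let psi0_ge0 x : 0 <= psi 0 x.
Proof.
have h k : 0 <= psi k.+1%:R^-1 x.
  have k0 : 0 < k.+1%:R^-1 :> R by rewrite invr_gt0.
  have := cvgr_to_ge (b := 0) (smoothing_cvg (x := x) k0); apply.
  apply: nearW => n; apply: Rintegral_ge0 => w _; exact: poisson_kernel_ge0.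
have cv : psi k.+1%:R^-1 x @[k --> \oo] --> psi 0 x.
  apply/cvgrPdist_le => e e0; near=> k; rewrite distrC (le_trans (psi_close _ _))//.
  by near: k; exact: (cvgr_le _ eta0).
by have := cvgr_to_ge (b := 0) cv; apply; exact: nearW.
Unshelve. all: by end_near. Qed.

Let density x := psi 0 x / pi.

Let pi0 : 0 < pi :> R. Proof. exact: pi_gt0. Qed.

Let continuous_smoothing sg n : 0 < sg ->
  continuous (fun x : R => \int[P]_w poisson_kernel sg (W n w - x)).
Proof.
move=> s0.
apply: (@continuous_param_integral R _ T P setT _ (cst sg^-1)) => //.
- exact: finite_measure_integrable_cst.
- move=> l; apply: (measurableT_comp (measurable_poisson_kernel s0)).
  exact: measurable_funB.
- move=> w _ x; apply: (@continuous_comp R R R (fun x => W n w - x)).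
    by apply: cvgB; [exact: cvg_cst|exact: cvg_id].
  exact: continuous_poisson_kernel.
- move=> l w _; rewrite ger0_norm ?poisson_kernel_ge0//.
  exact: poisson_kernel_le.
Qed.

Let smoothing_bound sg x n : 0 < sg ->
  `|\int[P]_w poisson_kernel sg (W n w - x)| <= sg^-1.
Proof.
move=> s0; apply: Rintegral_le_bound.
  apply: (measurableT_comp (measurable_poisson_kernel s0)).
  exact: measurable_funB.
by move=> w; rewrite ger0_norm ?poisson_kernel_ge0 ?poisson_kernel_le.
Qed.

Section vague.
Variables (g : R -> R) (B L : R).
Hypotheses (cg : continuous g) (gB : forall x, `|g x| <= B)
  (g0 : forall x, L < `|x| -> g x = 0).

Let mg : measurable_fun setT g.
Proof. exact: continuous_measurable_fun. Qed.

Let ig : mu.-integrable setT (EFin \o (fun x => `|g x|)).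
Proof.
apply: (dominated_integrable mu (g := fun x => B * \1_(`[- L, L]%classic : set R) x)) => //.
- exact: measurableT_comp.
- by apply: RintegrableZl => //; exact: integrable_indic_itv.
- move=> x _; rewrite normr_id indicE; case: (boolP (x \in _)) => xL.
    by rewrite mulr1.
  rewrite mulr0 g0 ?normr0//; rewrite ltNge; apply: contra xL => xL.
  by rewrite inE/= in_itv/= -ler_norml.
Qed.

Let unif_g e : 0 < e ->
  exists2 r, 0 < r & forall w x, `|x - w| < r -> `|g x - g w| <= e.
Proof.
move=> e0.
have cid : continuous (id : R -> R) by move=> w; exact: cvg_id.
have [r r0 gr] := uniformly_continuous_near_arc (L + 1) cg cid e0.
exists (Num.min r 1); first by rewrite lt_min r0 ltr01.
move=> w x; rewrite lt_min => /andP[xr x1].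
have [wL|wL] := leP `|w| (L + 1).
  by apply/ltW/gr => //; rewrite /ball/= distrC.
rewrite g0; last first.
  rewrite -(ltrD2r 1) (lt_le_trans wL)// -[w](subrK x) (le_trans (ler_normD _ _))//.
  by rewrite addrC lerD2l distrC ltW.
rewrite g0 ?subrr ?normr0 ?ltW//.
by rewrite (lt_trans _ wL)// ltrDl.
Qed.

(** Smoothing moves, by Fubini, from the law of [W n] to [g], which it hardly
    changes; the smoothed laws have the densities [psi sg / pi] in the limit. *)
Lemma vague_cvg :
  \int[P]_w g (W n w) @[n --> \oo] --> \int[mu]_x (g x * density x).
Proof.
have B0 : 0 <= B by rewrite (le_trans _ (gB 0)).
apply: cvg_uniform_approx => e e0.
have e2 : 0 < e / 2 by rewrite divr_gt0.
have [r r0 gr] := unif_g e2.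
pose G := \int[mu]_x `|g x|.
(* The width [k.+1%:R^-1] controls two errors: that of smoothing [g] and that of
   replacing the damped inversion integral by the undamped one. *)
have [k [kB keta]] : exists k : nat, 2 * B * (2 * k.+1%:R^-1 / r) <= e / 2 /\
    G * eta k / pi <= e.
  have h1 : 2 * B * (2 * k.+1%:R^-1 / r) @[k --> \oo] --> 0.
    have -> : 0 = 2 * B * (2 * 0 / r) :> R by rewrite !(mulr0,mul0r).
    by apply: cvgMr; apply: cvgMl; apply: cvgMr; exact: cvg_harmonicS.
  have h2 : G * eta k / pi @[k --> \oo] --> 0.
    have -> : 0 = G * 0 / pi :> R by rewrite !(mulr0,mul0r).
    by apply: cvgMl; apply: cvgMr; exact: eta0.
  near \oo => k; exists k; split; near: k.
    exact: (cvgr_le _ h1).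
  exact: (cvgr_le _ h2).
pose sg : R := k.+1%:R^-1.
have s0 : 0 < sg by rewrite invr_gt0.
exists (fun n => (\int[mu]_x (g x * \int[P]_w poisson_kernel sg (W n w - x))) / pi).
exists ((\int[mu]_x (g x * psi sg x)) / pi).
have igs : mu.-integrable setT (EFin \o (fun x => sg^-1 * `|g x|)).
  exact: RintegrableZl.
have igpsi s' : 0 <= s' -> mu.-integrable setT (EFin \o (fun x => g x * psi s' x)).
  move=> s'0; apply: (dominated_integrable mu (g := fun x => bound2 * `|g x|)) => //.
  - apply: measurable_funM => //; apply: continuous_measurable_fun.
    apply: (@continuous_param_integral R _ _ mu _ (integrand s') (fun t => 2 * M t)) => //.
    + move=> x; by apply: continuous_measurable_pos => t; exact: integrand_cont.
    + move=> t _ x; apply: cvgM; first exact: cvg_cst.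
      by apply: cvgD; apply: cvgM; [exact: cvg_cst| |exact: cvg_cst|];
        (under [X in X @ _ --> _]eq_fun do rewrite mulrC); rewrite mulrC;
        apply: continuous_mulr_comp; [exact: continuous_cos|exact: continuous_sin].
    + by move=> x t /pos_itv; exact: integrand_le.
  - exact: RintegrableZl.
  - move=> x _; rewrite normrM mulrC ler_wpM2r//.
    apply: (Rintegral_le_dominated mu) => //.
      by apply: continuous_measurable_pos => t; exact: integrand_cont.
    by move=> t /pos_itv; exact: integrand_le.
split.
- apply: cvgMl; apply: (Rintegral_dominated_cvg mu _ _ _ igs _).2 => //.
  + move=> n; apply: measurable_funM => //; apply: continuous_measurable_fun.
    exact: continuous_smoothing.
  + by move=> x _; apply: cvgMr; exact: smoothing_cvg.
  + move=> n x _; rewrite normrM mulrC ler_wpM2r//; exact: smoothing_bound.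
- apply: nearW => n.
  have mk : measurable_fun setT (fun z : T * R => g z.2 * poisson_kernel sg (W n z.1 - z.2)).
    apply: measurable_funM; first exact: measurableT_comp.
    apply: (measurableT_comp (measurable_poisson_kernel s0)).
    by apply: measurable_funB => //; exact: measurableT_comp.
  have F := Fubini_dominated P mk igs _.
  have -> : \int[mu]_x (g x * \int[P]_w poisson_kernel sg (W n w - x)) =
      \int[P]_w (\int[mu]_x (g x * poisson_kernel sg (W n w - x))).
    rewrite F.
      apply: eq_Rintegral => x _; rewrite -RintegralZl//.
      apply: (@bounded_integrable _ _ _ P _ sg^-1).
        apply: (measurableT_comp (measurable_poisson_kernel s0)).
        exact: measurable_funB.
      by move=> w; rewrite ger0_norm ?poisson_kernel_ge0 ?poisson_kernel_le.
    move=> w x; rewrite normrM mulrC ler_wpM2r//.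
    by rewrite ger0_norm ?poisson_kernel_ge0 ?poisson_kernel_le.
  pose Gs w := \int[mu]_x (g x * poisson_kernel sg (w - x)).
  have mGs : measurable_fun setT Gs.
    apply: continuous_measurable_fun.
    apply: (@continuous_param_integral R _ _ mu setT _ (fun x => sg^-1 * `|g x|)) => //.
    + move=> l; apply: measurable_funM => //.
      by apply: (measurableT_comp (measurable_poisson_kernel s0)); exact: measurable_funB.
    + move=> x _ w; apply: cvgMr; apply: (@continuous_comp R R R (fun w => w - x)).
        by apply: cvgB; [exact: cvg_id|exact: cvg_cst].
      exact: continuous_poisson_kernel.
    + move=> l x _; rewrite normrM mulrC ler_wpM2r//.
      by rewrite ger0_norm ?poisson_kernel_ge0 ?poisson_kernel_le.
  have close w : `|Gs w - pi * g w| <= e * pi.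
    rewrite (le_trans (poisson_smoothing_close mg gB e2 r0 s0 (gr w)))//.
    rewrite -mulrDl; apply: ler_wpM2r; first exact: ltW.
    by rewrite [leRHS](splitr e) lerD2l.
  have bGs w : `|Gs w| <= e * pi + pi * B.
    rewrite -[Gs w](subrK (pi * g w)) (le_trans (ler_normD _ _))// lerD//.
    by rewrite normrM gtr0_norm// ler_wpM2l// ltW.
  have iGs : P.-integrable setT (EFin \o (fun w => Gs (W n w))).
    apply: (@bounded_integrable _ _ _ P _ (e * pi + pi * B)) => //.
    exact: measurableT_comp.
  have igW : P.-integrable setT (EFin \o (fun w => g (W n w))).
    apply: (@bounded_integrable _ _ _ P _ B) => //.
    exact: measurableT_comp.
  rewrite -[X in _ - X](mulfK (lt0r_neq0 pi0)) -mulrBl mulrC -/(Gs _).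
  rewrite [X in _ * (_ - X)]mulrC -RintegralZl// -RintegralB//; last exact: RintegrableZl.
  rewrite normrM gtr0_norm ?invr_gt0// mulrC ler_pdivrMr//.
  apply: Rintegral_le_bound; last by move=> w; exact: close.
  apply: measurable_funB; first exact: (measurableT_comp mGs).
  by apply: measurable_funM => //; exact: (measurableT_comp mg).
- have -> : \int[mu]_x (g x * density x) = (\int[mu]_x (g x * psi 0 x)) / pi.
    rewrite -RintegralZr//; last exact: igpsi.
    by apply: eq_Rintegral => x _; rewrite mulrA.
  rewrite -mulrBl -RintegralB//; [|exact/igpsi/ltW|exact: igpsi].
  rewrite normrM (gtr0_norm (_ : 0 < pi^-1)) ?invr_gt0//.
  apply: le_trans keta; apply: ler_wpM2r; first by rewrite invr_ge0 ltW.
  rewrite mulrC /G -RintegralZl//; apply: (Rintegral_le_dominated mu) => //.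
  + apply: measurable_funB.
      by have /integrableP[/measurable_EFinP] := igpsi _ (ltW s0).
    by have /integrableP[/measurable_EFinP] := igpsi _ (lexx 0).
  + exact: RintegrableZl.
  + by move=> x _; rewrite -mulrBr normrM mulrC ler_wpM2r// psi_close.
Unshelve. all: by end_near. Qed.

End vague.

Let c_le1 t : 0 < t -> `|c t| <= 1.
Proof.
move=> t0; rewrite ler_norml.
have bd n : - 1 <= \int[P]_w cos (t * W n w) <= 1.
  rewrite -ler_norml; apply: Rintegral_le_bound; first exact: measurable_cos_scale.
  by move=> w; exact: norm_cos_le1.
apply/andP; split.
  have := cvgr_to_ge (b := -1) (cvgc t0); apply; apply: nearW => n.
  by case/andP : (bd n).
have := cvgr_to_le (b := 1) (cvgc t0); apply; apply: nearW => n.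
by case/andP : (bd n).
Qed.

Let psi_x0 K : psi K 0 = \int[mu]_(t in `]0, +oo[) (expR (- K * t) * c t).
Proof.
by apply: eq_Rintegral => t _; rewrite mulr0 cos0 sin0 mulr1 mulr0 addr0.
Qed.

Let Laplace1 K : 0 < K -> \int[mu]_(t in `]0, +oo[) expR (- K * t) = K^-1.
Proof.
move=> K0; have := Laplace_cos 0 K0.
under eq_Rintegral do rewrite mulr0 cos0 mulr1.
by move=> ->; field; exact: lt0r_neq0.
Qed.

(** An Abelian theorem: [K] times the Laplace transform of [c] at [K] tends to
    the value [1] of [c] at the origin.  Beyond a fixed [r] the factor
    [expR (- K * t)] is split into two halves, one of which is small. *)
Let Abelian e : 0 < e -> \forall k \near \oo, 1 - e <= k.+1%:R * psi k.+1%:R 0.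
Proof.
move=> e0; have e2 : 0 < e / 2 by rewrite divr_gt0.
have /cvgrPdist_lt/(_ _ e2)[r /= r0 rc] := c1.
have h4 : 4 * expR (- (r / 2) * k.+1%:R) @[k --> \oo] --> 0.
  rewrite -[X in _ --> X](mulr0 4); apply: cvgMr.
  have r2 : 0 < r / 2 by rewrite divr_gt0.
  move/cvg_pinftyP : (cvg_expRN r2); apply.
  by have h : (n%:R : R) @[n --> \oo] --> +oo by [exact: cvgr_idn]; have := h; rewrite -cvg_shiftS.
near=> k.
have hk4 : 4 * expR (- (r / 2) * k.+1%:R) <= e / 2.
  by near: k; exact: (cvgr_le _ h4).
have K0 : 0 < k.+1%:R :> R by [].
set K : R := k.+1%:R in K0 hk4 *.
have iE := integrable_expRN K0.
have K20 : 0 < K / 2 by rewrite divr_gt0.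
have iE2 := integrable_expRN K20.
have mE : measurable_fun (`]0, +oo[ : set R) (fun t => expR (- K * t) * c t).
  apply: continuous_measurable_pos => t t0; apply: cvgM; last exact: cc.
  exact: continuous_expRM.
have ic : mu.-integrable `]0, +oo[ (EFin \o (fun t => expR (- K * t) * c t)).
  apply: (dominated_integrable mu _ mE iE) => // t /pos_itv t0.
  by rewrite normrM ger0_norm ?expR_ge0// ler_piMr ?expR_ge0 ?c_le1.
rewrite lerBlDr -lerBlDl psi_x0.
have -> : 1 = K * \int[mu]_(t in `]0, +oo[) expR (- K * t).
  by rewrite Laplace1// mulfV// lt0r_neq0.
rewrite -mulrBr -RintegralB// -RintegralZl//; last exact: RintegrableB.
apply: (@le_trans _ _ (\int[mu]_(t in `]0, +oo[)
    (e / 2 * K * expR (- K * t) + 2 * K * expR (- (r / 2) * K) * expR (- (K / 2) * t)))).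
  apply: (le_trans (ler_norm _)); apply: (Rintegral_le_dominated mu) => //.
  - apply: measurable_funM => //; apply: measurable_funB => //.
    apply: continuous_measurable_pos => t _; exact: continuous_expRM.
  - by apply: RintegrableD => //; exact: RintegrableZl.
  move=> t /pos_itv t0.
  rewrite -{1}[expR (- K * t)]mulr1 -mulrBr !normrM gtr0_norm// (ger0_norm (expR_ge0 _)).
  have [tr|tr] := ltP t r.
    rewrite -[leLHS]addr0 lerD//.
      rewrite [leRHS](_ : _ = K * (expR (- K * t) * (e / 2))); last by ring.
      apply: ler_wpM2l; first exact: ltW.
      apply: ler_wpM2l; first exact: expR_ge0.
      by apply/ltW/rc => //=; rewrite sub0r normrN gtr0_norm.
    by rewrite !mulr_ge0 ?expR_ge0 ?ltW.
  rewrite -[leLHS]add0r lerD//; first by rewrite !mulr_ge0 ?expR_ge0 ?ltW.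
  rewrite [leRHS](_ : _ = K * (expR (- (r / 2) * K + - (K / 2) * t) * 2)); last first.
    by rewrite expRD; ring.
  apply: ler_wpM2l; first exact: ltW.
  apply: ler_pM => //; first by rewrite ler_expR; nra.
  by rewrite (le_trans (ler_normB _ _))// normr1 -[leRHS]/(1 + 1) lerD2l c_le1.
rewrite RintegralD//; [|exact: RintegrableZl|exact: RintegrableZl].
rewrite !RintegralZl// !Laplace1//.
have -> : e / 2 * K * K^-1 + 2 * K * expR (- (r / 2) * K) * (K / 2)^-1 =
    e / 2 + 4 * expR (- (r / 2) * K).
  by field; exact: lt0r_neq0.
by rewrite [leRHS](splitr e) lerD2l.
Unshelve. all: by end_near. Qed.

(** The test function [K ^ 2 / (K ^ 2 + x ^ 2)], a multiple of a wide Poisson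
    kernel, has an expectation close to [1] because [c] is close to [1] near the
    origin, and is small outside a large ball. *)
Lemma Levy_tight e : 0 < e -> exists2 L, 0 <= L &
  \forall n \near \oo, 1 - e <= \int[P]_w cutoff L (W n w).
Proof.
move=> e0; have e3 : 0 < e / 3 by rewrite divr_gt0.
near \oo => k.
have hk : 1 - e / 3 <= k.+1%:R * psi k.+1%:R 0 by near: k; exact: Abelian.
have K0 : 0 < k.+1%:R :> R by [].
set K : R := k.+1%:R in K0 hk.
(* This makes [e / 3 * (L / K) ^ 2] larger than [1]. *)
pose L := K * (1 + 3 / e).
have L0 : 0 <= L by rewrite mulr_ge0 ?ltW// addr_gt0// divr_gt0.
exists L => //.
have cv : K * \int[P]_w poisson_kernel K (W n w - 0) @[n --> \oo] --> K * psi K 0.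
  by apply: cvgMr; exact: smoothing_cvg.
have lt1 : 1 - e / 3 - e / 3 < K * psi K 0 by rewrite (lt_le_trans _ hk)// gtrBl.
have hgt : \forall n \near \oo, 1 - e / 3 - e / 3 <
    K * \int[P]_w poisson_kernel K (W n w - 0) by exact: (cvgr_gt _ cv _ lt1).
near=> n.
have hn : 1 - e / 3 - e / 3 < K * \int[P]_w poisson_kernel K (W n w - 0) by near: n.
rewrite (_ : 1 - e = 1 - e / 3 - e / 3 - e / 3); last by field.
rewrite lerBlDr (le_trans (ltW hn))//.
have mk : measurable_fun setT (fun w => poisson_kernel K (W n w - 0)).
  apply: (measurableT_comp (measurable_poisson_kernel K0)).
  exact: measurable_funB.
have ik : P.-integrable setT (EFin \o (fun w => poisson_kernel K (W n w - 0))).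
  apply: (@bounded_integrable _ _ _ P _ K^-1) => // w.
  by rewrite ger0_norm ?poisson_kernel_ge0 ?poisson_kernel_le.
have mc : measurable_fun setT (fun w => cutoff L (W n w)).
  apply: measurableT_comp => //; apply: continuous_measurable_fun.
  exact: continuous_cutoff.
have icut : P.-integrable setT (EFin \o (fun w => cutoff L (W n w))).
  apply: (@bounded_integrable _ _ _ P _ 1) => // w.
  by rewrite ger0_norm ?cutoff_ge0 ?cutoff_le1.
have icst : P.-integrable setT (EFin \o cst (e / 3)).
  exact: finite_measure_integrable_cst.
rewrite -RintegralZl//.
have -> : e / 3 = \int[P]_w (cst (e / 3)) w.
  by rewrite Rintegral_cst//= probability_setT mulr1.
rewrite -RintegralD//; apply: le_Rintegral => //.
- exact: RintegrableZl.
- exact: RintegrableD.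
move=> w _; rewrite subr0 /=.
have KE : K * poisson_kernel K (W n w) = K ^+ 2 / (K ^+ 2 + W n w ^+ 2).
  by rewrite /poisson_kernel mulrA expr2.
have den := poisson_kernel_den (W n w) K0.
have [wL|wL] := leP `|W n w| L.
  rewrite cutoff1// -[leLHS]addr0 lerD ?(ltW e3)// KE ler_pdivrMr// mul1r.
  by rewrite lerDl sqr_ge0.
rewrite -[leLHS]add0r lerD ?cutoff_ge0// KE ler_pdivrMr//.
have wL2 : L ^+ 2 <= W n w ^+ 2.
  by rewrite -[leRHS]real_normK ?num_real// ler_sqr ?nnegrE// ltW.
apply: (@le_trans _ _ (e / 3 * L ^+ 2)); last first.
  by rewrite ler_wpM2l ?(ltW e3)// (le_trans wL2)// lerDr sqr_ge0.
rewrite /L exprMn mulrCA ler_peMr ?sqr_ge0//.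
have -> : e / 3 * (1 + 3 / e) ^+ 2 = 2 + e / 3 + 3 / e.
  by field; exact: lt0r_neq0.
by have : 0 < 3 / e by [rewrite divr_gt0]; lra.
Unshelve. all: by end_near. Qed.

Lemma Levy_density_ge0 x : 0 <= density x.
Proof. by rewrite divr_ge0// ltW. Qed.

Lemma Levy_density_continuous : continuous density.
Proof. by move=> x; apply: cvgMl; exact: psi_cont. Qed.

Let mdensity : measurable_fun setT density.
Proof. by apply: continuous_measurable_fun; exact: Levy_density_continuous. Qed.

Let cut_cvg L : 0 <= L -> \int[P]_w cutoff L (W n w) @[n --> \oo] -->
  \int[mu]_x (cutoff L x * density x).
Proof.
move=> L0; apply: (@vague_cvg (cutoff L) 1 (L + 1)).
- exact: continuous_cutoff.
- by move=> x; rewrite ger0_norm ?cutoff_ge0 ?cutoff_le1.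
- by move=> x; exact: cutoff0.
Qed.

Let cut_mass_le1 L : 0 <= L -> \int[mu]_x (cutoff L x * density x) <= 1.
Proof.
move=> L0; have := cvgr_to_le (b := 1) (cut_cvg L0); apply; apply: nearW => n.
apply: (le_trans (ler_norm _)); apply: Rintegral_le_bound.
  apply: measurableT_comp => //; apply: continuous_measurable_fun.
  exact: continuous_cutoff.
by move=> w; rewrite ger0_norm ?cutoff_ge0 ?cutoff_le1.
Qed.

Let cut_int L : mu.-integrable setT (EFin \o (fun x => cutoff L x * density x)).
Proof.
apply: (dominated_integrable mu
  (g := fun x => bound2 / pi * \1_(`[- (L + 1), L + 1]%classic : set R) x)) => //.
- apply: measurable_funM => //; apply: continuous_measurable_fun.
  exact: continuous_cutoff.
- by apply: RintegrableZl => //; exact: integrable_indic_itv.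
- move=> x _; rewrite indicE; case: (boolP (x \in _)) => xL.
    rewrite mulr1 normrM ger0_norm ?cutoff_ge0//.
    apply: (@le_trans _ _ (1 * `|density x|)).
      by rewrite ler_wpM2r// cutoff_le1.
    rewrite mul1r normrM (gtr0_norm (_ : 0 < pi^-1)) ?invr_gt0//.
    by apply: ler_wpM2r => //; rewrite invr_ge0 ltW.
  rewrite mulr0 cutoff0 ?mul0r ?normr0//; rewrite ltNge; apply: contra xL => xL.
  by rewrite inE/= in_itv/= -ler_norml.
Qed.

Let cut_mass_ge e : 0 < e -> exists2 L, 0 <= L &
  1 - e <= \int[mu]_x (cutoff L x * density x).
Proof.
move=> e0; have [L L0 hL] := Levy_tight e0.
exists L => //; have := cvgr_to_ge (b := 1 - e) (cut_cvg L0); exact.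
Qed.

(** No mass is lost: convergence against cut-offs, together with tightness,
    bounds the mass of the limit density from below. *)
Lemma Levy_density_mass : (\int[mu]_x (density x)%:E = 1)%E.
Proof.
have E n : (\int[mu]_x (cutoff n%:R x * density x)%:E =
    (\int[mu]_x (cutoff n%:R x * density x))%:E)%E.
  by rewrite /Rintegral fineK//; apply: integrable_fin_num => //; exact: cut_int.
have lim1 : (\int[mu]_x (density x)%:E =
    limn (fun n => \int[mu]_x (cutoff n%:R x * density x)%:E))%E.
  rewrite -monotone_convergence//.
  - apply: eq_integral => x _; apply/esym/cvg_lim => //.
    apply: cvg_near_cst; near=> n; congr EFin.
    rewrite cutoff1 ?mul1r//; near: n; exact: nbhs_infty_ger.
  - by move=> n; have /integrableP[] := cut_int n%:R.
  - by move=> n x _; rewrite lee_fin mulr_ge0 ?cutoff_ge0 ?Levy_density_ge0.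
  - move=> x _ m n mn; rewrite lee_fin ler_wpM2r ?Levy_density_ge0//.
    by apply: le_cutoff; rewrite ler_nat.
have c1' : (fun n => \int[mu]_x (cutoff n%:R x * density x)%:E)%E @ \oo --> 1%E.
  under eq_fun do rewrite E; apply: cvg_EFin; first exact: nearW.
  apply/cvgrPdist_le => e e0.
  have [L L0 hL] := cut_mass_ge e0.
  near=> n; rewrite ger0_norm ?subr_ge0 ?cut_mass_le1//.
  rewrite /= lerBlDr -lerBlDl (le_trans hL)//; apply: le_Rintegral => //; try exact: cut_int.
  move=> x _; rewrite ler_wpM2r ?Levy_density_ge0//; apply: le_cutoff.
  by near: n; exact: nbhs_infty_ger.
by rewrite lim1; apply/cvg_lim.
Unshelve. all: by end_near. Qed.

Lemma Levy_density_integrable : mu.-integrable setT (EFin \o density).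
Proof.
apply/integrableP; split; first exact/measurable_EFinP.
rewrite (_ : integral _ _ _ = 1%E) ?ltry// -Levy_density_mass.
by apply: eq_integral => x _; rewrite /= ger0_norm// Levy_density_ge0.
Qed.

(** By tightness, [g] may be replaced by its product with a cut-off, which is
    compactly supported. *)
Theorem Levy_continuity (g : R -> R) (B : R) : continuous g ->
  (forall x, `|g x| <= B) ->
  \int[P]_w g (W n w) @[n --> \oo] --> \int[mu]_x (g x * density x).
Proof.
move=> cg gB.
have B0 : 0 <= B by rewrite (le_trans _ (gB 0)).
have mg : measurable_fun setT g by exact: continuous_measurable_fun.
apply: cvg_uniform_approx => e e0.
have eB : 0 < e / (B + 1) by rewrite divr_gt0// ltr_pwDr.
have [L L0 tightL] := Levy_tight eB.
have [L' L'0 massL'] := cut_mass_ge eB.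
pose K := Num.max L L'.
have K0 : 0 <= K by rewrite le_max L0.
have mcut : measurable_fun setT (cutoff K).
  by apply: continuous_measurable_fun; exact: continuous_cutoff.
have mgc : measurable_fun setT (fun x => g x * cutoff K x).
  exact: measurable_funM.
have Ble : B * (e / (B + 1)) <= e.
  rewrite mulrA ler_pdivrMr ?ltr_pwDr// mulrC ler_wpM2l ?(ltW e0)//.
  by rewrite lerDl.
exists (fun n => \int[P]_w (g (W n w) * cutoff K (W n w))).
exists (\int[mu]_x (g x * cutoff K x * density x)).
have ig : mu.-integrable setT (EFin \o (fun x => g x * density x)).
  apply: (dominated_integrable mu (g := fun x => B * density x)) => //.
  - exact: measurable_funM.
  - by apply: RintegrableZl => //; exact: Levy_density_integrable.
  - move=> x _; rewrite normrM (ger0_norm (Levy_density_ge0 x)).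
    by rewrite ler_wpM2r ?Levy_density_ge0.
have igc : mu.-integrable setT (EFin \o (fun x => g x * cutoff K x * density x)).
  apply: (dominated_integrable mu (g := fun x => B * density x)) => //.
  - exact: measurable_funM.
  - by apply: RintegrableZl => //; exact: Levy_density_integrable.
  - move=> x _; rewrite normrM (ger0_norm (Levy_density_ge0 x)).
    rewrite ler_wpM2r ?Levy_density_ge0// normrM (ger0_norm (cutoff_ge0 _ _)).
    by rewrite (le_trans _ (gB x))// ler_piMr ?cutoff_le1.
have split_le (x : R) : `|g x * cutoff K x - g x| <= B * (1 - cutoff K x).
  rewrite -{2}[g x]mulr1 -mulrBr normrM distrC (ger0_norm (_ : 0 <= 1 - _)).
    by rewrite ler_wpM2r ?subr_ge0 ?cutoff_le1.
  by rewrite subr_ge0 cutoff_le1.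
split.
- apply: (@vague_cvg (fun x => g x * cutoff K x) B (K + 1)).
  + by move=> x; apply: cvgM; [exact: cg|exact: continuous_cutoff].
  + move=> x; rewrite normrM (ger0_norm (cutoff_ge0 _ _)).
    by rewrite (le_trans _ (gB x))// ler_piMr ?cutoff_le1.
  + by move=> x xK; rewrite cutoff0 ?mulr0.
- near=> n.
  have iP (h : R -> R) C : measurable_fun setT h -> (forall x, `|h x| <= C) ->
      P.-integrable setT (EFin \o (fun w => h (W n w))).
    move=> mh hC; apply: (@bounded_integrable _ _ _ P _ C) => //.
    exact: measurableT_comp.
  have i1 : P.-integrable setT (EFin \o (fun w => g (W n w))) by exact: (iP _ B).
  have i2 : P.-integrable setT (EFin \o (fun w => cutoff K (W n w))).
    by apply: (iP _ 1) => // x; rewrite ger0_norm ?cutoff_ge0 ?cutoff_le1.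
  have i3 : P.-integrable setT (EFin \o (fun w => g (W n w) * cutoff K (W n w))).
    apply: (iP (fun x => g x * cutoff K x) B) => // x.
    rewrite normrM (ger0_norm (cutoff_ge0 _ _)).
    by rewrite (le_trans _ (gB x))// ler_piMr ?cutoff_le1.
  have i4 : P.-integrable setT (EFin \o (fun w => 1 - cutoff K (W n w))).
    by apply: RintegrableB => //; exact: (finite_measure_integrable_cst P 1).
  rewrite -RintegralB//.
  apply: (@le_trans _ _ (\int[P]_w (B * (1 - cutoff K (W n w))))).
    apply: (Rintegral_le_dominated P) => //.
    + by apply: measurable_funB; [apply: (measurableT_comp mgc)|apply: measurableT_comp].
    + exact: RintegrableZl.
  rewrite RintegralZl// (le_trans _ Ble)// ler_wpM2l//.
  rewrite RintegralB//; last exact: (finite_measure_integrable_cst P 1).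
  rewrite Rintegral_cst//= probability_setT mulr1 lerBlDr -lerBlDl.
  apply: (@le_trans _ _ (\int[P]_w cutoff L (W n w))); first by near: n.
  apply: le_Rintegral => //.
    apply: (iP (cutoff L) 1); last by move=> x; rewrite ger0_norm ?cutoff_ge0 ?cutoff_le1.
    by apply: continuous_measurable_fun; exact: continuous_cutoff.
  by move=> w _; apply: le_cutoff; rewrite le_max lexx.
- rewrite -RintegralB//.
  have i4 : mu.-integrable setT (EFin \o (fun x => density x - cutoff K x * density x)).
    by apply: RintegrableB => //; exact: Levy_density_integrable.
  apply: (@le_trans _ _ (\int[mu]_x (B * (density x - cutoff K x * density x)))).
    apply: (Rintegral_le_dominated mu) => //.
    + by apply: measurable_funB; apply: measurable_funM.
    + exact: RintegrableZl.
    + move=> x _; rewrite -mulrBl normrM (ger0_norm (Levy_density_ge0 x)).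
      rewrite [leRHS](_ : _ = B * (1 - cutoff K x) * density x); last by ring.
      by rewrite ler_wpM2r ?Levy_density_ge0.
  rewrite RintegralZl// (le_trans _ Ble)// ler_wpM2l//.
  rewrite RintegralB//; last exact: Levy_density_integrable.
  rewrite {1}/Rintegral Levy_density_mass/= lerBlDr -lerBlDl.
  rewrite (le_trans massL')//; apply: le_Rintegral => //; try exact: cut_int.
  move=> x _; rewrite ler_wpM2r ?Levy_density_ge0//; apply: le_cutoff.
  by rewrite le_max lexx orbT.
Unshelve. all: by end_near. Qed.

End Levy.

(** * Bounds for sine, cosine and powers *)

Section power_bounds.
Context {R : realType}.
Local Notation mu := (@lebesgue_measure R).

Lemma norm_sin_le (x : R) : `|sin x| <= `|x|.
Proof.
wlog x0 : x / 0 <= x.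
  move=> h; have [/h//|x0] := leP 0 x.
  by rewrite -normrN -sinN -[leRHS]normrN h// oppr_ge0 ltW.
move: x0; rewrite le_eqVlt => /predU1P[<-|x0]; first by rewrite sin0.
have ds (y : R) : y \in `]0, x[%R -> is_derive y (1 : R) (@sin R) (cos y) by move=> _; exact: is_derive_sin.
have cs : {within `[0, x], continuous (@sin R)}.
  by apply: continuous_subspaceT; exact: continuous_sin.
have [c _] := MVT x0 ds cs.
rewrite sin0 !subr0 => ->; rewrite normrM ler_piMl//; exact: norm_cos_le1.
Qed.

Lemma cos_lower (x : R) : 1 - x ^+ 2 / 2 <= cos x.
Proof.
have -> : x = (x / 2) *+ 2 by rewrite mulr2n -splitr.
rewrite cos_mulr2n.
have -> : cos (x / 2) ^+ 2 = 1 - sin (x / 2) ^+ 2 by have := cos2Dsin2 (x / 2); lra.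
have : sin (x / 2) ^+ 2 <= (x / 2) ^+ 2.
  rewrite -[leLHS]real_normK ?num_real// -[leRHS]real_normK ?num_real//.
  by rewrite ler_sqr ?nnegrE// norm_sin_le.
move=> h; have -> : (x / 2 *+ 2) ^+ 2 / 2 = 2 * (x / 2) ^+ 2 by field.
lra.
Qed.

Lemma onem_cos_le (x : R) : 1 - cos x <= `|x|.
Proof.
have [x2|x2] := leP `|x| 2.
  have := cos_lower x; have : x ^+ 2 / 2 <= `|x|.
    by rewrite -[x ^+ 2]real_normK ?num_real//; have := normr_ge0 x; nra.
  lra.
by have := cos_geN1 x; lra.
Qed.

Lemma sub_sin_le (x : R) : 0 <= x -> 0 <= x - sin x <= x ^+ 3.
Proof.
rewrite le_eqVlt => /predU1P[<-|x0].
  by rewrite sin0 subrr expr0n/= lexx.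
apply/andP; split.
  by rewrite subr_ge0 (le_trans (ler_norm _))// (le_trans (norm_sin_le _))// gtr0_norm.
have ds (y : R) : y \in `]0, x[%R -> is_derive y (1 : R) (fun x : R => x - sin x) (1 - cos y).
  by move=> _; apply: is_derive_eq.
have cs : {within `[0, x], continuous (fun x : R => x - sin x)}.
  apply: continuous_subspaceT => y; apply: cvgB; first exact: cvg_id.
  exact: continuous_sin.
have [c] := MVT x0 ds cs; rewrite in_itv/= => /andP[c0 cx].
rewrite sin0 !subr0 => ->; rewrite exprS mulrC ler_pM2l//.
have := cos_lower c; have : c ^+ 2 <= x ^+ 2 by rewrite ler_sqr ?nnegrE// ltW.
by have := sqr_ge0 c; lra.
Qed.

Lemma powR_at0 (a : R) : 0 < a -> x `^ a @[x --> 0^'+] --> 0.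
Proof.
move=> a0; apply/cvgrPdist_lt => e e0; near=> x.
have x0 : 0 < x by near: x; exact: nbhs_right_gt.
rewrite sub0r normrN ger0_norm ?powR_ge0//.
have -> : e = (e `^ a^-1) `^ a by rewrite -powRrM mulVf ?lt0r_neq0// powRr1// ltW.
rewrite gt0_ltr_powR ?nnegrE ?powR_ge0 ?ltW//.
by near: x; apply: nbhs_right_lt; exact: powR_gt0.
Unshelve. all: by end_near. Qed.

Lemma powRN_pinfty (a : R) : 0 < a -> x `^ (- a) @[x --> +oo] --> 0.
Proof.
move=> a0; apply/cvgrPdist_lt => e e0; near=> x.
have x0 : 0 < x by near: x; exact: nbhs_pinfty_gt.
rewrite sub0r normrN ger0_norm ?powR_ge0// powRN.
rewrite -[e]invrK ltf_pV2 ?posrE ?invr_gt0 ?powR_gt0//.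
have -> : e^-1 = (e^-1 `^ a^-1) `^ a.
  by rewrite -powRrM mulVf ?lt0r_neq0// powRr1// invr_ge0 ltW.
rewrite gt0_ltr_powR ?nnegrE ?powR_ge0 ?(ltW x0)//.
Unshelve. all: by end_near. Qed.

Lemma derivable_powR_pos (a x : R) : 0 < x -> derivable (fun t => t `^ a) x 1.
Proof. by move=> x0; have [] := is_derive1_powR a x0. Qed.

Lemma continuous_powR_pos (a x : R) : 0 < x -> {for x, continuous (fun t => t `^ a)}.
Proof. by move=> x0; apply: derivable_continuous_at; exact: derivable_powR_pos. Qed.

Lemma mul_powR (a x : R) : 0 < x -> x * x `^ a = x `^ (1 + a).
Proof. by move=> x0; rewrite powRD ?(gt_eqF x0) ?implybT// powRr1 ?ltW. Qed.

(** Of order [x `^ (- b)] at the origin and [x `^ (-1 - b)] at infinity, hence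
    integrable at both ends. *)
Definition power_majorant (b x : R) : R := x `^ (-1 - b) * Num.min 1 x.

Variable b : R.
Hypothesis b01 : 0 < b < 1.

Let b0 : 0 < b. Proof. by case/andP : b01. Qed.
Let b1 : b < 1. Proof. by case/andP : b01. Qed.

Lemma power_majorant_ge0 x : 0 <= x -> 0 <= power_majorant b x.
Proof. by move=> x0; rewrite mulr_ge0 ?powR_ge0// le_min ler01. Qed.

Let pow01_lty : (\int[mu]_(x in `]0%R, 1%R]) (x `^ (- b))%:E < +oo)%E.
Proof.
have c1b : 1 - b != 0 by rewrite subr_eq0 gt_eqF.
have un0 n : 0 < n.+2%:R^-1 :> R by rewrite invr_gt0.
have pos (x : R) : (`]0, 1]%classic : set R) x -> 0 < x.
  by rewrite /= in_itv/= => /andP[].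
have E : (\int[mu]_(x in `]0%R, 1%R]) (x `^ (- b))%:E =
    (1 `^ (1 - b) / (1 - b) - 0 / (1 - b))%:E)%E.
  apply: (@ge0_improper_FTC _ _ (fun n => n.+2%:R^-1) (fun=> 1) _
    (fun x => x `^ (1 - b) / (1 - b))) => //.
  - by move=> n; rewrite invf_lt1 ?ltr1n.
  - by move=> n x /=; rewrite !in_itv/= => /andP[+ ->]; rewrite andbT; exact: lt_le_trans.
  - move=> m n mn; apply: subset_itv; rewrite bnd_simp// lef_pV2 ?posrE//.
    by rewrite ler_nat.
  - move=> x; rewrite /= in_itv/= => /andP[x0 x1].
    exists (Num.truncn x^-1); rewrite x1 andbT.
    rewrite -[leRHS]invrK lef_pV2 ?posrE ?invr_gt0//.
    by apply/ltW; rewrite (lt_le_trans (truncnS_gt _))// ler_nat.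
  - by move=> x /pos; exact: continuous_powR_pos.
  - move=> x /pos x0; have ? := is_derive1_powR (1 - b) x0.
    apply: is_derive_eq; rewrite /GRing.scale/= ?mulr0 ?addr0 ?add0r.
    by rewrite mulrA mulVf// mul1r addrAC subrr add0r.
  - apply: cvgMl; have a0 : 0 < 1 - b by rewrite subr_gt0.
    move/cvg_at_rightP : (powR_at0 a0); apply; split=> //.
    by have := @cvg_harmonicS R; rewrite -cvg_shiftS.
  - exact: cvg_cst.
  - by move=> x _; exact: powR_ge0.
by rewrite E ltry.
Qed.

Let pow1y_lty : (\int[mu]_(x in `[1%R, +oo[) (x `^ (-1 - b))%:E < +oo)%E.
Proof.
have pos (x : R) : (`[1, +oo[%classic : set R) x -> 0 < x.
  by rewrite /= in_itv/= andbT; exact: lt_le_trans.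
have E : (\int[mu]_(x in `[1%R, +oo[) (x `^ (-1 - b))%:E =
    (0 / (- b) - 1 `^ (- b) / (- b))%:E)%E.
  apply: (@ge0_improper_FTC _ _ (fun=> 1) (fun n => n.+2%:R) _
    (fun x => x `^ (- b) / (- b))) => //.
  - by move=> n; rewrite ltr1n.
  - by move=> n x /=; rewrite !in_itv/= andbT => /andP[].
  - by move=> m n mn; apply: subset_itv; rewrite bnd_simp// ler_nat.
  - move=> x; rewrite /= in_itv/= andbT => x1.
    exists (Num.truncn x); rewrite x1/=.
    by apply/ltW; rewrite (lt_le_trans (truncnS_gt _))// ler_nat.
  - by move=> x /pos; exact: continuous_powR_pos.
  - move=> x /pos x0; have ? := is_derive1_powR (- b) x0.
    apply: is_derive_eq; rewrite /GRing.scale/= ?mulr0 ?addr0 ?add0r.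
    by rewrite mulrA mulVf ?oppr_eq0 ?gt_eqF// mul1r addrC.
  - exact: cvg_cst.
  - apply: cvgMl; move/cvg_pinftyP : (powRN_pinfty b0); apply.
    exact: cvg_natSS_pinfty.
  - by move=> x _; exact: powR_ge0.
by rewrite E ltry.
Qed.

Lemma integrable_power_majorant :
  mu.-integrable `]0, +oo[ (EFin \o power_majorant b).
Proof.
have mm : measurable_fun (`]0, +oo[ : set R) (power_majorant b).
  apply: measurable_funM; last exact: measurable_minr.
  by apply: measurable_funTS; exact: measurable_powR.
have ge0 (x : R) : (`]0, +oo[%classic : set R) x -> 0 <= power_majorant b x.
  by rewrite /= in_itv/= andbT => x0; apply: power_majorant_ge0; exact: ltW.
apply/integrableP; split; first exact/measurable_EFinP.
have -> : (`]0, +oo[%classic : set R) = `]0, 1]%classic `|` `]1, +oo[%classic.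
  apply/seteqP; split => x /=; rewrite !in_itv/= !andbT; last first.
    by case=> [/andP[]//|]; exact: lt_trans.
  by move=> x0; have [x1|x1] := leP x 1; [left|right]; rewrite ?x0.
have s1 : `]0, 1]%classic `<=` (`]0, +oo[%classic : set R).
  by apply: subset_itvl; rewrite bnd_simp.
have s2 : `]1, +oo[%classic `<=` (`]0, +oo[%classic : set R).
  by apply: subset_itvr; rewrite bnd_simp.
rewrite ge0_integral_setU//=; last 2 first.
- apply/measurable_EFinP; apply: measurableT_comp => //.
  by apply: measurable_funS mm => // x [/s1|/s2].
- rewrite disj_set2E; apply/eqP; rewrite -subset0 => x [] /=; rewrite !in_itv/= andbT.
  by move=> /andP[_ x1] /(le_lt_trans x1); rewrite ltxx.
apply: lte_add_pinfty.
  apply: (@le_lt_trans _ _ (\int[mu]_(x in `]0%R, 1%R]) (x `^ (- b))%:E)%E); last first.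
    exact: pow01_lty.
  apply: ge0_le_integral => //.
  - apply/measurable_EFinP; apply: measurableT_comp => //.
    exact: measurable_funS mm.
  - by apply/measurable_EFinP; apply: measurable_funTS; exact: measurable_powR.
  - move=> x; rewrite /= in_itv/= => /andP[x0 x1].
    rewrite lee_fin ger0_norm ?power_majorant_ge0 ?(ltW x0)// /power_majorant.
    by rewrite (min_idPr _)// mulrC mul_powR// addrA subrr add0r.
apply: (@le_lt_trans _ _ (\int[mu]_(x in `[1%R, +oo[) (x `^ (-1 - b))%:E)%E); last first.
  exact: pow1y_lty.
apply: (@le_trans _ _ (\int[mu]_(x in `]1%R, +oo[) (x `^ (-1 - b))%:E)%E).
  apply: ge0_le_integral => //.
  - apply/measurable_EFinP; apply: measurableT_comp => //.
    exact: measurable_funS mm.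
  - by apply/measurable_EFinP; apply: measurable_funTS; exact: measurable_powR.
  - move=> x; rewrite /= in_itv/= andbT => x1; have x0 := lt_trans ltr01 x1.
    rewrite lee_fin ger0_norm ?power_majorant_ge0 ?(ltW x0)// /power_majorant.
    by rewrite (min_idPl _) ?mulr1// ltW.
apply: ge0_subset_integral => //.
- by apply/measurable_EFinP; apply: measurable_funTS; exact: measurable_powR.
- by move=> x _; rewrite lee_fin powR_ge0.
- by apply: subset_itvr; rewrite bnd_simp.
Qed.

Lemma integrable_exp_pow (k : R) : 0 < k ->
  mu.-integrable `]0, +oo[ (EFin \o (fun x => expR (- (x * k)) * x `^ (- b))).
Proof.
move=> k0.
pose C := Num.max 1 k^-1.
have C1 : 1 <= C by rewrite le_max lexx.
apply: (dominated_integrable mu (g := fun x => C * power_majorant b x)) => //.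
- apply: continuous_measurable_pos => x x0; apply: cvgM; last exact: continuous_powR_pos.
  have h : {for x, continuous (fun x : R => expR (- (x * k)))}.
    by apply: derivable_continuous_at; apply: ex_derive.
  exact: h.
- by apply: RintegrableZl => //; exact: integrable_power_majorant.
move=> x; rewrite /= in_itv/= andbT => x0.
rewrite ger0_norm ?mulr_ge0 ?expR_ge0 ?powR_ge0// /power_majorant.
have -> : x `^ (- b) = x * x `^ (-1 - b) by rewrite mul_powR// addrA subrr add0r.
rewrite [leRHS]mulrCA mulrA mulrC ler_wpM2l ?powR_ge0//.
have e1 : expR (- (x * k)) <= 1 by rewrite -expR0 ler_expR oppr_le0 mulr_ge0 ?ltW.
have e2 : expR (- (x * k)) * x <= k^-1.
  rewrite expRN mulrC ler_pdivrMr ?expR_gt0// ler_pdivlMl// mulrC.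
  by rewrite (le_trans _ (expR_ge1Dx _))// lerDr.
have [x1|x1] := leP 1 x; last first.
  by apply: ler_pM; rewrite ?expR_ge0 ?(ltW x0)// (le_trans e1).
by rewrite mulr1 (le_trans e2)// le_max lexx orbT.
Qed.

End power_bounds.

(** * Fourier integrals of a power, by rotation of the Laplace transform *)

(** The Laplace transform of [x `^ (-1 - b)], compensated at the origin, on the
    unit circle: [rotated_re b phi] and [rotated_im b phi] are the real and
    imaginary parts of the integral of [(1 - e^(-s x)) x^(-1-b)] at
    [s = e^(i phi)].  On the positive reals it is a Gamma integral; on the
    imaginary axis it gives the Fourier integrals of the stable law. *)
Section rotation.
Context {R : realType}.
Local Notation mu := (@lebesgue_measure R).
Variable b : R.
Hypothesis b01 : 0 < b < 1.

Let b0 : 0 < b. Proof. by case/andP : b01. Qed.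
Let b1 : b < 1. Proof. by case/andP : b01. Qed.

Let rA (phi x : R) : R :=
  (1 - expR (- (x * cos phi)) * cos (x * sin phi)) * x `^ (-1 - b).
Let rB (phi x : R) : R :=
  expR (- (x * cos phi)) * sin (x * sin phi) * x `^ (-1 - b).
Let dA (phi x : R) : R := expR (- (x * cos phi)) *
  (x * cos phi * sin (x * sin phi) - x * sin phi * cos (x * sin phi)) * x `^ (-1 - b).
Let dB (phi x : R) : R := expR (- (x * cos phi)) *
  (x * sin phi * sin (x * sin phi) + x * cos phi * cos (x * sin phi)) * x `^ (-1 - b).

Definition rotated_re (phi : R) : R := \int[mu]_(x in `]0, +oo[) rA phi x.
Definition rotated_im (phi : R) : R := \int[mu]_(x in `]0, +oo[) rB phi x.

Let pos_itv (t : R) : (`]0, +oo[%classic : set R) t -> 0 < t.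
Proof. by rewrite /= in_itv/= andbT. Qed.

Let exp_le1 (x : R) : 0 <= x -> expR (- x) <= 1.
Proof. by move=> x0; rewrite -expR0 ler_expR oppr_le0. Qed.

Let re_bound (phi x : R) : 0 <= cos phi -> 0 < x ->
  `|1 - expR (- (x * cos phi)) * cos (x * sin phi)| <= 2 * Num.min 1 x.
Proof.
move=> c0 x0; have xc0 : 0 <= x * cos phi by rewrite mulr_ge0// ltW.
have E1 := exp_le1 xc0; have E0 := expR_ge0 (- (x * cos phi)).
have [x1|x1] := leP 1 x.
  rewrite mulr1 (le_trans (ler_normB _ _))// normr1 -[leRHS]/(1 + 1) lerD2l.
  by rewrite normrM ger0_norm// mulr_ile1 ?normr_ge0 ?norm_cos_le1.
set E := expR _ in E0 E1 *.
have -> : 1 - E * cos (x * sin phi) = (1 - E) + E * (1 - cos (x * sin phi)) by ring.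
rewrite (le_trans (ler_normD _ _))// mulr_natl mulr2n lerD//.
  rewrite ger0_norm ?subr_ge0//.
  have : 1 - x * cos phi <= E by have := expR_ge1Dx (- (x * cos phi)).
  have : x * cos phi <= x by rewrite ler_piMr ?cos_le1// ltW.
  lra.
have cs0 : 0 <= 1 - cos (x * sin phi) by rewrite subr_ge0 cos_le1.
rewrite ger0_norm ?mulr_ge0//.
apply: (@le_trans _ _ (1 - cos (x * sin phi))); first by rewrite ler_piMl.
rewrite (le_trans (onem_cos_le _))// normrM gtr0_norm//.
by rewrite ler_piMr ?norm_sin_le1// ltW.
Qed.

Let im_bound (phi x : R) : 0 <= cos phi -> 0 < x ->
  `|expR (- (x * cos phi)) * sin (x * sin phi)| <= 2 * Num.min 1 x.
Proof.
move=> c0 x0; have xc0 : 0 <= x * cos phi by rewrite mulr_ge0// ltW.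
have E1 := exp_le1 xc0; have E0 := expR_ge0 (- (x * cos phi)).
rewrite normrM ger0_norm//.
apply: (@le_trans _ _ `|sin (x * sin phi)|); first by rewrite ler_piMl.
have s1 : `|sin (x * sin phi)| <= x.
  rewrite (le_trans (norm_sin_le _))// normrM gtr0_norm//.
  by rewrite ler_piMr ?norm_sin_le1// ltW.
have s2 := norm_sin_le1 (x * sin phi).
by have [x1|x1] := leP 1 x; lra.
Qed.

Let i2maj : mu.-integrable `]0, +oo[ (EFin \o (fun x => 2 * power_majorant b x)).
Proof. by apply: RintegrableZl => //; exact: integrable_power_majorant. Qed.

Let rA_le phi x : 0 <= cos phi -> 0 < x -> `|rA phi x| <= 2 * power_majorant b x.
Proof.
move=> c0 x0; rewrite normrM (ger0_norm (powR_ge0 _ _)) /power_majorant.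
by rewrite [leRHS]mulrCA mulrC ler_wpM2l ?powR_ge0// re_bound.
Qed.

Let rB_le phi x : 0 <= cos phi -> 0 < x -> `|rB phi x| <= 2 * power_majorant b x.
Proof.
move=> c0 x0; rewrite normrM (ger0_norm (powR_ge0 _ _)) /power_majorant.
by rewrite [leRHS]mulrCA mulrC ler_wpM2l ?powR_ge0// im_bound.
Qed.

Let cont_trig (phi x : R) (f : R -> R) : derivable f (x * sin phi) 1 ->
  {for x, continuous (fun x : R => f (x * sin phi))}.
Proof.
move=> df; apply: (@continuous_comp R R R (fun x => x * sin phi) f x).
  exact: mulrr_continuous.
exact: derivable_continuous_at.
Qed.

Let cE phi x : {for x, continuous (fun x : R => expR (- (x * cos phi)))}.
Proof. by apply: derivable_continuous_at; apply: ex_derive. Qed.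

Let rA_cont phi x : 0 < x -> {for x, continuous (rA phi)}.
Proof.
move=> x0; apply: cvgM; last exact: continuous_powR_pos.
apply: cvgB; first exact: cvg_cst.
by apply: cvgM; [exact: cE|exact: cont_trig].
Qed.

Let rB_cont phi x : 0 < x -> {for x, continuous (rB phi)}.
Proof.
move=> x0; apply: cvgM; last exact: continuous_powR_pos.
by apply: cvgM; [exact: cE|exact: cont_trig].
Qed.

Let dA_cont phi x : 0 < x -> {for x, continuous (dA phi)}.
Proof.
move=> x0; apply: cvgM; last exact: continuous_powR_pos.
apply: cvgM; first exact: cE.
by apply: cvgB; (apply: cvgM; first exact: mulrr_continuous); exact: cont_trig.
Qed.

Let dB_cont phi x : 0 < x -> {for x, continuous (dB phi)}.
Proof.
move=> x0; apply: cvgM; last exact: continuous_powR_pos.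
apply: cvgM; first exact: cE.
by apply: cvgD; (apply: cvgM; first exact: mulrr_continuous); exact: cont_trig.
Qed.

Let rA_int phi : 0 <= cos phi -> mu.-integrable `]0, +oo[ (EFin \o rA phi).
Proof.
move=> c0; apply: (dominated_integrable mu _ _ i2maj) => //.
  by apply: continuous_measurable_pos => x; exact: rA_cont.
by move=> x /pos_itv; exact: rA_le.
Qed.

Let rB_int phi : 0 <= cos phi -> mu.-integrable `]0, +oo[ (EFin \o rB phi).
Proof.
move=> c0; apply: (dominated_integrable mu _ _ i2maj) => //.
  by apply: continuous_measurable_pos => x; exact: rB_cont.
by move=> x /pos_itv; exact: rB_le.
Qed.

Let G (k x : R) : R := 2 * (expR (- (x * k)) * x `^ (- b)).

Let G_ge0 k x : 0 <= G k x.
Proof. by rewrite !mulr_ge0 ?expR_ge0 ?powR_ge0. Qed.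

Let G_int k : 0 < k -> mu.-integrable `]0, +oo[ (EFin \o G k).
Proof. by move=> k0; apply: RintegrableZl => //; exact: integrable_exp_pow. Qed.

Let d_bound k phi x (p q r s : R) : 0 < k -> k <= cos phi -> 0 < x ->
  `|p| <= 1 -> `|q| <= 1 -> `|r| <= 1 -> `|s| <= 1 ->
  `|expR (- (x * cos phi)) * (x * p * q + x * r * s) * x `^ (-1 - b)| <= G k x.
Proof.
move=> k0 kc x0 p1 q1 r1 s1.
rewrite !normrM (ger0_norm (powR_ge0 _ _)) (ger0_norm (expR_ge0 _)) /G.
have -> : x `^ (- b) = x * x `^ (-1 - b) by rewrite mul_powR// addrA subrr add0r.
have -> : 2 * (expR (- (x * k)) * (x * x `^ (-1 - b))) =
  expR (- (x * k)) * (2 * x) * x `^ (-1 - b) by ring.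
apply: ler_wpM2r; first exact: powR_ge0.
apply: ler_pM; rewrite ?expR_ge0//.
  by rewrite ler_expR lerN2 ler_wpM2l// ltW.
rewrite -!mulrA -mulrDr normrM gtr0_norm// mulrC ler_wpM2r ?(ltW x0)//.
rewrite (le_trans (ler_normD _ _))// !normrM -[leRHS]/(1 + 1).
by rewrite lerD// mulr_ile1.
Qed.

Let dA_le k phi x : 0 < k -> k <= cos phi -> 0 < x -> `|dA phi x| <= G k x.
Proof.
move=> k0 kc x0; rewrite /dA -[X in _ * (_ + X) * _]mulrN.
by apply: d_bound; rewrite ?normrN ?norm_cos_le1 ?norm_sin_le1.
Qed.

Let dB_le k phi x : 0 < k -> k <= cos phi -> 0 < x -> `|dB phi x| <= G k x.
Proof.
move=> k0 kc x0.
by apply: d_bound; rewrite ?normrN ?norm_cos_le1 ?norm_sin_le1.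
Qed.

Let dA_int phi : 0 < cos phi -> mu.-integrable `]0, +oo[ (EFin \o dA phi).
Proof.
move=> c0; apply: (dominated_integrable mu _ _ (G_int c0)) => //.
  by apply: continuous_measurable_pos => x; exact: dA_cont.
by move=> x /pos_itv; exact: dA_le.
Qed.

Let dB_int phi : 0 < cos phi -> mu.-integrable `]0, +oo[ (EFin \o dB phi).
Proof.
move=> c0; apply: (dominated_integrable mu _ _ (G_int c0)) => //.
  by apply: continuous_measurable_pos => x; exact: dB_cont.
by move=> x /pos_itv; exact: dB_le.
Qed.

Let is_derive_rA x phi : is_derive phi (1 : R) (rA ^~ x) (dA phi x).
Proof. by apply: is_derive_eq; rewrite /GRing.scale/= /dA; ring. Qed.

Let is_derive_rB x phi : is_derive phi (1 : R) (rB ^~ x) (dB phi x).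
Proof. by apply: is_derive_eq; rewrite /GRing.scale/= /dB; ring. Qed.

Let cos_window (phi : R) : 0 < cos phi -> exists u v : R,
  phi \in `]u, v[%R /\ forall t : R, t \in `]u, v[%R -> cos phi / 2 <= cos t.
Proof.
move=> c0; have c2 : 0 < cos phi / 2 by rewrite divr_gt0.
have /cvgrPdist_lt/(_ _ c2)[e /= e0 he] := @continuous_cos R phi.
exists (phi - e), (phi + e); split; first by rewrite in_itv/= gtrBl ltrDl e0.
move=> t; rewrite in_itv/= => /andP[t1 t2].
have := he t; rewrite /ball_/= => /(_ _).
have -> : `|phi - t| < e by rewrite ltr_norml; apply/andP; split; lra.
move=> /(_ isT) h; have := ler_norm (cos phi - cos t); lra.
Qed.

(** Differentiation under the integral sign is legitimate in the open right half
    plane, where the derivatives of the integrands decay exponentially, locally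
    uniformly in the angle. *)
Let derive_under (f df : R -> R -> R) phi :
  0 < cos phi ->
  (forall t, 0 <= cos t -> mu.-integrable `]0, +oo[ (EFin \o f t)) ->
  (forall x t, is_derive t (1 : R) (f ^~ x) (df t x)) ->
  (forall k t x, 0 < k -> k <= cos t -> 0 < x -> `|df t x| <= G k x) ->
  is_derive phi (1 : R) (fun t => \int[mu]_(x in `]0, +oo[) f t x)
    (\int[mu]_(x in `]0, +oo[) df phi x).
Proof.
move=> c0 fi fd dfle; have c2 : 0 < cos phi / 2 by rewrite divr_gt0.
have [u [v [uv cuv]]] := cos_window c0.
have Iphi : (`]u, v[%classic : set R) phi by [].
have h1 t : (`]u, v[%classic : set R) t -> mu.-integrable `]0, +oo[ (EFin \o f t).
  by move=> /cuv tc; apply: fi; rewrite (le_trans _ tc)// ltW.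
have h2 (t x : R) : (`]u, v[%classic : set R) t -> (`]0, +oo[%classic : set R) x ->
    derivable (f ^~ x) t 1.
  by move=> _ _; have [] := fd x t.
have pE t x : partial1of2 f t x = df t x.
  by rewrite partial1of2E; exact: derive_val.
have h3 (t x : R) : (`]u, v[%classic : set R) t -> (`]0, +oo[%classic : set R) x ->
    `|partial1of2 f t x| <= G (cos phi / 2) x.
  by move=> /cuv tc /pos_itv x0; rewrite pE; exact: dfle.
have mD : measurable (`]0, +oo[%classic : set (measurableTypeR R)).
  exact: measurable_itv.
apply: DeriveDef.
  exact: (@derivable_under_integral R _ _ mu f _ mD phi u v Iphi h1 h2 _
    (G_ge0 _) (G_int c2) h3).
rewrite -derive1E.
rewrite (@differentiation_under_integral R _ _ mu f _ mD phi u v Iphi h1 h2 _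
    (G_ge0 _) (G_int c2) h3).
by apply: eq_Rintegral => x _; exact: pE.
Qed.

Let cvg_at0_bound (F : R -> R) :
  (forall x : R, 0 < x -> `|F x| <= 2 * Num.min 1 x * x `^ (- b)) ->
  F x @[x --> 0^'+] --> 0.
Proof.
move=> hF; have a0 : 0 < 1 - b by rewrite subr_gt0.
have h : 2 * x `^ (1 - b) @[x --> 0^'+] --> 0.
  by rewrite -[X in _ --> X](mulr0 2); apply: cvgMr; exact: powR_at0.
apply: norm_cvg0; apply: (@squeeze_cvgr _ _ _ _ (cst 0) _ _ _ _ (cvg_cst _) h).
near=> x; have x0 : 0 < x by near: x; exact: nbhs_right_gt.
rewrite normr_ge0/= (le_trans (hF _ x0))// -mulrA ler_pM2l//.
by rewrite -(mul_powR (- b) x0) ler_wpM2r ?powR_ge0// ge_min lexx orbT.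
Unshelve. all: by end_near. Qed.

Let cvg_pinfty_bound (F : R -> R) :
  (forall x : R, 0 < x -> `|F x| <= 2 * Num.min 1 x * x `^ (- b)) ->
  F x @[x --> +oo] --> 0.
Proof.
move=> hF.
have h : 2 * x `^ (- b) @[x --> +oo] --> 0.
  by rewrite -[X in _ --> X](mulr0 2); apply: cvgMr; exact: powRN_pinfty.
apply: norm_cvg0; apply: (@squeeze_cvgr _ _ _ _ (cst 0) _ _ _ _ (cvg_cst _) h).
near=> x; have x0 : 0 < x by near: x; exact: nbhs_pinfty_gt.
rewrite normr_ge0/= (le_trans (hF _ x0))// -mulrA ler_pM2l//.
by rewrite -[leRHS]mul1r ler_wpM2r ?powR_ge0// ge_min lexx.
Unshelve. all: by end_near. Qed.

Let powE (x : R) : 0 < x ->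
  x `^ (- b) = x * x `^ (-1 - b) /\ x `^ (- b - 1) = x `^ (-1 - b).
Proof.
by move=> x0; rewrite mul_powR// addrA subrr add0r [- b - 1]addrC.
Qed.

(** Integration by parts against [x `^ (- b)] turns the derivatives in the angle
    back into the original integrals. *)
Let parts_B phi : 0 < cos phi ->
  \int[mu]_(x in `]0, +oo[) dA phi x = - b * rotated_im phi.
Proof.
move=> c0; have c0' := ltW c0.
pose F x : R := expR (- (x * cos phi)) * sin (x * sin phi) * x `^ (- b).
have hF (x : R) : 0 < x -> `|F x| <= 2 * Num.min 1 x * x `^ (- b).
  move=> x0; rewrite normrM (ger0_norm (powR_ge0 _ _)) ler_wpM2r ?powR_ge0//.
  exact: im_bound.
have hFN (x : R) : 0 < x -> `|- F x| <= 2 * Num.min 1 x * x `^ (- b).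
  by rewrite normrN; exact: hF.
have : \int[mu]_(x in `]0, +oo[) (dA phi x + b * rB phi x) = 0 - 0.
  apply: (@improper_FTC_pos R (fun x => dA phi x + b * rB phi x) (fun x => - F x) 0 0).
  - move=> x x0; apply: cvgD; first exact: dA_cont.
    by apply: cvgMr; exact: rB_cont.
  - move=> x x0; have ? := is_derive1_powR (- b) x0; have [e1 e2] := powE x0.
    by apply: is_derive_eq; rewrite /GRing.scale/= e1 e2 /dA /rB; ring.
  - exact: cvg_at0_bound.
  - exact: cvg_pinfty_bound.
  - apply: RintegrableD => //; first exact: dA_int.
    by apply: RintegrableZl => //; exact: rB_int.
rewrite subrr RintegralD//; [|exact: dA_int|by apply: RintegrableZl => //; exact: rB_int].
rewrite RintegralZl//; last exact: rB_int.
by move/eqP; rewrite addr_eq0 => /eqP ->; rewrite mulNr.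
Qed.

Let parts_A phi : 0 < cos phi ->
  \int[mu]_(x in `]0, +oo[) dB phi x = b * rotated_re phi.
Proof.
move=> c0; have c0' := ltW c0.
pose F x : R := (1 - expR (- (x * cos phi)) * cos (x * sin phi)) * x `^ (- b).
have hF (x : R) : 0 < x -> `|F x| <= 2 * Num.min 1 x * x `^ (- b).
  move=> x0; rewrite normrM (ger0_norm (powR_ge0 _ _)) ler_wpM2r ?powR_ge0//.
  exact: re_bound.
have : \int[mu]_(x in `]0, +oo[) (dB phi x - b * rA phi x) = 0 - 0.
  apply: (@improper_FTC_pos R (fun x => dB phi x - b * rA phi x) F 0 0).
  - move=> x x0; apply: cvgB; first exact: dB_cont.
    by apply: cvgMr; exact: rA_cont.
  - move=> x x0; have ? := is_derive1_powR (- b) x0; have [e1 e2] := powE x0.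
    by apply: is_derive_eq; rewrite /GRing.scale/= e1 e2 /dB /rA; ring.
  - exact: cvg_at0_bound.
  - exact: cvg_pinfty_bound.
  - apply: RintegrableB => //; first exact: dB_int.
    by apply: RintegrableZl => //; exact: rA_int.
rewrite subrr RintegralB//; [|exact: dB_int|by apply: RintegrableZl => //; exact: rA_int].
rewrite RintegralZl//; last exact: rA_int.
by move/eqP; rewrite subr_eq0 => /eqP.
Qed.

Let is_derive_A phi : 0 < cos phi ->
  is_derive phi (1 : R) rotated_re (- b * rotated_im phi).
Proof.
move=> c0; rewrite -parts_B//; apply: (derive_under c0 rA_int is_derive_rA).
by move=> k t x; exact: dA_le.
Qed.

Let is_derive_B phi : 0 < cos phi ->
  is_derive phi (1 : R) rotated_im (b * rotated_re phi).
Proof.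
move=> c0; rewrite -parts_A//; apply: (derive_under c0 rB_int is_derive_rB).
by move=> k t x; exact: dB_le.
Qed.

Let cst_on (f : R -> R) phi : 0 <= phi < pi / 2 ->
  (forall t : R, 0 < cos t -> is_derive t (1 : R) f 0) -> f phi = f 0.
Proof.
move=> /andP[p0 p2] df; move: p0; rewrite le_eqVlt => /predU1P[<-//|p0].
have cpos t : 0 <= t <= phi -> 0 < cos t.
  move=> /andP[t0 t1]; apply: cos_gt0_pihalf.
  rewrite (lt_le_trans _ t0) ?oppr_lt0 ?divr_gt0 ?pi_gt0//=.
  exact: le_lt_trans p2.
have h1 (t : R) : t \in `]0, phi[%R -> is_derive t (1 : R) f (cst 0 t).
  by rewrite in_itv/= => /andP[t0 t1]; apply/df/cpos; rewrite !ltW.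
have h2 : {within `[0, phi], continuous f}.
  apply: continuous_in_subspaceT => t; rewrite inE/= in_itv/= => tp.
  by apply: derivable_continuous_at; have [] := df _ (cpos _ tp).
have [c _] := MVT p0 h1 h2.
by rewrite /= mul0r => /eqP; rewrite subr_eq0 => /eqP.
Qed.

Let rot0 : rotated_im 0 = 0.
Proof.
transitivity (\int[mu]_(x in `]0, +oo[) (cst 0 x : R)).
  by apply: eq_Rintegral => x _; rewrite /rB sin0 mulr0 sin0 mulr0 mul0r.
by rewrite Rintegral_cst// mul0r.
Qed.

(** The pair solves [A' = - b B], [B' = b A], [B 0 = 0]: turning the argument of
    the Laplace transform by [phi] turns its value by [b * phi].  Two first
    integrals of the system replace a uniqueness theorem. *)
Let rotation phi : 0 <= phi < pi / 2 ->
  rotated_re phi = rotated_re 0 * cos (b * phi) /\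
  rotated_im phi = rotated_re 0 * sin (b * phi).
Proof.
move=> p.
pose h1 t := rotated_re t * cos (b * t) + rotated_im t * sin (b * t).
pose h2 t := rotated_re t * sin (b * t) - rotated_im t * cos (b * t).
have d1 t : 0 < cos t -> is_derive t (1 : R) h1 0.
  move=> c0; have ? := is_derive_A c0; have ? := is_derive_B c0.
  by apply: is_derive_eq; rewrite /GRing.scale/=; ring.
have d2 t : 0 < cos t -> is_derive t (1 : R) h2 0.
  move=> c0; have ? := is_derive_A c0; have ? := is_derive_B c0.
  by apply: is_derive_eq; rewrite /GRing.scale/=; ring.
have := cst_on p d1; have := cst_on p d2.
rewrite /h1 /h2 rot0 mulr0 cos0 sin0 !mulr0 mulr1 subr0 addr0 => e2 e1.
have cs := cos2Dsin2 (b * phi).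
set A := rotated_re phi in e1 e2 *; set B := rotated_im phi in e1 e2 *.
set c := cos _ in e1 e2 cs *; set s := sin _ in e1 e2 cs *.
split.
  have -> : A = (A * c + B * s) * c + (A * s - B * c) * s + A * (1 - (c ^+ 2 + s ^+ 2)) by ring.
  by rewrite e1 e2 cs subrr; ring.
have -> : B = (A * c + B * s) * s - (A * s - B * c) * c + B * (1 - (c ^+ 2 + s ^+ 2)) by ring.
by rewrite e1 e2 cs subrr; ring.
Qed.

Let phin (n : nat) : R := pi / 2 - n.+1%:R^-1.

Let phin_range n : 0 <= phin n < pi / 2.
Proof.
rewrite /phin subr_ge0 gtrBl invr_gt0 ltr0n andbT.
apply: (@le_trans _ _ 1); first by rewrite invf_le1 ?ler1n.
by rewrite ler_pdivlMr// mul1r; exact: pi_ge2.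
Qed.

Let phin_cvg : phin n @[n --> \oo] --> pi / 2.
Proof.
rewrite -[X in _ --> X]subr0; apply: cvgB; first exact: cvg_cst.
exact: cvg_harmonicS.
Qed.

Let cos_phin n : 0 < cos (phin n).
Proof.
have /andP[p0 p1] := phin_range n; apply: cos_gt0_pihalf; rewrite p1 andbT.
by rewrite (lt_le_trans _ p0)// oppr_lt0 divr_gt0 ?pi_gt0.
Qed.

(** The imaginary axis itself is only reached as a limit, since there the
    derivatives in the angle are no longer integrable. *)
Let rotated_limit (r : R -> R -> R) :
  (forall phi x, 0 < x -> {for x, continuous (r phi)}) ->
  (forall phi x, 0 <= cos phi -> 0 < x -> `|r phi x| <= 2 * power_majorant b x) ->
  (forall x, continuous (r ^~ x)) ->
  \int[mu]_(x in `]0, +oo[) r (phin n) x @[n --> \oo] -->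
  \int[mu]_(x in `]0, +oo[) r (pi / 2) x.
Proof.
move=> rc rle rphi; apply: (Rintegral_dominated_cvg mu _ _ _ i2maj _).2 => //.
- by move=> n; apply: continuous_measurable_pos => x; exact: rc.
- by move=> x _; exact: (cvg_comp _ _ phin_cvg (rphi x (pi / 2))).
- by move=> n x /pos_itv x0; apply: rle => //; exact: ltW.
Qed.

Let rotated_re0 : rotated_re 0 = Gamma (1 - b) / b.
Proof.
have c0 : 0 < cos 0 :> R by rewrite cos0.
apply: (mulfI (lt0r_neq0 b0)); rewrite -(parts_A c0) mulrCA mulfV ?lt0r_neq0// mulr1.
rewrite /Gamma; apply: eq_Rintegral => x; rewrite inE => /pos_itv x0.
have [e1 _] := powE x0.
by rewrite /dB addrAC subrr add0r e1 cos0 sin0 !mulr0 cos0 sin0 !mulr1; ring.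
Qed.

Let cvg_trig (f : R -> R) : continuous f ->
  rotated_re 0 * f (b * phin n) @[n --> \oo] --> rotated_re 0 * f (b * (pi / 2)).
Proof.
move=> cf; apply: cvgMr; apply: (cvg_comp _ f); last exact: cf.
by apply: cvgMr; exact: phin_cvg.
Qed.

Lemma onem_cos_integral :
  \int[mu]_(x in `]0, +oo[) ((1 - cos x) * x `^ (-1 - b)) =
  Gamma (1 - b) / b * cos (b * (pi / 2)).
Proof.
have crA x : continuous (rA ^~ x).
  by move=> t; apply: derivable_continuous_at; have [] := is_derive_rA x t.
have h := rotated_limit rA_cont rA_le crA.
rewrite -rotated_re0.
have -> : \int[mu]_(x in `]0, +oo[) ((1 - cos x) * x `^ (-1 - b)) =
    \int[mu]_(x in `]0, +oo[) rA (pi / 2) x.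
  apply: eq_Rintegral => x _.
  by rewrite /rA cos_pihalf sin_pihalf mulr0 oppr0 expR0 mul1r mulr1.
move: h; rewrite (_ : (fun n => _) = (fun n => rotated_re 0 * cos (b * phin n))).
  by move=> /cvg_unique; apply => //; apply: cvg_trig; exact: continuous_cos.
by apply/funext => n; have [<-] := rotation (phin_range n).
Qed.

Lemma sin_integral :
  \int[mu]_(x in `]0, +oo[) (sin x * x `^ (-1 - b)) =
  Gamma (1 - b) / b * sin (b * (pi / 2)).
Proof.
have crB x : continuous (rB ^~ x).
  by move=> t; apply: derivable_continuous_at; have [] := is_derive_rB x t.
have h := rotated_limit rB_cont rB_le crB.
rewrite -rotated_re0.
have -> : \int[mu]_(x in `]0, +oo[) (sin x * x `^ (-1 - b)) =
    \int[mu]_(x in `]0, +oo[) rB (pi / 2) x.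
  apply: eq_Rintegral => x _.
  by rewrite /rB cos_pihalf sin_pihalf mulr0 oppr0 expR0 mul1r mulr1.
move: h; rewrite (_ : (fun n => _) = (fun n => rotated_re 0 * sin (b * phin n))).
  by move=> /cvg_unique; apply => //; apply: cvg_trig; exact: continuous_sin.
by apply/funext => n; have [_ <-] := rotation (phin_range n).
Qed.

Lemma Gamma_onem_gt0 : 0 < Gamma (1 - b).
Proof.
pose c : R := expR (- 2) * 2 `^ (- b).
have c0 : 0 < c by rewrite mulr_gt0 ?expR_gt0 ?powR_gt0.
have i1 : mu.-integrable `]0, +oo[ (EFin \o (fun x => c * \1_(`[1, 2]%classic : set R) x)).
  apply: RintegrableZl => //; apply: (integrableS measurableT) => //.
  exact: integrable_indic_itv.
apply: (@lt_le_trans _ _ (\int[mu]_(x in `]0, +oo[) (c * \1_(`[1, 2]%classic : set R) x))).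
  rewrite RintegralZl//; last first.
    by apply: (integrableS measurableT) => //; exact: integrable_indic_itv.
  rewrite mulr_gt0// /Rintegral integral_indic//.
  rewrite setIidl; last by move=> x /=; rewrite !in_itv/= andbT => /andP[+ _]; exact: lt_le_trans.
  have E : (mu (`[1%R, 2%R]%classic : set R) = 1%:E)%E.
    apply: etrans (lebesgue_measure_itv `[1%R, 2%R]) _.
    by rewrite /= lte_fin ltr1n -EFinD; congr EFin; ring.
  have : 0 < fine (1%:E : \bar R) by exact: ltr01.
  by rewrite -E.
apply: le_Rintegral => //.
  have k1 : 0 < 1 :> R by [].
  have := integrable_exp_pow b01 k1; apply: eq_integrable => // x _ /=.
  by rewrite mulr1 mulrC [1 - b - 1]addrAC subrr add0r.
move=> x /pos_itv x0; rewrite [1 - b - 1]addrAC subrr add0r indicE.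
case: (boolP (x \in _)) => /=; last by rewrite mulr0 mulr_ge0 ?powR_ge0 ?expR_ge0.
rewrite inE/= in_itv/= => /andP[x1 x2]; rewrite mulr1 /c mulrC.
apply: ler_pM; rewrite ?powR_ge0 ?expR_ge0// ?ler_expR ?lerN2//.
rewrite !powRN lef_pV2 ?posrE ?powR_gt0//.
by apply: ge0_ler_powR; rewrite ?nnegrE// ltW.
Qed.

End rotation.

(** * The power tail of the stationary rate *)

(** The probability that [alpha] is close to [1] varies regularly, so that
    [lambda / (1 - alpha)] has a power tail of index [1 + b], and its
    characteristic function behaves near the origin like the Fourier integrals of a
    pure power. *)
Section power_tail.
Context {R : realType} d (T : measurableType d) (P : probability T R).
Local Notation mu := (@lebesgue_measure R).
Variables (alpha : T -> R) (psi : R -> R) (b psi1 lambda : R).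
Hypotheses (malpha : measurable_fun setT alpha)
  (alpha01 : forall w, 0 < alpha w < 1) (b01 : 0 < b < 1)
  (lambda0 : 0 < lambda) (psi1_gt0 : 0 < psi1)
  (mdens : measurable_fun (`]0, 1[ : set R) (fun x => psi x * (1 - x) `^ b))
  (dens_ge0 : forall x : R, 0 < x < 1 -> 0 <= psi x * (1 - x) `^ b)
  (dens : forall B : set R, measurable B -> P (alpha @^-1` B) =
    (\int[mu]_(x in B `&` `]0%R, 1%R[) (psi x * (1 - x) `^ b)%:E)%E)
  (psi_lim : psi x @[x --> 1^'-] --> psi1).

Let b0 : 0 < b. Proof. by case/andP : b01. Qed.
Let b1 : b < 1. Proof. by case/andP : b01. Qed.
Let a0 : 0 < 1 + b. Proof. by rewrite addr_gt0. Qed.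

Definition upper_tail (t : R) : R := fine (P (alpha @^-1` `]1 - t, +oo[)).

Let mtail t : measurable (alpha @^-1` `]1 - t, +oo[).
Proof. by rewrite -[X in measurable X]setTI; exact: malpha. Qed.

Let tailE t : P (alpha @^-1` `]1 - t, +oo[) = (upper_tail t)%:E.
Proof. by rewrite /upper_tail fineK// fin_num_measure. Qed.

Let tail_ge0 t : 0 <= upper_tail t.
Proof. by rewrite fine_ge0. Qed.

Let tail_le1 t : upper_tail t <= 1.
Proof. by rewrite -lee_fin -tailE probability_le1. Qed.

Let tail_nd : nondecreasing upper_tail.
Proof.
move=> s t st; rewrite -lee_fin -!tailE le_measure ?inE// => w /=.
by rewrite !in_itv/= !andbT; apply: le_lt_trans; rewrite lerD2l lerN2.
Qed.

Let measurable_tail : measurable_fun setT upper_tail.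
Proof. exact: nondecreasing_measurable. Qed.

Lemma integral_power_end t : 0 < t ->
  (\int[mu]_(x in `](1 - t)%R, 1%R[) ((1 - x) `^ b)%:E = (t `^ (1 + b) / (1 + b))%:E)%E.
Proof.
move=> t0.
pose F (x : R) : R := - ((1 - x) `^ (1 + b) / (1 + b)).
pose u (n : nat) : R := 1 - (t - t / n.+3%:R).
pose v (n : nat) : R := 1 - t / n.+3%:R.
have tn n : 0 < t / n.+3%:R by rewrite divr_gt0.
have tn2 n : t / n.+3%:R <= t / 3 by rewrite ler_pM2l// lef_pV2 ?posrE// ler_nat.
have inD (x : R) : (`]1 - t, 1[%classic : set R) x -> 0 < 1 - x.
  by rewrite /= in_itv/= subr_gt0 => /andP[].
have cvt : t / n.+3%:R @[n --> \oo] --> 0.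
  rewrite -[X in _ --> X](mulr0 t); apply: cvgMr.
  by have := @cvg_harmonicS R; rewrite -(cvg_shiftn 2);
    under eq_fun do rewrite addn2.
have -> : t `^ (1 + b) / (1 + b) = 0 - (- (t `^ (1 + b) / (1 + b))) by ring.
apply: (@ge0_improper_FTC _ _ u v _ F) => //.
- move=> n; rewrite /u /v; have := tn n; have := tn2 n; move: t0; set q := t / n.+3%:R => ? ? ?; apply: (@le_lt_trans _ _ (1 - 2 / 3 * t)); lra.
- move=> n x /=; rewrite !in_itv/= /u /v => /andP[x1 x2].
  have := tn n; move: x1 x2; set q := t / n.+3%:R => x1 x2 q0.
  by apply/andP; split; lra.
- move=> m n mn; have h : t / n.+3%:R <= t / m.+3%:R.
    by rewrite ler_pM2l// lef_pV2 ?posrE// ler_nat !ltnS.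
  rewrite /u /v; move: h; set q := t / n.+3%:R; set q' := t / m.+3%:R => h.
  by apply: subset_itv; rewrite bnd_simp; lra.
- move=> x; rewrite /= in_itv/= => /andP[x1 x2].
  pose m := Num.min (x - (1 - t)) (1 - x).
  have m0 : 0 < m by rewrite lt_min !subr_gt0 x1.
  have /cvgrPdist_le/(_ _ m0)[N _ /(_ N (leqnn _))] := cvt.
  rewrite sub0r normrN gtr0_norm// le_min => /andP[h1 h2].
  exists N; apply/andP; rewrite /u /v; move: h1 h2; set q := t / N.+3%:R => h1 h2.
  by split; lra.
- move=> x /inD x0; apply: (@continuous_comp R R R (fun x => 1 - x) (fun y => y `^ b)).
    by apply: cvgB; [exact: cvg_cst|exact: cvg_id].
  exact: continuous_powR_pos.
- move=> x /inD x0; have h2 := is_derive1_powR (1 + b) x0.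
  have h1 : is_derive x (1 : R) (fun x : R => 1 - x) (0 - 1).
    exact: (is_deriveB (is_derive_cst _ _ _) (is_derive_id _ _)).
  have h3 : is_derive x (1 : R) (fun x => (1 - x) `^ (1 + b)) _ :=
    @is_derive1_comp R (fun y => y `^ (1 + b)) (fun x => 1 - x) x _ _ h2 h1.
  rewrite /F; apply: is_derive_eq; rewrite /GRing.scale/= (_ : 1 + b - 1 = b); last by ring.
  by field; exact: lt0r_neq0.
- apply: cvgN; apply: cvgMl.
  have -> : (fun n => (1 - u n) `^ (1 + b)) = (fun y : R => y `^ (1 + b)) \o (fun n => t - t / n.+3%:R).
    by apply/funext => n /=; rewrite /u opprB addrCA subrr addr0.
  apply: (cvg_comp _ (fun y : R => y `^ (1 + b))); last exact: continuous_powR_pos.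
  have h : t - t / n.+3%:R @[n --> \oo] --> t - 0 by apply: cvgB => //; exact: cvg_cst.
  by rewrite subr0 in h; exact: h.
- rewrite -[X in _ --> X]oppr0 -(mul0r (1 + b)^-1); apply: cvgN; apply: cvgMl.
  move/cvg_at_rightP : (powR_at0 a0) => /(_ (fun n => 1 - v n)); apply; split.
    by move=> n; rewrite /v opprB addrCA subrr addr0.
  by under eq_fun do rewrite /v opprB addrCA subrr addr0.
- by move=> x _; exact: powR_ge0.
Qed.

(** Near [1] the density is [psi1 * (1 - x) `^ b] up to a small factor, and the
    integral of this power over an interval of length [t] ending at [1] is
    [t `^ (1 + b) / (1 + b)]. *)
Lemma upper_tail_equiv e : 0 < e -> exists2 r, 0 < r &
  forall t, 0 < t < r ->
    `|upper_tail t / t `^ (1 + b) - psi1 / (1 + b)| <= e.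
Proof.
move=> e0; have ea : 0 < e * (1 + b) by rewrite mulr_gt0.
have /cvgrPdist_lt/(_ _ ea)[r0 /= r00 hr0] := psi_lim.
exists (Num.min r0 1); first by rewrite lt_min r00 ltr01.
move=> t /andP[t0]; rewrite lt_min => /andP[tr t1].
have ta : 0 < t `^ (1 + b) by exact: powR_gt0.
have DE : `]1 - t, +oo[%classic `&` `]0, 1[%classic = (`]1 - t, 1[%classic : set R).
  apply/seteqP; split => x /=; rewrite !in_itv/= ?andbT.
    by move=> [-> /andP[]].
  by move=> /andP[h1 h2]; rewrite h1 h2 andbT; split=> //; lra.
have D01 : (`]1 - t, 1[%classic : set R) `<=` `]0, 1[%classic.
  by rewrite -DE; apply: subIsetr.
have mf : measurable_fun (`]1 - t, 1[ : set R) (fun x => psi x * (1 - x) `^ b).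
  exact: measurable_funS mdens.
have mp : measurable_fun (`]1 - t, 1[ : set R) (fun x => (1 - x) `^ b).
  apply: measurable_funTS; apply: (measurableT_comp (measurable_powR b)).
  exact: measurable_funB.
have Ef : (\int[mu]_(x in `](1 - t)%R, 1%R[) (psi x * (1 - x) `^ b)%:E)%E =
    (upper_tail t)%:E by rewrite -tailE dens// DE.
have jf : mu.-integrable `]1 - t, 1[ (EFin \o (fun x => psi x * (1 - x) `^ b)).
  apply/integrableP; split; first exact/measurable_EFinP.
  rewrite (_ : integral _ _ _ = (upper_tail t)%:E) ?ltry// -Ef.
  apply: eq_integral => x; rewrite inE => /D01; rewrite /= in_itv/= => x01.
  by rewrite ger0_norm// dens_ge0.
have jp : mu.-integrable `]1 - t, 1[ (EFin \o (fun x => (1 - x) `^ b)).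
  apply/integrableP; split; first exact/measurable_EFinP.
  rewrite (_ : integral _ _ _ = (t `^ (1 + b) / (1 + b))%:E) ?ltry//.
  rewrite -integral_power_end//; apply: eq_integral => x _.
  by rewrite /= ger0_norm// powR_ge0.
have Rp : \int[mu]_(x in `]1 - t, 1[) ((1 - x) `^ b) = t `^ (1 + b) / (1 + b).
  by rewrite /Rintegral integral_power_end.
have Rf : \int[mu]_(x in `]1 - t, 1[) (psi x * (1 - x) `^ b) = upper_tail t.
  by rewrite /Rintegral Ef.
have : `|upper_tail t - psi1 * (t `^ (1 + b) / (1 + b))| <=
    e * (1 + b) * (t `^ (1 + b) / (1 + b)).
  rewrite -Rf -Rp -!RintegralZl// -RintegralB//; last exact: RintegrableZl.
  apply: (Rintegral_le_dominated mu) => //.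
  - by apply: measurable_funB => //; exact: measurable_funM.
  - exact: RintegrableZl.
  move=> x; rewrite /= in_itv/= => /andP[x1 x2].
  rewrite -mulrBl normrM (ger0_norm (powR_ge0 _ _)) ler_wpM2r ?powR_ge0//.
  rewrite distrC; apply/ltW/hr0 => //=; rewrite gtr0_norm ?subr_gt0//; lra.
have -> : e * (1 + b) * (t `^ (1 + b) / (1 + b)) = e * t `^ (1 + b).
  by field; exact: lt0r_neq0.
rewrite -ler_pdivrMr// -[X in _ / X](gtr0_norm ta) -normfV -normrM.
by congr (`| _ | <= _); field; rewrite !lt0r_neq0.
Qed.

Lemma upper_tail_cvg0 (t : nat -> R) : (forall n, 0 < t n) ->
  t n @[n --> \oo] --> 0 ->
  upper_tail (t n) / t n `^ (1 + b) @[n --> \oo] --> psi1 / (1 + b).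
Proof.
move=> t0 tcvg; apply/cvgrPdist_le => e e0; have [r r0 hr] := upper_tail_equiv e0.
have /cvgrPdist_lt/(_ _ r0) := tcvg; apply: filterS => n.
rewrite sub0r normrN gtr0_norm// => tr; rewrite distrC; apply: hr.
by rewrite t0.
Qed.

(** The equivalent at the origin gives the bound for small [t]; for the others a
    probability is at most [1]. *)
Lemma upper_tail_le : exists2 C, 0 < C & forall t, 0 < t ->
  upper_tail t <= C * t `^ (1 + b).
Proof.
have [r r0 hr] := upper_tail_equiv ltr01.
exists (1 + psi1 / (1 + b) + (r `^ (1 + b))^-1).
  by rewrite !addr_gt0 ?divr_gt0 ?invr_gt0 ?powR_gt0.
move=> t t0; have ta : 0 < t `^ (1 + b) by exact: powR_gt0.
rewrite -ler_pdivrMr//; have [tr|tr] := ltP t r.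
  have := hr t; rewrite t0 tr => /(_ isT) h.
  have := ler_norm (upper_tail t / t `^ (1 + b) - psi1 / (1 + b)).
  have : 0 < (r `^ (1 + b))^-1 by rewrite invr_gt0 powR_gt0.
  by lra.
apply: (@le_trans _ _ (r `^ (1 + b))^-1).
  apply: (@le_trans _ _ (1 / t `^ (1 + b))).
    by rewrite ler_wpM2r ?invr_ge0 ?powR_ge0.
  rewrite div1r lef_pV2 ?posrE ?powR_gt0//.
  by apply: ge0_ler_powR; rewrite ?nnegrE ?(ltW r0) ?(ltW t0) ?(ltW a0).
by rewrite lerDr addr_ge0// ltW// divr_gt0.
Qed.

Definition rate_rv (w : T) : R := lambda / (1 - alpha w).

Lemma rate_rv_gt0 w : 0 < rate_rv w.
Proof. by rewrite divr_gt0// subr_gt0; case/andP : (alpha01 w). Qed.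

Lemma measurable_rate_rv : measurable_fun setT rate_rv.
Proof.
apply: measurable_funM => //.
rewrite (_ : (fun w => _) = (fun y : R => y `^ -1) \o (fun w => 1 - alpha w)).
  by apply: measurableT_comp; [exact: measurable_powR|exact: measurable_funB].
apply/funext => w /=; rewrite powR_inv1// subr_ge0 ltW//.
by case/andP : (alpha01 w).
Qed.

Let lt_rate u v w : 0 < u -> 0 < v ->
  (v < u * rate_rv w) = (1 - u * lambda / v < alpha w).
Proof.
move=> u0 v0; have a1 : 0 < 1 - alpha w by rewrite subr_gt0; case/andP : (alpha01 w).
rewrite /rate_rv mulrA ltr_pdivlMr// mulrC -ltr_pdivlMr//.
by rewrite ltrBlDr addrC -ltrBlDr.
Qed.

Section layer_cake.
Variables (f F : R -> R).
Hypotheses (cf : continuous f) (f0 : forall x, 0 <= f x)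
  (dF : forall x : R, is_derive x (1 : R) F (f x)) (F0 : F 0 = 0).

Lemma layer_cake_FTC y : 0 < y ->
  (\int[mu]_(v in `]0%R, +oo[) (f v * (v < y)%R%:R)%:E = (F y)%:E)%E.
Proof.
move=> y0.
have mf : measurable_fun setT f by exact: continuous_measurable_fun.
have cF x : {for x, continuous F}.
  by apply: derivable_continuous_at; have [] := dF x.
have e1 : (\int[mu]_(v in `[0%R, y]) (f v)%:E = (F y)%:E - (F 0)%:E)%E.
  apply: continuous_FTC2 => //.
  - exact: continuous_subspaceT.
  - split; first by move=> x _; have [] := dF x.
    + by apply: cvg_at_right_filter; exact: cF.
    + by apply: cvg_at_left_filter; exact: cF.
  - by move=> x _; rewrite derive1E; exact: derive_val.
move: e1; rewrite F0 sube0 => <-.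
rewrite -integral_itv_bndo_bndc; last first.
  by apply/measurable_EFinP; exact: measurable_funTS.
rewrite -integral_itv_obnd_cbnd; last first.
  by apply/measurable_EFinP; exact: measurable_funTS.
rewrite integral_mkcond [RHS]integral_mkcond; apply: eq_integral => v _.
rewrite !patchE; case: (boolP (v \in `]0%R, +oo[%classic)) => [|v0].
  rewrite inE/= in_itv/= andbT => v0; case: ifPn => [|vy].
    by rewrite inE/= in_itv/= => /andP[_ ->]; rewrite mulr1.
  case: ltP; rewrite ?mulr0// => vy'.
  by move: vy; rewrite notin_setE/= in_itv/= v0 vy'.
case: ifPn => // vy; exfalso; move: v0 vy.
rewrite notin_setE/= in_itv/= andbT inE/= in_itv/= => v0 /andP[v1 _].
by rewrite v1 in v0.
Qed.

(** [F y] is the integral of [f] over [v < y]; exchanging the integrals leaves the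
    probability of [v < u * rate_rv], an event on [alpha]. *)
Lemma layer_cake u : 0 < u ->
  (\int[P]_w (F (u * rate_rv w))%:E =
   \int[mu]_(v in `]0%R, +oo[) (f v * upper_tail (u * lambda / v))%:E)%E.
Proof.
move=> u0.
have mf : measurable_fun setT f by exact: continuous_measurable_fun.
pose h (z : T * R) : R := f z.2 * (z.2 < u * rate_rv z.1)%R%:R * \1_(`]0, +oo[%classic : set R) z.2.
have mind : measurable_fun setT (fun z : T * R => (z.2 < u * rate_rv z.1)%R%:R : R).
  apply: (@measurableT_comp _ _ _ _ _ _ (fun c : bool => c%:R : R)) => //.
  apply: measurable_fun_ltr => //; apply: measurable_funM => //.
  by apply: measurableT_comp; first exact: measurable_rate_rv.
have mh : measurable_fun setT h.
  apply: measurable_funM; last by apply: measurableT_comp.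
  by apply: measurable_funM => //; exact: measurableT_comp.
have h0 z : 0 <= h z by rewrite /h !mulr_ge0.
transitivity (\int[P]_w \int[mu]_v (h (w, v))%:E)%E.
  apply: eq_integral => w _; rewrite -(layer_cake_FTC (mulr_gt0 u0 (rate_rv_gt0 w))).
  rewrite integral_mkcond; apply: eq_integral => v _.
  by rewrite restrict_EFin patch_indic.
have mhE : measurable_fun setT (EFin \o h) by exact/measurable_EFinP.
have h0E z : (0 <= (EFin \o h) z)%E by rewrite lee_fin.
transitivity (\int[mu]_v \int[P]_w (h (w, v))%:E)%E.
  exact: (@fubini_tonelli _ _ _ _ _ P mu (EFin \o h) mhE h0E).
rewrite [RHS]integral_mkcond; apply: eq_integral => v _.
rewrite restrict_EFin patch_indic /h /=.
case: (boolP (v \in (`]0, +oo[%classic : set R))) => [|v0]; last first.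
  rewrite indicE (negbTE v0) mulr0; apply: integral0_eq => w _.
  by rewrite mulr0.
rewrite inE/= in_itv/= andbT => v0.
rewrite indicE mem_set/= ?in_itv/= ?v0// mulr1.
under eq_integral do rewrite mulr1 EFinM.
rewrite ge0_integralZl_EFin//; last first.
  apply/measurable_EFinP; apply: (@measurableT_comp _ _ _ _ _ _ (fun c : bool => c%:R : R)) => //.
  by apply: measurable_fun_ltr => //; apply: measurable_funM => //; exact: measurable_rate_rv.
rewrite EFinM -tailE; congr (_ * _)%E.
rewrite -[X in _ = P X](setIT (alpha @^-1` _)) -integral_indic//.
apply: eq_integral => w _; congr EFin; rewrite indicE lt_rate//.
congr (nat_of_bool _)%:R; apply/idP/idP.
  by move=> h1; rewrite inE/= in_itv/= h1.
by rewrite inE/= in_itv/= andbT.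
Qed.

End layer_cake.

Let measurable_tail_inv c : measurable_fun (`]0, +oo[ : set R) (fun v => upper_tail (c / v)).
Proof.
have mD : measurable (`]0, +oo[%classic : set R) by [].
apply: (@eq_measurable_fun _ _ _ _ _ (fun v => upper_tail (c * v `^ -1))).
  by move=> v; rewrite inE/= in_itv/= andbT => v0; rewrite powR_inv1 ?ltW.
apply: measurable_funTS; apply: (measurableT_comp measurable_tail).
by apply: measurable_funM => //; exact: measurable_powR.
Qed.

Lemma tail_div_le : exists2 C, 0 < C & forall u v : R, 0 < u -> 0 < v ->
  upper_tail (u * lambda / v) <= C * u `^ (1 + b) * v `^ (-1 - b).
Proof.
have [C C0 hC] := upper_tail_le.
exists (C * lambda `^ (1 + b)); first by rewrite mulr_gt0 ?powR_gt0.
move=> u v u0 v0; have u0' := ltW u0; have v0' := ltW v0; have l0' := ltW lambda0.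
apply: (le_trans (hC _ _)); first by rewrite divr_gt0 ?mulr_gt0.
rewrite le_eqVlt; apply/orP; left; apply/eqP.
have -> : (-1 - b) = - (1 + b) by ring.
rewrite powRM ?mulr_ge0 ?invr_ge0// powRM// powRN -powR_inv1// -powRrM mulN1r powRN.
by ring.
Qed.

Lemma integrable_tail (f : R -> R) u K : continuous f -> 0 < u ->
  (forall v : R, 0 < v -> `|f v| <= K) ->
  mu.-integrable `]0, +oo[ (EFin \o (fun v => f v * upper_tail (u * lambda / v))).
Proof.
move=> cf u0 fK; have [C C0 hC] := tail_div_le.
have mD : measurable (`]0, +oo[%classic : set (measurableTypeR R)) by [].
have C1 : 0 <= C * u `^ (1 + b) by rewrite mulr_ge0 ?powR_ge0// ltW.
apply: (dominated_integrable mu mD _ (RintegrableZl mD (K * (1 + C * u `^ (1 + b))) (integrable_power_majorant b01))).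
  apply: measurable_funM; last exact: measurable_tail_inv.
  by apply: measurable_funTS; exact: continuous_measurable_fun.
move=> v; rewrite /= in_itv/= andbT => v0.
rewrite normrM (ger0_norm (tail_ge0 _)) -[leRHS]mulrA.
apply: ler_pM => //; first exact: fK.
have pv : 0 <= v `^ (-1 - b) by exact: powR_ge0.
rewrite /power_majorant /Num.min; case: ltP => [v1|v1].
  rewrite mulr1; apply: (le_trans (hC _ _ u0 v0)); rewrite ler_wpM2r//; lra.
apply: (le_trans (tail_le1 _)).
have -> : v `^ (-1 - b) * v = v `^ (- b).
  by rewrite mulrC mul_powR//; congr (_ `^ _); ring.
rewrite -[leLHS]mulr1; apply: ler_pM => //; first by lra.
by rewrite powRN invf_ge1 ?powR_gt0// (_ : 1 = 1 `^ b); last (by rewrite powR1); rewrite ge0_ler_powR ?nnegrE ?(ltW b0) ?(ltW v0).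
Qed.

Lemma layer_cake_Rintegral (f F : R -> R) u K : continuous f ->
  (forall x : R, 0 <= f x) -> (forall x : R, is_derive x (1 : R) F (f x)) ->
  F 0 = 0 -> 0 < u -> (forall v : R, 0 < v -> `|f v| <= K) ->
  P.-integrable setT (EFin \o (fun w => F (u * rate_rv w))) /\
  \int[P]_w F (u * rate_rv w) =
  \int[mu]_(v in `]0, +oo[) (f v * upper_tail (u * lambda / v)).
Proof.
move=> cf f0 dF F0 u0 fK; have lc := layer_cake cf f0 dF F0 u0.
have jf := integrable_tail cf u0 fK.
split; last by rewrite /Rintegral lc.
apply/integrableP; split.
  apply/measurable_EFinP; apply: (measurableT_comp _ _) => //.
    apply: continuous_measurable_fun => x.
    by apply: derivable_continuous_at; have [] := dF x.
  by apply: measurable_funM => //; exact: measurable_rate_rv.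
have F0' w : 0 <= F (u * rate_rv w).
  rewrite -lee_fin -(layer_cake_FTC cf dF F0 (mulr_gt0 u0 (rate_rv_gt0 w))).
  by apply: integral_ge0 => v _; rewrite lee_fin mulr_ge0.
rewrite (_ : integral _ _ _ = \int[P]_w (F (u * rate_rv w))%:E)%E.
  rewrite lc; apply: (integrable_lty (mu := mu)) => //; exact: jf.
by apply: eq_integral => w _; rewrite /= ger0_norm.
Qed.

(** The layer-cake formula for [f = 1]: the tail [v `^ (-1 - b)] is integrable at
    infinity since [b > 0]. *)
Lemma rate_rv_integrable : P.-integrable setT (EFin \o rate_rv).
Proof.
have [j _] := @layer_cake_Rintegral (fun=> 1) (fun x => x) 1 1 (fun x => @cvg_cst _ _ _ _ _)
  (fun=> ler01) (fun x => is_derive_id _ _) erefl ltr01 (fun x _ => ltac:(by rewrite normr1)).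
by apply: eq_integrable j => // w _ /=; rewrite mul1r.
Qed.

Let mVu (g : R -> R) u : measurable_fun setT g -> measurable_fun setT (fun w => g (u * rate_rv w)).
Proof.
move=> mg; apply: (measurableT_comp mg); apply: measurable_funM => //.
exact: measurable_rate_rv.
Qed.

Let icos u : P.-integrable setT (EFin \o (fun w => cos (u * rate_rv w))).
Proof.
apply: (@bounded_integrable _ _ _ P _ 1); first exact: mVu measurable_fun_cos.
by move=> w; exact: norm_cos_le1.
Qed.

Let isin u : P.-integrable setT (EFin \o (fun w => sin (u * rate_rv w))).
Proof.
apply: (@bounded_integrable _ _ _ P _ 1); first exact: mVu measurable_fun_sin.
by move=> w; exact: norm_sin_le1.
Qed.

(** The layer-cake formula needs a nonnegative [f]; as [sin] takes both signs, it
    is applied to [1] and to [1 - sin], and the results are subtracted. *)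
Lemma onem_cos_rate u : 0 < u -> 1 - \int[P]_w cos (u * rate_rv w) =
  \int[mu]_(v in `]0, +oo[) (sin v * upper_tail (u * lambda / v)).
Proof.
move=> u0.
have c1 : continuous (fun _ : R => 1 : R) by move=> x; exact: cvg_cst.
have cs : continuous (fun v : R => 1 - sin v).
  by move=> x; apply: cvgB; [exact: cvg_cst|exact: continuous_sin].
have n1 (v : R) : 0 < v -> `|1 : R| <= 2 by rewrite normr1 ler1n.
have ns (v : R) : 0 < v -> `|1 - sin v| <= 2.
  by move=> _; apply: (le_trans (ler_normB _ _)); rewrite normr1; have := norm_sin_le1 v; lra.
have d1 (x : R) : is_derive x (1 : R) (fun x => x) 1 by exact: is_derive_id.
have d2 (x : R) : is_derive x (1 : R) (fun x => x - (1 - cos x)) (1 - sin x).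
  by apply: is_derive_eq; rewrite /GRing.scale/=; ring.
have s0 (x : R) : 0 <= 1 - sin x by rewrite subr_ge0; exact: sin_le1.
have [j1 e1] := layer_cake_Rintegral c1 (fun=> ler01) d1 erefl u0 n1.
have F20 : 0 - (1 - cos 0) = 0 :> R by rewrite cos0 subrr subr0.
have [j2 e2] := layer_cake_Rintegral cs s0 d2 F20 u0 ns.
have mD : measurable (`]0, +oo[%classic : set (measurableTypeR R)) by [].
have -> : \int[mu]_(v in `]0, +oo[) (sin v * upper_tail (u * lambda / v)) =
    \int[P]_w (u * rate_rv w) -
    \int[P]_w (u * rate_rv w - (1 - cos (u * rate_rv w))).
  rewrite e1 e2 -RintegralB//; [|exact: integrable_tail c1 u0 n1|exact: integrable_tail cs u0 ns].
  by apply: eq_Rintegral => v _; ring.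
rewrite -RintegralB//.
rewrite (_ : 1 - _ = \int[P]_w (1 - cos (u * rate_rv w))).
  by apply: eq_Rintegral => w _; ring.
rewrite RintegralB//.
- by rewrite Rintegral_cst//= probability_setT mulr1.
- exact: finite_measure_integrable_cst.
Qed.

Lemma sub_sin_rate u : 0 < u ->
  u * (\int[P]_w rate_rv w) - \int[P]_w sin (u * rate_rv w) =
  \int[mu]_(v in `]0, +oo[) ((1 - cos v) * upper_tail (u * lambda / v)).
Proof.
move=> u0.
have cs : continuous (fun v : R => 1 - cos v).
  by move=> x; apply: cvgB; [exact: cvg_cst|exact: continuous_cos].
have ns (v : R) : 0 < v -> `|1 - cos v| <= 2.
  by move=> _; apply: (le_trans (ler_normB _ _)); rewrite normr1; have := norm_cos_le1 v; lra.
have d2 (x : R) : is_derive x (1 : R) (fun x => x - sin x) (1 - cos x).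
  by apply: is_derive_eq; rewrite /GRing.scale/=; ring.
have s0 (x : R) : 0 <= 1 - cos x by rewrite subr_ge0; exact: cos_le1.
have F20 : 0 - sin 0 = 0 :> R by rewrite sin0 subrr.
have [j2 <-] := layer_cake_Rintegral cs s0 d2 F20 u0 ns.
rewrite -RintegralZl//; last exact: rate_rv_integrable.
rewrite RintegralB//; first by apply: RintegrableZl => //; exact: rate_rv_integrable.
Qed.

(** The rescaled tails [u `^ (- (1 + b)) * upper_tail (u * lambda / v)] converge to
    a multiple of [v `^ (-1 - b)] and are dominated by another multiple. *)
Lemma tail_integral_cvg (f : R -> R) (u_ : nat -> R) : continuous f ->
  (forall v : R, 0 < v -> `|f v| <= 2 * Num.min 1 v) ->
  (forall n, 0 < u_ n) -> u_ n @[n --> \oo] --> 0 ->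
  (u_ n) `^ (- (1 + b)) * (\int[mu]_(v in `]0, +oo[) (f v * upper_tail (u_ n * lambda / v)))
    @[n --> \oo] -->
  psi1 / (1 + b) * lambda `^ (1 + b) * \int[mu]_(v in `]0, +oo[) (f v * v `^ (-1 - b)).
Proof.
move=> cf fK u0 ucvg; have [C C0 hC] := tail_div_le.
have mD : measurable (`]0, +oo[%classic : set (measurableTypeR R)) by [].
have mf : measurable_fun (`]0, +oo[%classic : set R) f.
  by apply: measurable_funTS; exact: continuous_measurable_fun.
have fK2 (v : R) : 0 < v -> `|f v| <= 2.
  move=> v0; apply: (le_trans (fK _ v0)); rewrite -[leRHS]mulr1 ler_pM2l//.
  by rewrite ge_min lexx.
have jf : mu.-integrable `]0, +oo[ (EFin \o (fun v => f v * v `^ (-1 - b))).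
  apply: (dominated_integrable mu mD _ (RintegrableZl mD 2 (integrable_power_majorant b01))).
    apply: measurable_funM => //; apply: measurable_funTS; exact: measurable_powR.
  move=> v; rewrite /= in_itv/= andbT => v0.
  rewrite normrM (ger0_norm (powR_ge0 _ _)) /power_majorant.
  rewrite [X in _ <= 2 * X]mulrC mulrA ler_wpM2r ?powR_ge0//; exact: fK.
rewrite -RintegralZl//.
under eq_fun => n do (rewrite -RintegralZl//; last exact: integrable_tail cf (u0 n) fK2).
apply: (Rintegral_dominated_cvg mu mD _ _ (RintegrableZl mD (2 * C) (integrable_power_majorant b01)) _).2.
- move=> n; apply: measurable_funM => //; apply: measurable_funM => //.
  exact: measurable_tail_inv.
- move=> v; rewrite /= in_itv/= andbT => v0.
  set tn := fun n => u_ n * lambda / v.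
  have tn0 n : 0 < tn n by rewrite divr_gt0 ?mulr_gt0.
  have tcvg : tn n @[n --> \oo] --> 0.
    rewrite -[X in _ --> X](mul0r (lambda / v)) /tn; under eq_fun do rewrite -mulrA.
    exact: cvgMl.
  have -> : psi1 / (1 + b) * lambda `^ (1 + b) * (f v * v `^ (-1 - b)) =
      (psi1 / (1 + b)) * (lambda `^ (1 + b) * f v * v `^ (-1 - b)) by ring.
  rewrite (_ : (fun n => _) = fun n => (upper_tail (tn n) / tn n `^ (1 + b)) *
      (lambda `^ (1 + b) * f v * v `^ (-1 - b))); last first.
    apply/funext => n; have u0' := ltW (u0 n); have v0' := ltW v0; have l0' := ltW lambda0.
    rewrite /tn; have -> : (-1 - b) = - (1 + b) by ring.
    rewrite powRM ?mulr_ge0 ?invr_ge0// powRM// -(powR_inv1 v0') -powRrM mulN1r !powRN.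
    by field; rewrite !lt0r_neq0 ?powR_gt0.
  by apply: cvgMl; exact: upper_tail_cvg0.
move=> n v; rewrite /= in_itv/= andbT => v0.
rewrite normrM (ger0_norm (powR_ge0 _ _)) normrM (ger0_norm (tail_ge0 _)).
have ua : 0 < u_ n `^ (1 + b) by exact: powR_gt0.
rewrite powRN mulrC ler_pdivrMr// /power_majorant.
have -> : 2 * C * (v `^ (-1 - b) * Num.min 1 v) * u_ n `^ (1 + b) =
   (2 * Num.min 1 v) * (C * u_ n `^ (1 + b) * v `^ (-1 - b)) by ring.
by apply: ler_pM => //; [exact: fK|exact: hC].
Qed.

End power_tail.

(** * Characteristic functions of sums of independent variables *)

(** Sums of independent random variables: the functionals [W] that are
    decoupled from all the [Y_ i] with [N <= i] are closed under linear
    combinations, and multiplying one of them by a function of [Y_ N]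
    decouples it from the [Y_ i] with [N < i] only.  The characteristic
    function of a sum follows by induction. *)
Section independent_sums.
Context {R : realType} d0 d (T0 : measurableType d0) (T : measurableType d)
  (P0 : probability T0 R) (P : probability T R).
Variables (Y0 : T0 -> R) (Y_ : nat -> T -> R).
Hypotheses (mY0 : measurable_fun setT Y0) (mY_ : forall i, measurable_fun setT (Y_ i))
  (indep : forall (s : seq nat) (B : nat -> set R), uniq s ->
    (forall i, measurable (B i)) ->
    P (\big[setI/setT]_(i <- s) (Y_ i @^-1` B i)) =
      (\prod_(i <- s) P0 (Y0 @^-1` B i))%E).

Definition decoupled (N : nat) (W : T -> R) : Prop :=
  [/\ measurable_fun setT W, exists K, forall w, `|W w| <= K &
    forall (s : seq nat) (B : nat -> set R), uniq s ->
      (forall i, i \in s -> (N <= i)%N) -> (forall i, measurable (B i)) ->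
      \int[P]_w (W w * \prod_(i <- s) \1_(B i) (Y_ i w)) =
      (\int[P]_w W w) * \prod_(i <- s) fine (P0 (Y0 @^-1` B i))].

Let mpre0 (B : set R) : measurable B -> measurable (Y0 @^-1` B).
Proof. by move=> mB; rewrite -[X in measurable X]setTI; exact: mY0. Qed.

Let mpre (B : set R) i : measurable B -> measurable (Y_ i @^-1` B).
Proof. by move=> mB; rewrite -[X in measurable X]setTI; exact: mY_. Qed.

Let prod_indicE (s : seq nat) (B : nat -> set R) w :
  \prod_(i <- s) \1_(B i) (Y_ i w) = \1_(\big[setI/setT]_(i <- s) (Y_ i @^-1` B i)) w :> R.
Proof.
elim: s => [|i s IH]; first by rewrite !big_nil indicT.
by rewrite !big_cons IH indicI.
Qed.

Let mprod (s : seq nat) (B : nat -> set R) : (forall i, measurable (B i)) ->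
  measurable_fun setT (fun w => \prod_(i <- s) \1_(B i) (Y_ i w) : R).
Proof.
move=> mB; elim: s => [|i s IH].
  by under eq_fun do rewrite big_nil; exact: measurable_cst.
under eq_fun do rewrite big_cons; apply: measurable_funM => //.
by apply: measurableT_comp => //; exact: measurable_indic.
Qed.

Let prod01 (s : seq nat) (B : nat -> set R) w :
  0 <= (\prod_(i <- s) \1_(B i) (Y_ i w) : R) <= 1.
Proof. by rewrite prod_indicE indicE; case: (_ \in _); rewrite lexx ler01. Qed.

Let bounded_mul (W : T -> R) K s B : measurable_fun setT W ->
  (forall w, `|W w| <= K) -> (forall i, measurable (B i)) ->
  P.-integrable setT (EFin \o (fun w => W w * \prod_(i <- s) \1_(B i) (Y_ i w))).
Proof.
move=> mW WK mB; apply: (@bounded_integrable _ _ _ P _ K).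
  by apply: measurable_funM => //; exact: mprod.
move=> w; rewrite normrM -[K]mulr1; apply: ler_pM => //.
by have /andP[h0 h1] := prod01 s B w; rewrite ger0_norm.
Qed.

Lemma decoupled_cst N c : decoupled N (fun=> c).
Proof.
split; [exact: measurable_cst|by exists (`|c|)|move=> s B us _ mB].
rewrite RintegralZl//; last first.
  rewrite (_ : (fun w => _) = (fun w => 1 * \prod_(i <- s) \1_(B i) (Y_ i w))).
    by apply: (@bounded_mul _ 1) => // w; rewrite normr1.
  by apply/funext => w; rewrite mul1r.
rewrite Rintegral_cst//= probability_setT mulr1; congr (_ * _).
under eq_Rintegral do rewrite prod_indicE.
rewrite /Rintegral integral_indic//; last first.
  by apply: bigsetI_measurable => i _; exact: mpre.
rewrite setIT; transitivity (fine (\prod_(i <- s) P0 (Y0 @^-1` B i))%E).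
  by congr fine; exact: indep.
elim: s {us} => [|i s IH]; first by rewrite !big_nil.
rewrite !big_cons -IH fineM// ?fin_num_measure//; first exact: mpre0.
by rewrite prode_fin_num// => j _; rewrite fin_num_measure//; exact: mpre0.
Qed.

Lemma decoupledD N W1 W2 c : decoupled N W1 -> decoupled N W2 ->
  decoupled N (fun w => W1 w + c * W2 w).
Proof.
move=> [m1 [K1 b1] h1] [m2 [K2 b2] h2]; split.
- by apply: measurable_funD => //; exact: measurable_funM.
- exists (K1 + `|c| * K2) => w; rewrite (le_trans (ler_normD _ _))//.
  by rewrite lerD// normrM ler_wpM2l.
move=> s B us sN mB; under eq_Rintegral do rewrite mulrDl -mulrA.
have i1 := bounded_integrable P m1 b1; have i2 := bounded_integrable P m2 b2.
have j1 := @bounded_mul _ _ s _ m1 b1 mB; have j2 := @bounded_mul _ _ s _ m2 b2 mB.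
rewrite RintegralD//; last exact: RintegrableZl.
rewrite RintegralD//; last exact: RintegrableZl.
by rewrite !RintegralZl// h1// h2// mulrDl mulrA.
Qed.

(** A nonnegative [W], times the indicators of the later variables, is the density
    of a measure under which [Y_ N] has a multiple of the law of [Y0]. *)
Let decoupledM_ge0 N (W : T -> R) (f : R -> R) (K : R) : decoupled N W -> (forall w, 0 <= W w) ->
  measurable_fun setT f -> (forall x : R, `|f x| <= K) ->
  forall (s : seq nat) (B : nat -> set R), uniq s ->
    (forall i, i \in s -> (N < i)%N) -> (forall i, measurable (B i)) ->
    \int[P]_w (W w * f (Y_ N w) * \prod_(i <- s) \1_(B i) (Y_ i w)) =
    (\int[P]_w W w) * (\int[P0]_w f (Y0 w)) * \prod_(i <- s) fine (P0 (Y0 @^-1` B i)).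
Proof.
move=> [mW [K1 b1] h] W0 mf fK s B us sN mB.
set c := \prod_(i <- s) _.
pose w1 w : R := W w * \prod_(i <- s) \1_(B i) (Y_ i w).
have mw1 : measurable_fun setT w1 by apply: measurable_funM => //; exact: mprod.
have w1_ge0 w : 0 <= w1 w by rewrite mulr_ge0//; case/andP : (prod01 s B w).
have EW0 : 0 <= \int[P]_w W w by exact: Rintegral_ge0.
have c0 : 0 <= (\int[P]_w W w) * c.
  by rewrite mulr_ge0//; apply: prodr_ge0 => i _; rewrite fine_ge0.
transitivity (\int[P]_w (w1 w * f (Y_ N w))).
  by apply: eq_Rintegral => w _; rewrite /w1; ring.
transitivity (\int[P0]_w ((\int[P]_w W w) * c * f (Y0 w))); last first.
  rewrite RintegralZl//; first by rewrite mulrAC.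
  apply: (@bounded_integrable _ _ _ P0 _ K) => //; exact: measurableT_comp.
apply: (@weighted_Rintegral _ _ _ _ _ _ _ P P0 w1 (fun=> (\int[P]_w W w) * c)) => //.
- move=> C mC.
  pose B' i := if i == N then C else B i.
  have mB' i : measurable (B' i) by rewrite /B'; case: ifP.
  have Ns : N \notin s by apply/negP => /sN; rewrite ltnn.
  have eB g : \prod_(i <- N :: s) g i (B' i) = g N C * \prod_(i <- s) g i (B i) :> R.
    rewrite big_cons /B' eqxx; congr (_ * _); apply: eq_big_seq => i si.
    by case: eqP => // iN; move: Ns; rewrite -iN si.
  have hN : \int[P]_w (W w * \prod_(i <- N :: s) \1_(B' i) (Y_ i w)) =
      (\int[P]_w W w) * \prod_(i <- N :: s) fine (P0 (Y0 @^-1` B' i)).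
    apply: h => //=; first by rewrite Ns.
    by move=> i; rewrite inE => /orP[/eqP ->//|/sN/ltnW].
  rewrite (eB (fun _ B => fine (P0 (Y0 @^-1` B)))) -/c in hN.
  transitivity ((\int[P]_w (W w * \prod_(i <- N :: s) \1_(B' i) (Y_ i w)))%:E)%E.
    rewrite /Rintegral fineK; last first.
      by apply: integrable_fin_num => //; exact: bounded_mul b1 _.
    apply: eq_integral => w _; congr EFin.
    by rewrite (eB (fun i B => \1_B (Y_ i w))) /w1; ring.
  rewrite hN; under [RHS]eq_integral do rewrite EFinM.
  have mI : measurable_fun setT (fun w => (\1_C (Y0 w) : R)%:E).
    apply/measurable_EFinP; apply: (measurableT_comp _ mY0).
    exact: measurable_indic.
  rewrite ge0_integralZl_EFin//.
  rewrite (_ : (\int[P0]_x _)%E = P0 (Y0 @^-1` C)); last first.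
    rewrite -[X in _ = P0 X](setIT (Y0 @^-1` C)) -integral_indic//; exact: mpre0.
  rewrite -[in RHS](@fineK _ (P0 _)) ?fin_num_measure//; last exact: mpre0.
  by rewrite -EFinM; congr EFin; ring.
- apply: (@bounded_integrable _ _ _ P _ (K1 * K)).
    by apply: measurable_funM => //; exact: measurableT_comp.
  move=> w; rewrite normrM; apply: ler_pM => //.
  rewrite /w1 normrM -[K1]mulr1; apply: ler_pM => //.
  by have /andP[h0 h1] := prod01 s B w; rewrite ger0_norm.
Qed.

(** A signed [W] becomes nonnegative after adding its bound. *)
Lemma decoupledM N (W : T -> R) (f : R -> R) (K : R) : decoupled N W ->
  measurable_fun setT f -> (forall x : R, `|f x| <= K) ->
  \int[P]_w (W w * f (Y_ N w)) = (\int[P]_w W w) * (\int[P0]_w f (Y0 w)) /\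
  decoupled N.+1 (fun w => W w * f (Y_ N w)).
Proof.
move=> dW mf fK; have [mW [K1 b1] h] := dW.
have d1 : decoupled N (fun w => K1 + 1 * W w) by apply: decoupledD => //; exact: decoupled_cst.
have d2 : decoupled N (fun=> K1) by exact: decoupled_cst.
have d1_ge0 w : 0 <= K1 + 1 * W w by have := b1 w; rewrite ler_norml mul1r => /andP[]; lra.
have K10 (w : T) : 0 <= K1 by rewrite (le_trans _ (b1 w)).
have mfY : measurable_fun setT (fun w => f (Y_ N w)) by exact: measurableT_comp.
have key (s : seq nat) (B : nat -> set R) : uniq s ->
    (forall i, i \in s -> (N < i)%N) -> (forall i, measurable (B i)) ->
    \int[P]_w (W w * f (Y_ N w) * \prod_(i <- s) \1_(B i) (Y_ i w)) =
    (\int[P]_w W w) * (\int[P0]_w f (Y0 w)) * \prod_(i <- s) fine (P0 (Y0 @^-1` B i)).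
  move=> us sN mB.
  have h1 := decoupledM_ge0 d1 d1_ge0 mf fK us sN mB.
  have h2 := decoupledM_ge0 d2 K10 mf fK us sN mB.
  have iW := bounded_integrable P mW b1.
  have iK : P.-integrable setT (EFin \o (fun=> K1)).
    exact: finite_measure_integrable_cst.
  have jb (c : R) (U : T -> R) : measurable_fun setT U -> (forall w, `|U w| <= c) ->
      P.-integrable setT (EFin \o (fun w => U w * f (Y_ N w) * \prod_(i <- s) \1_(B i) (Y_ i w))).
    move=> mU bU; apply: (@bounded_mul (fun w => U w * f (Y_ N w)) (c * K)) => //.
      exact: measurable_funM.
    by move=> w; rewrite normrM; apply: ler_pM.
  have -> : \int[P]_w (W w * f (Y_ N w) * \prod_(i <- s) \1_(B i) (Y_ i w)) =
    \int[P]_w ((K1 + 1 * W w) * f (Y_ N w) * \prod_(i <- s) \1_(B i) (Y_ i w)) -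
    \int[P]_w (K1 * f (Y_ N w) * \prod_(i <- s) \1_(B i) (Y_ i w)).
    rewrite -RintegralB//; first by apply: eq_Rintegral => w _; ring.
    - apply: (jb (2 * K1)); first by case: d1.
      by move=> w; rewrite mul1r (le_trans (ler_normD _ _))// ger0_norm ?K10// mulr_natl mulr2n lerD.
    - by apply: (jb K1) => // w; rewrite ger0_norm ?K10.
  rewrite h1 h2 (_ : \int[P]_w (K1 + 1 * W w) = \int[P]_w K1 + \int[P]_w W w); first by ring.
  rewrite -RintegralD//; by apply: eq_Rintegral => w _; rewrite mul1r.
have e : \int[P]_w (W w * f (Y_ N w)) = (\int[P]_w W w) * (\int[P0]_w f (Y0 w)).
  have := key [::] (fun=> setT) erefl (fun _ => ltac:(by [])) (fun=> measurableT).
  rewrite big_nil mulr1 => <-; apply: eq_Rintegral => w _.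
  by rewrite big_nil mulr1.
split=> //; split.
- exact: measurable_funM.
- by exists (K1 * K) => w; rewrite normrM; apply: ler_pM.
- by move=> s B us sN mB; rewrite e key.
Qed.

Let S (N : nat) (w : T) : R := \sum_(j < N) Y_ j w.

(** The addition formulas for sine and cosine split off the last summand. *)
Lemma char_sum (t : R) (N : nat) :
  (\int[P]_w cos (t * \sum_(j < N) Y_ j w) +i* \int[P]_w sin (t * \sum_(j < N) Y_ j w)) =
  (\int[P0]_w cos (t * Y0 w) +i* \int[P0]_w sin (t * Y0 w)) ^+ N.
Proof.
suff [] : [/\ decoupled N (fun w => cos (t * S N w)),
  decoupled N (fun w => sin (t * S N w)) &
  (\int[P]_w cos (t * S N w) +i* \int[P]_w sin (t * S N w)) =
  (\int[P0]_w cos (t * Y0 w) +i* \int[P0]_w sin (t * Y0 w)) ^+ N] by [].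
have mc : measurable_fun setT (fun x : R => cos (t * x)).
  by apply: measurableT_comp; [exact: measurable_fun_cos|exact: measurable_funM].
have ms : measurable_fun setT (fun x : R => sin (t * x)).
  by apply: measurableT_comp; [exact: measurable_fun_sin|exact: measurable_funM].
have bc (x : R) : `|cos (t * x)| <= 1 by exact: norm_cos_le1.
have bs (x : R) : `|sin (t * x)| <= 1 by exact: norm_sin_le1.
elim: N => [|N [dc ds IH]].
  have E w : S 0 w = 0 by rewrite /S big_ord0.
  split.
  - by under eq_fun do rewrite E mulr0 cos0; exact: decoupled_cst.
  - by under eq_fun do rewrite E mulr0 sin0; exact: decoupled_cst.
  - under eq_Rintegral do rewrite E mulr0 cos0.
    under [X in _ +i* X]eq_Rintegral do rewrite E mulr0 sin0.
    by rewrite !Rintegral_cst//= probability_setT mulr1 mul0r.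
have E w : S N.+1 w = S N w + Y_ N w by rewrite /S big_ord_recr.
have [e1 d1] := decoupledM dc mc bc; have [e2 d2] := decoupledM ds ms bs.
have [e3 d3] := decoupledM ds mc bc; have [e4 d4] := decoupledM dc ms bs.
have Ec : (fun w => cos (t * S N.+1 w)) = (fun w =>
    cos (t * S N w) * cos (t * Y_ N w) + -1 * (sin (t * S N w) * sin (t * Y_ N w))).
  by apply/funext => w; rewrite E mulrDr cosD mulN1r.
have Es : (fun w => sin (t * S N.+1 w)) = (fun w =>
    sin (t * S N w) * cos (t * Y_ N w) + 1 * (cos (t * S N w) * sin (t * Y_ N w))).
  by apply/funext => w; rewrite E mulrDr sinD mul1r.
rewrite Ec Es; split; [exact: decoupledD|exact: decoupledD|].
have I W : decoupled N.+1 W -> P.-integrable setT (EFin \o W).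
  by move=> [mW [K WK] _]; exact: (@bounded_integrable _ _ _ P W K).
have J W c : decoupled N.+1 W -> P.-integrable setT (EFin \o (fun w => c * W w)).
  by move=> dW; apply: RintegrableZl => //; exact: I.
rewrite !RintegralD ?RintegralZl//; try by [exact: I|exact: J].
rewrite e1 e2 e3 e4 exprSr -IH; apply/eqP; rewrite eq_complex /=.
by apply/andP; split; apply/eqP; ring.
Qed.

End independent_sums.

(** * The domain of attraction of a stable law *)

(** The hypotheses [hA] and [hB] say that the characteristic function of
    [V - E V] is [1 - (A + i B) u ^ (1 + b) + o (u ^ (1 + b))] as [u] decreases to
    [0]; they are kept in the two real forms in which a power tail delivers them. *)
Section domain_of_attraction.
Context {R : realType} d0 (T0 : measurableType d0) (P0 : probability T0 R).
Variables (V : T0 -> R) (A B b : R).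
Hypotheses (mV : measurable_fun setT V) (V0 : forall w, 0 <= V w)
  (b01 : 0 < b < 1) (A0 : 0 < A)
  (hA : forall u_ : nat -> R, (forall n, 0 < u_ n) -> u_ n @[n --> \oo] --> 0 ->
    u_ n `^ (- (1 + b)) * (1 - \int[P0]_w cos (u_ n * V w)) @[n --> \oo] --> A)
  (hB : forall u_ : nat -> R, (forall n, 0 < u_ n) -> u_ n @[n --> \oo] --> 0 ->
    u_ n `^ (- (1 + b)) * (u_ n * (\int[P0]_w V w) - \int[P0]_w sin (u_ n * V w))
      @[n --> \oo] --> B).

Let b0 : 0 < b. Proof. by case/andP : b01. Qed.
Let b1 : b < 1. Proof. by case/andP : b01. Qed.
Let a0 : 0 < 1 + b. Proof. by rewrite addr_gt0. Qed.

Let m := \int[P0]_w V w.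
Let m_ge0 : 0 <= m. Proof. exact: Rintegral_ge0. Qed.

Let cvg_powR0 (u_ : nat -> R) (c : R) : 0 < c -> (forall n, 0 < u_ n) ->
  u_ n @[n --> \oo] --> 0 -> u_ n `^ c @[n --> \oo] --> 0.
Proof.
move=> c0 u0 uc; move/cvg_at_rightP : (powR_at0 c0) => /(_ u_); apply; split=> //.
Qed.

Let icos u : P0.-integrable setT (EFin \o (fun w => cos (u * V w))).
Proof.
by apply: (@bounded_integrable _ _ _ P0 _ 1); [exact: measurable_cos_scale|move=> w; exact: norm_cos_le1].
Qed.

Let isin u : P0.-integrable setT (EFin \o (fun w => sin (u * V w))).
Proof.
by apply: (@bounded_integrable _ _ _ P0 _ 1); [exact: measurable_sin_scale|move=> w; exact: norm_sin_le1].
Qed.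

Let cos_centered u : \int[P0]_w cos (u * (V w - m)) =
  (\int[P0]_w cos (u * V w)) * cos (u * m) + (\int[P0]_w sin (u * V w)) * sin (u * m).
Proof.
under eq_Rintegral do rewrite mulrBr cosB.
rewrite RintegralD//.
- by rewrite !RintegralZr.
- by under eq_fun do rewrite mulrC; apply: RintegrableZl => //; exact: icos.
- by under eq_fun do rewrite mulrC; apply: RintegrableZl => //; exact: isin.
Qed.

Let sin_centered u : \int[P0]_w sin (u * (V w - m)) =
  (\int[P0]_w sin (u * V w)) * cos (u * m) - (\int[P0]_w cos (u * V w)) * sin (u * m).
Proof.
under eq_Rintegral do rewrite mulrBr sinB.
rewrite RintegralB//.
- by rewrite !RintegralZr.
- by under eq_fun do rewrite mulrC; apply: RintegrableZl => //; exact: isin.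
- by under eq_fun do rewrite mulrC; apply: RintegrableZl => //; exact: icos.
Qed.

Section along_a_sequence.
Variable u_ : nat -> R.
Hypotheses (u0 : forall n, 0 < u_ n) (uc : u_ n @[n --> \oo] --> 0).

Let x_ n := u_ n * m.
Let x0 n : 0 <= x_ n. Proof. by rewrite mulr_ge0// ltW. Qed.
Let xc : x_ n @[n --> \oo] --> 0.
Proof. by rewrite -[X in _ --> X](mul0r m); exact: cvgMl. Qed.

Let cosx : cos (x_ n) @[n --> \oo] --> (1 : R).
Proof. by rewrite -cos0; apply: (cvg_comp _ (@cos R) xc); exact: continuous_cos. Qed.

Let sinx : sin (x_ n) @[n --> \oo] --> (0 : R).
Proof. by rewrite -[X in _ --> X]sin0; apply: (cvg_comp _ (@sin R) xc); exact: continuous_sin. Qed.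

(** Centring by the mean produces errors of second order in [u], negligible
    before [u ^ (1 + b)] because [b < 1]. *)
Let negligible (r_ : nat -> R) : (forall n, `|r_ n| <= 2 * x_ n ^+ 2 + 2 * x_ n ^+ 3) ->
  u_ n `^ (- (1 + b)) * r_ n @[n --> \oo] --> 0.
Proof.
move=> rle; apply: norm_cvg0; apply: (@squeeze_cvgr _ _ _ _ (fun=> 0)
   (fun n => 2 * m ^+ 2 * u_ n `^ (1 - b) + 2 * m ^+ 3 * u_ n `^ (2 - b))).
- apply: nearW => n; rewrite normr_ge0/= normrM (ger0_norm (powR_ge0 _ _)).
  apply: (le_trans (ler_wpM2l (powR_ge0 _ _) (rle n))).
  have e k : u_ n `^ (- (1 + b) + k%:R) = u_ n `^ (- (1 + b)) * u_ n ^+ k.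
    by rewrite powRD ?(gt_eqF (u0 n)) ?implybT// powR_mulrn// ltW.
  have -> : 1 - b = - (1 + b) + 2 by ring.
  have -> : 2 - b = - (1 + b) + 3 by ring.
  rewrite !e /x_.
  by rewrite le_eqVlt; apply/orP; left; apply/eqP; ring.
- exact: cvg_cst.
have -> : 0 = 2 * m ^+ 2 * 0 + 2 * m ^+ 3 * 0 :> R by ring.
have b2 : 0 < 2 - b by rewrite subr_gt0 (lt_trans b1)// ltr1n.
have b1' : 0 < 1 - b by rewrite subr_gt0.
by apply: cvgD; apply: cvgMr; apply: cvg_powR0.
Qed.

Lemma centered_cos_cvg :
  u_ n `^ (- (1 + b)) * (\int[P0]_w cos (u_ n * (V w - m)) - 1) @[n --> \oo] --> - A.
Proof.
have -> : - A = - (A * 1) - B * 0 + 0 by ring.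
rewrite (_ : (fun n => _) = fun n =>
   - ((u_ n `^ (- (1 + b)) * (1 - \int[P0]_w cos (u_ n * V w))) * cos (x_ n)) -
    (u_ n `^ (- (1 + b)) * (u_ n * m - \int[P0]_w sin (u_ n * V w))) * sin (x_ n) +
   u_ n `^ (- (1 + b)) * (cos (x_ n) - 1 + x_ n * sin (x_ n))); last first.
  by apply/funext => n; rewrite cos_centered /x_; ring.
apply: cvgD; last first.
  apply: negligible => n; have := cos_lower (x_ n); have := cos_le1 (x_ n).
  have := norm_sin_le (x_ n); rewrite (ger0_norm (x0 n)) => s1 c1 c2.
  have x2 : 0 <= x_ n ^+ 2 by exact: sqr_ge0.
  have x3 : 0 <= x_ n ^+ 3 by exact: exprn_ge0.
  have s2 : `|x_ n * sin (x_ n)| <= x_ n ^+ 2.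
    by rewrite normrM (ger0_norm (x0 n)) expr2 ler_wpM2l.
  rewrite (le_trans (ler_normD _ _))// [X in X + _]ler0_norm ?subr_le0//; lra.
apply: cvgB; first by apply: cvgN; apply: cvgM cosx; exact: hA.
by apply: cvgM sinx; exact: hB.
Qed.

Lemma centered_sin_cvg :
  u_ n `^ (- (1 + b)) * (\int[P0]_w sin (u_ n * (V w - m))) @[n --> \oo] --> - B.
Proof.
have -> : - B = - (B * 1) + A * 0 + 0 by ring.
rewrite (_ : (fun n => _) = fun n =>
   - ((u_ n `^ (- (1 + b)) * (u_ n * m - \int[P0]_w sin (u_ n * V w))) * cos (x_ n)) +
   (u_ n `^ (- (1 + b)) * (1 - \int[P0]_w cos (u_ n * V w))) * sin (x_ n) +
   u_ n `^ (- (1 + b)) * (x_ n * (cos (x_ n) - 1) + (x_ n - sin (x_ n)))); last first.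
  by apply/funext => n; rewrite sin_centered /x_; ring.
apply: cvgD; last first.
  apply: negligible => n; have := cos_lower (x_ n); have := cos_le1 (x_ n).
  have /andP[s1 s2] := sub_sin_le (x0 n) => c1 c2.
  have x2 : 0 <= x_ n ^+ 2 by exact: sqr_ge0.
  have x3 : 0 <= x_ n ^+ 3 by exact: exprn_ge0.
  have s3 : `|x_ n * (cos (x_ n) - 1)| <= x_ n ^+ 3.
    rewrite normrM (ger0_norm (x0 n)) exprS ler_wpM2l// ler0_norm ?subr_le0//; lra.
  by rewrite (le_trans (ler_normD _ _))// [X in _ + X]ger0_norm//; lra.
apply: cvgD; first by apply: cvgN; apply: cvgM cosx; exact: hB.
by apply: cvgM sinx; exact: hA.
Qed.

End along_a_sequence.

Definition stable_re (t : R) : R := expR (- A * t `^ (1 + b)) * cos (B * t `^ (1 + b)).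
Definition stable_im (t : R) : R := - (expR (- A * t `^ (1 + b)) * sin (B * t `^ (1 + b))).

Local Notation normc := Normc.normc.

Let normc_le (z : R[i]) : normc z <= `|complex.Re z| + `|complex.Im z|.
Proof.
case: z => x y /=; rewrite -ler_sqr ?nnegrE ?sqrtr_ge0 ?addr_ge0//.
rewrite sqr_sqrtr ?addr_ge0 ?sqr_ge0// sqrrD !real_normK ?num_real//.
rewrite -subr_ge0 (_ : _ - _ = `|x| * `|y| *+ 2); last by ring.
by rewrite mulrn_wge0 ?mulr_ge0.
Qed.

Let normc_Re (z : R[i]) : `|complex.Re z| <= normc z.
Proof.
by case: z => x y /=; rewrite -sqrtr_sqr ler_wsqrtr// lerDl sqr_ge0.
Qed.

Let normc_Im (z : R[i]) : `|complex.Im z| <= normc z.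
Proof.
by case: z => x y /=; rewrite -sqrtr_sqr ler_wsqrtr// lerDr sqr_ge0.
Qed.

Let normcX_le1 (z : R[i]) N : normc z <= 1 -> normc (z ^+ N) <= 1.
Proof.
move=> z1; elim: N => [|N IH]; first by rewrite expr0 Normc.normc1.
rewrite exprS Normc.normcM -[leRHS]mulr1; apply: ler_pM => //;
  exact: (le_trans (normr_ge0 _) (normc_Re _)).
Qed.

Let normc_ge0 (z : R[i]) : 0 <= normc z.
Proof. exact: (le_trans (normr_ge0 _) (normc_Re _)). Qed.

Let normc_subX (z w : R[i]) N : normc z <= 1 -> normc w <= 1 ->
  normc (z ^+ N - w ^+ N) <= N%:R * normc (z - w).
Proof.
move=> z1 w1; elim: N => [|N IH].
  by rewrite !expr0 subrr Normc.normc0 mul0r.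
have -> : z ^+ N.+1 - w ^+ N.+1 = z * (z ^+ N - w ^+ N) + (z - w) * w ^+ N.
  by rewrite !exprS; ring.
apply: (le_trans (le_normcD _ _)); rewrite !Normc.normcM -natr1 mulrDl mul1r.
apply: lerD; first by rewrite -[leRHS]mul1r; apply: ler_pM.
by rewrite -[leRHS]mulr1; apply: ler_pM => //; exact: normcX_le1.
Qed.

Let char_le1 (U : T0 -> R) : measurable_fun setT U ->
  normc (\int[P0]_w cos (U w) +i* \int[P0]_w sin (U w)) <= 1.
Proof.
move=> mU; set p := \int[P0]_w cos (U w); set q := \int[P0]_w sin (U w).
have jc : P0.-integrable setT (EFin \o (fun w => cos (U w))).
  apply: (@bounded_integrable _ _ _ P0 _ 1); last by move=> w; exact: norm_cos_le1.
  by apply: measurableT_comp => //; exact: measurable_fun_cos.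
have js : P0.-integrable setT (EFin \o (fun w => sin (U w))).
  apply: (@bounded_integrable _ _ _ P0 _ 1); last by move=> w; exact: norm_sin_le1.
  by apply: measurableT_comp => //; exact: measurable_fun_sin.
rewrite /=; set r := Num.sqrt _; have r0 : 0 <= r by exact: sqrtr_ge0.
have r2 : r ^+ 2 = p ^+ 2 + q ^+ 2 by rewrite sqr_sqrtr// addr_ge0 ?sqr_ge0.
have : r ^+ 2 <= r.
  rewrite r2 (_ : p ^+ 2 + q ^+ 2 = \int[P0]_w (p * cos (U w) + q * sin (U w))); last first.
    have e (c : R) f : P0.-integrable setT (EFin \o f) ->
      \int[P0]_w (c * f w) = c * \int[P0]_w f w by move=> jf; rewrite RintegralZl.
    rewrite RintegralD//; [|exact: RintegrableZl|exact: RintegrableZl].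
    by rewrite (e p _ jc) (e q _ js) !expr2.
  rewrite [leRHS](_ : r = \int[P0]_w r); last by rewrite Rintegral_cst//= probability_setT mulr1.
  apply: le_Rintegral => //.
  - by apply: RintegrableD => //; exact: RintegrableZl.
  - exact: finite_measure_integrable_cst.
  move=> w _; apply: (le_trans (ler_norm _)); rewrite -ler_sqr ?nnegrE// real_normK ?num_real//.
  have e := cos2Dsin2 (U w); rewrite r2 -[leRHS]mulr1 -e -subr_ge0.
  rewrite [X in 0 <= X](_ : _ = (p * sin (U w) - q * cos (U w)) ^+ 2) ?sqr_ge0//; ring.
rewrite leNgt; case: (ltP 1 r) => // r1 rr; exfalso.
have : r * 1 < r * r by rewrite ltr_pM2l ?(lt_trans ltr01).
by rewrite mulr1 -expr2 (negbTE rr).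
Qed.

Let exp_pow (x y : R) N :
  (expR x * cos y +i* - (expR x * sin y)) ^+ N =
  expR (N%:R * x) * cos (N%:R * y) +i* - (expR (N%:R * x) * sin (N%:R * y)).
Proof.
elim: N => [|N IH]; first by rewrite !mul0r expr0 expR0 cos0 sin0 mulr1 mulr0 oppr0.
rewrite exprS IH -natr1 !mulrDl !mul1r expRD cosD sinD.
by apply/eqP; rewrite eq_complex/=; apply/andP; split; apply/eqP; ring.
Qed.

Let derive_seq (f : R -> R) (df : R) (h_ : nat -> R) : is_derive 0 (1 : R) f df ->
  (forall n, 0 < h_ n) -> h_ n @[n --> \oo] --> 0 ->
  (h_ n)^-1 * (f (h_ n) - f 0) @[n --> \oo] --> df.
Proof.
move=> [dv <-] h0 hc; apply/cvgrPdist_lt => e e0.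
have /cvgrPdist_lt/(_ _ e0)[r /= r0 hr] := dv.
have /cvgrPdist_lt/(_ _ r0) := hc; apply: filterS => n hn.
have := hr (h_ n) hn; rewrite gt_eqF// => /(_ isT).
by rewrite /shift/= /GRing.scale/= mulr1 addr0.
Qed.

(** Powers of numbers in the unit disc satisfy
    [|z ^ N - w ^ N| <= N |z - w|], so it is enough that the characteristic
    function of [V - E V] at [t / N ^ (1 / (1 + b))] differs by [o (1 / N)] from
    that of the [N]-th convolution root of the stable law. *)
Lemma char_pow_cvg (t : R) : 0 < t ->
  let z N : R[i] := (\int[P0]_w cos (t * N%:R `^ (- (1 + b)^-1) * (V w - m)) +i*
    \int[P0]_w sin (t * N%:R `^ (- (1 + b)^-1) * (V w - m))) ^+ N in
  complex.Re (z N) @[N --> \oo] --> stable_re t /\ complex.Im (z N) @[N --> \oo] --> stable_im t.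
Proof.
move=> t0 z.
pose u_ N := t * N.+1%:R `^ (- (1 + b)^-1).
have u0 N : 0 < u_ N by rewrite mulr_gt0// powR_gt0.
have uc : u_ n @[n --> \oo] --> 0.
  rewrite -[X in _ --> X](mulr0 t); apply: cvgMr.
  have /cvg_pinftyP/(_ (fun n => n.+1%:R)) : (x : R) `^ (- (1 + b)^-1) @[x --> +oo] --> 0.
    by apply: powRN_pinfty; rewrite invr_gt0.
  by apply; rewrite (cvg_shiftS (fun n => n%:R : R)); exact: cvgr_idn.
have ua N : N.+1%:R * u_ N `^ (1 + b) = t `^ (1 + b).
  rewrite /u_ powRM ?powR_ge0 ?ltW// -powRrM mulNr mulVf ?lt0r_neq0// powR_inv1// mulrCA.
  by rewrite divff ?mulr1// pnatr_eq0.
have uN N : u_ N `^ (- (1 + b)) = N.+1%:R / t `^ (1 + b).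
  by rewrite powRN -(ua N) invfM mulrA divff ?mul1r// pnatr_eq0.
pose ch N : R[i] := \int[P0]_w cos (u_ N * (V w - m)) +i* \int[P0]_w sin (u_ N * (V w - m)).
(* The [N]-th convolution root of the stable law is the same law rescaled. *)
pose st N : R[i] := expR (- A * u_ N `^ (1 + b)) * cos (B * u_ N `^ (1 + b)) +i*
  - (expR (- A * u_ N `^ (1 + b)) * sin (B * u_ N `^ (1 + b))).
have ta0 : 0 < t `^ (1 + b) by rewrite powR_gt0.
have stN N : st N ^+ N.+1 = stable_re t +i* stable_im t.
  rewrite /st exp_pow /stable_re /stable_im.
  by rewrite (mulrCA _ (- A)) (mulrCA _ B) ua.
have st1 N : normc (st N) <= 1.
  rewrite /= sqrrN !exprMn -mulrDr cos2Dsin2 mulr1 sqrtr_sqr ger0_norm ?expR_ge0//.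
  by rewrite -expR0 ler_expR mulNr oppr_le0 mulr_ge0 ?powR_ge0// ltW.
have ch1 N : normc (ch N) <= 1.
  by apply: char_le1; apply: measurable_funM => //; exact: measurable_funB.
have zE N : z N.+1 = ch N ^+ N.+1 by [].
have hs N : 0 < u_ N `^ (1 + b) by rewrite powR_gt0.
have hsc : u_ N `^ (1 + b) @[N --> \oo] --> 0 by exact: cvg_powR0.
have sre : u_ N `^ (- (1 + b)) * (complex.Re (st N) - 1) @[N --> \oo] --> - A.
  have dre : is_derive 0 (1 : R) (fun s => expR (- A * s) * cos (B * s)) (- A).
    by apply: is_derive_eq; rewrite /GRing.scale/= !mulr0 expR0 cos0 sin0; ring.
  have := derive_seq dre hs hsc; rewrite !mulr0 expR0 cos0 mulr1.
  by under eq_fun do rewrite -powRN.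
have sim : u_ N `^ (- (1 + b)) * complex.Im (st N) @[N --> \oo] --> - B.
  have dim : is_derive 0 (1 : R) (fun s => - (expR (- A * s) * sin (B * s))) (- B).
    by apply: is_derive_eq; rewrite /GRing.scale/= !mulr0 expR0 cos0 sin0; ring.
  have := derive_seq dim hs hsc; rewrite !mulr0 sin0 mulr0 oppr0.
  by under eq_fun do rewrite -powRN subr0.
pose bd N := t `^ (1 + b) *
    (`|u_ N `^ (- (1 + b)) * (complex.Re (ch N) - 1) - u_ N `^ (- (1 + b)) * (complex.Re (st N) - 1)| +
     `|u_ N `^ (- (1 + b)) * complex.Im (ch N) - u_ N `^ (- (1 + b)) * complex.Im (st N)|).
have dle N : N.+1%:R * normc (ch N - st N) <= bd N.
  rewrite /bd -!mulrBr !normrM (ger0_norm (powR_ge0 _ _)) -mulrDr.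
  rewrite uN mulrA (mulrCA (t `^ _)) divff ?lt0r_neq0// mulr1 ler_wpM2l//.
  have -> : complex.Re (ch N) - 1 - (complex.Re (st N) - 1) = complex.Re (ch N - st N).
    by rewrite /=; ring.
  exact: normc_le.
have dcvg : N.+1%:R * normc (ch N - st N) @[N --> \oo] --> 0.
  apply: (@squeeze_cvgr _ _ _ _ (fun=> 0) bd).
  - by apply: nearW => N; rewrite dle andbT mulr_ge0.
  - exact: cvg_cst.
  have -> : 0 = t `^ (1 + b) * (`|- A - - A| + `|- B - - B|) :> R.
    by rewrite !subrr !normr0 addr0 mulr0.
  apply: cvgMr; apply: cvgD; apply: cvg_norm; apply: cvgB => //.
    exact: centered_cos_cvg.
  exact: centered_sin_cvg.
have zc : normc (z N.+1 - (stable_re t +i* stable_im t)) @[N --> \oo] --> 0.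
  apply: (@squeeze_cvgr _ _ _ _ (fun=> 0) _ _ _ _ _ dcvg); last exact: cvg_cst.
  by apply: nearW => N; rewrite normc_ge0/= zE -(stN N) normc_subX.
have fin (f : R[i] -> R) : (forall z w, `|f z - f w| <= normc (z - w)) ->
    f (z N) @[N --> \oo] --> f (stable_re t +i* stable_im t).
  move=> fle; rewrite -(cvg_shiftS (fun N => f (z N))).
  apply/cvgrPdist_lt => e e0; have /cvgrPdist_lt/(_ _ e0) := zc.
  apply: filterS => N; rewrite sub0r normrN ger0_norm// => h.
  by rewrite distrC; apply: le_lt_trans h; exact: fle.
split; [apply: (fin (@complex.Re R)) => v w|apply: (fin (@complex.Im R)) => v w].
  by apply: le_trans (normc_Re _); case: v; case: w.
by apply: le_trans (normc_Im _); case: v; case: w.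
Qed.

End domain_of_attraction.

(** * The stable law *)

(** Laws on the line are determined by the expectations of bounded continuous
    functions: the indicator of a half-line is a limit of continuous ramps. *)
Section determination_of_laws.
Context {R : realType} d1 d2 (T1 : measurableType d1) (T2 : measurableType d2)
  (P1 : probability T1 R) (P2 : probability T2 R).
Variables (W1 : T1 -> R) (W2 : T2 -> R).
Hypotheses (mW1 : measurable_fun setT W1) (mW2 : measurable_fun setT W2)
  (same : forall (g : R -> R), continuous g -> (forall x, `|g x| <= 1) ->
    \int[P1]_w g (W1 w) = \int[P2]_w g (W2 w)).

Let ramp (x : R) (n : nat) (y : R) : R := 1 - cutoff 0 (n%:R * Num.max 0 (y - x)).

Lemma eq_law (B : set R) : measurable B -> P1 (W1 @^-1` B) = P2 (W2 @^-1` B).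
Proof.
have cramp x n : continuous (ramp x n).
  move=> y; apply: cvgB; first exact: cvg_cst.
  apply: (@continuous_comp R R R (fun y => n%:R * Num.max 0 (y - x)) (cutoff 0)).
    apply: cvgMr; apply: (@continuous_comp R R R (fun y => y - x) (fun z => Num.max 0 z)).
      by apply: cvgB; [exact: cvg_id|exact: cvg_cst].
    by apply: continuous_max; [exact: cvg_cst|exact: cvg_id].
  exact: continuous_cutoff.
have ramp01 x n y : 0 <= ramp x n y <= 1.
  by rewrite /ramp subr_ge0 cutoff_le1 lerBlDr lerDl cutoff_ge0.
have ramp1 x n y : `|ramp x n y| <= 1.
  by have /andP[h0 h1] := ramp01 x n y; rewrite ger0_norm.
have ramp_cvg x y : ramp x n y @[n --> \oo] --> (\1_(`]x, +oo[%classic : set R) y : R).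
  have [yx|xy] := leP y x.
    rewrite (_ : (fun n => _) = fun=> 0).
      rewrite indicE memNset; first exact: cvg_cst.
      by rewrite /= in_itv/= andbT; apply/negP; rewrite -leNgt.
    apply/funext => n; rewrite /ramp; have -> : Num.max 0 (y - x) = 0 by apply/max_idPl; rewrite subr_le0.
    by rewrite mulr0 cutoff1 ?subrr// normr0.
  rewrite indicE mem_set/= ?in_itv/= ?andbT//.
  have /cvgryPgt/(_ (1 / (y - x))) : (n%:R : R) @[n --> \oo] --> +oo by exact: cvgr_idn.
  move=> h; apply: cvg_near_cst; apply: filterS h => n h.
  rewrite /ramp max_r ?subr_ge0 ?ltW// cutoff0 ?subr0// add0r ger0_norm.
    by rewrite -ltr_pdivrMr// subr_gt0.
  by rewrite mulr_ge0// subr_ge0 ltW.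
have tail di (Ti : measurableType di) (Pi : probability Ti R) (W : Ti -> R) x :
    measurable_fun setT W ->
    \int[Pi]_w ramp x n (W w) @[n --> \oo] --> fine (Pi (W @^-1` `]x, +oo[)).
  move=> mW; have mpre : measurable (W @^-1` `]x, +oo[).
    by rewrite -[X in measurable X]setTI; exact: mW.
  rewrite (_ : fine _ = \int[Pi]_w \1_(`]x, +oo[%classic : set R) (W w)).
    apply: (Rintegral_dominated_cvg Pi measurableT _ (g := cst 1) _ _ _).2 => //.
    - move=> n; apply: (measurableT_comp _ mW) => //.
      by apply: continuous_measurable_fun; exact: cramp.
    - exact: finite_measure_integrable_cst.
  by rewrite /Rintegral (integral_indic _ _ mpre)// setIT.
move=> mB; pose Y1 : {RV P1 >-> R} := mfun_Sub (mem_set mW1).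
pose Y2 : {RV P2 >-> R} := mfun_Sub (mem_set mW2).
apply: (@measure_unique _ R R (@RGenOInfty.G R) (fun n => `]- n%:R, +oo[%classic) _ _ _ _
  (distribution P1 Y1) (distribution P2 Y2)) mB.
- exact: RGenOInfty.measurableE.
- move=> _ _ [x ->] [y ->]; exists (Num.max x y).
  by apply/seteqP; split => z /=; rewrite !in_itv/= !andbT gt_max => /andP.
- by move=> n; exists (- n%:R).
- apply/seteqP; split => // y _; exists (Num.truncn `|y|).+1 => //=.
  rewrite in_itv/= andbT ltrNl (le_lt_trans (ler_norm _))// normrN.
  exact: truncnS_gt.
- move=> _ [x ->]; rewrite /distribution /pushforward/=.
  have m1 : measurable (W1 @^-1` `]x, +oo[) by rewrite -[X in measurable X]setTI; exact: mW1.
  have m2 : measurable (W2 @^-1` `]x, +oo[) by rewrite -[X in measurable X]setTI; exact: mW2.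
  rewrite -[LHS]fineK ?fin_num_measure// -[RHS]fineK ?fin_num_measure//; congr EFin.
  apply: (cvg_unique _ (tail _ _ P1 W1 x mW1)) => //.
  have -> : (fun n => \int[P1]_w ramp x n (W1 w)) = (fun n => \int[P2]_w ramp x n (W2 w)).
    by apply/funext => n; exact: (same (cramp x n) (ramp1 x n)).
  exact: tail.
- by move=> n; rewrite (le_lt_trans (probability_le1 _ _))// ?ltry//; exact: measurable_itv.
Qed.

End determination_of_laws.

Section density_probability.
Context {R : realType}.
Local Notation mu := (@lebesgue_measure R).

(** The proofs are arguments so that the measure is canonically a
    probability. *)
Definition density_prob (f : R -> R) of (forall x, 0 <= f x) & continuous f &
    (\int[mu]_x (f x)%:E = 1)%E :=
  fun B : set (measurableTypeR R) => (\int[mu]_(x in B) (f x)%:E)%E.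

Variables (f : R -> R) (f0 : forall x, 0 <= f x) (cf : continuous f)
  (f1 : (\int[mu]_x (f x)%:E = 1)%E).

Local Notation prob := (density_prob f0 cf f1).

Let mf : measurable_fun setT f. Proof. exact: continuous_measurable_fun. Qed.

Let prob0 : prob set0 = 0%E.
Proof. by rewrite /density_prob integral_set0. Qed.

Let prob_ge0 B : (0 <= prob B)%E.
Proof. by apply: integral_ge0 => x _; rewrite lee_fin. Qed.

Let prob_sigma_additive : semi_sigma_additive prob.
Proof.
move=> /= F mF tF mUF; rewrite /density_prob; apply: cvg_toP.
  apply: ereal_nondecreasing_is_cvgn => m n mn.
  apply: lee_sum_nneg_natr => // k _ _; apply: integral_ge0 => /= x Fkx.
  by rewrite lee_fin.
rewrite ge0_integral_bigcup//=.
- by apply/measurable_EFinP; exact: measurable_funTS.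
- by move=> x _; rewrite lee_fin.
Qed.

HB.instance Definition _ := isMeasure.Build _ _ _
  prob prob0 prob_ge0 prob_sigma_additive.

Let prob_setT : prob [set: measurableTypeR R] = 1%E.
Proof. exact: f1. Qed.

HB.instance Definition _ := @Measure_isProbability.Build _ _ R prob prob_setT.

Lemma density_prob_set1 z : prob [set z] = 0%E.
Proof. exact: integral_set1. Qed.

Lemma Rintegral_density_prob (g : R -> R) (B : R) : measurable_fun setT g ->
  (forall x, `|g x| <= B) -> \int[prob]_x g x = \int[mu]_x (g x * f x).
Proof.
move=> mg gB.
have jf : mu.-integrable setT (EFin \o f).
  apply/integrableP; split; first exact/measurable_EFinP.
  rewrite (_ : integral _ _ _ = 1%E) ?ltry// -f1.
  by apply: eq_integral => x _; rewrite /= ger0_norm.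
transitivity (\int[prob]_x (1 * g x)); first by apply: eq_Rintegral => x _; rewrite mul1r.
transitivity (\int[mu]_x (f x * g x)); last by apply: eq_Rintegral => x _; rewrite mulrC.
apply/esym; apply: (@weighted_Rintegral _ _ _ _ _ _ (measurableTypeR R) mu prob f (fun=> 1) idfun idfun) => //.
- exact: measurable_id.
- exact: measurable_id.
- move=> C mC; under [RHS]eq_integral do rewrite mul1r.
  rewrite integral_indic// setIT /density_prob [RHS]integral_mkcond.
  by apply: eq_integral => x _; rewrite restrict_EFin patch_indic.
- apply: (dominated_integrable mu measurableT _ (RintegrableZl measurableT B jf)).
    exact: measurable_funM.
  by move=> x _; rewrite normrM (ger0_norm (f0 x)) mulrC ler_wpM2r.
Qed.

End density_probability.

Lemma Rintegral_prod {R : realType} d (T : measurableType d) (P : probability T R)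
    (f : T * T -> R) (B : R) : measurable_fun setT f -> (forall z, `|f z| <= B) ->
  \int[(P \x P)%E]_z f z = \int[P]_x \int[P]_y f (x, y).
Proof.
move=> mf fB.
have jf : (P \x P)%E.-integrable setT (EFin \o f).
  exact: (@bounded_integrable _ _ _ (P \x P)%E f B).
rewrite /Rintegral -(integral12_prod_meas1 jf); congr fine.
apply: eq_integral => x _; rewrite fineK//; apply: integrable_fin_num => //.
apply: (@bounded_integrable _ _ _ P (fun y => f (x, y)) B) => //.
exact: (measurableT_comp mf).
Qed.

(** The characteristic function [exp (- (A + i B) t ^ (1 + b))], [t > 0], is
    dominated by [M t = exp (A - A t)], as [t ^ (1 + b) >= t - 1]; so the law has a
    continuous density, in particular no atoms, and is determined by the
    inversion integral. *)
Section stable_law.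
Context {R : realType}.
Local Notation mu := (@lebesgue_measure R).
Variables (A B b : R).
Hypotheses (A0 : 0 < A) (b01 : 0 < b < 1).

Let b0 : 0 < b. Proof. by case/andP : b01. Qed.
Let a0 : 0 < 1 + b. Proof. by rewrite addr_gt0. Qed.

Let M (t : R) := expR A * expR (- A * t).

Let iM : mu.-integrable `]0, +oo[ (EFin \o M).
Proof. by apply: RintegrableZl => //; exact: integrable_expRN. Qed.

Let exp_le_M (t : R) : 0 < t -> expR (- A * t `^ (1 + b)) <= M t.
Proof.
move=> t0; rewrite /M -expRD ler_expR -subr_ge0.
have -> : A + - A * t - - A * t `^ (1 + b) = A * (1 - t + t `^ (1 + b)) by ring.
apply: mulr_ge0; first exact: ltW.
have [t1|t1] := leP t 1; first by rewrite addr_ge0 ?powR_ge0// subr_ge0.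
have : t <= t `^ (1 + b) by rewrite -[leLHS]powRr1 ?(ltW t0)// ler_powR ?(ltW t1)// lerDl ltW.
by lra.
Qed.

Let re_le (t : R) : 0 < t -> `|stable_re A B b t| <= M t.
Proof.
move=> t0; rewrite normrM (ger0_norm (expR_ge0 _)) -[M t]mulr1.
by apply: ler_pM => //; [exact: exp_le_M|exact: norm_cos_le1].
Qed.

Let im_le (t : R) : 0 < t -> `|stable_im A B b t| <= M t.
Proof.
move=> t0; rewrite normrN normrM (ger0_norm (expR_ge0 _)) -[M t]mulr1.
by apply: ler_pM => //; [exact: exp_le_M|exact: norm_sin_le1].
Qed.

Let re_cont (t : R) : 0 < t -> {for t, continuous (stable_re A B b)}.
Proof.
move=> t0; have pc : {for t, continuous (fun t : R => t `^ (1 + b))} by exact: continuous_powR_pos.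
have sc (f : R -> R) c : continuous f -> {for t, continuous (fun t : R => f (c * t `^ (1 + b)))}.
  move=> cf; apply: (@continuous_comp R R R (fun t => c * t `^ (1 + b)) f); last exact: cf.
  by apply: cvgMr; exact: pc.
by apply: cvgM; [exact: (sc _ _ (@continuous_expR R))|exact: (sc _ _ (@continuous_cos R))].
Qed.

Let im_cont (t : R) : 0 < t -> {for t, continuous (stable_im A B b)}.
Proof.
move=> t0; have pc : {for t, continuous (fun t : R => t `^ (1 + b))} by exact: continuous_powR_pos.
have sc (f : R -> R) c : continuous f -> {for t, continuous (fun t : R => f (c * t `^ (1 + b)))}.
  move=> cf; apply: (@continuous_comp R R R (fun t => c * t `^ (1 + b)) f); last exact: cf.
  by apply: cvgMr; exact: pc.
by apply: cvgN; apply: cvgM; [exact: (sc _ _ (@continuous_expR R))|exact: (sc _ _ (@continuous_sin R))].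
Qed.

Let re_at0 : stable_re A B b t @[t --> 0^'+] --> (1 : R).
Proof.
have sc (f : R -> R) c : continuous f -> f (c * t `^ (1 + b)) @[t --> 0^'+] --> f 0.
  move=> cf; have h : c * t `^ (1 + b) @[t --> 0^'+] --> c * 0.
    by apply: cvgMr; exact: powR_at0.
  rewrite mulr0 in h; exact: (cvg_comp (fun t : R => c * t `^ (1 + b)) f h (cf 0)).
have h := cvgM (sc _ (- A) (@continuous_expR R)) (sc _ B (@continuous_cos R)).
by rewrite expR0 cos0 mulr1 in h; exact: h.
Qed.

Section limit.
Context d (T : measurableType d) (P : probability T R).
Variables (W : nat -> T -> R).
Hypotheses (mW : forall n, measurable_fun setT (W n))
  (Wc : forall t : R, 0 < t -> \int[P]_w cos (t * W n w) @[n --> \oo] --> stable_re A B b t)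
  (Ws : forall t : R, 0 < t -> \int[P]_w sin (t * W n w) @[n --> \oo] --> stable_im A B b t).

Lemma stable_limit : exists (dZ : measure_display) (TZ : measurableType dZ)
  (PZ : probability TZ R) (Z : {RV PZ >-> R}),
  (forall (g : R -> R) (K : R), continuous g -> (forall x, `|g x| <= K) ->
    \int[P]_w g (W n w) @[n --> \oo] --> \int[PZ]_w g (Z w)) /\
  (forall z : R, PZ (Z @^-1` [set z]) = 0%E).
Proof.
pose f x := damped_inversion (stable_re A B b) (stable_im A B b) 0 x / pi.
have f0 x : 0 <= f x.
  exact: (Levy_density_ge0 mW re_cont im_cont iM re_le im_le Wc Ws).
have cf : continuous f by exact: (Levy_density_continuous re_cont im_cont iM re_le im_le).
have f1 : (\int[mu]_x (f x)%:E = 1)%E.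
  exact: (Levy_density_mass mW re_cont im_cont iM re_le im_le Wc Ws re_at0).
have mid : @measurable_fun _ _ (measurableTypeR R) R setT idfun by exact: measurable_id.
exists _, (measurableTypeR R), (density_prob f0 cf f1), (@mfun_Sub _ _ (measurableTypeR R) R idfun (mem_set mid)).
split; last exact: density_prob_set1.
move=> g K cg gK; rewrite (Rintegral_density_prob f0 cf f1 (continuous_measurable_fun cg) gK).
exact: (Levy_continuity mW re_cont im_cont iM re_le im_le Wc Ws re_at0 cg gK).
Qed.

End limit.

(** For a constant sequence, the continuity theorem is an inversion formula. *)
Lemma stable_char_eq_law d1 d2 (T1 : measurableType d1) (T2 : measurableType d2)
    (P1 : probability T1 R) (P2 : probability T2 R) (W1 : T1 -> R) (W2 : T2 -> R) :
  measurable_fun setT W1 -> measurable_fun setT W2 ->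
  (forall t : R, 0 < t -> \int[P1]_w cos (t * W1 w) = stable_re A B b t) ->
  (forall t : R, 0 < t -> \int[P1]_w sin (t * W1 w) = stable_im A B b t) ->
  (forall t : R, 0 < t -> \int[P2]_w cos (t * W2 w) = stable_re A B b t) ->
  (forall t : R, 0 < t -> \int[P2]_w sin (t * W2 w) = stable_im A B b t) ->
  forall C, measurable C -> P1 (W1 @^-1` C) = P2 (W2 @^-1` C).
Proof.
move=> m1 m2 c1 s1 c2 s2; apply: eq_law => // g cg g1.
have lim di (Ti : measurableType di) (Pi : probability Ti R) (W : Ti -> R) :
    measurable_fun setT W ->
    (forall t : R, 0 < t -> \int[Pi]_w cos (t * W w) = stable_re A B b t) ->
    (forall t : R, 0 < t -> \int[Pi]_w sin (t * W w) = stable_im A B b t) ->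
    \int[Pi]_w g (W w) = \int[mu]_x (g x *
       (damped_inversion (stable_re A B b) (stable_im A B b) 0 x / pi)).
  move=> mW cW sW.
  have Wc (t : R) : 0 < t -> \int[Pi]_w cos (t * W w) @[n --> \oo] --> stable_re A B b t.
    by move=> t0; rewrite -cW//; exact: cvg_cst.
  have Ws (t : R) : 0 < t -> \int[Pi]_w sin (t * W w) @[n --> \oo] --> stable_im A B b t.
    by move=> t0; rewrite -sW//; exact: cvg_cst.
  have h := @Levy_continuity _ _ _ Pi (fun=> W) _ _ _ (fun=> mW) re_cont im_cont iM re_le im_le Wc Ws re_at0 g 1 cg g1.
  by apply: (cvg_unique _ _ h) => //; exact: cvg_cst.
by rewrite (lim _ _ _ _ m1 c1 s1) (lim _ _ _ _ m2 c2 s2).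
Qed.

(** With [r ^ (1 + b) = u ^ (1 + b) + v ^ (1 + b)], the variable
    [(u Z_1 + v Z_2) / r] has the characteristic function of [Z], because the
    exponent is homogeneous of degree [1 + b]: no translation is needed. *)
Lemma char_stable_rv d (T : measurableType d) (P : probability T R)
    (Z : {RV P >-> R}) :
  (forall z : R, P (Z @^-1` [set z]) = 0%E) ->
  (forall t : R, 0 < t -> \int[P]_w cos (t * Z w) = stable_re A B b t) ->
  (forall t : R, 0 < t -> \int[P]_w sin (t * Z w) = stable_im A B b t) ->
  stable_rv (1 + b) Z.
Proof.
move=> Z0 cZ sZ; split=> [z|u v u0 v0]; first by rewrite Z0 eq_sym onee_neq0.
exists 0 => C mC.
pose s := u `^ (1 + b) + v `^ (1 + b); pose r := s `^ (1 + b)^-1.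
have s0 : 0 < s by rewrite addr_gt0 ?powR_gt0.
have r0 : 0 < r by exact: powR_gt0.
have ra : r `^ (1 + b) = s.
  by rewrite /r -powRrM mulVf ?lt0r_neq0// powRr1// ltW.
pose x := u / r; pose y := v / r.
have split_pow (t : R) : 0 < t ->
    (t * x) `^ (1 + b) + (t * y) `^ (1 + b) = t `^ (1 + b).
  move=> t0; rewrite !powRM ?mulr_ge0 ?invr_ge0 ?ltW// -mulrDr -mulrDl -/s.
  by rewrite -[r^-1]powR_inv1 ?ltW// -powRrM mulN1r powRN ra divff ?mulr1// lt0r_neq0.
pose W (w : T * T) : R := x * Z w.1 + y * Z w.2.
have mZ1 : measurable_fun setT (fun w : T * T => Z w.1).
  by apply: (measurableT_comp (measurable_funPT Z)); exact: measurable_fst.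
have mZ2 : measurable_fun setT (fun w : T * T => Z w.2).
  by apply: (measurableT_comp (measurable_funPT Z)); exact: measurable_snd.
have mW : measurable_fun setT W by apply: measurable_funD; exact: measurable_funM.
have mCr : measurable ((fun z : R => r * z) @^-1` C).
  rewrite -[X in measurable X]setTI.
  by apply: (_ : measurable_fun setT (fun z : R => r * z)) => //; exact: measurable_funM.
have -> : [set w | C (r * Z w + 0)] = Z @^-1` ((fun z : R => r * z) @^-1` C).
  by apply/seteqP; split => w /=; rewrite addr0.
have -> : [set w : T * T | C (u * Z w.1 + v * Z w.2)] = W @^-1` ((fun z : R => r * z) @^-1` C).
  have e w : r * W w = u * Z w.1 + v * Z w.2.
    by rewrite /W /x /y; field; exact: lt0r_neq0.
  by apply/seteqP; split => w; rewrite /preimage/= e.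
have ic := fun t => integrable_cos_scale P t (measurable_funPT Z).
have js := fun t => integrable_sin_scale P t (measurable_funPT Z).
have x0 : 0 < x by rewrite divr_gt0.
have y0 : 0 < y by rewrite divr_gt0.
apply: (@stable_char_eq_law _ _ _ _ (P \x P)%E P W Z) => // t t0.
- rewrite (@Rintegral_prod _ _ _ P (fun w => cos (t * W w)) 1); last 2 first.
    exact: measurable_cos_scale.
    by move=> w; exact: norm_cos_le1.
  transitivity (\int[P]_w1 (stable_re A B b (t * y) * cos (t * x * Z w1) -
      stable_im A B b (t * y) * sin (t * x * Z w1))).
    apply: eq_Rintegral => w1 _.
    rewrite -(cZ _ (mulr_gt0 t0 y0)) -(sZ _ (mulr_gt0 t0 y0)).
    rewrite -!RintegralZr// -RintegralB//.
    + by apply: eq_Rintegral => w2 _; rewrite /W /= mulrDr !mulrA cosD; ring.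
    + by under eq_fun do rewrite mulrC; apply: RintegrableZl => //; exact: ic.
    + by under eq_fun do rewrite mulrC; apply: RintegrableZl => //; exact: js.
  rewrite RintegralB//; [|by apply: RintegrableZl => //; exact: ic|by apply: RintegrableZl => //; exact: js].
  rewrite !RintegralZl//.
  rewrite (cZ _ (mulr_gt0 t0 x0)) (sZ _ (mulr_gt0 t0 x0)) /stable_re /stable_im -(split_pow _ t0).
  rewrite !mulrDr expRD cosD.
  move: (expR (- A * (t * x) `^ (1 + b))) (expR (- A * (t * y) `^ (1 + b)))
    (cos (B * (t * x) `^ (1 + b))) (cos (B * (t * y) `^ (1 + b)))
    (sin (B * (t * x) `^ (1 + b))) (sin (B * (t * y) `^ (1 + b))) => *; ring.
- rewrite (@Rintegral_prod _ _ _ P (fun w => sin (t * W w)) 1); last 2 first.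
    exact: measurable_sin_scale.
    by move=> w; exact: norm_sin_le1.
  transitivity (\int[P]_w1 (stable_re A B b (t * y) * sin (t * x * Z w1) +
      stable_im A B b (t * y) * cos (t * x * Z w1))).
    apply: eq_Rintegral => w1 _.
    rewrite -(cZ _ (mulr_gt0 t0 y0)) -(sZ _ (mulr_gt0 t0 y0)).
    rewrite -!RintegralZr// -RintegralD//.
    + by apply: eq_Rintegral => w2 _; rewrite /W /= mulrDr !mulrA sinD; ring.
    + by under eq_fun do rewrite mulrC; apply: RintegrableZl => //; exact: ic.
    + by under eq_fun do rewrite mulrC; apply: RintegrableZl => //; exact: js.
  rewrite RintegralD//; [|by apply: RintegrableZl => //; exact: js|by apply: RintegrableZl => //; exact: ic].
  rewrite !RintegralZl//.
  rewrite (cZ _ (mulr_gt0 t0 x0)) (sZ _ (mulr_gt0 t0 x0)) /stable_re /stable_im -(split_pow _ t0).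
  rewrite !mulrDr expRD sinD.
  move: (expR (- A * (t * x) `^ (1 + b))) (expR (- A * (t * y) `^ (1 + b)))
    (cos (B * (t * x) `^ (1 + b))) (cos (B * (t * y) `^ (1 + b)))
    (sin (B * (t * x) `^ (1 + b))) (sin (B * (t * y) `^ (1 + b))) => *; ring.
Qed.

(** Negative arguments are reached by parity, and [0] directly. *)
Lemma stable_char_full d (T : measurableType d) (P : probability T R) (Z : T -> R) :
  measurable_fun setT Z ->
  (forall t : R, 0 < t -> \int[P]_w cos (t * Z w) = stable_re A B b t) ->
  (forall t : R, 0 < t -> \int[P]_w sin (t * Z w) = stable_im A B b t) ->
  forall t : R, \int[P]_w cos (t * Z w) = stable_re A B b `|t| /\
    \int[P]_w sin (t * Z w) = Num.sg t * stable_im A B b `|t|.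
Proof.
move=> mZ cZ sZ t; have [t0|t0|->] := ltgtP t 0.
- rewrite ltr0_norm// ltr0_sg// mulN1r -cZ ?oppr_gt0// -sZ ?oppr_gt0//; split.
    by apply: eq_Rintegral => w _; rewrite mulNr cosN.
  rewrite -mulN1r -RintegralZl//; last exact: integrable_sin_scale.
  by apply: eq_Rintegral => w _; rewrite (mulNr t) sinN mulN1r opprK.
- by rewrite gtr0_norm// gtr0_sg// mul1r cZ// sZ.
rewrite normr0 sgr0 mul0r /stable_re powR0 ?lt0r_neq0// !mulr0 expR0 cos0 mulr1; split.
  under eq_Rintegral do rewrite mul0r cos0.
  by rewrite Rintegral_cst//= probability_setT mulr1.
under eq_Rintegral do rewrite mul0r sin0.
by rewrite Rintegral_cst//= mul0r.
Qed.

End stable_law.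

(** * Moments of the process given the thinning probability *)

Section weighted_measure.
Context {R : realType} d (T : measurableType d) (m : {measure set T -> \bar R}).

Definition weighted_measure (w : T -> R) of (forall x, 0 <= w x) &
    measurable_fun setT w :=
  fun B : set T => (\int[m]_(x in B) (w x)%:E)%E.

Variables (w : T -> R) (w0 : forall x, 0 <= w x) (mw : measurable_fun setT w).

Local Notation meas := (weighted_measure w0 mw).

Let meas0 : meas set0 = 0%E.
Proof. by rewrite /weighted_measure integral_set0. Qed.

Let meas_ge0 B : (0 <= meas B)%E.
Proof. by apply: integral_ge0 => x _; rewrite lee_fin. Qed.

Let meas_sigma_additive : semi_sigma_additive meas.
Proof.
move=> /= F mF tF mUF; rewrite /weighted_measure; apply: cvg_toP.
  apply: ereal_nondecreasing_is_cvgn => i j ij.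
  apply: lee_sum_nneg_natr => // k _ _; apply: integral_ge0 => /= x Fkx.
  by rewrite lee_fin.
rewrite ge0_integral_bigcup//=.
- by apply/measurable_EFinP; exact: measurable_funTS.
- by move=> x _; rewrite lee_fin.
Qed.

HB.instance Definition _ := isMeasure.Build _ _ _
  meas meas0 meas_ge0 meas_sigma_additive.

End weighted_measure.

(** A sum over a random number of terms becomes an ordinary sum on each event
    where the number of terms is fixed. *)
Section discrete_partition.
Context {R : realType} d (T : measurableType d) (m : {measure set T -> \bar R}).
Variables (N : T -> nat) (mN : measurable_fun setT N).

Let mlevel v : measurable (N @^-1` [set v]).
Proof. by rewrite -[X in measurable X]setTI; exact: mN. Qed.

Lemma integral_by_values (F : T -> R) : measurable_fun setT F -> (forall w, 0 <= F w) ->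
  (\int[m]_w (F w)%:E = \sum_(0 <= v <oo) \int[m]_w (F w * (N w == v)%:R)%:E)%E.
Proof.
move=> mF F0.
have cover : \bigcup_v (N @^-1` [set v]) = setT.
  by apply/seteqP; split => // w _; exists (N w).
rewrite -[in LHS]cover ge0_integral_bigcup//=.
- apply: eq_eseriesr => v _; rewrite integral_mkcond; apply: eq_integral => w _.
  rewrite patchE; case: eqP => Nw; first by rewrite mem_set ?mulr1.
  by rewrite memNset ?mulr0.
- by rewrite cover; exact/measurable_EFinP.
- by move=> w _; rewrite lee_fin.
- by move=> i j _ _ [w [/= <- <-]].
Qed.

Lemma eq_integral_by_values (F G : T -> R) :
  measurable_fun setT F -> (forall w, 0 <= F w) ->
  measurable_fun setT G -> (forall w, 0 <= G w) ->
  (forall v, (\int[m]_w (F w * (N w == v)%:R)%:E = \int[m]_w (G w * (N w == v)%:R)%:E)%E) ->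
  (\int[m]_w (F w)%:E = \int[m]_w (G w)%:E)%E.
Proof.
move=> mF F0 mG G0 FG; rewrite !integral_by_values//.
by apply: eq_eseriesr => v _.
Qed.

Lemma measurable_level v : measurable_fun setT (fun w => (N w == v)%:R : R).
Proof.
rewrite (_ : (fun w => _) = \1_(N @^-1` [set v])); first exact: measurable_indic.
apply/funext => w; rewrite indicE; congr (nat_of_bool _)%:R.
by apply/eqP/idP => [Nw|]; rewrite inE.
Qed.

End discrete_partition.

Lemma measurable_truncn {R : realType} : measurable_fun setT (fun x : R => Num.truncn x).
Proof.
move=> _ B _; rewrite setTI.
rewrite (_ : _ @^-1` B = \bigcup_(v in B) [set x | Num.truncn x = v]); last first.
  by apply/seteqP; split => x => [Bx|[v Bv /= ->//]]; exists (Num.truncn x).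
apply: bigcup_measurable => -[|v] _.
  rewrite (_ : [set _ | _] = `]-oo, 1[%classic); first exact: measurable_itv.
  apply/seteqP; split => x /=; rewrite in_itv/=.
    by move=> x0; have := truncnS_gt x; rewrite x0.
  by move=> x1; apply/truncn0Pn; rewrite -ltNge.
rewrite (_ : [set _ | _] = `[v.+1%:R, v.+2%:R[%classic); first exact: measurable_itv.
apply/seteqP; split => x /=; rewrite in_itv/=; last exact: truncn_def.
move=> xv; have x0 : 0 <= x.
  rewrite leNgt; apply/negP => x0; move: xv.
  by rewrite (truncn0Pn x _)// -ltNge (lt_trans x0).
by have := truncn_itv x0; rewrite xv.
Qed.

Section poisson_moments.
Context {R : realType}.
Variables (r : R) (r0 : 0 < r).

Let pmf_ge0 k : 0 <= poisson_pmf r k. Proof. exact: poisson_pmf_ge0. Qed.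

Lemma poisson_mass : (\sum_(0 <= k <oo) (poisson_pmf r k)%:E = 1)%E.
Proof.
have : poisson_prob r 0 setT = 1%E :> \bar R := probability_setT _.
by rewrite /poisson_prob r0 nneseries_esumT// => *; rewrite lee_fin.
Qed.

Lemma poisson_pmfS k : k.+1%:R * poisson_pmf r k.+1 = r * poisson_pmf r k.
Proof.
rewrite /poisson_pmf r0 factS natrM exprS; field.
by rewrite pnatr_eq0 -lt0n fact_gt0/= addrC natr1 pnatr_eq0.
Qed.

(** The identity [k * pmf k = r * pmf k.-1] moves a factor [k] into a shift; the
    first two moments are obtained by iterating it. *)
Lemma poisson_shift (f : nat -> R) : (forall k, 0 <= f k) ->
  (\sum_(0 <= k <oo) (f k * k%:R * poisson_pmf r k)%:E =
   r%:E * \sum_(0 <= k <oo) (f k.+1 * poisson_pmf r k)%:E)%E.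
Proof.
move=> f0; rewrite nneseries_recl//; last by move=> k _; rewrite lee_fin !mulr_ge0.
rewrite mulr0 mul0r add0e -nneseries_addn//; last by move=> k; rewrite lee_fin !mulr_ge0.
rewrite -nneseriesZl//; last by move=> k _; rewrite lee_fin mulr_ge0.
apply: eq_eseriesr => k _; rewrite -EFinM addn1; congr EFin.
by rewrite -mulrA poisson_pmfS; ring.
Qed.

Lemma poisson_mean : (\sum_(0 <= k <oo) (k%:R * poisson_pmf r k)%:E = r%:E)%E.
Proof.
have := poisson_shift (fun=> ler01).
under eq_eseriesr do rewrite mul1r.
by under [in RHS]eq_eseriesr do rewrite mul1r; rewrite poisson_mass mule1.
Qed.

Lemma poisson_second_moment :
  (\sum_(0 <= k <oo) (k%:R ^+ 2 * poisson_pmf r k)%:E = (r ^+ 2 + r)%:E)%E.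
Proof.
have := poisson_shift (fun k => ler0n R k).
under eq_eseriesr do rewrite -expr2.
move=> ->; under eq_eseriesr do rewrite -natr1 mulrDl mul1r EFinD.
rewrite nneseriesD//; try by move=> k _; rewrite lee_fin ?mulr_ge0.
by rewrite poisson_mean poisson_mass -EFinD -EFinM mulrDr mulr1 expr2.
Qed.

End poisson_moments.

(** Moments are computed forward in time.  The sets in [others i] form a
    pi-system generating the sigma-algebra of [alpha] and of all the inputs other
    than the one with index [i]; conditional independence of finite families
    extends to it, so that an input may be integrated out against any function of
    [alpha] and of the other inputs.  No conditional expectation is formed: every
    statement carries a nonnegative weight [W] measurable for that
    sigma-algebra. *)
Section inar_moments.
Context {R : realType} d0 (T0 : measurableType d0) (P0 : probability T0 R).
Variables (lambda : R) (alpha : {RV P0 >-> R}) (X0 : {RV P0 >-> nat})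
  (xi : nat -> nat -> {RV P0 >-> nat}) (eps : nat -> {RV P0 >-> nat}).
Hypotheses (lambda0 : 0 < lambda)
  (inputs : randomized_inar_inputs lambda alpha X0 xi eps).

Local Notation I := (option (nat + nat * nat)).
Local Notation Y := (inar_inputs X0 xi eps).

Let alpha01 w : 0 < alpha w < 1. Proof. by case: inputs. Qed.

Definition input_pmf (i : I) (a : R) (v : nat) : R :=
  match i with
  | None => poisson_pmf (lambda / (1 - a)) v
  | Some (inl _) => poisson_pmf lambda v
  | Some (inr _) => if v == 1%N then a else if v == 0%N then 1 - a else 0
  end.

Let malpha : measurable_fun setT alpha := measurable_funPT alpha.
Let mY i : measurable_fun setT (Y i) := measurable_funPT (Y i).

Let mpreY i (B : set nat) : measurable (Y i @^-1` B).
Proof. by rewrite -[X in measurable X]setTI; exact: mY. Qed.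

Let mprea (B : set R) : measurable B -> measurable (alpha @^-1` B).
Proof. by move=> mB; rewrite -[X in measurable X]setTI; exact: malpha. Qed.

Lemma input_pmf_ge0 i w v : 0 <= input_pmf i (alpha w) v.
Proof.
have /andP[a0 a1] := alpha01 w.
case: i => [[k|[k j]]|] /=; [exact: poisson_pmf_ge0| |exact: poisson_pmf_ge0].
by case: ifP => // _; [exact: ltW|case: ifP => // _; rewrite subr_ge0 ltW].
Qed.

(** The values [0] and [1] already carry the total mass. *)
Let xi_large k j v : (1 < v)%N -> P0 (xi k j @^-1` [set v]) = 0%E.
Proof.
move=> v1; have [_ _ hxi _ _] := inputs; have [[_ h1] [_ h0]] := hxi k j.
have := h1 setT measurableT; have := h0 setT measurableT.
rewrite preimage_setT !setIT => e0 e1.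
have e01 : (P0 (xi k j @^-1` [set 1%N]) + P0 (xi k j @^-1` [set 0%N]) = 1)%E.
  rewrite e0 e1 -ge0_integralD//.
  - under eq_integral do rewrite -EFinD addrC subrK.
    transitivity (1%E * P0 setT)%E; first exact: integral_cst.
    by rewrite mul1e; exact: probability_setT.
  - by move=> w _; rewrite lee_fin; case/andP : (alpha01 w) => /ltW.
  - exact/measurable_EFinP.
  - by move=> w _; rewrite lee_fin subr_ge0; case/andP : (alpha01 w) => _ /ltW.
  - by apply/measurable_EFinP; exact: measurable_funB.
have mx u : measurable (xi k j @^-1` [set u]).
  by rewrite -[X in measurable X]setTI; exact: (measurable_funPT (xi k j)).
pose D := xi k j @^-1` [set 1%N] `|` xi k j @^-1` [set 0%N].
have mD : measurable D by exact: measurableU.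
have PD : P0 D = 1%E.
  rewrite measureU//; apply/seteqP; split => // w [/= -> ].
  by [].
apply/eqP; rewrite -measure_le0; apply: (@le_trans _ _ (P0 (~` D))).
  apply: le_measure; rewrite ?inE//; first exact: measurableC.
  move=> w /= xv; rewrite /D/= => -[]; rewrite /= xv => h.
    by move: v1; rewrite h.
  by move: v1; rewrite h.
by rewrite probability_setC// PD subee.
Qed.

Lemma input_cond_prob i v : is_cond_prob alpha (Y i @^-1` [set v]) (fun a => input_pmf i a v).
Proof.
have [_ _ hxi heps hX0] := inputs.
case: i => [[k|[k j]]|]; [exact: heps| |exact: hX0].
have [h1 h0] := hxi k j.
case: v => [|[|v]]; [exact: h0|exact: h1|].
split; first exact: measurable_cst.
move=> B mB; rewrite [RHS](_ : _ = 0%E); last by rewrite /= integral0.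
apply/eqP; rewrite -measure_le0 -(@xi_large k j v.+2)//.
apply: le_measure; rewrite ?inE//.
- apply: measurableI; last exact: mprea.
  exact: (mpreY (Some (inr (k, j)))).
- exact: (mpreY (Some (inr (k, j)))).
Qed.

Let mpmf i v : measurable_fun setT (fun a => input_pmf i a v).
Proof. by have [] := input_cond_prob i v. Qed.

Definition others (i : I) (E : set T0) : Prop :=
  exists (B : set R) (s : seq I) (v : I -> nat), [/\ measurable B, i \notin s &
    E = alpha @^-1` B `&` [set w | forall j, j \in s -> Y j w = v j]].

Local Notation T_ i := (g_sigma_algebraType (others i)).

Let big_setI (s : seq I) (v : I -> nat) :
  \big[setI/setT]_(j <- s) (Y j @^-1` [set v j]) = [set w | forall j, j \in s -> Y j w = v j].
Proof.
apply/seteqP; split => w; rewrite -bigcap_seq.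
  by move=> h j js; exact: h.
by move=> h j js; exact: h.
Qed.

Let mset (s : seq I) (v : I -> nat) : measurable [set w | forall j, j \in s -> Y j w = v j].
Proof. by rewrite -big_setI; apply: bigsetI_measurable => j _; exact: mpreY. Qed.

Let others_measurable i : others i `<=` measurable.
Proof. by move=> E [B [s [v [mB _ ->]]]]; apply: measurableI => //; exact: mprea. Qed.

(** Two prescriptions of the same input either agree or define the empty event,
    which is prescribed by an empty set of values of [alpha]. *)
Let others_setI i : setI_closed (others i).
Proof.
move=> _ _ [B [s [v [mB si ->]]]] [B' [s' [v' [mB' s'i ->]]]].
have [[j [js js' vj]]|h] := pselect (exists j, [/\ j \in s, j \in s' & v j <> v' j]).
  exists set0, [::], v; split=> //; apply/seteqP; split => // w.
    by move=> [[_ h] [_ h']]; case: vj; rewrite -h// h'.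
  by move=> [].
exists (B `&` B'), (s ++ s'), (fun j => if j \in s then v j else v' j); split.
- exact: measurableI.
- by rewrite mem_cat negb_or si.
apply/seteqP; split => w.
  move=> [[/= Bw h1] [B'w h2]]; split=> //= j; rewrite mem_cat.
  by case: ifP => [js _|_ /= js]; [exact: h1|exact: h2].
move=> [/= [Bw B'w] h1]; split; split=> //= j js.
  by have := h1 j; rewrite mem_cat js; exact.
have := h1 j; rewrite mem_cat js orbT => /(_ isT) ->; case: ifP => // js'.
by apply: contrapT => vj; apply: h; exists j.
Qed.

Let others_setT i : others i setT.
Proof.
exists setT, [::], (fun=> 0%N); split=> //.
by apply/seteqP; split.
Qed.

Let others_indep i v E : others i E ->
  P0 (Y i @^-1` [set v] `&` E) = (\int[P0]_(w in E) (input_pmf i (alpha w) v)%:E)%E.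
Proof.
move=> [B [s [u [mB si ->]]]].
pose s' := undup s; have us' : uniq s' by exact: undup_uniq.
have si' : i \notin s' by rewrite mem_undup.
pose u' j := if j == i then v else u j.
have [_ ci _ _ _] := inputs.
have cs : is_cond_prob alpha (\big[setI/setT]_(j <- s') (Y j @^-1` [set u' j]))
    (fun a => \prod_(j <- s') input_pmf j a (u' j)).
  by apply: ci => // j _; exact: input_cond_prob.
have cis : is_cond_prob alpha (\big[setI/setT]_(j <- i :: s') (Y j @^-1` [set u' j]))
    (fun a => \prod_(j <- i :: s') input_pmf j a (u' j)).
  by apply: ci => [|j _]; [rewrite /= si'|exact: input_cond_prob].
have Es : [set w | forall j, j \in s -> Y j w = u j] =
    \big[setI/setT]_(j <- s') (Y j @^-1` [set u' j]).
  rewrite big_setI; apply/seteqP; split => w h j js.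
    rewrite /u'; case: eqP => [ji|_]; first by move: si'; rewrite -ji js.
    by apply: h; rewrite -mem_undup.
  have := h j; rewrite mem_undup => /(_ js); rewrite /u'; case: eqP => // ji.
  by move: si; rewrite -ji js.
rewrite Es; set S := \big[setI/setT]_(j <- s') _ in cs *.
have mS : measurable S by apply: bigsetI_measurable => j _; exact: mpreY.
have u'i : u' i = v by rewrite /u' eqxx.
transitivity (\int[P0]_(w in alpha @^-1` B) (\prod_(j <- i :: s') input_pmf j (alpha w) (u' j))%:E)%E.
  rewrite -(cis.2 B mB) big_cons u'i -/S; congr (P0 _).
  by rewrite [alpha @^-1` B `&` S]setIC setIA.
pose f (a : R) : R := \1_B a * `|input_pmf i a v|.
pose g (a : R) : R := \prod_(j <- s') input_pmf j a (u' j).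
have g0 w : 0 <= g (alpha w) by apply: prodr_ge0 => j _; exact: input_pmf_ge0.
have mg : measurable_fun setT g.
  rewrite /g; elim: (s') => [|j t IH].
    by under eq_fun do rewrite big_nil; exact: measurable_cst.
  by under eq_fun do rewrite big_cons; apply: measurable_funM.
have mf : measurable_fun setT f.
  by apply: measurable_funM; [exact: measurable_indic|exact: measurableT_comp].
have f0 a : 0 <= f a by rewrite mulr_ge0// indicE.
transitivity (\int[P0]_w (\1_S w * f (alpha w))%:E)%E; last first.
  rewrite [RHS]integral_mkcond; apply: eq_integral => w _.
  rewrite patchE /f ger0_norm ?input_pmf_ge0// !indicE.
  have -> : (w \in alpha @^-1` B `&` S) = (w \in S) && (alpha w \in B).
    by rewrite in_setI andbC; congr (_ && _); apply/idP/idP; rewrite !inE.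
  by case: (w \in S); case: (alpha w \in B); rewrite /= ?mul1r ?mul0r.
rewrite (@weighted_ge0_integral _ _ _ _ _ _ _ P0 P0 (\1_S) (fun w => g (alpha w)) alpha alpha)//.
- rewrite [LHS]integral_mkcond; apply: eq_integral => w _.
  rewrite patchE /f ger0_norm ?input_pmf_ge0// !indicE big_cons u'i -/(g (alpha w)).
  have -> : (w \in alpha @^-1` B) = (alpha w \in B) by apply/idP/idP; rewrite !inE.
  by case: (alpha w \in B); rewrite /= ?mul1r ?mul0r ?mulr0// mulrC.
- exact: measurableT_comp.
- move=> C mC; transitivity (P0 (S `&` alpha @^-1` C)).
    rewrite -[X in _ = P0 X]setIT -integral_indic//; last by apply: measurableI => //; exact: mprea.
    by apply: eq_integral => w _; rewrite indicI.
  rewrite cs.2// [LHS]integral_mkcond; apply: eq_integral => w _; rewrite patchE indicE.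
  have -> : (w \in alpha @^-1` C) = (alpha w \in C) by apply/idP/idP; rewrite !inE.
  by case: (alpha w \in C); rewrite ?mulr1 ?mulr0.
Qed.

Let sub_others i (E : set T0) : (others i).-sigma.-measurable (E : set (T_ i)) -> measurable E.
Proof.
move=> h; apply: (smallest_sub (@sigma_algebra_measurable _ T0) (@others_measurable i)).
exact: h.
Qed.

Let mid i : @measurable_fun _ _ T0 (T_ i) setT idfun.
Proof.
move=> _ B mB; rewrite setTI preimage_id; exact: (@sub_others i B mB).
Qed.

Lemma past_measurable i (W : T_ i -> R) :
  measurable_fun setT W -> measurable_fun setT (W : T0 -> R).
Proof. by move=> mW _ B mB; have := mW measurableT B mB; rewrite !setTI; exact: (@sub_others i). Qed.

(** Both sides define finite measures on the sigma-algebra generated by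
    [others i], equal on that pi-system. *)
Lemma input_given_others i v (W : T_ i -> R) :
  measurable_fun setT W -> (forall w, 0 <= W w) ->
  (\int[P0]_w (W w * (Y i w == v)%:R)%:E = \int[P0]_w (W w * input_pmf i (alpha w) v)%:E)%E.
Proof.
move=> mW W0.
have mp : measurable_fun setT (fun w => input_pmf i (alpha w) v).
  exact: (measurableT_comp (mpmf i v)).
have p0 w := input_pmf_ge0 i w v.
under eq_integral do rewrite mulrC; under [RHS]eq_integral do rewrite mulrC.
apply: (@weighted_ge0_integral _ _ _ _ _ _ (T_ i) P0 P0 (fun w => (Y i w == v)%:R)
  (fun w => input_pmf i (alpha w) v) idfun idfun) => //.
- exact: measurable_level.
move=> E mE.
have mE0 : measurable (E : set T0) by exact: (@sub_others i E mE).
pose ind w : R := (Y i w == v)%:R.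
have ind0 w : 0 <= ind w by [].
have mind : measurable_fun setT ind by exact: measurable_level.
have toE (F : T0 -> R) : (\int[P0]_w (F w * \1_E w)%:E = \int[P0]_(w in E) (F w)%:E)%E.
  rewrite [RHS]integral_mkcond; apply: eq_integral => w _.
  by rewrite patchE indicE; case: (w \in E); rewrite ?mulr1 ?mulr0.
rewrite !toE.
apply: (@g_sigma_algebra_measure_unique _ R T0 (others i) (@others_measurable i) (fun=> setT) (fun=> @others_setT i) _
  (weighted_measure P0 ind0 mind) (weighted_measure P0 p0 mp) (@others_setI i) _ _ E mE).
- by rewrite bigcup_const//; exists 0%N.
- move=> A oA; have mA := others_measurable oA.
  rewrite /= /weighted_measure -(others_indep v oA) -integral_indic//.
  apply: eq_integral => w _; rewrite indicE; congr (nat_of_bool _)%:R%:E.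
  by apply/eqP/idP => [Yw|]; rewrite inE.
- move=> _; apply: (integrable_lty (mu := P0)) => //.
  apply: (@bounded_integrable _ _ _ P0 ind 1) => // w.
  by rewrite /ind; case: eqP; rewrite ?normr1 ?normr0.
Qed.

Lemma input_moment i (f : nat -> R) (m : R -> R) (W : T_ i -> R) :
  measurable_fun setT W -> (forall w, 0 <= W w) -> (forall v, 0 <= f v) ->
  (forall w, \sum_(0 <= v <oo) (f v * input_pmf i (alpha w) v)%:E = (m (alpha w))%:E)%E ->
  (\int[P0]_w (W w * f (Y i w))%:E = \int[P0]_w (W w * m (alpha w))%:E)%E.
Proof.
move=> mW W0 f0 fm.
have mW0 : measurable_fun setT (W : T0 -> R) := past_measurable mW.
rewrite (integral_by_values P0 (mY i)); last 2 first.
- apply: measurable_funM => //.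
  by apply: (@measurableT_comp _ _ _ _ _ _ (fun v : nat => f v)).
- by move=> w; rewrite mulr_ge0.
transitivity (\sum_(0 <= v <oo) \int[P0]_w (f v * W w * input_pmf i (alpha w) v)%:E)%E.
  apply: eq_eseriesr => v _.
  rewrite -(@input_given_others i v (fun w => f v * W w)); last 2 first.
  - exact: measurable_funM.
  - by move=> w; rewrite mulr_ge0.
  apply: eq_integral => w _; congr EFin; case: eqP => [->|_]; last by rewrite !mulr0.
  by rewrite (mulrC (W w)).
rewrite -integral_nneseries//.
- apply: eq_integral => w _; rewrite EFinM -fm -nneseriesZl//.
  + by apply: eq_eseriesr => v _; rewrite -EFinM; congr EFin; ring.
  + by move=> v _; rewrite lee_fin mulr_ge0// input_pmf_ge0.
- move=> v; apply/measurable_EFinP; apply: measurable_funM; first exact: measurable_funM.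
  exact: (measurableT_comp (mpmf i v)).
- by move=> v w _; rewrite lee_fin !mulr_ge0// input_pmf_ge0.
Qed.

Let bernoulli_series k j w (f : nat -> R) : (forall v, 0 <= f v) ->
  (\sum_(0 <= v <oo) (f v * input_pmf (Some (inr (k, j))) (alpha w) v)%:E =
   (f 0%N * (1 - alpha w) + f 1%N * alpha w)%:E)%E.
Proof.
move=> f0; have p0 := input_pmf_ge0 (Some (inr (k, j))) w.
rewrite nneseries_recl//; last by move=> v _; rewrite lee_fin mulr_ge0.
rewrite -nneseries_addn//; last by move=> v; rewrite lee_fin mulr_ge0.
rewrite nneseries_recl//; last by move=> v _; rewrite lee_fin mulr_ge0.
rewrite -nneseries_addn//; last by move=> v; rewrite lee_fin mulr_ge0.
rewrite eseries0 ?adde0//.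
by move=> v _ _; rewrite !addn1 /= mulr0.
Qed.

Section past.
Variable k : nat.

(** The inputs that enter the process at the step from time [k] to time
    [k.+1]. *)
Definition fresh (i : I) : bool :=
  match i with
  | None => false
  | Some (inl k') => k' == k
  | Some (inr (k', _)) => k' == k
  end.

Let measurable_others i j : j != i -> @measurable_fun _ _ (T_ i) nat setT (Y j).
Proof.
move=> ji _ B _; rewrite setTI.
rewrite (_ : _ @^-1` B = \bigcup_(v in B) (Y j @^-1` [set v])); last first.
  by apply/seteqP; split => w => [Bw|[v Bv /= ->//]]; exists (Y j w).
apply: bigcup_measurable => v _; apply: sub_sigma_algebra.
exists setT, [:: j], (fun=> v); split=> //; first by rewrite inE eq_sym.
apply/seteqP; split => w /= => [<-|[_ h]]; last by apply: h; rewrite inE.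
by split=> // j'; rewrite inE => /eqP ->.
Qed.

Lemma measurable_alpha_others i : @measurable_fun _ _ (T_ i) R setT alpha.
Proof.
move=> _ B mB; rewrite setTI; apply: sub_sigma_algebra.
exists B, [::], (fun=> 0%N); split=> //.
by apply/seteqP; split => w //= [].
Qed.

Let measurable_random_sum d' (T' : measurableType d') (N : T' -> nat)
    (x_ : nat -> T' -> nat) : measurable_fun setT N ->
  (forall j, measurable_fun setT (x_ j)) ->
  measurable_fun setT (fun w => \sum_(j < N w) x_ j w)%N.
Proof.
move=> mN mx _ B _; rewrite setTI.
have ms n : measurable_fun setT (fun w => \sum_(j < n) x_ j w)%N.
  elim: n => [|n IH]; first by under eq_fun do rewrite big_ord0; exact: measurable_cst.
  by under eq_fun do rewrite big_ord_recr; apply: measurable_fun_addn.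
rewrite (_ : _ @^-1` B = \bigcup_n (N @^-1` [set n] `&` (fun w => \sum_(j < n) x_ j w)%N @^-1` B)).
  apply: bigcupT_measurable => n; apply: measurableI.
    by rewrite -[X in measurable X]setTI; exact: mN.
  by rewrite -[X in measurable X]setTI; exact: ms.
by apply/seteqP; split => w => [Bw|[n _ /= [<-]//]]; exists (N w).
Qed.

Lemma inar_past l i : (l <= k)%N -> fresh i ->
  @measurable_fun _ _ (T_ i) nat setT (inar X0 xi eps l).
Proof.
move=> + fi; elim: l => [_|l IH lk].
  by apply: (measurable_others (j := None)); case: i fi => //= -[].
apply: measurable_fun_addn.
  apply: (@measurable_random_sum _ (T_ i) (inar X0 xi eps l) (fun j => xi l j)).
    exact: IH (ltnW lk).
  move=> j; apply: (measurable_others (j := Some (inr (l, j)))).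
  clear IH; case: i fi => [[k'|[k' j']]|]//= /eqP ->.
  by apply/eqP => -[lk' _]; move: lk; rewrite lk' ltnn.
apply: (measurable_others (j := Some (inl l))).
clear IH; case: i fi => [[k'|[k' j']]|]//= /eqP ->.
by apply/eqP => -[lk']; move: lk; rewrite lk' ltnn.
Qed.

(** Measurability is required input by input, because each fresh input is
    integrated out against all the others. *)
Definition past (W : T0 -> R) : Prop :=
  forall i, fresh i -> @measurable_fun _ _ (T_ i) R setT W.

Lemma past_alpha (h : R -> R) : measurable_fun setT h -> past (fun w => h (alpha w)).
Proof. by move=> mh i _; apply: (measurableT_comp mh); exact: measurable_alpha_others. Qed.

Lemma past_inar l (f : nat -> R) : (l <= k)%N -> past (fun w => f (inar X0 xi eps l w)).
Proof.
move=> lk i fi; apply: (@measurableT_comp _ _ _ _ _ _ (fun v : nat => f v)) => //.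
exact: inar_past.
Qed.

Lemma pastM W1 W2 : past W1 -> past W2 -> past (fun w => W1 w * W2 w).
Proof. by move=> p1 p2 i fi; apply: measurable_funM; [exact: p1|exact: p2]. Qed.

Let mean (f : T0 -> R) : \bar R := (\int[P0]_w (f w)%:E)%E.

Let meanD (f g : T0 -> R) : measurable_fun setT f -> (forall w, 0 <= f w) ->
  measurable_fun setT g -> (forall w, 0 <= g w) ->
  (mean (fun w => (f w + g w)%R) = mean f + mean g)%E.
Proof.
move=> mf f0 mg g0; rewrite -ge0_integralD//;
  by [move=> w _; rewrite lee_fin|exact/measurable_EFinP].
Qed.

Let past0 W : past W -> measurable_fun setT W.
Proof. by move=> pW; apply: (@past_measurable (Some (inl k))); apply: pW => /=. Qed.

(** The thinning of a population of deterministic size [x]. *)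
Let bin (x : nat) (w : T0) : R := \sum_(j < x) (xi k j w)%:R.

Let bin_ge0 x w : 0 <= bin x w. Proof. by apply: sumr_ge0. Qed.

Let nat_measurable d' (T' : measurableType d') (N : T' -> nat) :
  measurable_fun setT N -> measurable_fun setT (fun w => (N w)%:R : R).
Proof. by move=> mN; apply: (@measurableT_comp _ _ _ _ _ _ (fun v : nat => v%:R : R)). Qed.

Let bin_others x i : fresh i -> (forall j, (j < x)%N -> Some (inr (k, j)) != i) ->
  @measurable_fun _ _ (T_ i) R setT (bin x).
Proof.
move=> fi xi_i; apply: (@measurable_sum _ (T_ i)) => j.
by apply: nat_measurable; apply: (measurable_others (j := Some (inr (k, j : nat)))); exact: xi_i.
Qed.

Let mbin x : measurable_fun setT (bin x).
Proof. by apply: measurable_sum => j; apply: nat_measurable. Qed.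

Let alpha_ge0 w : 0 <= alpha w. Proof. by case/andP : (alpha01 w) => /ltW. Qed.
Let onem_alpha_ge0 w : 0 <= 1 - alpha w.
Proof. by rewrite subr_ge0; case/andP : (alpha01 w) => _ /ltW. Qed.

Let past_alphaM W : past W -> past (fun w => W w * alpha w).
Proof. by move=> pW; apply: pastM => //; apply: (@past_alpha idfun); exact: measurable_id. Qed.

Let xi_mean j W : @measurable_fun _ _ (T_ (Some (inr (k, j)))) R setT W -> (forall w, 0 <= W w) ->
  mean (fun w => W w * (xi k j w)%:R) = mean (fun w => W w * alpha w).
Proof.
move=> mW W0; apply: (@input_moment (Some (inr (k, j))) (fun v => v%:R) idfun) => // w.
by rewrite bernoulli_series// mul0r mul1r add0r.
Qed.

Let xi_square j W : @measurable_fun _ _ (T_ (Some (inr (k, j)))) R setT W -> (forall w, 0 <= W w) ->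
  mean (fun w => W w * (xi k j w)%:R ^+ 2) = mean (fun w => W w * alpha w).
Proof.
move=> mW W0; apply: (@input_moment (Some (inr (k, j))) (fun v => v%:R ^+ 2) idfun) => // w.
by rewrite bernoulli_series// expr0n/= mul0r expr1n mul1r add0r.
Qed.

Let eps_mean W : @measurable_fun _ _ (T_ (Some (inl k))) R setT W -> (forall w, 0 <= W w) ->
  mean (fun w => W w * (eps k w)%:R) = mean (fun w => W w * lambda).
Proof.
move=> mW W0; apply: (@input_moment (Some (inl k)) (fun v => v%:R) (fun=> lambda)) => // w.
exact: poisson_mean.
Qed.

Let eps_square W : @measurable_fun _ _ (T_ (Some (inl k))) R setT W -> (forall w, 0 <= W w) ->
  mean (fun w => W w * (eps k w)%:R ^+ 2) = mean (fun w => W w * (lambda ^+ 2 + lambda)).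
Proof.
move=> mW W0; apply: (@input_moment (Some (inl k)) (fun v => v%:R ^+ 2) (fun=> lambda ^+ 2 + lambda)) => // w.
exact: poisson_second_moment.
Qed.

Let bin_mean x W : past W -> (forall w, 0 <= W w) ->
  mean (fun w => W w * bin x w) = mean (fun w => W w * (x%:R * alpha w)).
Proof.
move=> pW W0; have mW := past0 pW; elim: x => [|x IH].
  by apply: eq_integral => w _; rewrite /bin big_ord0 mul0r mulr0.
transitivity (mean (fun w => (W w * bin x w)%R) + mean (fun w => (W w * (xi k x w)%:R)%R))%E.
  rewrite -meanD//.
  - by apply: eq_integral => w _; rewrite /bin big_ord_recr/= mulrDr.
  - exact: measurable_funM.
  - by move=> w; rewrite mulr_ge0.
  - by apply: measurable_funM => //; exact: nat_measurable.
  - by move=> w; rewrite mulr_ge0.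
rewrite IH xi_mean//; last by apply: pW => /=.
rewrite -meanD//.
- by apply: eq_integral => w _; congr EFin; rewrite -natr1; ring.
- by apply: measurable_funM => //; exact: measurable_funM.
- by move=> w; rewrite !mulr_ge0.
- exact: measurable_funM.
- by move=> w; rewrite mulr_ge0.
Qed.

(** By induction on the size of the population: the square of the new term
    contributes its mean, and the cross term the product of two means. *)
Let bin_square x W : past W -> (forall w, 0 <= W w) ->
  mean (fun w => W w * bin x w ^+ 2) =
  mean (fun w => W w * ((x%:R * alpha w) ^+ 2 + x%:R * (alpha w * (1 - alpha w)))).
Proof.
move=> pW W0; have mW := past0 pW; elim: x => [|x IH].
  by apply: eq_integral => w _; rewrite /bin big_ord0 !mul0r expr0n/= addr0.
have mo : measurable_fun setT (fun w => 1 - alpha w) by exact: measurable_funB.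
have ma2 : measurable_fun setT (fun w => alpha w * (1 - alpha w)) by exact: measurable_funM.
have mb2 : measurable_fun setT (fun w => bin x w ^+ 2) by exact: measurable_funX.
have mx : measurable_fun setT (fun w => (xi k x w)%:R : R) by exact: nat_measurable.
have m1 : measurable_fun setT (fun w => W w * bin x w ^+ 2) by exact: measurable_funM.
have m2 : measurable_fun setT (fun w => 2 * W w * bin x w * (xi k x w)%:R).
  by apply: measurable_funM => //; apply: measurable_funM => //; exact: measurable_funM.
have m3 : measurable_fun setT (fun w => W w * (xi k x w)%:R ^+ 2).
  by apply: measurable_funM => //; exact: measurable_funX.
transitivity (mean (fun w => (W w * bin x w ^+ 2)%R) +
   (mean (fun w => (2 * W w * bin x w * (xi k x w)%:R)%R) +
    mean (fun w => (W w * (xi k x w)%:R ^+ 2)%R)))%E.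
  rewrite -!meanD//; try by move=> w; rewrite ?addr_ge0 ?mulr_ge0 ?sqr_ge0.
  - by apply: eq_integral => w _; congr EFin; rewrite /bin big_ord_recr/=; ring.
  - exact: measurable_funD.
rewrite IH xi_square//; last by apply: pW => /=.
rewrite xi_mean; last 2 first.
- apply: measurable_funM; last by apply: bin_others => [/=|j jx]; [|apply/eqP => -[jx']; rewrite jx' ltnn in jx].
  by apply: measurable_funM => //; apply: pW => /=.
- by move=> w; rewrite !mulr_ge0.
have -> : mean (fun w => 2 * W w * bin x w * alpha w) =
    mean (fun w => (W w * alpha w * 2) * (x%:R * alpha w)).
  rewrite -bin_mean.
  - by apply: eq_integral => w _; congr EFin; ring.
  - by apply: pastM; [exact: past_alphaM|exact: (@past_alpha (fun=> 2))].
  - by move=> w; rewrite !mulr_ge0.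
have n1 : measurable_fun setT (fun w => W w * alpha w * 2 * (x%:R * alpha w)).
  by apply: measurable_funM; [apply: measurable_funM => //|]; exact: measurable_funM.
have n2 : measurable_fun setT (fun w => W w * alpha w) by exact: measurable_funM.
rewrite -!meanD//; try by move=> w; rewrite ?addr_ge0 ?mulr_ge0 ?sqr_ge0 ?addr_ge0 ?mulr_ge0.
- by apply: eq_integral => w _; congr EFin; rewrite -natr1; ring.
- apply: measurable_funM => //; apply: measurable_funD; last exact: measurable_funM.
  by apply: measurable_funX; exact: measurable_funM.
- exact: measurable_funD.
Qed.

Local Notation X := (inar X0 xi eps).

Lemma measurable_inar_past : measurable_fun setT (X k).
Proof.
move=> _ B mB; rewrite setTI; apply: (@sub_others (Some (inl k))).
have := @inar_past k (Some (inl k)) (leqnn k) (eqxx k) measurableT B mB.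
by rewrite setTI.
Qed.

Let past_level W x : past W -> past (fun w => W w * (X k w == x)%:R).
Proof.
move=> pW; apply: pastM => //.
exact: (@past_inar k (fun v => (v == x)%:R)).
Qed.

Let inarS w : (X k.+1 w)%:R = bin (X k w) w + (eps k w)%:R :> R.
Proof. by rewrite [X k.+1 w]/= natrD natr_sum. Qed.

Let mX : measurable_fun setT (fun w => (X k w)%:R : R).
Proof. by apply: nat_measurable; exact: measurable_inar_past. Qed.

Let mXS : measurable_fun setT (fun w => (X k.+1 w)%:R : R).
Proof.
apply: nat_measurable; apply: measurable_fun_addn; last exact: (mY (Some (inl k))).
apply: (@measurable_random_sum _ T0 (X k) (fun j => xi k j)).
  exact: measurable_inar_past.
by move=> j; exact: (mY (Some (inr (k, j)))).
Qed.

(** On the event [X k = x], which belongs to the past, the thinning has the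
    deterministic size [x]. *)
Lemma inar_step_mean W : past W -> (forall w, 0 <= W w) ->
  mean (fun w => W w * (X k.+1 w)%:R) = mean (fun w => W w * (alpha w * (X k w)%:R + lambda)).
Proof.
move=> pW W0; have mW := past0 pW; have l0 := ltW lambda0.
apply: (eq_integral_by_values measurable_inar_past).
- exact: measurable_funM.
- by move=> w; rewrite mulr_ge0.
- by apply: measurable_funM => //; apply: measurable_funD => //; exact: measurable_funM.
- by move=> w; rewrite mulr_ge0// addr_ge0// mulr_ge0.
move=> x; pose U w := W w * (X k w == x)%:R.
have pU : past U by exact: past_level.
have mU := past0 pU; have U0 w : 0 <= U w by rewrite mulr_ge0.
transitivity (mean (fun w => (U w * bin x w)%R) + mean (fun w => (U w * (eps k w)%:R)%R))%E.
  rewrite -meanD//.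
  - apply: eq_integral => w _; congr EFin; rewrite /U inarS.
    by case: eqP => [->|_]; rewrite ?mulr1 ?mulrDr// !(mulr0, mul0r) addr0.
  - exact: measurable_funM.
  - by move=> w; rewrite mulr_ge0.
  - by apply: measurable_funM => //; exact: nat_measurable.
  - by move=> w; rewrite mulr_ge0.
rewrite bin_mean// eps_mean//; last by apply: pU => /=.
rewrite -meanD//.
- apply: eq_integral => w _; congr EFin; rewrite /U.
  by case: eqP => [->|_]; rewrite ?mulr1 ?mulrDr// ?(mulrC x%:R)// !(mulr0, mul0r) addr0.
- by apply: measurable_funM => //; exact: measurable_funM.
- by move=> w; rewrite !mulr_ge0.
- exact: measurable_funM.
- by move=> w; rewrite mulr_ge0.
Qed.

Lemma inar_step_square W : past W -> (forall w, 0 <= W w) ->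
  mean (fun w => W w * (X k.+1 w)%:R ^+ 2) =
  mean (fun w => W w * ((alpha w * (X k w)%:R + lambda) ^+ 2 +
    alpha w * (1 - alpha w) * (X k w)%:R + lambda)).
Proof.
move=> pW W0; have mW := past0 pW; have l0 := ltW lambda0.
have mo : measurable_fun setT (fun w => 1 - alpha w) by exact: measurable_funB.
have ma2 : measurable_fun setT (fun w => alpha w * (1 - alpha w)) by exact: measurable_funM.
have me : measurable_fun setT (fun w => (eps k w)%:R : R) by exact: nat_measurable.
apply: (eq_integral_by_values measurable_inar_past).
- by apply: measurable_funM => //; exact: measurable_funX.
- by move=> w; rewrite mulr_ge0// sqr_ge0.
- apply: measurable_funM => //; apply: measurable_funD => //; apply: measurable_funD.
    by apply: measurable_funX; apply: measurable_funD => //; exact: measurable_funM.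
  exact: measurable_funM.
- by move=> w; rewrite mulr_ge0// !addr_ge0// ?sqr_ge0// !mulr_ge0.
move=> x; pose U w := W w * (X k w == x)%:R.
have pU : past U by exact: past_level.
have mU := past0 pU; have U0 w : 0 <= U w by rewrite mulr_ge0.
have m1 : measurable_fun setT (fun w => U w * bin x w ^+ 2).
  by apply: measurable_funM => //; exact: measurable_funX.
have m2 : measurable_fun setT (fun w => 2 * U w * bin x w * (eps k w)%:R).
  by apply: measurable_funM => //; apply: measurable_funM => //; exact: measurable_funM.
have m3 : measurable_fun setT (fun w => U w * (eps k w)%:R ^+ 2).
  by apply: measurable_funM => //; exact: measurable_funX.
transitivity (mean (fun w => (U w * bin x w ^+ 2)%R) +
   (mean (fun w => (2 * U w * bin x w * (eps k w)%:R)%R) +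
    mean (fun w => (U w * (eps k w)%:R ^+ 2)%R)))%E.
  rewrite -!meanD//; try by move=> w; rewrite ?addr_ge0 ?mulr_ge0 ?sqr_ge0.
  - apply: eq_integral => w _; congr EFin; rewrite /U inarS.
    case: eqP => [->|_]; last by rewrite !(mulr0, mul0r, addr0).
    by rewrite !mulr1; move: (bin x w) ((eps k w)%:R) => y e; ring.
  - exact: measurable_funD.
rewrite bin_square// eps_square//; last by apply: pU => /=.
rewrite eps_mean; last 2 first.
- apply: measurable_funM; last by apply: bin_others => [/=|j _]; [|apply/eqP].
  by apply: measurable_funM => //; apply: pU => /=.
- by move=> w; rewrite !mulr_ge0.
have -> : mean (fun w => 2 * U w * bin x w * lambda) =
    mean (fun w => (U w * (2 * lambda)) * (x%:R * alpha w)).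
  rewrite -bin_mean.
  - by apply: eq_integral => w _; congr EFin; ring.
  - by apply: pastM => //; exact: (@past_alpha (fun=> 2 * lambda)).
  - by move=> w; rewrite !mulr_ge0.
have n1 : measurable_fun setT (fun w => U w * (2 * lambda) * (x%:R * alpha w)).
  by apply: measurable_funM; exact: measurable_funM.
have n2 : measurable_fun setT (fun w => U w * (lambda ^+ 2 + lambda)) by exact: measurable_funM.
have ll : 0 <= lambda ^+ 2 + lambda by rewrite addr_ge0// sqr_ge0.
rewrite -!meanD//; try by move=> w; rewrite ?addr_ge0 ?mulr_ge0 ?sqr_ge0 ?addr_ge0 ?mulr_ge0.
- apply: eq_integral => w _; congr EFin; rewrite /U.
  case: eqP => [->|_]; last by rewrite !(mulr0, mul0r, addr0).
  by rewrite !mulr1; move: (x%:R : R) => y; ring.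
- apply: measurable_funM => //; apply: measurable_funD; last exact: measurable_funM.
  by apply: measurable_funX; exact: measurable_funM.
- exact: measurable_funD.
Qed.

End past.

(** The stationary mean given [alpha = a], written with a power so as to be
    measurable on the whole line. *)
Definition rate (a : R) : R := lambda * (1 - a) `^ (-1).

Lemma measurable_rate : measurable_fun setT rate.
Proof.
apply: measurable_funM => //; apply: (measurableT_comp (measurable_powR (-1))).
exact: measurable_funB.
Qed.

Lemma rateE a : a < 1 -> rate a = lambda / (1 - a).
Proof. by move=> a1; rewrite /rate powR_inv1// subr_ge0 ltW. Qed.

Lemma rate_alpha_gt0 w : 0 < rate (alpha w).
Proof.
by rewrite mulr_gt0// powR_gt0// subr_gt0; case/andP : (alpha01 w).
Qed.

Let rate_eq w : lambda = (1 - alpha w) * rate (alpha w).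
Proof.
have /andP[_ a1] := alpha01 w; rewrite rateE//; field.
by rewrite subr_eq0 gt_eqF.
Qed.

Local Notation X := (inar X0 xi eps).
Local Notation "'mean' f" := (\int[P0]_w (f%R w)%:E)%E (at level 10, f at level 8).
Local Notation V w := (rate (alpha w)).

Lemma measurable_inar k : measurable_fun setT (X k).
Proof. exact: measurable_inar_past. Qed.

Let mX k : measurable_fun setT (fun w => (X k w)%:R : R).
Proof.
by apply: (@measurableT_comp _ _ _ _ _ _ (fun v : nat => v%:R : R)) => //; exact: measurable_inar.
Qed.

Let mh (h : R -> R) : measurable_fun setT h -> measurable_fun setT (fun w => h (alpha w)).
Proof. by move=> ?; exact: measurableT_comp. Qed.

Let sumE (f g : T0 -> R) : measurable_fun setT f -> (forall w, 0 <= f w) ->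
  measurable_fun setT g -> (forall w, 0 <= g w) ->
  (\int[P0]_w (f w + g w)%:E = \int[P0]_w (f w)%:E + \int[P0]_w (g w)%:E)%E.
Proof.
move=> mf f0 mg g0; rewrite -ge0_integralD//;
  by [move=> w _; rewrite lee_fin|exact/measurable_EFinP].
Qed.

Let alpha_ge0 w : 0 <= alpha w. Proof. by case/andP : (alpha01 w) => /ltW. Qed.
Let onem_alpha_ge0 w : 0 <= 1 - alpha w.
Proof. by rewrite subr_ge0; case/andP : (alpha01 w) => _ /ltW. Qed.
Let V_ge0 w : 0 <= V w. Proof. exact/ltW/rate_alpha_gt0. Qed.

(** The recursion [v = a * v + lambda] fixes [v = rate a], so the mean given
    [alpha = a] is the same at all times.  The factor [a] is absorbed into the
    weight [h], over which the induction quantifies. *)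
Lemma inar_mean (h : R -> R) k : measurable_fun setT h -> (forall w, 0 <= h (alpha w)) ->
  (\int[P0]_w (h (alpha w) * (X k w)%:R)%:E = \int[P0]_w (h (alpha w) * V w)%:E)%E.
Proof.
have l0 := ltW lambda0; elim: k h => [|k IH] h mh0 h0.
  apply: (@input_moment None (fun v => v%:R) rate (fun w => h (alpha w))) => //.
    by apply: (measurableT_comp mh0); exact: measurable_alpha_others.
  move=> w; have /andP[_ a1] := alpha01 w; rewrite rateE//.
  by apply: poisson_mean; rewrite divr_gt0// subr_gt0.
rewrite (@inar_step_mean k (fun w => h (alpha w)))//; last exact: past_alpha.
transitivity (\int[P0]_w (h (alpha w) * alpha w * (X k w)%:R)%:E +
    \int[P0]_w (h (alpha w) * lambda)%:E)%E.
  rewrite -sumE.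
  - by apply: eq_integral => w _; rewrite mulrDr mulrA.
  - by apply: measurable_funM => //; apply: measurable_funM => //; exact: mh.
  - by move=> w; rewrite !mulr_ge0 ?powR_ge0.
  - by apply: measurable_funM => //; exact: mh.
  - by move=> w; rewrite mulr_ge0.
rewrite (IH (fun a => h a * a)); last 2 first.
- exact: measurable_funM.
- by move=> w; rewrite mulr_ge0.
rewrite -sumE.
- by apply: eq_integral => w _; congr EFin; rewrite (rate_eq w); move: (V w) => v; ring.
- apply: measurable_funM; last exact: mh measurable_rate.
  by apply: measurable_funM => //; exact: mh.
- by move=> w; rewrite !mulr_ge0 ?powR_ge0.
- by apply: measurable_funM => //; exact: mh.
- by move=> w; rewrite mulr_ge0.
Qed.

(** Thinning a Poisson variable and adding an independent Poisson variable leaves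
    the stationary Poisson law unchanged; here at the level of second moments. *)
Lemma inar_second_moment (h : R -> R) k : measurable_fun setT h ->
  (forall w, 0 <= h (alpha w)) ->
  (\int[P0]_w (h (alpha w) * (X k w)%:R ^+ 2)%:E =
   \int[P0]_w (h (alpha w) * (V w ^+ 2 + V w))%:E)%E.
Proof.
have l0 := ltW lambda0; elim: k h => [|k IH] h mh0 h0.
  apply: (@input_moment None (fun v => v%:R ^+ 2) (fun a => rate a ^+ 2 + rate a) (fun w => h (alpha w))) => //.
    by apply: (measurableT_comp mh0); exact: measurable_alpha_others.
  move=> w; have /andP[_ a1] := alpha01 w; rewrite rateE//.
  by apply: poisson_second_moment; rewrite divr_gt0// subr_gt0.
rewrite (@inar_step_square k (fun w => h (alpha w)))//; last exact: past_alpha.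
pose h1 (a : R) := h a * a ^+ 2.
pose h2 (a : R) := h a * (2 * lambda * a + a * (1 - a)).
pose h3 (a : R) := h a * (lambda ^+ 2 + lambda).
have m1 : measurable_fun setT h1 by apply: measurable_funM => //; exact: exprn_measurable.
have m2 : measurable_fun setT h2.
  apply: measurable_funM => //; apply: measurable_funD; first exact: measurable_funM.
  by apply: measurable_funM => //; exact: measurable_funB.
have m3 : measurable_fun setT h3 by exact: measurable_funM.
have p1 w : 0 <= h1 (alpha w) by rewrite mulr_ge0// sqr_ge0.
have p2 w : 0 <= h2 (alpha w) by rewrite mulr_ge0// addr_ge0// !mulr_ge0.
have p3 w : 0 <= h3 (alpha w) by rewrite mulr_ge0// addr_ge0// sqr_ge0.
transitivity (\int[P0]_w (h1 (alpha w) * (X k w)%:R ^+ 2)%:E +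
    (\int[P0]_w (h2 (alpha w) * (X k w)%:R)%:E + \int[P0]_w (h3 (alpha w))%:E))%E.
  have q2 : measurable_fun setT (fun w => h2 (alpha w) * (X k w)%:R).
    by apply: measurable_funM => //; exact: mh.
  rewrite -!sumE//.
  all: try exact: mh.
  all: try by move=> w; rewrite ?addr_ge0// mulr_ge0// sqr_ge0.
  - by apply: eq_integral => w _; congr EFin; rewrite /h1 /h2 /h3; ring.
  - by apply: measurable_funM; [exact: mh|exact: measurable_funX].
  - by apply: measurable_funD => //; exact: mh.
rewrite (IH h1)// (inar_mean _ m2)//.
have mV : measurable_fun setT (fun w => V w) by exact: mh measurable_rate.
have q2 : measurable_fun setT (fun w => h2 (alpha w) * V w).
  by apply: measurable_funM => //; exact: mh.
rewrite -!sumE//.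
all: try exact: mh.
all: try by move=> w; rewrite ?addr_ge0// mulr_ge0// ?addr_ge0// sqr_ge0.
- apply: eq_integral => w _; congr EFin; rewrite /h1 /h2 /h3.
  have -> : lambda = (1 - alpha w) * V w := rate_eq w.
  by move: (V w) => v; ring.
- apply: measurable_funM; first exact: mh.
  by apply: measurable_funD => //; exact: measurable_funX.
- by apply: measurable_funD => //; exact: mh.
Qed.

(** Each step of the lag multiplies the covariance given [alpha = a] by [a]. *)
Lemma inar_lag_moment (h : R -> R) l e : measurable_fun setT h ->
  (forall w, 0 <= h (alpha w)) ->
  (\int[P0]_w (h (alpha w) * (X l w)%:R * (X (l + e) w)%:R)%:E =
   \int[P0]_w (h (alpha w) * (V w ^+ 2 + alpha w ^+ e * V w))%:E)%E.
Proof.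
have l0 := ltW lambda0; elim: e h => [|e IH] h mh0 h0.
  have := inar_second_moment l mh0 h0; rewrite addn0 => H.
  transitivity (\int[P0]_w (h (alpha w) * (X l w)%:R ^+ 2)%:E)%E.
    by apply: eq_integral => w _; rewrite expr2 mulrA.
  by rewrite H; apply: eq_integral => w _; rewrite expr0 mul1r.
rewrite addnS (@inar_step_mean (l + e) (fun w => h (alpha w) * (X l w)%:R)); last 2 first.
- apply: pastM; first exact: past_alpha.
  by apply: (@past_inar _ _ (fun v => v%:R)); exact: leq_addr.
- by move=> w; rewrite mulr_ge0.
transitivity (\int[P0]_w (h (alpha w) * alpha w * (X l w)%:R * (X (l + e) w)%:R)%:E +
    \int[P0]_w (h (alpha w) * lambda * (X l w)%:R)%:E)%E.
  rewrite -sumE.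
  - by apply: eq_integral => w _; congr EFin; ring.
  - do 2! (apply: measurable_funM => //); apply: measurable_funM => //; exact: mh.
  - by move=> w; rewrite !mulr_ge0 ?powR_ge0.
  - by apply: measurable_funM => //; apply: measurable_funM => //; exact: mh.
  - by move=> w; rewrite !mulr_ge0 ?powR_ge0.
rewrite (IH (fun a => h a * a)); last 2 first.
- exact: measurable_funM.
- by move=> w; rewrite mulr_ge0.
rewrite (@inar_mean (fun a => h a * lambda)); last 2 first.
- exact: measurable_funM.
- by move=> w; rewrite mulr_ge0.
have mV : measurable_fun setT (fun w => V w) by exact: mh measurable_rate.
rewrite -sumE.
- apply: eq_integral => w _; congr EFin; rewrite (rate_eq w) (exprS (alpha w)).
  by move: (V w) (alpha w ^+ e) => v u; ring.
- apply: measurable_funM; first by apply: measurable_funM => //; exact: mh.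
  apply: measurable_funD; first exact: measurable_funX.
  by apply: measurable_funM => //; exact: measurable_funX.
- by move=> w; rewrite !mulr_ge0// addr_ge0 ?sqr_ge0// mulr_ge0// exprn_ge0.
- by apply: measurable_funM => //; apply: measurable_funM => //; exact: mh.
- by move=> w; rewrite !mulr_ge0 ?powR_ge0.
Qed.

Definition deviation (k : nat) (w : T0) : R := (X k w)%:R - V w.

Let mV : measurable_fun setT (fun w => V w). Proof. exact: mh measurable_rate. Qed.

Lemma measurable_deviation k : measurable_fun setT (deviation k).
Proof. exact: measurable_funB. Qed.

(** A weight [h] of [alpha] under which [V] is bounded makes all the moments
    finite, whereas [V ^ 2] itself may fail to be integrable. *)
Section bounded_weight.
Variables (h : R -> R) (K : R).
Hypotheses (mh0 : measurable_fun setT h) (h01 : forall w, 0 <= h (alpha w) <= 1)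
  (hK : forall w, h (alpha w) * V w <= K) (hK2 : forall w, h (alpha w) * V w ^+ 2 <= K).

Let h0 w : 0 <= h (alpha w). Proof. by case/andP : (h01 w). Qed.

Let fin_int (F : T0 -> R) (G : T0 -> R) (M : R) : measurable_fun setT F ->
  (forall w, 0 <= F w) -> (forall w, `|G w| <= M) ->
  (\int[P0]_w (F w)%:E = \int[P0]_w (G w)%:E)%E -> measurable_fun setT G ->
  P0.-integrable setT (EFin \o F) /\ \int[P0]_w F w = \int[P0]_w G w.
Proof.
move=> mF F0 GM FG mG; split; last by rewrite /Rintegral FG.
have iG : P0.-integrable setT (EFin \o G) by exact: (@bounded_integrable _ _ _ P0 G M).
apply/integrableP; split; first exact/measurable_EFinP.
rewrite (_ : integral _ _ _ = \int[P0]_w (F w)%:E)%E.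
  by rewrite FG; apply: (integrable_lty (mu := P0)) => //; exact: iG.
by apply: eq_integral => w _; rewrite /= ger0_norm.
Qed.

Let hVX k : P0.-integrable setT (EFin \o (fun w => h (alpha w) * V w * (X k w)%:R)) /\
  \int[P0]_w (h (alpha w) * V w * (X k w)%:R) = \int[P0]_w (h (alpha w) * V w ^+ 2).
Proof.
have mhh := mh mh0.
apply: (@fin_int _ _ K).
- by apply: measurable_funM => //; exact: measurable_funM.
- by move=> w; rewrite mulr_ge0// mulr_ge0.
- by move=> w; rewrite ger0_norm// mulr_ge0// sqr_ge0.
- rewrite (@inar_mean (fun a => h a * rate a)).
  + by apply: eq_integral => w _; rewrite expr2 mulrA.
  + by apply: measurable_funM => //; exact: measurable_rate.
  + by move=> w; rewrite mulr_ge0.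
- by apply: measurable_funM => //; exact: measurable_funX.
Qed.

Let hXX l e : P0.-integrable setT (EFin \o (fun w => h (alpha w) * (X l w)%:R * (X (l + e) w)%:R)) /\
  \int[P0]_w (h (alpha w) * (X l w)%:R * (X (l + e) w)%:R) =
  \int[P0]_w (h (alpha w) * (V w ^+ 2 + alpha w ^+ e * V w)).
Proof.
have mhh := mh mh0.
have mpow : measurable_fun setT (fun w => alpha w ^+ e) by exact: measurable_funX.
have p0 w : 0 <= alpha w ^+ e * V w by rewrite mulr_ge0// exprn_ge0.
apply: (@fin_int _ _ (K + K)).
- by apply: measurable_funM => //; exact: measurable_funM.
- by move=> w; rewrite mulr_ge0// mulr_ge0.
- move=> w; rewrite ger0_norm; last by rewrite mulr_ge0// addr_ge0// sqr_ge0.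
  rewrite mulrDr lerD// (le_trans _ (hK w))// ler_wpM2l// ler_piMl// exprn_ile1//.
  by case/andP : (alpha01 w) => _ /ltW.
- exact: inar_lag_moment.
- apply: measurable_funM => //; apply: measurable_funD; first exact: measurable_funX.
  exact: measurable_funM.
Qed.

Let hVV : P0.-integrable setT (EFin \o (fun w => h (alpha w) * V w ^+ 2)).
Proof.
apply: (@bounded_integrable _ _ _ P0 _ K).
  by apply: measurable_funM; [exact: mh|exact: measurable_funX].
by move=> w; rewrite ger0_norm// mulr_ge0// sqr_ge0.
Qed.

Let devE l m w : h (alpha w) * deviation l w * deviation m w =
  (h (alpha w) * (X l w)%:R * (X m w)%:R + h (alpha w) * V w ^+ 2) -
  (h (alpha w) * V w * (X l w)%:R + h (alpha w) * V w * (X m w)%:R).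
Proof. by rewrite /deviation; move: (V w) => v; ring. Qed.

Let dev_cov_le l e :
  P0.-integrable setT (EFin \o (fun w => h (alpha w) * deviation l w * deviation (l + e) w)) /\
  \int[P0]_w (h (alpha w) * deviation l w * deviation (l + e) w) =
  \int[P0]_w (h (alpha w) * (alpha w ^+ e * V w)).
Proof.
have [i1 e1] := hXX l e; have [i2 e2] := hVX l; have [i3 e3] := hVX (l + e).
have i12 := RintegrableD measurableT i1 hVV; have i23 := RintegrableD measurableT i2 i3.
have E : (fun w => h (alpha w) * deviation l w * deviation (l + e) w) = (fun w =>
  (h (alpha w) * (X l w)%:R * (X (l + e) w)%:R + h (alpha w) * V w ^+ 2) -
  (h (alpha w) * V w * (X l w)%:R + h (alpha w) * V w * (X (l + e) w)%:R)).
  by apply/funext => w; exact: devE.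
rewrite E; split; first exact: RintegrableB.
have RD (f g : T0 -> R) : P0.-integrable setT (EFin \o f) ->
    P0.-integrable setT (EFin \o g) ->
    \int[P0]_w (f w + g w) = \int[P0]_w f w + \int[P0]_w g w.
  by move=> jf jg; rewrite RintegralD.
rewrite RintegralB// (RD _ _ i1 hVV) (RD _ _ i2 i3) e1 e2 e3.
have i4 : P0.-integrable setT (EFin \o (fun w => h (alpha w) * (alpha w ^+ e * V w))).
  apply: (@bounded_integrable _ _ _ P0 _ K).
    apply: measurable_funM; first exact: mh.
    by apply: measurable_funM => //; exact: measurable_funX.
  move=> w; have p0 : 0 <= alpha w ^+ e * V w by rewrite mulr_ge0// exprn_ge0.
  rewrite (ger0_norm (mulr_ge0 (h0 w) p0)) (le_trans _ (hK w))// ler_wpM2l// ler_piMl// exprn_ile1//.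
  by case/andP : (alpha01 w) => _ /ltW.
under eq_Rintegral do rewrite mulrDr.
by rewrite RintegralD//; ring.
Qed.

(** The exponent is the distance between [l] and [m], one of the two truncated
    differences being [0]. *)
Lemma deviation_cov l m :
  P0.-integrable setT (EFin \o (fun w => h (alpha w) * deviation l w * deviation m w)) /\
  \int[P0]_w (h (alpha w) * deviation l w * deviation m w) =
  \int[P0]_w (h (alpha w) * (alpha w ^+ ((m - l) + (l - m)) * V w)).
Proof.
have [lm|ml] := leqP l m.
  have := dev_cov_le l (m - l); rewrite subnKC// => -[i1 ->]; split=> //.
  by rewrite (eqP lm) addn0.
have := dev_cov_le m (l - m); rewrite subnKC ?(ltnW ml)// => -[i1 e1].
have E : (fun w => h (alpha w) * deviation l w * deviation m w) =
    (fun w => h (alpha w) * deviation m w * deviation l w).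
  by apply/funext => w; rewrite mulrAC.
by rewrite E; split=> //; rewrite e1 (eqP (ltnW ml)) add0n.
Qed.

Let dev_sum (M : nat) (w : T0) : R := \sum_(1 <= k < M) deviation k w.

Let dev_sumS M w : (0 < M)%N -> dev_sum M.+1 w = dev_sum M w + deviation M w.
Proof. by move=> M0; rewrite /dev_sum big_nat_recr. Qed.

Let hVint (f : T0 -> R) (c : R) : measurable_fun setT f -> (forall w, 0 <= f w <= c) ->
  P0.-integrable setT (EFin \o (fun w => h (alpha w) * (f w * V w))).
Proof.
move=> mf f0c; apply: (@bounded_integrable _ _ _ P0 _ (c * K)).
  by apply: measurable_funM; [exact: mh|exact: measurable_funM].
move=> w; have /andP[f0 fc] := f0c w.
rewrite mulrCA normrM (ger0_norm f0) ler_pM// ger0_norm ?hK//.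
by rewrite mulr_ge0.
Qed.

Let pow_sum (m L : nat) (w : T0) : R := \sum_(1 <= l < L) alpha w ^+ ((m - l) + (l - m)).

Let mpow_sum m L : measurable_fun setT (pow_sum m L).
Proof. by apply: measurable_sum => l; exact: measurable_funX. Qed.

Let pow_le1 e w : 0 <= alpha w ^+ e <= 1.
Proof. by rewrite exprn_ge0// exprn_ile1//; case/andP : (alpha01 w) => _ /ltW. Qed.

Let pow_sum_ge0 m L w : 0 <= pow_sum m L w <= L%:R.
Proof.
apply/andP; split; first by apply: sumr_ge0 => l _; case/andP : (pow_le1 (m - l + (l - m)) w).
elim: L => [|L IH]; first by rewrite /pow_sum big_geq.
have [->|L0] := posnP L; first by rewrite /pow_sum big_geq.
rewrite /pow_sum big_nat_recr// -natr1 lerD//.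
by case/andP : (pow_le1 (m - L + (L - m)) w).
Qed.

Let cross m L :
  P0.-integrable setT (EFin \o (fun w => h (alpha w) * dev_sum L w * deviation m w)) /\
  \int[P0]_w (h (alpha w) * dev_sum L w * deviation m w) =
  \int[P0]_w (h (alpha w) * (pow_sum m L w * V w)).
Proof.
have triv L' : (L' <= 1)%N ->
    P0.-integrable setT (EFin \o (fun w => h (alpha w) * dev_sum L' w * deviation m w)) /\
    \int[P0]_w (h (alpha w) * dev_sum L' w * deviation m w) =
    \int[P0]_w (h (alpha w) * (pow_sum m L' w * V w)).
  move=> L1.
  have E1 : (fun w => h (alpha w) * dev_sum L' w * deviation m w) = (fun=> 0).
    by apply/funext => w; rewrite /dev_sum big_geq// mulr0 mul0r.
  have E2 : (fun w => h (alpha w) * (pow_sum m L' w * V w)) = (fun=> 0).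
    by apply/funext => w; rewrite /pow_sum big_geq// mul0r mulr0.
  by rewrite E1 E2; split=> //; exact: finite_measure_integrable_cst.
elim: L => [|L [i1 e1]]; first exact: triv.
have [L0|L0] := posnP L; first by rewrite L0; exact: triv.
have [i2 e2] := deviation_cov L m.
have E : (fun w => h (alpha w) * dev_sum L.+1 w * deviation m w) = (fun w =>
    h (alpha w) * dev_sum L w * deviation m w + h (alpha w) * deviation L w * deviation m w).
  by apply/funext => w; rewrite dev_sumS//; ring.
rewrite E; split; first exact: RintegrableD.
rewrite RintegralD// e1 e2 -RintegralD//.
- by apply: eq_Rintegral => w _; rewrite /pow_sum big_nat_recr//= addnC; ring.
- exact: (hVint (mpow_sum m L) (pow_sum_ge0 m L)).
- by apply: (hVint _ (pow_le1 _)); exact: measurable_funX.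
Qed.

(** A geometric series. *)
Let pow_sum_le M w : (1 - alpha w) * pow_sum M M w <= 1.
Proof.
have /andP[a0 a1] := alpha01 w.
suff h1 : (1 - alpha w) * pow_sum M M w <= alpha w by rewrite (le_trans h1)// ltW.
elim: M => [|M IH]; first by rewrite /pow_sum big_geq// mulr0 ltW.
have [->|M0] := posnP M; first by rewrite /pow_sum big_geq// mulr0 ltW.
have -> : pow_sum M.+1 M.+1 w = alpha w * (pow_sum M M w + 1).
  rewrite /pow_sum big_nat_recr// mulrDr mulr1 big_distrr/=; congr (_ + _).
    rewrite !big_seq; apply: eq_bigr => l; rewrite mem_index_iota => /andP[_ lM].
    by rewrite -exprS subSn ?(ltnW lM)// !(eqP (ltnW lM)) (eqP (leqW (ltnW lM))) !addn0.
  by rewrite subSnn (eqP (leqnSn M)) addn0 expr1.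
rewrite mulrCA -[leRHS]mulr1 ler_pM2l// mulrDr mulr1.
by move: IH; set q := (1 - _) * _ => ?; lra.
Qed.

Let hVratio w : h (alpha w) * (V w / (1 - alpha w)) <= K / lambda.
Proof.
have /andP[a0 a1] := alpha01 w; have a1' : 0 < 1 - alpha w by rewrite subr_gt0.
rewrite ler_pdivlMr//; apply: le_trans (hK2 w); rewrite le_eqVlt; apply/orP; left; apply/eqP.
rewrite [in LHS](rate_eq w); move: (V w) => v; field; exact: lt0r_neq0.
Qed.

(** The covariances decay geometrically with the lag, with sum at most
    [V / (1 - alpha) = V ^ 2 / lambda]; so the variance of a sum of [M] terms grows
    only linearly in [M]. *)
Lemma deviation_sum_square_le M :
  P0.-integrable setT (EFin \o (fun w => h (alpha w) * (\sum_(1 <= k < M.+1) deviation k w) ^+ 2)) /\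
  \int[P0]_w (h (alpha w) * (\sum_(1 <= k < M.+1) deviation k w) ^+ 2) <=
  M%:R * (2 * (K / lambda) + K).
Proof.
elim: M => [|M [i1 le1]].
  have -> : (fun w => h (alpha w) * (\sum_(1 <= k < 1) deviation k w) ^+ 2) = (fun=> 0).
    by apply/funext => w; rewrite big_geq// expr0n/= mulr0.
  split; first exact: finite_measure_integrable_cst.
  by rewrite Rintegral_cst//= !mul0r.
have [i2 e2] := cross M.+1 M.+1; have [i3 e3] := deviation_cov M.+1 M.+1.
have E : (fun w => h (alpha w) * (\sum_(1 <= k < M.+2) deviation k w) ^+ 2) = (fun w =>
    h (alpha w) * (\sum_(1 <= k < M.+1) deviation k w) ^+ 2 +
    (2 * (h (alpha w) * dev_sum M.+1 w * deviation M.+1 w) +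
     h (alpha w) * deviation M.+1 w * deviation M.+1 w)).
  by apply/funext => w; rewrite big_nat_recr//= -/(dev_sum M.+1 w); ring.
have i2' := RintegrableZl measurableT 2 i2.
have i23 := RintegrableD measurableT i2' i3.
rewrite E; split; first exact: RintegrableD.
have -> : \int[P0]_w (h (alpha w) * (\sum_(1 <= k < M.+1) deviation k w) ^+ 2 +
    (2 * (h (alpha w) * dev_sum M.+1 w * deviation M.+1 w) +
     h (alpha w) * deviation M.+1 w * deviation M.+1 w)) =
    \int[P0]_w (h (alpha w) * (\sum_(1 <= k < M.+1) deviation k w) ^+ 2) +
    (2 * \int[P0]_w (h (alpha w) * dev_sum M.+1 w * deviation M.+1 w) +
     \int[P0]_w (h (alpha w) * deviation M.+1 w * deviation M.+1 w)).
  have RD (f g : T0 -> R) : P0.-integrable setT (EFin \o f) ->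
      P0.-integrable setT (EFin \o g) ->
      \int[P0]_w (f w + g w) = \int[P0]_w f w + \int[P0]_w g w.
    by move=> jf jg; rewrite RintegralD.
  rewrite (RD _ _ i1 i23) (RD _ _ i2' i3); congr (_ + (_ + _)).
  by rewrite RintegralZl.
have -> : M.+1%:R * (2 * (K / lambda) + K) =
    M%:R * (2 * (K / lambda) + K) + (2 * (K / lambda) + K).
  by rewrite -natr1 mulrDl mul1r.
apply: lerD => //; rewrite e2 e3.
apply: lerD.
  rewrite ler_pM2l//; apply: (le_trans (ler_norm _)); apply: Rintegral_le_bound => //.
    apply: measurable_funM; first exact: mh.
    by apply: measurable_funM => //; exact: mpow_sum.
  move=> w; have /andP[a0 a1] := alpha01 w; have a1' : 0 < 1 - alpha w by rewrite subr_gt0.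
  have /andP[p0 _] := pow_sum_ge0 M.+1 M.+1 w.
  rewrite ger0_norm; last by rewrite mulr_ge0// mulr_ge0.
  apply: le_trans (hVratio w); rewrite ler_wpM2l// mulrC ler_wpM2l//.
  by rewrite -[leRHS]mul1r ler_pdivlMr// mulrC; exact: pow_sum_le.
apply: (le_trans (ler_norm _)); apply: Rintegral_le_bound.
  apply: measurable_funM; first exact: mh.
  by apply: measurable_funM => //; exact: measurable_funX.
move=> w; rewrite subnn expr0 mul1r ger0_norm// mulr_ge0//.
Qed.

Lemma deviation_square k : P0.-integrable setT (EFin \o (fun w => h (alpha w) * deviation k w ^+ 2)) /\
  \int[P0]_w (h (alpha w) * deviation k w ^+ 2) = \int[P0]_w (h (alpha w) * V w).
Proof.
have [i1 e1] := deviation_cov k k.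
have E : (fun w => h (alpha w) * deviation k w ^+ 2) =
    (fun w => h (alpha w) * deviation k w * deviation k w).
  by apply/funext => w; rewrite expr2 mulrA.
rewrite E; split=> //; rewrite e1.
by apply: eq_Rintegral => w _; rewrite subnn expr0 mul1r.
Qed.

End bounded_weight.

(** The two second moments whose difference is the variance may be infinite;
    cutting according to the integer part of [V], the weighted formula applies to
    each piece. *)
Lemma deviation_variance k :
  (\int[P0]_w (deviation k w ^+ 2)%:E = \int[P0]_w (V w)%:E)%E.
Proof.
pose N w := Num.truncn (V w).
have mtr := @measurable_truncn R.
have mN : measurable_fun setT N by exact: (measurableT_comp mtr mV).
apply: (eq_integral_by_values mN) => //.
- by apply: measurable_funX; exact: measurable_deviation.
- by move=> w; exact: sqr_ge0.
move=> v; pose h (a : R) : R := (Num.truncn (rate a) == v)%:R.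
have mh0 : measurable_fun setT h.
  by apply: measurable_level; exact: (measurableT_comp mtr measurable_rate).
have h01 w : 0 <= h (alpha w) <= 1 by rewrite /h; case: eqP; rewrite ?lexx ?ler01.
have hV w : h (alpha w) * V w <= v.+1%:R.
  rewrite /h; case: eqP => [<-|_]; last by rewrite mul0r.
  by rewrite mul1r ltW// truncnS_gt.
have hV2 w : h (alpha w) * V w ^+ 2 <= v.+1%:R ^+ 2.
  rewrite /h; case: eqP => [<-|_]; last by rewrite mul0r sqr_ge0.
  by rewrite mul1r ler_sqr ?nnegrE// ltW// truncnS_gt.
have v1 : v.+1%:R <= v.+1%:R ^+ 2 :> R by rewrite expr2 ler_peMl// ler1n.
have hV' w : h (alpha w) * V w <= v.+1%:R ^+ 2 by rewrite (le_trans (hV w)).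
have [i1 e1] := deviation_square mh0 h01 hV' hV2 k.
have i2 : P0.-integrable setT (EFin \o (fun w => h (alpha w) * V w)).
  apply: (@bounded_integrable _ _ _ P0 _ v.+1%:R).
    by apply: measurable_funM => //; exact: mh.
  by move=> w; rewrite ger0_norm// mulr_ge0//; case/andP : (h01 w).
transitivity (\int[P0]_w (h (alpha w) * deviation k w ^+ 2))%:E.
  rewrite /Rintegral fineK; last exact: integrable_fin_num i1.
  by apply: eq_integral => w _; rewrite mulrC.
rewrite e1 /Rintegral fineK; last exact: integrable_fin_num i2.
by apply: eq_integral => w _; rewrite mulrC.
Qed.

End inar_moments.

(** * A Slutsky theorem for finite-dimensional distributions *)

(** Continuous functions of a random row are measurable: the row is the limit
    of its discretisations, which take countably many values. *)
Section random_rows.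
Context {R : realType} d (T : measurableType d).

Lemma measurable_countable (K : countType) (c : T -> K) (f : K -> R) :
  (forall k, measurable (c @^-1` [set k])) -> measurable_fun setT (fun w => f (c w)).
Proof.
move=> mc; pose N w := pickle (c w).
have mN : measurable_fun setT N.
  move=> _ B _; rewrite setTI.
  rewrite (_ : _ @^-1` B = \bigcup_(n in B) (N @^-1` [set n])); last first.
    by apply/seteqP; split => w => [Bw|[n Bn /= ->//]]; exists (N w).
  apply: bigcup_measurable => n _.
  have [[w Nw]|h] := pselect (exists w, N w = n); last first.
    rewrite (_ : _ @^-1` _ = set0); first exact: measurable0.
    by apply/seteqP; split => // w Nw; apply: h; exists w.
  rewrite (_ : _ @^-1` _ = c @^-1` [set (c w)])//.
  apply/seteqP; split => u /=; rewrite -Nw /N.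
    by move/(pcan_inj pickleK).
  by move=> ->.
rewrite (_ : (fun w => f (c w)) = (fun n => if unpickle n is Some k then f k else 0) \o N).
  exact: (measurableT_comp _ mN).
by apply/funext => w; rewrite /= /N pickleK.
Qed.

Let code (n : nat) (x : R) : nat * nat :=
  (Num.truncn (n.+1%:R * x), Num.truncn (- (n.+1%:R * x))).

Let decode (n : nat) (c : nat * nat) : R := (c.1%:R - c.2%:R) / n.+1%:R.

Let decode_code n x : `|x - decode n (code n x)| <= n.+1%:R^-1.
Proof.
pose y := n.+1%:R * x.
have -> : x - decode n (code n x) =
    (y - ((Num.truncn y)%:R - (Num.truncn (- y))%:R)) / n.+1%:R.
  have xy : x = y / n.+1%:R by rewrite /y mulrC mulKf// pnatr_eq0.
  by rewrite /decode /code /= -/y {1}xy -mulrBl.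
rewrite normrM normfV [X in _ / X]ger0_norm// ler_pdivrMr// mulVf ?pnatr_eq0//.
have t0 (z : R) : z <= 0 -> Num.truncn z = 0%N.
  by move=> z0; apply/truncn0Pn; rewrite -ltNge (le_lt_trans z0).
have [y0|y0] := leP 0 y.
  have := truncn_itv y0; rewrite (t0 (- y)) ?oppr_le0// subr0 -natr1 => /andP[h1 h2].
  by rewrite ger0_norm ?subr_ge0//; lra.
have ny0 : 0 <= - y by rewrite oppr_ge0 ltW.
have := truncn_itv ny0; rewrite (t0 y (ltW y0)) sub0r opprK -natr1 => /andP[h1 h2].
by rewrite ler0_norm; lra.
Qed.

Lemma measurable_continuous_row m (v : T -> 'rV[R]_m) (g : 'rV[R]_m -> R) :
  (forall i, measurable_fun setT (fun w => v w 0 i)) -> continuous g ->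
  measurable_fun setT (fun w => g (v w)).
Proof.
move=> mv cg.
pose c n w : {ffun 'I_m -> nat * nat} := [ffun i => code n (v w 0 i)].
pose vn n w : 'rV[R]_m := \row_i decode n (code n (v w 0 i)).
apply: (measurable_fun_cvg (h := fun n w => g (vn n w))) => //.
  move=> n.
  rewrite (_ : (fun w => g (vn n w)) = fun w => (fun k : {ffun 'I_m -> nat * nat} =>
      g (\row_i decode n (k i))) (c n w)); last first.
    apply/funext => w /=; congr g; apply/rowP => i.
    by rewrite !mxE ffunE.
  apply: (@measurable_countable _ (c n) (fun k => g (\row_i decode n (k i)))) => k.
  rewrite (_ : _ @^-1` _ = \bigcap_(i in [set: 'I_m])
      (((fun w => Num.truncn (n.+1%:R * v w 0 i)) @^-1` [set (k i).1]) `&`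
       ((fun w => Num.truncn (- (n.+1%:R * v w 0 i))) @^-1` [set (k i).2]))); last first.
    apply/seteqP; split => w.
      by move=> /= <- i _; rewrite /= ffunE.
    move=> h; apply/ffunP => i; rewrite ffunE /code.
    by have [/= -> ->] := h i I; rewrite -surjective_pairing.
  apply: fin_bigcap_measurable => [|i _]; first exact: finite_finset.
  apply: measurableI.
    rewrite -[X in measurable X]setTI.
    have : measurable_fun setT (fun w => Num.truncn (n.+1%:R * v w 0 i)).
      by apply: (measurableT_comp measurable_truncn); exact: measurable_funM.
    by move=> h; exact: h.
  rewrite -[X in measurable X]setTI.
  have : measurable_fun setT (fun w => Num.truncn (- (n.+1%:R * v w 0 i))).
    apply: (measurableT_comp measurable_truncn); apply: measurableT_comp => //.
    exact: measurable_funM.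
  by move=> h; exact: h.
move=> w _; apply: (@cvg_comp _ _ _ (fun n => vn n w) g _ (nbhs (v w))); last exact: cg.
apply/cvg_ballP => e e0.
have /cvgrPdist_lt/(_ _ e0) := @cvg_harmonicS R.
apply: filterS => n; rewrite sub0r normrN ger0_norm// => ne; split=> // i j.
rewrite mxE (ord1 i) -ball_normE/=; exact: le_lt_trans (decode_code n _) ne.
Qed.

End random_rows.

Lemma Rintegral_big {R : realType} d (T : measurableType d) (P : probability T R)
    (J : Type) (s : seq J) (f : J -> T -> R) :
  (forall i, P.-integrable setT (EFin \o f i)) ->
  P.-integrable setT (EFin \o (fun w => \sum_(i <- s) f i w)) /\
  \int[P]_w (\sum_(i <- s) f i w) = \sum_(i <- s) \int[P]_w f i w.
Proof.
move=> jf; elim: s => [|i s [IH1 IH2]].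
  have -> : (fun w => \sum_(i <- [::]) f i w) = (fun=> 0).
    by apply/funext => w; rewrite big_nil.
  split; first exact: finite_measure_integrable_cst.
  by rewrite Rintegral_cst//= mul0r big_nil.
have E : (fun w => \sum_(j <- i :: s) f j w) = (fun w => f i w + \sum_(j <- s) f j w).
  by apply/funext => w; rewrite big_cons.
by rewrite E; split; [exact: RintegrableD|rewrite RintegralD// IH2 big_cons].
Qed.

Lemma Rintegral_indic_prob {R : realType} d (T : measurableType d)
    (P : probability T R) (A : set T) : measurable A ->
  P.-integrable setT (EFin \o (\1_A : T -> R)) /\ \int[P]_w \1_A w = fine (P A).
Proof.
move=> mA; split; last by rewrite /Rintegral integral_indic// setIT.
apply: (@bounded_integrable _ _ _ P _ 1); first exact: measurable_indic.
by move=> w; rewrite indicE; case: (_ \in _); rewrite ?normr1 ?normr0.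
Qed.

Lemma measurable_norm_gt {R : realType} d (T : measurableType d) (f : T -> R) e :
  measurable_fun setT f -> measurable [set w | e < `|f w|].
Proof.
move=> mf; have mn : measurable_fun setT (fun w => `|f w|) by exact: measurableT_comp.
have := mn measurableT `]e, +oo[%classic (measurable_itv _); rewrite setTI.
rewrite (_ : _ @^-1` _ = [set w | e < `|f w|])//.
by apply/seteqP; split => w /=; rewrite in_itv/= andbT.
Qed.

Lemma measurable_norm_ge {R : realType} d (T : measurableType d) (f : T -> R) e :
  measurable_fun setT f -> measurable [set w | e <= `|f w|].
Proof.
move=> mf; have mn : measurable_fun setT (fun w => `|f w|) by exact: measurableT_comp.
have := mn measurableT `[e, +oo[%classic (measurable_itv _); rewrite setTI.
rewrite (_ : _ @^-1` _ = [set w | e <= `|f w|])//.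
by apply/seteqP; split => w /=; rewrite in_itv/= andbT.
Qed.

Section Slutsky.
Context {R : realType} d d' (T : measurableType d) (T' : measurableType d')
  (P : probability T R) (Q : probability T' R).

(** Convergence to [0] in probability. *)
Definition vanishing (r_ : nat -> T -> R) : Prop :=
  forall e, 0 < e -> fine (P [set w | e <= `|r_ n w|]) @[n --> \oo] --> (0 : R).

Variables (W : nat -> T -> R) (Z : T' -> R).
Hypotheses (mW : forall n, measurable_fun setT (W n)) (mZ : measurable_fun setT Z)
  (WZ : forall (g : R -> R) (K : R), continuous g -> (forall x, `|g x| <= K) ->
    \int[P]_w g (W n w) @[n --> \oo] --> \int[Q]_w g (Z w)).

Let mcut L : measurable_fun setT (@cutoff R L).
Proof. by apply: continuous_measurable_fun; exact: continuous_cutoff. Qed.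

Let cut_bound L x : `|cutoff L x| <= 1 :> R.
Proof. by rewrite ger0_norm ?cutoff_ge0// cutoff_le1. Qed.

(** The limit law is tight, and a cut-off is a bounded continuous test function
    that compares its tails with those of [W n]. *)
Lemma law_cvg_tight e : 0 < e -> exists2 L, 0 <= L &
  \forall n \near \oo, fine (P [set w | L < `|W n w|]) <= e.
Proof.
move=> e0; have e2 : 0 < e / 2 by rewrite divr_gt0.
have lim1 : \int[Q]_w cutoff k%:R (Z w) @[k --> \oo] --> (1 : R).
  suff : \int[Q]_w cutoff k%:R (Z w) @[k --> \oo] --> \int[Q]_w (1 : R).
    by rewrite Rintegral_cst//= probability_setT mulr1.
  apply: (Rintegral_dominated_cvg Q measurableT _ (g := cst 1) _ _ _).2 => //.
  - by move=> k; apply: measurableT_comp.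
  - move=> w _; apply: cvg_near_cst.
    have /cvgryPge/(_ `|Z w|) : (k%:R : R) @[k --> \oo] --> +oo by exact: cvgr_idn.
    by apply: filterS => k; exact: cutoff1.
  - exact: finite_measure_integrable_cst.
have /cvgrPdist_lt/(_ _ e2)[k _ /(_ k (leqnn k)) hk] := lim1.
exists (k%:R + 1); first by rewrite addr_ge0.
have /cvgrPdist_lt/(_ _ e2) := WZ (@continuous_cutoff R k%:R) (cut_bound k%:R).
apply: filterS => n hn.
have mB : measurable [set w | k%:R + 1 < `|W n w|].
  exact: measurable_norm_gt.
have ic : P.-integrable setT (EFin \o (fun w => cutoff k%:R (W n w))).
  by apply: (@bounded_integrable _ _ _ P _ 1) => //; exact: measurableT_comp.
have i1 : P.-integrable setT (EFin \o (fun=> 1 : R)).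
  exact: finite_measure_integrable_cst.
apply: (@le_trans _ _ (1 - \int[P]_w cutoff k%:R (W n w))); last first.
  by move: hk hn; rewrite !ltr_norml => /andP[? ?] /andP[? ?]; lra.
have -> : fine (P [set w | k%:R + 1 < `|W n w|]) = \int[P]_w \1_[set w | k%:R + 1 < `|W n w|] w.
  by rewrite /Rintegral integral_indic// setIT.
have -> : 1 - \int[P]_w cutoff k%:R (W n w) = \int[P]_w (1 - cutoff k%:R (W n w)).
  by rewrite RintegralB// Rintegral_cst//= probability_setT mulr1.
apply: le_Rintegral => //.
- by apply: (@bounded_integrable _ _ _ P _ 1) => [|w]; [exact: measurable_indic|rewrite indicE; case: (_ \in _); rewrite ?normr1 ?normr0].
- exact: RintegrableB.
move=> w _; rewrite indicE; case: (boolP (w \in _)) => [|_]; last first.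
  by rewrite subr_ge0 cutoff_le1.
rewrite inE/= => kw; rewrite cutoff0 ?subr0//.
Qed.

(** While [W n] stays in a large ball and the perturbations are small, the row is
    close to the compact arc of the points [\row_i (a i * x)], near which [g] is
    uniformly continuous; on the remaining event, of small probability, [g] is
    bounded.  The limits of the coordinates are proportional to one variable, so
    convergence in law on the line suffices. *)
Theorem Slutsky_row m (a_ : nat -> 'I_m -> R) (a : 'I_m -> R)
    (r_ : 'I_m -> nat -> T -> R) (g : 'rV[R]_m -> R) (K : R) :
  (forall i, a_ n i @[n --> \oo] --> a i) ->
  (forall i n, measurable_fun setT (r_ i n)) -> (forall i, vanishing (r_ i)) ->
  continuous g -> (forall x, `|g x| <= K) ->
  \int[P]_w g (\row_i (a_ n i * W n w + r_ i n w)) @[n --> \oo] -->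
  \int[Q]_w g (\row_i (a i * Z w)).
Proof.
move=> aa mr rv cg gK.
have K0 : 0 <= K by rewrite (le_trans _ (gK 0)).
pose phi (x : R) : 'rV[R]_m := \row_i (a i * x).
have cphi : continuous phi.
  move=> x; apply/cvg_ballP => e e0.
  pose A := 1 + \sum_i `|a i|.
  have sA0 : 0 <= \sum_i `|a i| by exact: sumr_ge0.
  have A0 : 0 < A by rewrite ltr_pwDl.
  have aA i : `|a i| <= A.
    rewrite /A (bigD1 i)//= addrCA lerDl addr_ge0// sumr_ge0//.
  have /cvgrPdist_lt/(_ _ (divr_gt0 e0 A0)) := @cvg_id _ (nbhs x).
  apply: filterS => y xy; split=> // i j; rewrite !mxE -ball_normE/= -mulrBr normrM.
  apply: (@le_lt_trans _ _ (A * `|x - y|)); first by rewrite ler_wpM2r.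
  by rewrite mulrC -ltr_pdivlMr.
have gphi : continuous (fun x => g (phi x)).
  by move=> x; apply: (@continuous_comp R _ R phi g); [exact: cphi|exact: cg].
have lim := WZ gphi (fun x => gK (phi x)).
pose v n w : 'rV[R]_m := \row_i (a_ n i * W n w + r_ i n w).
have mgv n : measurable_fun setT (fun w => g (v n w)).
  apply: measurable_continuous_row => // i.
  have -> : (fun w => v n w 0 i) = (fun w => a_ n i * W n w + r_ i n w).
    by apply/funext => w; rewrite mxE.
  by apply: measurable_funD => //; exact: measurable_funM.
have mgp n : measurable_fun setT (fun w => g (phi (W n w))).
  exact: (measurableT_comp (continuous_measurable_fun gphi) (mW n)).
suff diff0 : \int[P]_w g (v n w) - \int[P]_w g (phi (W n w)) @[n --> \oo] --> (0 : R).
  have h := cvgD diff0 lim; rewrite add0r in h.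
  suff E : (fun n => \int[P]_w g (v n w)) = (fun n => (\int[P]_w g (v n w) -
      \int[P]_w g (phi (W n w))) + \int[P]_w g (phi (W n w))).
    by rewrite -/(v _ _) E; exact: h.
  by apply/funext => n; rewrite subrK.
apply/cvgrPdist_le => e e0.
pose e1 := e / (2 + 2 * K + 2 * K * m%:R).
have den0 : 0 < 2 + 2 * K + 2 * K * m%:R.
  have k1 : 0 <= 2 * K by rewrite mulr_ge0.
  have k2 : 0 <= 2 * K * m%:R by rewrite mulr_ge0.
  by rewrite -addrA ltr_pwDl// addr_ge0.
have e10 : 0 < e1 by rewrite divr_gt0.
have [L L0 tight] := law_cvg_tight e10.
have [r r0 hr] := uniformly_continuous_near_arc L cg cphi e10.
have r2 : 0 < r / 2 by rewrite divr_gt0.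
have small_a : \forall n \near \oo, forall i, `|a i - a_ n i| * L < r / 2.
  apply: filter_forall => i.
  have L1 : 0 < L + 1 by rewrite ltr_wpDl.
  have /cvgrPdist_lt/(_ _ (divr_gt0 r2 L1)) := aa i; apply: filterS => n.
  rewrite ltr_pdivlMr//; apply: le_lt_trans.
  by rewrite ler_wpM2l// lerDl.
have small_r : \forall n \near \oo, forall i, fine (P [set w | r / 2 <= `|r_ i n w|]) <= e1.
  apply: filter_forall => i.
  have /cvgrPdist_lt/(_ _ e10) := rv i _ r2; apply: filterS => n.
  by rewrite sub0r normrN => h; apply/ltW; apply: le_lt_trans h; exact: ler_norm.
near=> n.
have hB : fine (P [set w | L < `|W n w|]) <= e1 by near: n.
have hC1 : forall i, fine (P [set w | r / 2 <= `|r_ i n w|]) <= e1 by near: n.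
have sa : forall i, `|a i - a_ n i| * L < r / 2 by near: n.
rewrite sub0r normrN.
have iv : P.-integrable setT (EFin \o (fun w => g (v n w))).
  exact: (@bounded_integrable _ _ _ P _ K).
have ip : P.-integrable setT (EFin \o (fun w => g (phi (W n w)))).
  exact: (@bounded_integrable _ _ _ P _ K).
rewrite -RintegralB//.
pose B := [set w | L < `|W n w|]; pose C i := [set w | r / 2 <= `|r_ i n w|].
have [iB eB] := Rintegral_indic_prob P (measurable_norm_gt L (mW n)).
have iC i := (Rintegral_indic_prob P (measurable_norm_ge (r / 2) (mr i n))).1.
have eC i := (Rintegral_indic_prob P (measurable_norm_ge (r / 2) (mr i n))).2.
have [iS eS] := Rintegral_big (index_enum 'I_m) iC.
have iBS := RintegrableD measurableT iB iS.
have iKBS := RintegrableZl measurableT (2 * K) iBS.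
have ie : P.-integrable setT (EFin \o (fun=> e1)) by exact: finite_measure_integrable_cst.
pose F w := e1 + 2 * K * (\1_B w + \sum_i \1_(C i) w).
have iF : P.-integrable setT (EFin \o F) by exact: RintegrableD.
apply: (@le_trans _ _ (\int[P]_w F w)).
  apply: (Rintegral_le_dominated P) => //; first exact: measurable_funB.
  move=> w _; rewrite /F.
  have S0 : 0 <= \sum_i \1_(C i) w :> R by apply: sumr_ge0 => i _; rewrite indicE.
  have crude : `|g (v n w) - g (phi (W n w))| <= 2 * K.
    by rewrite (le_trans (ler_normB _ _))// mulr_natl mulr2n lerD.
  have [wB|wB] := leP `|W n w| L; last first.
    rewrite (le_trans crude)// [\1_B w]indicE mem_set// mulrDr mulr1.
    have : 0 <= 2 * K * \sum_i \1_(C i) w by rewrite !mulr_ge0.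
    by have := ltW e10; lra.
  have [[i wi]|wC] := pselect (exists i, C i w).
    rewrite (le_trans crude)// (bigD1 i)//= [\1_(C i) w]indicE mem_set//.
    have : 0 <= 2 * K * (\1_B w + \sum_(j < m | j != i) \1_(C j) w).
      by rewrite !mulr_ge0// addr_ge0 ?indicE// sumr_ge0// => j _; rewrite indicE.
    rewrite !mulrDr mulr1 => ?; have := ltW e10; lra.
  apply: (@le_trans _ _ e1); last first.
    by rewrite lerDl !mulr_ge0// addr_ge0// indicE.
  apply/ltW; apply: (hr _ _ wB); split=> // k i; rewrite ord1 !mxE -ball_normE/=.
  have -> : a i * W n w - (a_ n i * W n w + r_ i n w) = (a i - a_ n i) * W n w - r_ i n w.
    by ring.
  apply: (le_lt_trans (ler_normB _ _)); rewrite [ltRHS]splitr; apply: ltr_leD.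
    by apply: le_lt_trans (sa i); rewrite normrM ler_wpM2l.
  by rewrite leNgt; apply/negP => h; apply: wC; exists i; exact: ltW.
have -> : \int[P]_w F w = e1 + 2 * K * (fine (P B) + \sum_i fine (P (C i))).
  rewrite /F RintegralD// Rintegral_cst//= probability_setT mulr1; congr (_ + _).
  rewrite RintegralZl//; congr (_ * _).
  rewrite RintegralD//; congr (_ + _); first exact: eB.
  by rewrite eS; apply: eq_bigr => i _; exact: eC.
have hC : \sum_i fine (P (C i)) <= m%:R * e1.
  apply: (@le_trans _ _ (\sum_(i < m) e1)); last first.
    by rewrite sumr_const card_ord mulr_natl.
  by apply: ler_sum => i _; exact: hC1.
apply: (@le_trans _ _ (e1 + 2 * K * (e1 + m%:R * e1))).
  by rewrite lerD2l ler_wpM2l ?mulr_ge0// lerD.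
apply: (@le_trans _ _ (e1 * (2 + 2 * K + 2 * K * m%:R))).
  by rewrite -subr_ge0 (_ : _ - _ = e1) ?ltW//; ring.
by rewrite /e1 divfK// lt0r_neq0.
Unshelve. all: by end_near. Qed.

End Slutsky.

(** * Transfer to the independent copies *)

(** The generators of [trajectory_measurable]. *)
Definition path_sets {R : realType} : set (set (R * (nat -> nat))) :=
  [set C | (exists2 B : set R, measurable B & C = fst @^-1` B) \/
           (exists (k : nat) (B : set nat), C = (fun p => p.2 k) @^-1` B)].

(** A trajectory is a random element of a measurable space; the law of each copy
    is that of the model, so integrals of functions of one trajectory transfer, and
    those of products of functions of two trajectories factorize. *)
Section copies_transfer.
Context {R : realType} d0 (T0 : measurableType d0) (P0 : probability T0 R)
  d (T : measurableType d) (P : probability T R).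
Variables (alpha : T0 -> R) (X : nat -> T0 -> nat)
  (alpha_ : nat -> {RV P >-> R}) (X_ : nat -> nat -> {RV P >-> nat}).
Hypotheses (malpha : measurable_fun setT alpha) (mX : forall k, measurable_fun setT (X k))
  (copies : independent_copies P0 alpha X alpha_ X_).

Local Notation U := (g_sigma_algebraType (@path_sets R)).

Definition model_path (w : T0) : U := trajectory alpha X w.
Definition copy_path (j : nat) (w : T) : U := trajectory (alpha_ j) (fun k => X_ j k) w.

Lemma measurable_path_fst : measurable_fun setT (fun p : U => p.1 : R).
Proof.
move=> _ B mB; rewrite setTI; apply: sub_sigma_algebra; left; by exists B.
Qed.

Lemma measurable_path_snd k : measurable_fun setT (fun p : U => p.2 k : nat).
Proof.
move=> _ B mB; rewrite setTI; apply: sub_sigma_algebra; right; by exists k, B.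
Qed.

Lemma measurable_model_path : measurable_fun setT model_path.
Proof.
apply: (@measurability _ _ _ U setT _ (@path_sets R) erefl).
move=> _ [_ [[B mB ->]|[k [B ->]]] <-].
  by have := malpha measurableT mB.
by have := mX k measurableT (Y := B) => /(_ I).
Qed.

Lemma measurable_copy_path j : measurable_fun setT (copy_path j).
Proof.
apply: (@measurability _ _ _ U setT _ (@path_sets R) erefl).
move=> _ [_ [[B mB ->]|[k [B ->]]] <-].
  by have := @measurable_funPT _ _ _ _ (alpha_ j) measurableT B mB.
by have := @measurable_funPT _ _ _ _ (X_ j k) measurableT B I.
Qed.

Let copy_law j (C : set U) : measurable C ->
  P (copy_path j @^-1` C) = P0 (model_path @^-1` C).
Proof. by move=> mC; exact: copies.1. Qed.

Lemma copy_ge0_integral j (f : U -> R) : measurable_fun setT f -> (forall p, 0 <= f p) ->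
  (\int[P]_w (f (copy_path j w))%:E = \int[P0]_w (f (model_path w))%:E)%E.
Proof.
move=> mf f0.
have h := @weighted_ge0_integral _ _ _ _ _ _ U P P0 (fun=> 1) (fun=> 1) (copy_path j) model_path
  (@measurable_cst _ _ _ _ _ _) (@measurable_cst _ _ _ _ _ _) (fun=> ler01) (fun=> ler01)
  (measurable_copy_path j) measurable_model_path _ f mf f0.
under eq_integral do rewrite -[f _]mul1r; under [RHS]eq_integral do rewrite -[f _]mul1r.
apply: h => C mC.
have mp : measurable (copy_path j @^-1` C).
  by rewrite -[X in measurable X]setTI; exact: measurable_copy_path.
have mp0 : measurable (model_path @^-1` C).
  by rewrite -[X in measurable X]setTI; exact: measurable_model_path.
under eq_integral do rewrite mul1r; under [RHS]eq_integral do rewrite mul1r.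
transitivity (P (copy_path j @^-1` C)).
  by rewrite -[in RHS](setIT (copy_path j @^-1` C)) -integral_indic.
by rewrite copy_law// -[in LHS](setIT (model_path @^-1` C)) -integral_indic.
Qed.

Lemma copy_integrable j (f : U -> R) : measurable_fun setT f ->
  P0.-integrable setT (EFin \o (fun w => f (model_path w))) ->
  P.-integrable setT (EFin \o (fun w => f (copy_path j w))).
Proof.
move=> mf /integrableP[_ i0]; apply/integrableP; split.
  by apply/measurable_EFinP; apply: (measurableT_comp mf); exact: measurable_copy_path.
have := @copy_ge0_integral j (fun p => `|f p|).
by rewrite /= => -> //; exact: measurableT_comp.
Qed.

Lemma copy_Rintegral j (f : U -> R) : measurable_fun setT f ->
  P0.-integrable setT (EFin \o (fun w => f (model_path w))) ->
  \int[P]_w f (copy_path j w) = \int[P0]_w f (model_path w).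
Proof.
move=> mf i0; have i1 := copy_integrable j mf i0.
have mp : measurable_fun setT f^\+ by exact: measurable_funrpos.
have mn : measurable_fun setT f^\- by exact: measurable_funrneg.
have h di (Ti : measurableType di) (Q : probability Ti R) (phi : Ti -> U) :
    measurable_fun setT phi -> Q.-integrable setT (EFin \o (fun w => f (phi w))) ->
    \int[Q]_w f (phi w) = fine (\int[Q]_w (f^\+ (phi w))%:E) - fine (\int[Q]_w (f^\- (phi w))%:E).
  move=> mphi ii; rewrite -RintegralB//.
  - by apply: eq_Rintegral => w _; rewrite -{1}(funrposBneg f).
  - apply: (dominated_integrable Q measurableT (measurableT_comp mp mphi) (integrable_norm ii)).
    by move=> w _; rewrite /= ger0_norm ?funrpos_ge0// /funrpos ge_max ler_norm normr_ge0.
  - apply: (dominated_integrable Q measurableT (measurableT_comp mn mphi) (integrable_norm ii)).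
    by move=> w _; rewrite /= ger0_norm ?funrneg_ge0// /funrneg ge_max normr_ge0 -normrN ler_norm.
rewrite (h _ _ P _ (measurable_copy_path j) i1) (h _ _ P0 _ measurable_model_path i0).
by rewrite !(copy_ge0_integral j).
Qed.

Let mpre j (C : set U) : measurable C -> measurable (copy_path j @^-1` C).
Proof. by move=> mC; rewrite -[X in measurable X]setTI; exact: measurable_copy_path. Qed.

Let mpre0 (C : set U) : measurable C -> measurable (model_path @^-1` C).
Proof. by move=> mC; rewrite -[X in measurable X]setTI; exact: measurable_model_path. Qed.

Let copy_pair i j (C D : set U) : i != j -> measurable C -> measurable D ->
  P (copy_path i @^-1` C `&` copy_path j @^-1` D) =
  (P0 (model_path @^-1` C) * P0 (model_path @^-1` D))%E.
Proof.
move=> ij mC mD.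
have := copies.2 [:: i; j] (fun l => if l == i then C else D).
rewrite /= inE ij => /(_ isT); rewrite !big_cons !big_nil eqxx eq_sym (negbTE ij).
rewrite setIT mule1 => -> //.
  by rewrite -(copy_law i mC) -(copy_law j mD).
by move=> l _; case: ifP.
Qed.

(** The nonnegative factor [g] is the density of a measure under which the other
    copy still has the law of the model, up to the total mass; this is first
    checked for indicators in place of [f], with the roles exchanged. *)
Lemma copy_prod i j (f g : U -> R) : i != j -> measurable_fun setT f ->
  measurable_fun setT g -> (forall p, 0 <= g p) ->
  P0.-integrable setT (EFin \o (fun w => g (model_path w))) ->
  P0.-integrable setT (EFin \o (fun w => f (model_path w))) ->
  P.-integrable setT (EFin \o (fun w => g (copy_path j w) * f (copy_path i w))) ->
  \int[P]_w (g (copy_path j w) * f (copy_path i w)) =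
  (\int[P0]_w g (model_path w)) * \int[P0]_w f (model_path w).
Proof.
move=> ij mf mg g0 ig jf igf; set c := \int[P0]_w g (model_path w).
have c0 : 0 <= c by exact: Rintegral_ge0.
have mgj : measurable_fun setT (fun w => g (copy_path j w)).
  exact: (measurableT_comp mg (measurable_copy_path j)).
have ec : (\int[P0]_w (g (model_path w))%:E = c%:E)%E.
  by rewrite /c /Rintegral fineK//; exact: integrable_fin_num ig.
transitivity (\int[P0]_w (c * f (model_path w))); last first.
  by rewrite RintegralZl.
apply: (@weighted_Rintegral _ _ _ _ _ _ U P P0 (fun w => g (copy_path j w)) (fun=> c)
  (copy_path i) model_path) => //; first exact: measurable_copy_path.
  exact: measurable_model_path.
move=> C mC.
transitivity (\int[P0]_w (fine (P0 (model_path @^-1` C)) * g (model_path w))%:E)%E.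
  under eq_integral do rewrite mulrC.
  apply: (@weighted_ge0_integral _ _ _ _ _ _ U P P0 (fun w => \1_C (copy_path i w))
    (fun=> fine (P0 (model_path @^-1` C))) (copy_path j) model_path) => //.
  - by apply: (measurableT_comp _ (measurable_copy_path i)); exact: measurable_indic.
  - by move=> _; exact: fine_ge0.
  - exact: measurable_copy_path.
  - exact: measurable_model_path.
  move=> D mD.
  transitivity (P (copy_path i @^-1` C `&` copy_path j @^-1` D)).
    rewrite -[X in _ = P X]setIT -integral_indic//; last first.
      by apply: measurableI; exact: mpre.
    by apply: eq_integral => w _; rewrite indicI.
  rewrite copy_pair// -[in LHS](@fineK _ (P0 (model_path @^-1` C))) ?fin_num_measure//; last exact: mpre0.
  rewrite -[in LHS](setIT (model_path @^-1` D)) -integral_indic//; last exact: mpre0.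
  under [RHS]eq_integral do rewrite EFinM.
  have mi : measurable_fun setT (fun w => (\1_D (model_path w))%:E : \bar R).
    by apply/measurable_EFinP; apply: (measurableT_comp _ measurable_model_path); exact: measurable_indic.
  by rewrite ge0_integralZl_EFin// fine_ge0.
have mgm : measurable_fun setT (fun w => (g (model_path w))%:E).
  by apply/measurable_EFinP; exact: (measurableT_comp mg measurable_model_path).
have mC1 : measurable_fun setT (fun w => (\1_C (model_path w))%:E : \bar R).
  by apply/measurable_EFinP; apply: (measurableT_comp _ measurable_model_path); exact: measurable_indic.
have p0 : 0 <= fine (P0 (model_path @^-1` C)) by exact: fine_ge0.
transitivity ((fine (P0 (model_path @^-1` C)))%:E * c%:E)%E.
  by rewrite -ec -ge0_integralZl_EFin//= => w _; rewrite lee_fin.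
transitivity (c%:E * \int[P0]_w (\1_C (model_path w))%:E)%E; last first.
  by rewrite -ge0_integralZl_EFin.
rewrite muleC; congr (_ * _)%E.
rewrite fineK ?fin_num_measure//; last exact: mpre0.
by rewrite -[LHS](congr1 P0 (setIT (model_path @^-1` C))) -integral_indic//; exact: mpre0.
Qed.

Section orthogonality.
Variable f : U -> R.
Hypotheses (mf : measurable_fun setT f)
  (f2 : P0.-integrable setT (EFin \o (fun w => f (model_path w) ^+ 2)))
  (f_mean0 : \int[P0]_w f (model_path w) = 0).

Let mf2 : measurable_fun setT (fun p => f p ^+ 2). Proof. exact: measurable_funX. Qed.

Let le_1sq (x : R) : `|x| <= 1 + x ^+ 2.
Proof.
have [x1|x1] := leP `|x| 1; first by rewrite (le_trans x1)// lerDl sqr_ge0.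
rewrite (@le_trans _ _ (x ^+ 2))//; last by rewrite lerDr.
by rewrite -[x ^+ 2]real_normK ?num_real// expr2 ler_peMr// ltW.
Qed.

Let f1 : P0.-integrable setT (EFin \o (fun w => f (model_path w))).
Proof.
have i1 : P0.-integrable setT (EFin \o (fun=> 1 : R)) by exact: finite_measure_integrable_cst.
apply: (dominated_integrable P0 measurableT _ (RintegrableD measurableT i1 f2)).
  exact: (measurableT_comp mf measurable_model_path).
by move=> w _; exact: le_1sq.
Qed.

Let f2j j : P.-integrable setT (EFin \o (fun w => f (copy_path j w) ^+ 2)).
Proof. exact: (copy_integrable j mf2 f2). Qed.

Let prod_int i j (g h : U -> R) : measurable_fun setT g -> measurable_fun setT h ->
  (forall p, `|g p| <= `|f p|) -> (forall p, `|h p| <= `|f p|) ->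
  P.-integrable setT (EFin \o (fun w => g (copy_path j w) * h (copy_path i w))).
Proof.
move=> mg mh gf hf.
apply: (dominated_integrable P measurableT _ (RintegrableD measurableT (f2j j) (f2j i))).
  by apply: measurable_funM; [exact: (measurableT_comp mg (measurable_copy_path j))|exact: (measurableT_comp mh (measurable_copy_path i))].
move=> w _; rewrite normrM.
apply: (@le_trans _ _ (`|f (copy_path j w)| * `|f (copy_path i w)|)); first exact: ler_pM.
rewrite -[f (copy_path j w) ^+ 2]real_normK ?num_real// -[f (copy_path i w) ^+ 2]real_normK ?num_real//.
move: `|f (copy_path j w)| `|f (copy_path i w)| (normr_ge0 (f (copy_path j w))) (normr_ge0 (f (copy_path i w))) => a b a0 b0.
rewrite -subr_ge0 (_ : _ - _ = (a - b) ^+ 2 + a * b); last by ring.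
by rewrite addr_ge0 ?sqr_ge0// mulr_ge0.
Qed.

Lemma copy_orthogonal i j : i != j ->
  P.-integrable setT (EFin \o (fun w => f (copy_path j w) * f (copy_path i w))) /\
  \int[P]_w (f (copy_path j w) * f (copy_path i w)) = 0.
Proof.
move=> ij; split; first exact: prod_int.
have mp : measurable_fun setT f^\+ by exact: measurable_funrpos.
have mn : measurable_fun setT f^\- by exact: measurable_funrneg.
have pf p : `|f^\+ p| <= `|f p|.
  by rewrite ger0_norm ?funrpos_ge0// /funrpos ge_max ler_norm normr_ge0.
have nf p : `|f^\- p| <= `|f p|.
  by rewrite ger0_norm ?funrneg_ge0// /funrneg ge_max normr_ge0 -normrN ler_norm.
have ip := prod_int i j mp mf pf (fun p => lexx _).
have iN := prod_int i j mn mf nf (fun p => lexx _).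
have jp : P0.-integrable setT (EFin \o (fun w => f^\+ (model_path w))).
  apply: (dominated_integrable P0 measurableT (measurableT_comp mp measurable_model_path) (integrable_norm f1)).
  by move=> w _; exact: pf.
have jn : P0.-integrable setT (EFin \o (fun w => f^\- (model_path w))).
  apply: (dominated_integrable P0 measurableT (measurableT_comp mn measurable_model_path) (integrable_norm f1)).
  by move=> w _; exact: nf.
transitivity (\int[P]_w (f^\+ (copy_path j w) * f (copy_path i w)) -
    \int[P]_w (f^\- (copy_path j w) * f (copy_path i w))).
  by rewrite -RintegralB//; apply: eq_Rintegral => w _; rewrite -mulrBl -{1}(funrposBneg f).
rewrite (copy_prod ij mf mp (funrpos_ge0 f) jp f1 ip).
by rewrite (copy_prod ij mf mn (funrneg_ge0 f) jn f1 iN) f_mean0 !mulr0 subrr.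
Qed.

(** As [f] is centred, only the diagonal terms of the square contribute. *)
Lemma copy_sum_square N :
  P.-integrable setT (EFin \o (fun w => (\sum_(j < N) f (copy_path j w)) ^+ 2)) /\
  \int[P]_w (\sum_(j < N) f (copy_path j w)) ^+ 2 =
  N%:R * \int[P0]_w f (model_path w) ^+ 2.
Proof.
elim: N => [|N [i1 e1]].
  have -> : (fun w => (\sum_(j < 0) f (copy_path j w)) ^+ 2) = (fun=> 0).
    by apply/funext => w; rewrite big_ord0 expr0n.
  by split; [exact: finite_measure_integrable_cst|rewrite Rintegral_cst//= !mul0r].
have Nj (j : 'I_N) : N != j by rewrite neq_ltn ltn_ord orbT.
have [ic ec] := Rintegral_big (index_enum 'I_N) (fun j => (copy_orthogonal (Nj j)).1).
have i2 := RintegrableZl measurableT 2 ic.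
have i3 := RintegrableD measurableT i2 (f2j N).
have E : (fun w => (\sum_(j < N.+1) f (copy_path j w)) ^+ 2) = (fun w =>
    (\sum_(j < N) f (copy_path j w)) ^+ 2 +
    (2 * (\sum_(j < N) f (copy_path j w) * f (copy_path N w)) + f (copy_path N w) ^+ 2)).
  by apply/funext => w; rewrite big_ord_recr/= -big_distrl/=; ring.
rewrite E; split; first exact: RintegrableD.
have RD (g h : T -> R) : P.-integrable setT (EFin \o g) ->
    P.-integrable setT (EFin \o h) ->
    \int[P]_w (g w + h w) = \int[P]_w g w + \int[P]_w h w.
  by move=> jg jh; rewrite RintegralD.
rewrite (RD _ _ i1 i3) (RD _ _ i2 (f2j N)) e1.
rewrite (copy_Rintegral N mf2 f2).
have -> : N.+1%:R * \int[P0]_w f (model_path w) ^+ 2 =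
    N%:R * \int[P0]_w f (model_path w) ^+ 2 + \int[P0]_w f (model_path w) ^+ 2.
  by rewrite -natr1 [LHS]mulrDl mul1r.
rewrite (_ : \int[P]_w (2 * _) = 0) ?add0r//.
transitivity (2 * \int[P]_w (\sum_(j < N) f (copy_path j w) * f (copy_path N w))).
  by rewrite RintegralZl.
by rewrite ec big1 ?mulr0// => j _; exact: (copy_orthogonal (Nj j)).2.
Qed.

End orthogonality.

End copies_transfer.

Section vanishing_lemmas.
Context {R : realType} d (T : measurableType d) (P : probability T R).

(** The inequality of Chebyshev on the event [h = 1], when the second moment is
    finite only there. *)
Lemma square_deviation_bound (f h : T -> R) e : measurable_fun setT f -> measurable_fun setT h ->
  (forall w, h w = 0 \/ h w = 1) -> P.-integrable setT (EFin \o (fun w => h w * f w ^+ 2)) ->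
  0 < e ->
  fine (P [set w | e <= `|f w|]) <= fine (P [set w | h w = 0]) + (\int[P]_w (h w * f w ^+ 2)) / e ^+ 2.
Proof.
move=> mf mh h01 ihf e0; have e2 : 0 < e ^+ 2 by rewrite exprn_gt0.
have mA : measurable [set w | e <= `|f w|] by exact: measurable_norm_ge.
have mB : measurable [set w | h w = 0].
  by have := mh measurableT [set 0] (measurable_set1 0); rewrite setTI.
have [iA <-] := Rintegral_indic_prob P mA; have [iB <-] := Rintegral_indic_prob P mB.
have iz := RintegrableZl measurableT (e ^+ 2)^-1 ihf.
rewrite mulrC -RintegralZl// -RintegralD//; apply: le_Rintegral => //.
  exact: RintegrableD.
move=> w _; have hf0 : 0 <= (e ^+ 2)^-1 * (h w * f w ^+ 2).
  apply: mulr_ge0; first by rewrite invr_ge0 ltW.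
  by case: (h01 w) => ->; rewrite ?mul0r ?mul1r ?sqr_ge0.
rewrite [leLHS]indicE; case: (boolP (w \in _)) => [|_]; last by rewrite addr_ge0// indicE.
rewrite inE/= => ef; case: (h01 w) => hw.
  by rewrite indicE mem_set//= lerDl.
rewrite indicE memNset/=; last by rewrite hw => /eqP; rewrite oner_eq0.
rewrite add0r hw mul1r mulrC ler_pdivlMr// mul1r -[leRHS]real_normK ?num_real//.
by rewrite ler_sqr ?nnegrE// ltW.
Qed.

Lemma vanishing_scale (c : R) (r_ : nat -> T -> R) : vanishing P r_ -> vanishing P (fun n w => c * r_ n w).
Proof.
move=> rv e e0; have [->|c0] := eqVneq c 0.
  rewrite (_ : (fun n => _) = fun=> 0); first exact: cvg_cst.
  apply/funext => n; rewrite (_ : [set w | _] = set0) ?measure0//.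
  by apply/seteqP; split => // w /=; rewrite mul0r normr0 leNgt e0.
have c1 : 0 < `|c| by rewrite normr_gt0.
have := rv (e / `|c|) (divr_gt0 e0 c1).
rewrite (_ : (fun n => fine (P [set w | e <= `|c * r_ n w|])) =
  (fun n => fine (P [set w | e / `|c| <= `|r_ n w|])))//.
apply/funext => n; congr (fine (P _)); apply: eq_set => w.
by rewrite normrM mulrC -ler_pdivrMr.
Qed.

Lemma vanishing_sum (J : Type) (s : seq J) (r_ : J -> nat -> T -> R) :
  (forall i n, measurable_fun setT (r_ i n)) -> (forall i, vanishing P (r_ i)) ->
  vanishing P (fun n w => \sum_(i <- s) r_ i n w).
Proof.
move=> mr rv; elim: s => [|i s IH] e e0.
  rewrite (_ : (fun n => _) = fun=> 0); first exact: cvg_cst.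
  apply/funext => n; rewrite (_ : [set w | _] = set0) ?measure0//.
  by apply/seteqP; split => // w /=; rewrite big_nil normr0 leNgt e0.
have e2 : 0 < e / 2 by rewrite divr_gt0.
apply: (@squeeze_cvgr _ _ _ _ (fun=> 0) (fun n => fine (P [set w | e / 2 <= `|r_ i n w|]) +
   fine (P [set w | e / 2 <= `|\sum_(j <- s) r_ j n w|]))).
- apply: nearW => n; rewrite fine_ge0//=.
  have ms : measurable_fun setT (fun w => \sum_(j <- s) r_ j n w) by exact: measurable_sum.
  have m1 := measurable_norm_ge (e / 2) (mr i n); have m2 := measurable_norm_ge (e / 2) ms.
  rewrite -fineD ?fin_num_measure//; apply: fine_le; rewrite ?fin_numD ?fin_num_measure//.
    by apply: measurable_norm_ge; exact: measurable_sum.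
  apply: le_trans (measureU2 _ m1 m2); apply: le_measure; rewrite ?inE.
  + by apply: measurable_norm_ge; exact: measurable_sum.
  + exact: measurableU.
  move=> w /=; rewrite big_cons => h; have [h1|h1] := leP (e / 2) `|r_ i n w|; [by left|right].
  by have := ler_normD (r_ i n w) (\sum_(j <- s) r_ j n w); lra.
- exact: cvg_cst.
by rewrite -[X in _ --> X](addr0 0); apply: cvgD; [exact: rv|exact: IH].
Qed.

End vanishing_lemmas.

(** * The two iterated limits *)

Section limit_tools.
Context {R : realType}.

Lemma fdd_cvg_Rintegral (U : nat -> process R) (Y : process R) :
  (forall (m : nat) (t : 'I_m -> {nonneg R}) (g : 'rV[R]_m -> R) (K : R),
    continuous g -> (forall x, `|g x| <= K) ->
    \int[proc_prob (U n)]_w g (proc_vec t w) @[n --> \oo] --> \int[proc_prob Y]_w g (proc_vec t w)) ->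
  fdd_cvg U Y.
Proof.
move=> h m t g cg [M [Mr hM]].
have gK x : `|g x| <= M + 1 by apply: (hM (M + 1)) => //; rewrite ltrDl.
have E (V : process R) : ('E_(proc_prob V)[g \o proc_vec t] =
    (\int[proc_prob V]_w g (proc_vec t w))%:E)%E.
  rewrite unlock /Rintegral fineK//; apply: integrable_fin_num => //.
  apply: (@bounded_integrable _ _ _ (proc_prob V) _ (M + 1)) => //.
  apply: measurable_continuous_row => // i.
  by under eq_fun do rewrite mxE; exact: proc_measurable.
under eq_fun do rewrite E; rewrite E.
by apply: cvg_EFin; [exact: nearW|exact: h].
Qed.

Lemma truncn_ratio_cvg (t : {nonneg R}) :
  (Num.truncn (n%:R * t%:num))%:R / n%:R @[n --> \oo] --> (t%:num : R).
Proof.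
have tge (n : nat) : 0 <= n%:R * t%:num :> R by rewrite mulr_ge0.
apply: (@squeeze_cvgr _ _ _ _ (fun n => t%:num - n%:R^-1) (fun=> t%:num)).
- near=> n; have n0 : 0 < n%:R :> R by rewrite ltr0n; near: n; exists 1%N.
  rewrite ler_pdivlMr// mulrBl mulVf ?lt0r_neq0// ler_pdivrMr//.
  rewrite (mulrC t%:num n%:R) truncn_le tge andbT lerBlDr natr1.
  exact: ltW (truncnS_gt _).
- rewrite -[X in _ --> X]subr0; apply: cvgB; first exact: cvg_cst.
  by apply/gtr0_cvgV0; [exists 1%N => // n /= n0; rewrite ltr0n|exact: cvgr_idn].
- exact: cvg_cst.
Unshelve. all: by end_near. Qed.

Lemma square_integrable_sum d (T : measurableType d) (P : probability T R) (J : Type)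
    (s : seq J) (f : J -> T -> R) :
  (forall i, measurable_fun setT (f i)) ->
  (forall i, P.-integrable setT (EFin \o (fun w => f i w ^+ 2))) ->
  P.-integrable setT (EFin \o (fun w => (\sum_(i <- s) f i w) ^+ 2)).
Proof.
move=> mf f2; elim: s => [|i s IH].
  have -> : (fun w => (\sum_(i <- [::]) f i w) ^+ 2) = (fun=> 0).
    by apply/funext => w; rewrite big_nil expr0n.
  exact: finite_measure_integrable_cst.
have ms : measurable_fun setT (fun w => \sum_(j <- s) f j w) by exact: measurable_sum.
have i2 := RintegrableZl measurableT 2 (RintegrableD measurableT (f2 i) IH).
apply: (dominated_integrable P measurableT _ i2).
  by apply: measurable_funX; exact: measurable_sum.
move=> w _; rewrite big_cons ger0_norm ?sqr_ge0//.
move: (f i w) (\sum_(j <- s) _) => x y.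
by rewrite -subr_ge0 (_ : _ - _ = (x - y) ^+ 2) ?sqr_ge0//; ring.
Qed.

Lemma vanishing0 d (T : measurableType d) (P : probability T R) : vanishing P (fun _ _ => 0).
Proof.
move=> e e0; rewrite (_ : (fun n => _) = fun=> 0); first exact: cvg_cst.
apply/funext => n; rewrite (_ : [set w | _] = set0) ?measure0//.
by apply/seteqP; split => // w /=; rewrite normr0 leNgt e0.
Qed.

(** A process on a line through the origin is governed by one random slope. *)
Lemma cvg_law_line d (T : measurableType d) (P : probability T R)
    d' (T' : measurableType d') (Q : probability T' R) (W : nat -> T -> R) (Z : T' -> R)
    m (a_ : nat -> 'I_m -> R) (a : 'I_m -> R) (g : 'rV[R]_m -> R) (K : R) :
  (forall n, measurable_fun setT (W n)) -> measurable_fun setT Z ->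
  (forall (g : R -> R) (K : R), continuous g -> (forall x, `|g x| <= K) ->
    \int[P]_w g (W n w) @[n --> \oo] --> \int[Q]_w g (Z w)) ->
  (forall i, a_ n i @[n --> \oo] --> a i) -> continuous g -> (forall x, `|g x| <= K) ->
  \int[P]_w g (\row_i (a_ n i * W n w)) @[n --> \oo] --> \int[Q]_w g (\row_i (a i * Z w)).
Proof.
move=> mW mZ WZ ha cg gK.
have := Slutsky_row mW mZ WZ ha (r_ := fun _ _ _ => 0)
  (fun _ _ => measurable_cst _) (fun=> vanishing0 P) cg gK.
by apply: cvg_trans; apply: near_eq_cvg; apply: nearW => n;
  apply: eq_Rintegral => w _; congr g; apply/rowP => i; rewrite !mxE addr0.
Qed.

End limit_tools.

Lemma cexp_rotation {R : realType} (q K x : R) :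
  cexp (- q%:C * (K%:C * cexp (0 -i* x))) =
  (expR (- (q * K * cos x)) * cos (q * K * sin x)) +i*
  (expR (- (q * K * cos x)) * sin (q * K * sin x)).
Proof.
rewrite (_ : - q%:C * _ = (- (q * K * cos x)) +i* (q * K * sin x)).
  by rewrite /cexp; apply/eqP; rewrite eq_complex/= !mul0r subr0 addr0 !eqxx.
rewrite /cexp expR0 cosN sinN; apply/eqP; rewrite eq_complex/=.
by apply/andP; split; apply/eqP; ring.
Qed.

Section double_aggregation.
Context {R : realType} d0 (T0 : measurableType d0) (P0 : probability T0 R)
  d (T : measurableType d) (P : probability T R).
Variables (lambda : R) (alpha : {RV P0 >-> R}) (X0 : {RV P0 >-> nat})
  (xi : nat -> nat -> {RV P0 >-> nat}) (eps : nat -> {RV P0 >-> nat})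
  (alpha_ : nat -> {RV P >-> R}) (X_ : nat -> nat -> {RV P >-> nat})
  (b psi1 : R) (psi : R -> R).
Hypotheses (lambda0 : 0 < lambda)
  (inputs : randomized_inar_inputs lambda alpha X0 xi eps)
  (copies : independent_copies P0 alpha (inar X0 xi eps) alpha_ X_)
  (density : has_density_on01 alpha (fun x => psi x * (1 - x) `^ b))
  (psi_lim : psi x @[x --> 1^'-] --> psi1)
  (psi1_gt0 : 0 < psi1) (b01 : 0 < b < 1).

Local Notation mu := (@lebesgue_measure R).
Local Notation U := (g_sigma_algebraType (@path_sets R)).
Local Notation X := (inar X0 xi eps).

Let b0 : 0 < b. Proof. by case/andP : b01. Qed.
Let b1 : b < 1. Proof. by case/andP : b01. Qed.
Let a0 : 0 < 1 + b. Proof. by rewrite addr_gt0. Qed.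
Let malpha : measurable_fun setT alpha. Proof. exact: measurable_funPT. Qed.
Let alpha01 w : 0 < alpha w < 1. Proof. by case: inputs. Qed.
Let mX k : measurable_fun setT (X k). Proof. exact: measurable_inar. Qed.

Definition mean_rate : R := \int[P0]_w rate lambda (alpha w).

(** The part of the normalized sums that survives in both limits: given the
    thinning probabilities [alpha_ j], the copy with index [j] fluctuates around
    its own stationary mean, the rate of [alpha_ j], which differs from the overall
    mean by a heavy-tailed amount. *)
Definition normalized_rates (N : nat) (w : T) : R :=
  N%:R `^ (- (1 + b)^-1) * \sum_(j < N) (rate lambda (alpha_ j w) - mean_rate).

Definition stable_A : R :=
  psi1 / (1 + b) * lambda `^ (1 + b) * (Gamma (1 - b) / b * sin (b * (pi / 2))).
Definition stable_B : R :=
  psi1 / (1 + b) * lambda `^ (1 + b) * (Gamma (1 - b) / b * cos (b * (pi / 2))).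

Lemma stable_A_gt0 : 0 < stable_A.
Proof.
have Gb := Gamma_onem_gt0 b01; have p0 := pi_gt0 R.
rewrite /stable_A; apply: mulr_gt0.
  by apply: mulr_gt0; [exact: divr_gt0|exact: powR_gt0].
apply: mulr_gt0; first exact: divr_gt0.
apply: sin_gt0_pi; rewrite mulr_gt0 ?divr_gt0//=.
apply: (@le_lt_trans _ _ (1 * (pi / 2))); last by lra.
by rewrite ler_wpM2r ?divr_ge0 ?ltW.
Qed.

Let rate_rvE w : rate_rv alpha lambda w = rate lambda (alpha w).
Proof. by rewrite /rate_rv rateE//; case/andP : (alpha01 w). Qed.

Lemma rate_integrable : P0.-integrable setT (EFin \o (fun w => rate lambda (alpha w))).
Proof.
have [mdens dens_ge0 dens] := density.
have := rate_rv_integrable malpha alpha01 b01 lambda0 psi1_gt0 mdens dens_ge0 dens psi_lim.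
by rewrite (_ : rate_rv alpha lambda = fun w => rate lambda (alpha w))//; exact/funext.
Qed.

(** The constants of the stable law: those of the tail of the rates, times the
    Fourier integrals of the power [v `^ (-1 - b)]. *)
Let rate_cos (u_ : nat -> R) : (forall n, 0 < u_ n) -> u_ n @[n --> \oo] --> 0 ->
  u_ n `^ (- (1 + b)) * (1 - \int[P0]_w cos (u_ n * rate lambda (alpha w))) @[n --> \oo]
    --> stable_A.
Proof.
have [mdens dens_ge0 dens] := density; move=> u0 ucvg.
have E n := onem_cos_rate malpha alpha01 b01 lambda0 psi1_gt0 mdens dens_ge0 dens psi_lim (u0 n).
under eq_fun => n.
  rewrite (_ : 1 - _ = \int[mu]_(v in `]0, +oo[) (sin v * upper_tail P0 alpha (u_ n * lambda / v))).
    over.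
  by rewrite -E; congr (1 - _); apply: eq_Rintegral => w _; rewrite rate_rvE.
rewrite /stable_A -sin_integral//.
apply: (tail_integral_cvg malpha b01 lambda0 psi1_gt0 mdens dens_ge0 dens psi_lim) => //.
  exact: continuous_sin.
move=> v v0; apply: (@le_trans _ _ (Num.min 1 v)).
  by rewrite le_min norm_sin_le1/= (le_trans (norm_sin_le v))// gtr0_norm.
by rewrite ler_peMl ?ler1n// le_min ler01 ltW.
Qed.

Let rate_sin (u_ : nat -> R) : (forall n, 0 < u_ n) -> u_ n @[n --> \oo] --> 0 ->
  u_ n `^ (- (1 + b)) * (u_ n * (\int[P0]_w rate lambda (alpha w)) -
    \int[P0]_w sin (u_ n * rate lambda (alpha w))) @[n --> \oo] --> stable_B.
Proof.
have [mdens dens_ge0 dens] := density; move=> u0 ucvg.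
have E n := sub_sin_rate malpha alpha01 b01 lambda0 psi1_gt0 mdens dens_ge0 dens psi_lim (u0 n).
under eq_fun => n.
  rewrite (_ : u_ n * _ - _ = \int[mu]_(v in `]0, +oo[) ((1 - cos v) * upper_tail P0 alpha (u_ n * lambda / v))).
    over.
  rewrite -E; congr (u_ n * _ - _); apply: eq_Rintegral => w _; rewrite rate_rvE//.
rewrite /stable_B -onem_cos_integral//.
apply: (tail_integral_cvg malpha b01 lambda0 psi1_gt0 mdens dens_ge0 dens psi_lim (f := fun v => 1 - cos v)) => //.
  move=> v; apply: cvgB; [exact: cvg_cst|exact: continuous_cos].
move=> v v0; rewrite ger0_norm ?subr_ge0 ?cos_le1//.
have [v1|v1] := leP 1 v.
  by have := cos_geN1 v; lra.
by have := onem_cos_le v; rewrite gtr0_norm//; lra.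
Qed.

Let Y_ j (w : T) : R := rate lambda (alpha_ j w) - mean_rate.
Let Y0 (w : T0) : R := rate lambda (alpha w) - mean_rate.

Let mY_ j : measurable_fun setT (Y_ j).
Proof.
apply: measurable_funB => //; apply: (measurableT_comp (measurable_rate lambda)).
exact: measurable_funPT.
Qed.

Let mY0 : measurable_fun setT Y0.
Proof. by apply: measurable_funB => //; apply: (measurableT_comp (measurable_rate lambda)). Qed.

(** Events on the rates are events on the trajectories. *)
Let indep_rates (s : seq nat) (B : nat -> set R) : uniq s -> (forall i, measurable (B i)) ->
  (P (\big[setI/setT]_(i <- s) (Y_ i @^-1` B i)) = \prod_(i <- s) P0 (Y0 @^-1` B i))%E.
Proof.
move=> us mB; pose f (p : U) := rate lambda p.1 - mean_rate.
have mf : measurable_fun setT f.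
  apply: measurable_funB => //; apply: (measurableT_comp (measurable_rate lambda)).
  exact: measurable_path_fst.
have mC i : measurable (f @^-1` B i) by rewrite -[X in measurable X]setTI; exact: mf.
have -> : P (\big[setI/setT]_(i <- s) (Y_ i @^-1` B i)) =
    (\prod_(i <- s) P (copy_path alpha_ X_ i @^-1` (f @^-1` B i)))%E.
  by apply: (copies.2 s (fun i => f @^-1` B i)) => // i _; exact: mC.
by apply: eq_bigr => i _; apply: copies.1; exact: mC.
Qed.

Lemma measurable_normalized_rates N : measurable_fun setT (normalized_rates N).
Proof.
by apply: measurable_funM => //; apply: measurable_sum => j; exact: mY_.
Qed.

Lemma normalized_rates_char t : 0 < t ->
  \int[P]_w cos (t * normalized_rates N w) @[N --> \oo] --> stable_re stable_A stable_B b t /\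
  \int[P]_w sin (t * normalized_rates N w) @[N --> \oo] --> stable_im stable_A stable_B b t.
Proof.
move=> t0.
have := @char_pow_cvg _ _ _ P0 (fun w => rate lambda (alpha w)) stable_A stable_B b
  (measurableT_comp (measurable_rate lambda) malpha)
  (fun w => ltW (rate_alpha_gt0 lambda0 inputs w)) b01 stable_A_gt0 rate_cos rate_sin t t0.
have E N : (\int[P]_w cos (t * normalized_rates N w) +i* \int[P]_w sin (t * normalized_rates N w)) =
   (\int[P0]_w cos (t * N%:R `^ (- (1 + b)^-1) * (rate lambda (alpha w) - mean_rate)) +i*
    \int[P0]_w sin (t * N%:R `^ (- (1 + b)^-1) * (rate lambda (alpha w) - mean_rate))) ^+ N.
  rewrite -(char_sum mY0 mY_ indep_rates).
  by congr (_ +i* _); apply: eq_Rintegral => w _; rewrite mulrA.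
by cbv zeta; under eq_fun do rewrite -E; under [X in _ /\ (X @ _ --> _)]eq_fun do rewrite -E.
Qed.

(** The angle [pi * (1 + b) / 2] of the statement is a quarter turn more than the
    angle [b * (pi / 2)] of the Fourier integrals, which absorbs the sign of
    [- b]. *)
Lemma stable_char_fun dZ (TZ : measurableType dZ) (PZ : probability TZ R) (Z : {RV PZ >-> R}) :
  (forall t : R, 0 < t -> \int[PZ]_w cos (t * Z w) = stable_re stable_A stable_B b t) ->
  (forall t : R, 0 < t -> \int[PZ]_w sin (t * Z w) = stable_im stable_A stable_B b t) ->
  forall theta : R, char_fun Z theta =
    cexp (- (`|theta| `^ (1 + b))%:C * omega lambda psi1 b theta).
Proof.
move=> hc hs theta.
have [ec es] := stable_char_full b01 (@measurable_funPT _ _ _ _ Z) hc hs theta.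
have bn : b != 0 by rewrite lt0r_neq0.
have an : 1 + b != 0 by rewrite lt0r_neq0.
rewrite /char_fun !expectation_Rintegral ec es /omega cexp_rotation /stable_re /stable_im.
set q := `|theta| `^ (1 + b); set K := psi1 * _ * _ / _.
have ex : pi * (1 + b) / 2 = b * (pi / 2) + pi / 2 :> R by field.
have eA : stable_A = - K * sin (b * (pi / 2)) by rewrite /K /stable_A; field; rewrite bn an.
have eB : stable_B = - K * cos (b * (pi / 2)) by rewrite /K /stable_B; field; rewrite bn an.
have [t0|t0|t0] := ltgtP theta 0.
- rewrite ltr0_sg// mulrN1 !mulNr ex cosN sinN cosDpihalf sinDpihalf eA eB.
  rewrite mul1r opprK; congr (expR _ * _ +i* (expR _ * _)); try (congr (cos _)); try (congr (sin _)); ring.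
- rewrite gtr0_sg// mulr1 ex cosDpihalf sinDpihalf eA eB mul1r.
  move: (sin _) (cos (b * _)) => s c.
  have -> : - (q * K * - s) = - (- K * s * q) by ring.
  have -> : q * K * c = - (- K * c * q) by ring.
  by rewrite mulNr cosN sinN mulrN.
have -> : q = 0 by rewrite /q t0 normr0 powR0.
by rewrite t0 sgr0 !(mulr0, mul0r) sin0 oppr0 cos0 expR0 !(mulr0, mulr1, mul0r).
Qed.

Definition path_deviation (M : nat) (p : U) : R :=
  \sum_(1 <= k < M.+1) ((p.2 k)%:R - rate lambda p.1).

Let measurable_natr : measurable_fun setT (fun m : nat => m%:R : R).
Proof. by []. Qed.

Let measurable_path_deviation M : measurable_fun setT (path_deviation M).
Proof.
apply: measurable_sum => k; apply: measurable_funB.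
  exact: (measurableT_comp measurable_natr (measurable_path_snd k)).
exact: (measurableT_comp (measurable_rate lambda) measurable_path_fst).
Qed.

Let path_deviationE M w : path_deviation M (model_path alpha X w) =
  \sum_(1 <= k < M.+1) deviation lambda alpha X0 xi eps k w.
Proof. by []. Qed.

Let integrable_ge0_eq (f : T0 -> R) : measurable_fun setT f -> (forall w, 0 <= f w) ->
  (\int[P0]_w (f w)%:E = \int[P0]_w (rate lambda (alpha w))%:E)%E ->
  P0.-integrable setT (EFin \o f) /\ \int[P0]_w f w = mean_rate.
Proof.
move=> mf f0 ef; split; last by rewrite /mean_rate /Rintegral ef.
apply/integrableP; split; first exact/measurable_EFinP.
under eq_integral => w _ do rewrite /= ger0_norm//.
rewrite ef; have /integrableP[_] := rate_integrable.
apply: le_lt_trans; rewrite le_eqVlt; apply/orP; left; apply/eqP.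
by apply: eq_integral => w _; rewrite /= gtr0_norm// (rate_alpha_gt0 lambda0 inputs).
Qed.

Let measurable_X k : measurable_fun setT (fun w => (X k w)%:R : R).
Proof. exact: (measurableT_comp measurable_natr (mX k)). Qed.

Lemma inar_mean_rate k : P0.-integrable setT (EFin \o (fun w => (X k w)%:R : R)) /\
  \int[P0]_w (X k w)%:R = mean_rate.
Proof.
apply: integrable_ge0_eq => //.
have := inar_mean lambda0 inputs k (@measurable_cst _ _ _ _ _ (1 : R)) (fun=> ler01).
by under eq_integral do rewrite mul1r; under [X in _ = X -> _]eq_integral do rewrite mul1r.
Qed.

Lemma copy_mean j k : fine ('E_P[fun w => (X_ j k w)%:R])%E = mean_rate.
Proof.
rewrite expectation_Rintegral -(inar_mean_rate k).2.
apply: (@copy_Rintegral _ _ _ P0 _ _ P alpha X alpha_ X_ malpha mX copies j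
  (fun p : U => (p.2 k)%:R)); last exact: (inar_mean_rate k).1.
exact: (measurableT_comp measurable_natr (measurable_path_snd k)).
Qed.

Let dev_mean0 M : \int[P0]_w path_deviation M (model_path alpha X w) = 0.
Proof.
have hi k : P0.-integrable setT (EFin \o deviation lambda alpha X0 xi eps k).
  exact: (RintegrableB measurableT (inar_mean_rate k).1 rate_integrable).
transitivity (\int[P0]_w \sum_(1 <= k < M.+1) deviation lambda alpha X0 xi eps k w) => //.
rewrite (Rintegral_big _ hi).2 big1// => k _.
rewrite /deviation RintegralB//; [|exact: (inar_mean_rate k).1|exact: rate_integrable].
by rewrite (inar_mean_rate k).2 subrr.
Qed.

Let dev_square M : P0.-integrable setT
  (EFin \o (fun w => path_deviation M (model_path alpha X w) ^+ 2)).
Proof.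
apply: (@square_integrable_sum _ _ _ P0 _ _ (fun k => deviation lambda alpha X0 xi eps k)).
  by move=> k; exact: measurable_deviation.
move=> k; apply: (integrable_ge0_eq _ _ _).1; last exact: deviation_variance.
  by apply: measurable_funX; exact: measurable_deviation.
by move=> w; exact: sqr_ge0.
Qed.

(** Around the overall mean, a copy deviates first by its rate, for all times
    alike, which yields a term linear in time; then around its rate. *)
Lemma scaled_decomposition N n t w : scaled b X_ N n t w =
  (Num.truncn (n%:R * t%:num))%:R / n%:R * normalized_rates N w +
  n%:R^-1 * (N%:R `^ (- (1 + b)^-1) *
    \sum_(j < N) path_deviation (Num.truncn (n%:R * t%:num)) (copy_path alpha_ X_ j w)).
Proof.
rewrite /scaled /aggregated /normalized_rates /path_deviation; set M := Num.truncn _.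
transitivity (n%:R^-1 * N%:R `^ (- (1 + b)^-1) *
  (M%:R * (\sum_(j < N) (rate lambda (alpha_ j w) - mean_rate)) +
   \sum_(j < N) \sum_(1 <= k < M.+1) ((X_ j k w)%:R - rate lambda (alpha_ j w)))); last by ring.
congr (_ * _); rewrite big_distrr/= -big_split/=; apply: eq_bigr => j _.
transitivity (\sum_(1 <= k < M.+1) ((rate lambda (alpha_ j w) - mean_rate) +
   ((X_ j k w)%:R - rate lambda (alpha_ j w)))).
  by apply: eq_bigr => k _; rewrite copy_mean; ring.
by rewrite big_split/= sumr_const_nat subSS subn0 mulr_natl.
Qed.

Let msum_dev M N : measurable_fun setT
  (fun w => \sum_(j < N) path_deviation M (copy_path alpha_ X_ j w)).
Proof.
apply: measurable_sum => j.
exact: (measurableT_comp (measurable_path_deviation M) (measurable_copy_path alpha_ X_ j)).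
Qed.

(** For a fixed horizon the deviations around the rates are centred and
    square-integrable: their sum over [N] copies is of order [N ^ (1 / 2)], less
    than the normalization [N ^ (1 / (1 + b))]. *)
Lemma deviations_vanish_copies M :
  vanishing P (fun N w => N%:R `^ (- (1 + b)^-1) *
    \sum_(j < N) path_deviation M (copy_path alpha_ X_ j w)).
Proof.
move=> e e0; set v := \int[P0]_w path_deviation M (model_path alpha X w) ^+ 2.
have v0 : 0 <= v by apply: Rintegral_ge0 => w _; exact: sqr_ge0.
pose c := 2 / (1 + b) - 1.
have c0 : 0 < c by rewrite subr_gt0 ltr_pdivlMr// mul1r; have := b1; lra.
have e2 : 0 < e ^+ 2 by rewrite exprn_gt0.
apply: (@squeeze_cvgr _ _ _ _ (fun=> 0) (fun N => N%:R `^ (- c) * (v / e ^+ 2))).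
- near=> N; have N0 : 0 < N%:R :> R by rewrite ltr0n; near: N; exists 1%N.
  rewrite fine_ge0//=.
  have [i2 e2'] := copy_sum_square malpha mX copies (measurable_path_deviation M) (dev_square M) (dev_mean0 M) N.
  set q := N%:R `^ (- (1 + b)^-1).
  have E : (fun w => 1 * (q * \sum_(j < N) path_deviation M (copy_path alpha_ X_ j w)) ^+ 2) =
    (fun w => q ^+ 2 * (\sum_(j < N) path_deviation M (copy_path alpha_ X_ j w)) ^+ 2).
    by apply/funext => w; rewrite mul1r exprMn.
  have ii := RintegrableZl measurableT (q ^+ 2) i2.
  have := @square_deviation_bound _ _ _ P
    (fun w => q * \sum_(j < N) path_deviation M (copy_path alpha_ X_ j w)) (fun=> 1) e
    (measurable_funM (@measurable_cst _ _ _ _ _ _) (msum_dev M N)) (@measurable_cst _ _ _ _ _ _)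
    (fun=> or_intror erefl).
  rewrite E => /(_ ii e0) h; apply: (le_trans h).
  rewrite (_ : [set _ | _] = set0) ?measure0 ?add0r; last first.
    by apply/seteqP; split => // w /= /eqP; rewrite oner_eq0.
  rewrite RintegralZl// e2' le_eqVlt; apply/orP; left; apply/eqP.
  rewrite !mulrA; congr (_ * _ / _).
  rewrite /c /q -powR_mulrn ?powR_ge0// -powRrM -[X in _ * X = _]powRr1 ?ltW//.
  rewrite -powRD; last by rewrite lt0r_neq0 ?implybT.
  congr (_ `^ _); field; exact: lt0r_neq0.
- exact: cvg_cst.
have h : N%:R `^ (- c) * (v / e ^+ 2) @[N --> \oo] --> 0 * (v / e ^+ 2).
  by apply: cvgMl; exact: (cvg_comp _ _ (@cvgr_idn R) (powRN_pinfty c0)).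
by rewrite mul0r in h.
Unshelve. all: by end_near. Qed.

(** The law of large numbers for one copy.  The variance given [alpha] is at most
    linear in time, with a coefficient of the order of the square of the rate,
    which is not integrable; off the event [alpha > 1 - r], whose probability is
    small, this coefficient is bounded. *)
Lemma deviation_vanish_time j (t : {nonneg R}) :
  vanishing P (fun n w => n%:R^-1 *
    path_deviation (Num.truncn (n%:R * t%:num)) (copy_path alpha_ X_ j w)).
Proof.
have [mdens dens_ge0 dens] := density.
have [C C0 hC] := upper_tail_le malpha b01 psi1_gt0 mdens dens_ge0 dens psi_lim.
move=> e e0; have e2 : 0 < e ^+ 2 by rewrite exprn_gt0.
apply/cvgrPdist_le => z z0.
have z2 : 0 < z / 2 by rewrite divr_gt0.
(* The bound on the upper tail at [r] is then exactly [z / 2]. *)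
pose r := (z / 2 / C) `^ (1 + b)^-1.
have r0 : 0 < r by rewrite powR_gt0// divr_gt0.
have hr : upper_tail P0 alpha r <= z / 2.
  apply: (le_trans (hC r r0)); rewrite /r -powRrM mulVf ?lt0r_neq0// powRr1.
    by rewrite mulrC divfK ?lt0r_neq0.
  by rewrite ltW// divr_gt0.
pose h (a : R) : R := \1_(`]-oo, 1 - r] : set R) a.
have mh : measurable_fun setT h by exact: measurable_indic.
have h01 a : h a = 0 \/ h a = 1.
  by rewrite /h indicE; case: (_ \in _); [right|left].
pose K := lambda / r + (lambda / r) ^+ 2.
have lr0 : 0 < lambda / r by rewrite divr_gt0.
have rate_le w : h (alpha w) = 1 -> rate lambda (alpha w) <= lambda / r.
  rewrite /h indicE; case: (boolP (_ \in _)) => [|_ /eqP]; last by rewrite eq_sym oner_eq0.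
  rewrite inE/= in_itv/= => ar _; rewrite rateE; last by case/andP : (alpha01 w).
  rewrite ler_pM2l// lef_pV2 ?posrE//; last by rewrite subr_gt0; case/andP : (alpha01 w).
  by rewrite lerBrDl -lerBrDr.
have hK w : h (alpha w) * rate lambda (alpha w) <= K.
  case: (h01 (alpha w)) => [->|ha]; first by rewrite mul0r addr_ge0 ?sqr_ge0// ltW.
  by rewrite ha mul1r (le_trans (rate_le _ ha))// lerDl sqr_ge0.
have hK2 w : h (alpha w) * rate lambda (alpha w) ^+ 2 <= K.
  case: (h01 (alpha w)) => [->|ha]; first by rewrite mul0r addr_ge0 ?sqr_ge0// ltW.
  rewrite ha mul1r (@le_trans _ _ ((lambda / r) ^+ 2))//; last by rewrite lerDr ltW.
  by rewrite ler_sqr ?nnegrE ?(ltW lr0) ?rate_le// ltW// (rate_alpha_gt0 lambda0 inputs).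
have h01' w : 0 <= h (alpha w) <= 1.
  by case: (h01 (alpha w)) => ->; rewrite ?lexx ?ler01.
pose k := 2 * (K / lambda) + K.
have K0 : 0 <= K by rewrite addr_ge0 ?sqr_ge0// ltW.
have k0 : 0 <= k by rewrite addr_ge0// mulr_ge0// divr_ge0// ltW.
have bound n : fine (P [set w | e <= `|n%:R^-1 *
    path_deviation (Num.truncn (n%:R * t%:num)) (copy_path alpha_ X_ j w)|]) <=
    z / 2 + (n%:R^-1) ^+ 2 * ((Num.truncn (n%:R * t%:num))%:R * k) / e ^+ 2.
  set M := Num.truncn _; pose f p := n%:R^-1 * path_deviation M p.
  have mf : measurable_fun setT f by apply: measurable_funM => //; exact: measurable_path_deviation.
  have mC : measurable [set p : U | e <= `|f p|] by exact: measurable_norm_ge.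
  have -> : P [set w | e <= `|n%:R^-1 * path_deviation M (copy_path alpha_ X_ j w)|] =
      P0 [set w | e <= `|f (model_path alpha X w)|].
    exact: (copies.1 j _ mC).
  have [i1 l1] := deviation_sum_square_le lambda0 inputs mh h01' hK hK2 M.
  have E : (fun w => h (alpha w) * f (model_path alpha X w) ^+ 2) =
    (fun w => (n%:R^-1) ^+ 2 * (h (alpha w) *
      (\sum_(1 <= k < M.+1) deviation lambda alpha X0 xi eps k w) ^+ 2)).
    by apply/funext => w; rewrite /f exprMn mulrCA path_deviationE.
  have := @square_deviation_bound _ _ _ P0 (fun w => f (model_path alpha X w))
    (fun w => h (alpha w)) e (measurableT_comp mf (measurable_model_path malpha mX))
    (measurableT_comp mh malpha) (fun w => h01 (alpha w)).
  rewrite E => /(_ (RintegrableZl measurableT _ i1) e0) hs; apply: (le_trans hs).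
  rewrite RintegralZl//; apply: lerD.
    apply: le_trans hr; rewrite /upper_tail (_ : [set _ | _] = alpha @^-1` `]1 - r, +oo[)//.
    apply/seteqP; split => w /=; rewrite in_itv/= andbT /h indicE.
      case: (boolP (_ \in _)) => [_ /eqP|]; first by rewrite oner_eq0.
      by rewrite notin_setE/= in_itv/= => /negP; rewrite -ltNge.
    by move=> ar; rewrite memNset//= in_itv/= => /(lt_le_trans ar); rewrite ltxx.
  by rewrite ler_pM2r ?invr_gt0// ler_wpM2l// sqr_ge0.
have lim : (n%:R^-1) ^+ 2 * ((Num.truncn (n%:R * t%:num))%:R * k) / e ^+ 2 @[n --> \oo] --> 0.
  have i0 : n%:R^-1 @[n --> \oo] --> (0 : R).
    by apply/gtr0_cvgV0; [exists 1%N => // n /= n0; rewrite ltr0n|exact: cvgr_idn].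
  have hh : n%:R^-1 * ((Num.truncn (n%:R * t%:num))%:R / n%:R * (k / e ^+ 2)) @[n --> \oo] -->
      0 * (t%:num * (k / e ^+ 2)).
    by apply: cvgM => //; apply: cvgMl => //; exact: truncn_ratio_cvg.
  rewrite mul0r in hh; apply: cvg_trans hh; apply: near_eq_cvg; apply: nearW => n.
  by ring.
near=> n; rewrite sub0r normrN ger0_norm ?fine_ge0//.
apply: (le_trans (bound n)); rewrite [leRHS]splitr lerD2l.
have : `|0 - (n%:R^-1) ^+ 2 * ((Num.truncn (n%:R * t%:num))%:R * k) / e ^+ 2| <= z / 2.
  by near: n; move/cvgrPdist_le : lim => /(_ _ z2).
by rewrite sub0r normrN; apply: le_trans; exact: ler_norm.
Unshelve. all: by end_near. Qed.

Let msum n N (t : {nonneg R}) : measurable_fun setT (fun w => n%:R^-1 * (N%:R `^ (- (1 + b)^-1) *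
    \sum_(j < N) path_deviation (Num.truncn (n%:R * t%:num)) (copy_path alpha_ X_ j w))).
Proof. by do 2! apply: measurable_funM => //. Qed.

Section limits.
Context dZ (TZ : measurableType dZ) (PZ : probability TZ R).
Variable Z : {RV PZ >-> R}.
Hypothesis rates_cvg : forall (g : R -> R) (K : R), continuous g -> (forall x, `|g x| <= K) ->
  \int[P]_w g (normalized_rates N w) @[N --> \oo] --> \int[PZ]_w g (Z w).

Let mZ : measurable_fun setT Z. Proof. exact: measurable_funPT. Qed.

Let row_scaled n N m (t : 'I_m -> {nonneg R}) (g : 'rV[R]_m -> R) :
  \int[proc_prob (scaled_process b X_ N n)]_w g (proc_vec t w) =
  \int[P]_w g (\row_i ((Num.truncn (n%:R * (t i)%:num))%:R / n%:R * normalized_rates N w +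
    n%:R^-1 * (N%:R `^ (- (1 + b)^-1) *
    \sum_(j < N) path_deviation (Num.truncn (n%:R * (t i)%:num)) (copy_path alpha_ X_ j w)))).
Proof.
by apply: eq_Rintegral => w _; congr g; apply/rowP => i; rewrite !mxE -scaled_decomposition.
Qed.

(** For fixed [n] the rates converge, as [N] grows, to the stable variable with
    the factor [truncn (n * t) / n]; this factor then tends to [t]. *)
Lemma copies_then_time :
  iterated_fdd_lim (fun n N => scaled_process b X_ N n) (line_process Z).
Proof.
have mline n (t : {nonneg R}) :
    measurable_fun setT (fun w => (Num.truncn (n%:R * t%:num))%:R / n%:R * Z w).
  exact: measurable_funM.
exists (fun n => Process PZ (mline n)); split.
  move=> n _; apply: fdd_cvg_Rintegral => m t g K cg gK.
  under eq_fun do rewrite row_scaled.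
  apply: (Slutsky_row measurable_normalized_rates mZ rates_cvg
    (a_ := fun _ i => (Num.truncn (n%:R * (t i)%:num))%:R / n%:R) _ _ _ cg gK).
  - by move=> i; exact: cvg_cst.
  - by move=> i N; exact: msum.
  - by move=> i; apply: vanishing_scale; exact: deviations_vanish_copies.
apply: fdd_cvg_Rintegral => m t g K cg gK.
rewrite (_ : \int[_]_w g (proc_vec t w) = \int[PZ]_w g (\row_i ((t i)%:num * Z w))).
  exact: (cvg_law_line (fun=> mZ) mZ (fun g K _ _ => cvg_cst _)
    (fun i => @truncn_ratio_cvg _ (t i)) cg gK).
by apply: eq_Rintegral => w _; congr g; apply/rowP => i; rewrite !mxE mulrC.
Qed.

(** For fixed [N] the slope [normalized_rates N] appears as [n] grows; it then
    converges to the stable variable. *)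
Lemma time_then_copies :
  iterated_fdd_lim (fun N n => scaled_process b X_ N n) (line_process Z).
Proof.
have mline N (t : {nonneg R}) : measurable_fun setT (fun w => t%:num * normalized_rates N w).
  by apply: measurable_funM => //; exact: measurable_normalized_rates.
exists (fun N => Process P (mline N)); split.
  move=> N _; apply: fdd_cvg_Rintegral => m t g K cg gK.
  under eq_fun do rewrite row_scaled.
  apply: (Slutsky_row (fun=> measurable_normalized_rates N) (measurable_normalized_rates N)
    (fun g K _ _ => cvg_cst _)
    (a_ := fun n i => (Num.truncn (n%:R * (t i)%:num))%:R / n%:R) _ _ _ cg gK).
  - by move=> i; exact: truncn_ratio_cvg.
  - by move=> i n; exact: msum.
  move=> i; pose r (j : 'I_N) n w := n%:R^-1 *
    path_deviation (Num.truncn (n%:R * (t i)%:num)) (copy_path alpha_ X_ j w).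
  have vr : vanishing P (fun n w => \sum_(j <- index_enum 'I_N) r j n w).
    apply: vanishing_sum => [j n|j]; last exact: deviation_vanish_time.
    apply: measurable_funM => //.
    exact: (measurableT_comp (measurable_path_deviation _) (measurable_copy_path alpha_ X_ j)).
  have := vanishing_scale (N%:R `^ (- (1 + b)^-1)) vr.
  congr (vanishing P _); apply/funext => n; apply/funext => w.
  by rewrite /r -big_distrr/=; ring.
apply: fdd_cvg_Rintegral => m t g K cg gK.
rewrite (_ : \int[_]_w g (proc_vec t w) = \int[PZ]_w g (\row_i ((t i)%:num * Z w))).
  exact: (cvg_law_line measurable_normalized_rates mZ rates_cvg (fun i => cvg_cst _) cg gK).
by apply: eq_Rintegral => w _; congr g; apply/rowP => i; rewrite !mxE mulrC.
Qed.

End limits.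

End double_aggregation.

Theorem theorem4p12 (R : realType)
    (d0 : measure_display) (T0 : measurableType d0) (P0 : probability T0 R)
    (lambda : R) (alpha : {RV P0 >-> R}) (X0 : {RV P0 >-> nat})
    (xi : nat -> nat -> {RV P0 >-> nat}) (eps : nat -> {RV P0 >-> nat})
    (d : measure_display) (T : measurableType d) (P : probability T R)
    (alpha_ : nat -> {RV P >-> R}) (X_ : nat -> nat -> {RV P >-> nat})
    (beta psi1 : R) (psi : R -> R)
    (lambda_gt0 : 0 < lambda)
    (inputs : randomized_inar_inputs lambda alpha X0 xi eps)
    (copies : independent_copies P0 alpha (inar X0 xi eps) alpha_ X_)
    (density : has_density_on01 alpha (fun x => psi x * (1 - x) `^ beta))
    (psi_lim : psi x @[x --> 1^'-] --> psi1)
    (psi1_gt0 : 0 < psi1)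
    (beta01 : 0 < beta < 1) :
  exists (dZ : measure_display) (TZ : measurableType dZ)
      (PZ : probability TZ R) (Z : {RV PZ >-> R}),
    [/\ stable_rv (1 + beta) Z,
        forall theta : R, char_fun Z theta =
          cexp (- (`|theta| `^ (1 + beta))%:C * omega lambda psi1 beta theta),
        iterated_fdd_lim (fun n N => scaled_process beta X_ N n)
          (line_process Z) &
        iterated_fdd_lim (fun N n => scaled_process beta X_ N n)
          (line_process Z)].
Proof.
have [dZ [TZ [PZ [Z [hZ noatom]]]]] := stable_limit
  (stable_A_gt0 lambda_gt0 psi1_gt0 beta01) beta01
  (measurable_normalized_rates lambda alpha alpha_ beta)
  (fun t t0 => (normalized_rates_char lambda_gt0 inputs copies density psi_lim psi1_gt0 beta01 t0).1)
  (fun t t0 => (normalized_rates_char lambda_gt0 inputs copies density psi_lim psi1_gt0 beta01 t0).2).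
have hc (t : R) : 0 < t -> \int[PZ]_w cos (t * Z w) =
    stable_re (stable_A lambda beta psi1) (stable_B lambda beta psi1) beta t.
  move=> t0; apply: (cvg_unique _ (hZ (fun x => cos (t * x)) 1 _ _)
    (normalized_rates_char lambda_gt0 inputs copies density psi_lim psi1_gt0 beta01 t0).1).
  - exact: Rhausdorff.
  - move=> x; apply: continuous_comp; [exact: mulrl_continuous|exact: continuous_cos].
  - by move=> x; exact: norm_cos_le1.
have hs (t : R) : 0 < t -> \int[PZ]_w sin (t * Z w) =
    stable_im (stable_A lambda beta psi1) (stable_B lambda beta psi1) beta t.
  move=> t0; apply: (cvg_unique _ (hZ (fun x => sin (t * x)) 1 _ _)
    (normalized_rates_char lambda_gt0 inputs copies density psi_lim psi1_gt0 beta01 t0).2).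
  - exact: Rhausdorff.
  - move=> x; apply: continuous_comp; [exact: mulrl_continuous|exact: continuous_sin].
  - by move=> x; exact: norm_sin_le1.
exists dZ, TZ, PZ, Z; split.
- exact: (char_stable_rv (stable_A_gt0 lambda_gt0 psi1_gt0 beta01) beta01 noatom hc hs).
- exact: stable_char_fun hc hs.
- exact: (copies_then_time lambda_gt0 inputs copies density psi_lim psi1_gt0 beta01 hZ).
- exact: (time_then_copies lambda_gt0 inputs copies density psi_lim psi1_gt0 beta01 hZ).
Qed.
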